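(* Let $s\in(0,1)$. The family $\{\hat{Q}_n^{(s,s)}\}_{n=0}^\infty\cup\{\hat{P}_n^{(-s,-s)}\}_{n=0}^\infty$ is a frame on $H^s_{w_s}(\mathbb{R})$, in the sense that there exist constants $0<c\le C<\infty$ such that for all $u\in H^s_{w_s}(\mathbb{R})$ $$c\|u\|^2_{H^s_{w_s}(\mathbb{R})}\le\sum_{n=0}^\infty\left[(u,\hat{Q}_n^{(s,s)})^2_{H^s_{w_s}(\mathbb{R})}+(u,\hat{P}_n^{(-s,-s)})^2_{H^s_{w_s}(\mathbb{R})}\right]\le C\|u\|^2_{H^s_{w_s}(\mathbb{R})}.$$
   Context: Functions are real-valued. For $\sigma\in(0,1)$, $(-\Delta)^\sigma$ denotes the fractional Laplacian on $\mathbb{R}$: on Schwartz functions, $(-\Delta)^{\sigma}u(x)=c_{1,\sigma}\,\mathrm{p.v.}\int_{\mathbb{R}}\frac{u(x)-u(y)}{|x-y|^{1+2\sigma}}\,dy$ with $c_{1,\sigma}=\frac{4^\sigma\Gamma(1/2+\sigma)}{\pi^{1/2}|\Gamma(-\sigma)|}$ (equivalently the Fourier multiplier $|\xi|^{2\sigma}$), extended to less regular functions weakly; for negative exponents $\sigma$, $(-\Delta)^{\sigma}$ is likewise the Fourier multiplier $|\xi|^{2\sigma}$. Jacobi polynomials, for $a,b>-1$: $P_n^{(a,b)}(x)=\frac{(a+1)_n}{n!}\,{}_2F_1(-n,1+a+b+n;a+1;\tfrac12(1-x))$, set to $0$ for $x\notin[-1,1]$. Weighted Jacobi polynomials: $Q_n^{(a,b)}(x)=(1-x)_+^a(1+x)_+^bP_n^{(a,b)}(x)$,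 set to $0$ for $x\notin[-1,1]$, where $(z)_+=\max(0,z)$. Extended Jacobi functions, for $a>-1$ and $\sigma\in(-1,0)\cup(0,1)$: $\tilde P_n^{(a,\sigma)}=(-\Delta)^\sigma Q_n^{(a,a)}$ on $\mathbb{R}$; in particular $\tilde P_n^{(-s,-s)}=(-\Delta)^{-s}Q_n^{(-s,-s)}$. For $\sigma\in(-1/2,0)\cup(0,1)$ and $x\in(-1,1)$ it is known that $\tilde P_n^{(\sigma,\sigma)}(x)=c_{\sigma,n}P_n^{(\sigma,\sigma)}(x)$ with $c_{\sigma,n}=\frac{4^\sigma\Gamma(\sigma+\lfloor n/2\rfloor+1)\Gamma(n+\sigma-\lfloor n/2\rfloor+1/2)}{\lfloor n/2\rfloor!\,\Gamma(n-\lfloor n/2\rfloor+1/2)}$. Let $w_s(x)=(1-x^2)^{-s}$ for $|x|<1$ and $w_s(x)=0$ otherwise, so $\mathrm{supp}\,w_s=[-1,1]$. $L^2_{w_s}(-1,1)$ has inner product $(f,g)_{L^2_{w_s}(-1,1)}=\int_{-1}^1fgw_s\,dx$. The Hilbert space $H^s_{w_s}(\mathbb{R})$ is $\{u\in L^2_{w_s}(-1,1):\mathrm{supp}(u)\subseteq[-1,1],\ (-\Delta)^{s/2}u\in L^2(\mathbb{R})\}$ with inner product $(u,v)_{H^s_{w_s}(\mathbb{R})}=(u,v)_{L^2_{w_s}(-1,1)}+((-\Delta)^{s/2}u,(-\Delta)^{s/2}v)_{L^2(\mathbb{R})}$. Where an argument is one of the functions $\tilde P_n^{(-s,-s)}$,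 which need not vanish outside $[-1,1]$, this inner product and the corresponding norm are evaluated by the same formula (restricting to $(-1,1)$ in the first term only). Normalized functions: $\hat Q_n^{(s,s)}=Q_n^{(s,s)}/\|Q_n^{(s,s)}\|_{H^s_{w_s}(\mathbb{R})}$ and $\hat P_n^{(-s,-s)}=\tilde P_n^{(-s,-s)}/\|\tilde P_n^{(-s,-s)}\|_{H^s_{w_s}(\mathbb{R})}$.
   Formalization: For s ≥ 1/2 the function P̂_0^{(-s,-s)} is undefined: |ξ|^{-2s} times the transform of Q_0^{(-s,-s)} is not locally integrable at 0 and its norm would be infinite; in that single case P̂_0 is taken to be 0. *)

(* Defs.v *)
From HB Require Import structures.
From mathcomp Require Import all_boot all_order all_algebra.
From mathcomp Require Import all_classical all_reals all_analysis.

Set Implicit Arguments.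
Unset Strict Implicit.
Unset Printing Implicit Defensive.

Import Order.TTheory GRing.Theory Num.Theory.
Import numFieldNormedType.Exports.

Local Open Scope classical_set_scope.
Local Open Scope ring_scope.

Section SpecialFunctions.
Context {R : realType}.
Notation mu := (@lebesgue_measure R).
Implicit Types (a b c x z : R) (k n : nat).

Definition pochhammer a k : R := \prod_(i < k) (a + i%:R).

Definition Gamma_integral z : R :=
  \int[mu]_(t in `]0, +oo[) (t `^ (z - 1) * expR (- t)).

(* Euler's integral at z + m > 0, brought back to z by the functional equation
   Gamma(z + m) = (z)_m Gamma(z).  This is Gamma at every real z which is not a
   pole; m = 1 when z > 0. *)
Definition Gamma z : R :=
  let m := (Num.truncn (- z)).+1 in
  Gamma_integral (z + m%:R) / pochhammer z m.

Definition hyp2F1 a b c z : R :=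
  limn (series (fun k =>
    pochhammer a k * pochhammer b k / (pochhammer c k * k`!%:R) * z ^+ k)).

Definition jacobi a b n x : R :=
  if -1 <= x <= 1 then
    pochhammer (a + 1) n / n`!%:R *
    hyp2F1 (- n%:R) (1 + a + b + n%:R) (a + 1) ((1 - x) / 2)
  else 0.

(* At the endpoints [powR] gives 0 `^ a = 0 also for a < 0. *)
Definition weighted_jacobi a b n x : R :=
  if -1 <= x <= 1 then
    Num.max 0 (1 - x) `^ a * Num.max 0 (1 + x) `^ b * jacobi a b n x
  else 0.

End SpecialFunctions.

Section FractionalLaplacian.
Context {R : realType}.
Notation mu := (@lebesgue_measure R).
Implicit Types (sigma x xi : R) (u g phi : R -> R).

Definition schwartz phi : Prop :=
  (forall k x, derivable (derive1n k phi) x 1) /\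
  (forall m k, exists M : R, forall x, `|x ^+ m * derive1n k phi x| <= M).

Definition fracLap_const sigma : R :=
  4 `^ sigma * Gamma (1 / 2 + sigma) / (Num.sqrt pi * `|Gamma (- sigma)|).

Definition fracLap_pv sigma phi x : R :=
  fracLap_const sigma *
  lim ((\int[mu]_(y in [set y | (e < `|x - y|)%R])
          ((phi x - phi y) / `|x - y| `^ (1 + 2 * sigma))) @[e --> 0^'+]).

Definition is_fracLap_weak sigma u g : Prop :=
  forall phi, schwartz phi ->
    [/\ mu.-integrable setT (fun x => (u x * fracLap_pv sigma phi x)%:E),
        mu.-integrable setT (fun x => (g x * phi x)%:E) &
        \int[mu]_(x in setT) (g x * phi x) =
        \int[mu]_(x in setT) (u x * fracLap_pv sigma phi x)].

(* The Fourier transform of an integrable u is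
   xi |-> fourier_cos u xi - i fourier_sin u xi. *)
Definition fourier_cos u xi : R :=
  \int[mu]_(x in setT) (u x * cos (x * xi)).
Definition fourier_sin u xi : R :=
  \int[mu]_(x in setT) (u x * sin (x * xi)).

(* For u integrable, g^ = |xi|^(2 sigma) u^ as tempered distributions:
   < g, phi^ > = < |xi|^(2 sigma) u^, phi > for every real Schwartz phi, split
   into real and imaginary parts. *)
Definition is_fracLap_multiplier sigma u g : Prop :=
  mu.-integrable setT (fun x => (u x)%:E) /\
  forall phi, schwartz phi ->
    [/\ mu.-integrable setT (fun x => (g x * phi x)%:E),
        mu.-integrable setT
          (fun xi => (`|xi| `^ (2 * sigma) * fourier_cos u xi * phi xi)%:E),
        mu.-integrable setT
          (fun xi => (`|xi| `^ (2 * sigma) * fourier_sin u xi * phi xi)%:E),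
        \int[mu]_(x in setT) (g x * fourier_cos phi x) =
        \int[mu]_(xi in setT)
          (`|xi| `^ (2 * sigma) * fourier_cos u xi * phi xi) &
        \int[mu]_(x in setT) (g x * fourier_sin phi x) =
        \int[mu]_(xi in setT)
          (`|xi| `^ (2 * sigma) * fourier_sin u xi * phi xi)].

Definition is_fracLap sigma u g : Prop :=
  if 0 < sigma then is_fracLap_weak sigma u g
  else is_fracLap_multiplier sigma u g.

(* Determined up to a null set when it exists as a function; the zero function
   otherwise. *)
Definition fracLap sigma u : R -> R :=
  xget (fun=> 0) [set g | is_fracLap sigma u g].

Definition ext_jacobi a sigma n : R -> R :=
  fracLap sigma (weighted_jacobi a a n).

End FractionalLaplacian.

Section WeightedSobolev.
Context {R : realType}.
Notation mu := (@lebesgue_measure R).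
Implicit Types (s x : R) (u v f g : R -> R).

Definition weight s x : R :=
  if `|x| < 1 then (1 - x ^+ 2) `^ (- s) else 0.

Definition Hs s : set (R -> R) :=
  [set u : R -> R | [/\ measurable_fun setT u,
    (\int[mu]_(x in `](-1)%R, 1%R[) (u x ^+ 2 * weight s x)%:E < +oo)%E,
    {ae mu, forall x, ~ (-1 <= x <= 1) -> u x = 0} &
    exists g, [/\ is_fracLap (s / 2) u g, measurable_fun setT g &
      (\int[mu]_(x in setT) (g x ^+ 2)%:E < +oo)%E]]].

Definition Hs_inner s u v : R :=
  \int[mu]_(x in `](-1)%R, 1%R[) (u x * v x * weight s x) +
  \int[mu]_(x in setT) (fracLap (s / 2) u x * fracLap (s / 2) v x).

Definition Hs_sqnorm s u : \bar R :=
  (\int[mu]_(x in `](-1)%R, 1%R[) (u x ^+ 2 * weight s x)%:E +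
   \int[mu]_(x in setT) (fracLap (s / 2) u x ^+ 2)%:E)%E.

(* Division by an infinite norm gives 0, since [fine +oo] and 0^-1 are 0. *)
Definition Hs_normalize s f : R -> R :=
  fun x => f x / Num.sqrt (fine (Hs_sqnorm s f)).

(* For 1/2 <= s the transform of weighted_jacobi (- s) (- s) 0 is nonzero at 0,
   so |xi|^(- 2 s) times it is not locally integrable and |xi|^(- s) times it is
   not in L^2: P_hat s 0 is then 0.  This is the only degenerate case. *)
Definition Q_hat s n : R -> R := Hs_normalize s (weighted_jacobi s s n).
Definition P_hat s n : R -> R := Hs_normalize s (ext_jacobi (- s) (- s) n).

End WeightedSobolev.

(* Main.v *)
(** Write w for the weight (1 - x^2)^(-s) on (-1,1) and L for (-Delta)^(s/2).  The
heat kernel G_t replaces the Fourier transform: a function is determined almost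
everywhere by its pairings with the translates of the G_t, and on these |xi|^(2 b)
acts by subordination, that is by an integral of the heat flow over time.

Up to a constant, (-Delta)^(-s) q_n for q_n = w P_n is the Riesz potential
int tau^(s-1) e^(tau Delta) q_n dtau.  Applying the Jacobi operator to G_tau(x - y) in
x and in y gives the same result up to a total derivative in tau, so this potential
is orthogonal to q_m for m <> n; by completeness of the Jacobi polynomials it is a
multiple of P_n on (-1,1).  Hence the dual functions are orthogonal in L^2_w, and
the same vanishing integral makes their images under L orthogonal in L^2.  Bessel's
inequality for both families and (A + B)^2 / (a + b) <= A^2 / a + B^2 / b bound the
dual half of the sum by the squared norm of u.

For Q_n = (1 - x^2)^s P_n, the function (-Delta)^s Q_n is the derivative of a Riesz
potential of order 1 - s of Q_n' = (1 - x^2)^(s-1) r_n, where r_n is again a Jacobi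
polynomial; by the previous argument it equals lambda_n P_n on (-1,1).  This gives
(L u, L Q_n) = lambda_n int u P_n for every u in H^s, so that the Q_n are orthogonal
for both parts of the inner product and their half of the sum is
sum (1 + lambda_n) (int u P_n)^2 / h_n.  Parseval's identity in L^2_w and Fatou's
lemma along the heat flow show that it dominates the squared norm of u, and Bessel's
inequality gives the converse.  So c = 1 and C = 2. *)

Require Import Defs.
From mathcomp Require Import all_boot all_order all_algebra.
From mathcomp Require Import all_classical all_reals all_analysis.
From mathcomp Require Import measurable_realfun lebesgue_integral_under.
From mathcomp Require Import ring lra.
Import Order.TTheory GRing.Theory Num.Theory.
Import numFieldNormedType.Exports.
Local Open Scope classical_set_scope.
Local Open Scope ring_scope.
Set Implicit Arguments.
Unset Strict Implicit.
Unset Printing Implicit Defensive.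

(** * Integration on the real line *)

(** The lower bound rests on the weighted half alone; the dual half has only to be bounded above, so
    vanishing dual functions do no harm. No constant is evaluated: the Gamma factors and eigenvalues
    enter as unnamed numbers, and the sign of the eigenvalues is read off a squared norm.

    The obstacle is the order of the operator. For 1/2 <= s the kernel |h|^(-1-2s) of (-Delta)^s is
    not integrable against Lipschitz increments, so (-Delta)^s is never formed: (-Delta)^(s/2) is
    applied twice, each time with |h|^(-1-s), for which the principal value is an absolutely
    convergent integral on test functions. Even then Q_n is only s-Hoelder, the borderline case, and
    its increments are controlled in the mean rather than pointwise.

    The total derivative in tau exists only because the time weight tau^(th-1) carries the exponent
    of the weight (1-x^2)^(-th). One lemma thus serves twice, with th = s for the dual functions and
    th = 1 - s for the derivatives Q_n'. Its boundary term at tau = 0 vanishes because p(x) r(y) -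
    p(y) r(x) cancels the singularity on the diagonal. *)

Section measurability.
Context {R : realType} {d : measure_display} {T : measurableType d}.
Implicit Types f g : T -> R.

(** Inversion is discontinuous at 0, so it is rewritten as f times a real power of f^2, the power
    map being measurable everywhere; with 1/0 = 0 the identity also holds at the zeros of f. *)
Lemma measurable_funV f : measurable_fun setT f ->
  measurable_fun setT (fun x => (f x)^-1).
Proof.
move=> mf.
have -> : (fun x => (f x)^-1) = (fun x => f x * (f x ^+ 2) `^ (-1)).
  apply/funext => x; have [->|fx0] := eqVneq (f x) 0.
    by rewrite invr0 mul0r.
  by rewrite powR_inv1 ?sqr_ge0// expr2 invfM mulrA divff// mul1r.
apply: measurable_funM => //.
apply: (@measurableT_comp _ _ _ _ _ _ (@powR R ^~ (-1)) _ (fun x => f x ^+ 2)) => //.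
exact: measurable_funX.
Qed.

Lemma measurable_fun_powR f a : measurable_fun setT f ->
  measurable_fun setT (fun x => f x `^ a).
Proof. by move=> mf; apply: (@measurableT_comp _ _ _ _ _ _ (@powR R ^~ a) _ f). Qed.

Lemma measurable_fun_expR f : measurable_fun setT f ->
  measurable_fun setT (fun x => expR (f x)).
Proof. by move=> mf; apply: (@measurableT_comp _ _ _ _ _ _ (@expR R) _ f). Qed.

Lemma measurable_fun_cos f : measurable_fun setT f ->
  measurable_fun setT (fun x => cos (f x)).
Proof.
by move=> mf; apply: (@measurableT_comp _ _ _ _ _ _ (@cos R) _ f) => //;
  apply: continuous_measurable_fun; exact: continuous_cos.
Qed.

Lemma measurable_fun_sin f : measurable_fun setT f ->
  measurable_fun setT (fun x => sin (f x)).
Proof.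
by move=> mf; apply: (@measurableT_comp _ _ _ _ _ _ (@sin R) _ f) => //;
  apply: continuous_measurable_fun; exact: continuous_sin.
Qed.

Lemma measurable_fun_sqrt f : measurable_fun setT f ->
  measurable_fun setT (fun x => Num.sqrt (f x)).
Proof.
by move=> mf; apply: (@measurableT_comp _ _ _ _ _ _ (@Num.sqrt R) _ f) => //;
  apply: continuous_measurable_fun; exact: sqrt_continuous.
Qed.

Lemma measurable_fun_norm f : measurable_fun setT f ->
  measurable_fun setT (fun x => `|f x|).
Proof. by move=> mf; apply: (@measurableT_comp _ _ _ _ _ _ (@Num.norm R R) _ f). Qed.

End measurability.

(** Hooks, redefined as indicators, heat kernels, polynomials and time weights appear, so that a
    single tactic settles joint measurability throughout. *)
Ltac mea_box := fail.
Ltac mea_heat := fail.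
Ltac mea_poly := fail.
Ltac mea_pk := fail.
Ltac mea_ext := first [mea_box | mea_heat | mea_poly | mea_pk].
Ltac mea_step :=
  first
  [ assumption
  | mea_ext
  | match goal with
    | |- measurable_fun _ (fun x => ?c) => exact: measurable_cst
    | |- measurable_fun _ (fun x => x) => exact: measurable_id
    | |- measurable_fun _ (fun x => x.1) => exact: measurable_fst
    | |- measurable_fun _ (fun x => x.2) => exact: measurable_snd
    | |- measurable_fun _ (fun x => @?f x + @?g x) =>
        apply: (@measurable_funD _ _ _ _ f g)
    | |- measurable_fun _ (fun x => - @?f x) =>
        apply: (@measurable_funN _ _ _ _ f)
    | |- measurable_fun _ (fun x => @?f x * @?g x) =>
        apply: (@measurable_funM _ _ _ _ f g)
    | |- measurable_fun _ (fun x => @?f x ^+ ?n) =>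
        apply: (@measurable_funX _ _ _ _ f n)
    | |- measurable_fun _ (fun x => (@?f x)^-1) => apply: (@measurable_funV _ _ _ f)
    | |- measurable_fun _ (fun x => `|@?f x|) => apply: (@measurable_fun_norm _ _ _ f)
    | |- measurable_fun _ (fun x => @?f x `^ ?a) =>
        apply: (@measurable_fun_powR _ _ _ f a)
    | |- measurable_fun _ (fun x => expR (@?f x)) =>
        apply: (@measurable_fun_expR _ _ _ f)
    | |- measurable_fun _ (fun x => cos (@?f x)) =>
        apply: (@measurable_fun_cos _ _ _ f)
    | |- measurable_fun _ (fun x => sin (@?f x)) =>
        apply: (@measurable_fun_sin _ _ _ f)
    | |- measurable_fun _ (fun x => Num.sqrt (@?f x)) =>
        apply: (@measurable_fun_sqrt _ _ _ f)
    | |- measurable_fun _ (fun x => if _ then _ else _) =>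
        apply: measurable_fun_ifT
    | |- measurable_fun _ (fun x => @Order.lt _ _ (@?f x) (@?g x)) =>
        apply: (@measurable_fun_ltr _ _ _ _ f g)
    | |- measurable_fun _ (fun x => @Order.le _ _ (@?f x) (@?g x)) =>
        apply: (@measurable_fun_ler _ _ _ _ f g)
    | |- measurable_fun _ (@Order.lt _ _ ?c) =>
        apply: (@measurable_fun_ltr _ _ _ _ (fun=> c) (fun x => x))
    | |- measurable_fun _ (@Order.le _ _ ?c) =>
        apply: (@measurable_fun_ler _ _ _ _ (fun=> c) (fun x => x))
    | |- measurable_fun _ (fun x => (@?f x) && (@?g x)) =>
        apply: (@measurable_and _ _ _ f g)
    | H : measurable_fun _ (fun z => ?F z.1 z.2) |- _ =>
        let G := match type of H with measurable_fun _ ?g => g end in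
        match goal with |- measurable_fun _ (fun x => F (@?a x) (@?b x)) =>
          refine (@measurableT_comp _ _ _ _ _ _ G _ (fun x => (a x, b x)) H _);
          refine (@measurable_fun_pair _ _ _ _ _ _ a b _ _)
        end
    | H : measurable_fun _ ?F |- _ =>
        match goal with |- measurable_fun _ (fun x => F (@?a x)) =>
          apply: (@measurableT_comp _ _ _ _ _ _ F _ a H)
        end
    end ].
Ltac mea := intros; repeat mea_step.

Section integration.
Context {R : realType}.
Notation mu := (@lebesgue_measure R).
Implicit Types (f g : R -> R).

Definition Int f := mu.-integrable setT (EFin \o f).

Lemma Int_meas f : Int f -> measurable_fun setT f.
Proof. by move=> /measurable_int /measurable_EFinP. Qed.

Lemma le_Int g f : measurable_fun setT f -> (forall x, `|f x| <= g x) ->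
  Int g -> Int f.
Proof.
move=> mf fg; apply: le_integrable => //; first exact/measurable_EFinP.
by move=> x _ /=; rewrite lee_fin (le_trans (fg x))// ler_norm.
Qed.

Lemma eq_Int f g : f =1 g -> Int f -> Int g.
Proof. by move=> /funext ->. Qed.

Lemma IntD f g : Int f -> Int g -> Int (fun x => f x + g x).
Proof. by move=> If Ig; have := integrableD measurableT If Ig. Qed.

Lemma IntZ c f : Int f -> Int (fun x => c * f x).
Proof. by move=> If; have := integrableZl measurableT c If. Qed.

Lemma IntN f : Int f -> Int (fun x => - f x).
Proof. by move=> /(IntZ (-1)); apply: eq_Int => x; rewrite mulN1r. Qed.

Lemma IntB f g : Int f -> Int g -> Int (fun x => f x - g x).
Proof. by move=> If /IntN; exact: IntD. Qed.

Lemma Int0 : Int (fun=> 0).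
Proof. exact: integrable0. Qed.

Lemma Int_norm f : Int f -> Int (fun x => `|f x|).
Proof. exact: integrable_norm. Qed.

Lemma IntMb f g (M : R) : measurable_fun setT f -> (forall x, `|f x| <= M) ->
  Int g -> Int (fun x => f x * g x).
Proof.
move=> mf fM Ig; have mg := Int_meas Ig.
apply: (@le_Int (fun x => M * `|g x|)); first by mea.
  by move=> x; rewrite normrM ler_wpM2r.
exact/IntZ/Int_norm.
Qed.

Lemma IntP f : measurable_fun setT f ->
  (\int[mu]_x (`|f x|)%:E < +oo)%E -> Int f.
Proof. by move=> mf h; apply/integrableP; split => //; exact/measurable_EFinP. Qed.

Lemma Int_fin f : Int f -> (\int[mu]_x (f x)%:E)%E = (\int[mu]_x f x)%:E.
Proof. by move=> If; rewrite fineK//; exact: integrable_fin_num. Qed.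

Lemma Int_lty f : Int f -> (\int[mu]_x (`|f x|)%:E < +oo)%E.
Proof. by move=> If; rewrite Int_fin ?ltry//; exact: Int_norm. Qed.

Lemma RID f g : Int f -> Int g ->
  \int[mu]_x (f x + g x) = \int[mu]_x f x + \int[mu]_x g x.
Proof. by move=> If Ig; rewrite RintegralD. Qed.

Lemma RIB f g : Int f -> Int g ->
  \int[mu]_x (f x - g x) = \int[mu]_x f x - \int[mu]_x g x.
Proof. by move=> If Ig; rewrite RintegralB. Qed.

Lemma RIZ c f : Int f -> \int[mu]_x (c * f x) = c * \int[mu]_x f x.
Proof. by move=> If; rewrite RintegralZl. Qed.

Lemma RIZr c f : Int f -> \int[mu]_x (f x * c) = \int[mu]_x f x * c.
Proof. by move=> If; rewrite RintegralZr. Qed.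

Lemma RIN f : Int f -> \int[mu]_x (- f x) = - \int[mu]_x f x.
Proof.
by move=> If; under eq_Rintegral do rewrite -mulN1r; rewrite RIZ// mulN1r.
Qed.

Lemma RI0 : \int[mu]_x (0 : R) = 0.
Proof. by rewrite /Rintegral integral0. Qed.

Lemma eq_RI f g : f =1 g -> \int[mu]_x f x = \int[mu]_x g x.
Proof. by move=> /funext ->. Qed.

Lemma RI_ge0 f : (forall x, 0 <= f x) -> 0 <= \int[mu]_x f x.
Proof. by move=> f0; apply: Rintegral_ge0. Qed.

Lemma le_RI f g : Int f -> Int g -> (forall x, f x <= g x) ->
  \int[mu]_x f x <= \int[mu]_x g x.
Proof. by move=> If Ig fg; apply: le_Rintegral. Qed.

Lemma norm_RI f : Int f -> `|\int[mu]_x f x| <= \int[mu]_x `|f x|.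
Proof. by move=> If; apply: le_normr_Rintegral. Qed.

Lemma norm_RI_le f g : Int f -> Int g -> (forall x, `|f x| <= g x) ->
  `|\int[mu]_x f x| <= \int[mu]_x g x.
Proof.
by move=> If Ig fg; rewrite (le_trans (norm_RI If))// le_RI//; exact: Int_norm.
Qed.

Lemma le_RI_ge0 f g : measurable_fun setT f -> (forall x, 0 <= f x) -> Int g ->
  (forall x, f x <= g x) -> Int f /\ \int[mu]_x f x <= \int[mu]_x g x.
Proof.
move=> mf f0 Ig fg; have If : Int f.
  by apply: (le_Int mf _ Ig) => x; rewrite ger0_norm.
by split => //; exact: le_RI.
Qed.

Lemma ae_mp (P Q : R -> Prop) : (forall x, P x -> Q x) ->
  {ae mu, forall x, P x} -> {ae mu, forall x, Q x}.
Proof. by move=> PQ; apply: (@filterS _ _ (ae_filter_ringOfSetsType mu)). Qed.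

Lemma ae_and (P Q : R -> Prop) : {ae mu, forall x, P x} ->
  {ae mu, forall x, Q x} -> {ae mu, forall x, P x /\ Q x}.
Proof. by move=> *; apply: (@filterI _ _ (ae_filter_ringOfSetsType mu)). Qed.

Lemma ae_all (P : R -> Prop) : (forall x, P x) -> {ae mu, forall x, P x}.
Proof. by move=> h; apply: aeW. Qed.

Lemma ae_eq_RI f g : measurable_fun setT f -> measurable_fun setT g ->
  {ae mu, forall x, f x = g x} -> \int[mu]_x f x = \int[mu]_x g x.
Proof.
move=> mf mg fg; congr fine; apply: ae_eq_integral => //.
- exact/measurable_EFinP.
- exact/measurable_EFinP.
- by apply: ae_mp fg => x /= ->.
Qed.

Lemma ae_eq_Int f g : measurable_fun setT g ->
  {ae mu, forall x, f x = g x} -> Int f -> Int g.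
Proof.
move=> mg fg If; have mf := Int_meas If; apply: IntP => //.
suff -> : (\int[mu]_x (`|g x|)%:E = \int[mu]_x (`|f x|)%:E)%E by apply: Int_lty.
apply: ae_eq_integral => //.
- by apply/measurable_EFinP; mea.
- by apply/measurable_EFinP; mea.
- by apply: ae_mp fg => x /= ->.
Qed.

Lemma RI_eq0 f : Int f -> (forall x, 0 <= f x) -> \int[mu]_x f x = 0 ->
  {ae mu, forall x, f x = 0}.
Proof.
move=> If f0 If0; have mf := Int_meas If.
have mE : measurable_fun setT (EFin \o f) by exact/measurable_EFinP.
have : (\int[mu]_(x in setT) `|(EFin \o f) x| = 0)%E.
  rewrite -[RHS]/(0%:E) -If0 -Int_fin//.
  by apply: eq_integral => x _ /=; rewrite ger0_norm.
move/(ae_eq_integral_abs mu measurableT mE).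
by apply: ae_mp => x /(_ I) /= [].
Qed.

(** Fatou's lemma with a one-sided hypothesis: f has only to lie below the lower limit of the
    sequence, and it inherits integrability together with the bound. *)
Lemma fatou_bound (f_ : nat -> R -> R) f (S : R) :
  (forall n, Int (f_ n)) -> (forall n x, 0 <= f_ n x) ->
  measurable_fun setT f -> (forall x, 0 <= f x) ->
  {ae mu, forall x, forall e, 0 < e -> \forall n \near \oo, f x - e <= f_ n x} ->
  (forall n, \int[mu]_x f_ n x <= S) ->
  Int f /\ \int[mu]_x f x <= S.
Proof.
move=> If_ f_0 mf f0 fcv IS.
have mf_ n := Int_meas (If_ n).
have mE n : measurable_fun setT (fun x => (f_ n x)%:E) by exact/measurable_EFinP.
have H : (\int[mu]_x (f x)%:E <= S%:E)%E.
  apply: (@le_trans _ _ (\int[mu]_x limn_einf (fun n => (f_ n x)%:E))%E).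
    apply: ae_ge0_le_integral => //.
    - by move=> x _; rewrite lee_fin.
    - exact/measurable_EFinP.
    - move=> x _; rewrite limn_einf_lim; apply: lime_ge; first exact: is_cvg_einfs.
      by apply: nearW => n; apply: le_ereal_inf_tmp => _ [m _ <-]; rewrite lee_fin.
    (* Measurability of the lower limit is deduced from that of the upper limit of the negatives. *)
    - have -> : (fun x => limn_einf (fun n => (f_ n x)%:E)) =
          (fun x => - limn_esup (fun n => - (f_ n x)%:E))%E.
        by apply/funext => x; rewrite -[in LHS](oppeK (limn_einf _)) -limn_esupN.
      apply: measurableT_comp => //.
      apply: (@measurable_fun_limn_esup _ _ _ _ (fun n x => (- (f_ n x)%:E)%E)) => n.
      by apply: measurableT_comp.
    - apply: ae_mp fcv => x fx _.
      rewrite limn_einf_lim; apply/lee_subgt0Pr => e e0.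
      apply: lime_ge; first exact: is_cvg_einfs.
      have [N _ NP] := fx e e0; near=> n.
      apply: le_ereal_inf_tmp => _ [m /= nm <-]; rewrite -EFinB lee_fin; apply: NP => /=.
      by apply: leq_trans nm; near: n; exists N.
  apply: le_trans; first by apply: fatou => // n x _; rewrite lee_fin.
  rewrite limn_einf_lim; apply: lime_le; first exact: is_cvg_einfs.
  apply: nearW => n; apply: (@le_trans _ _ (\int[mu]_x (f_ n x)%:E)%E).
    by apply: ereal_inf_lbound; exists n => /=.
  by rewrite Int_fin// lee_fin.
have If : Int f.
  apply: IntP => //; under eq_integral do rewrite ger0_norm//.
  exact: le_lt_trans H (ltry _).
by split => //; rewrite -lee_fin -Int_fin.
Unshelve. all: by end_near. Qed.

Lemma dct (f_ : nat -> R -> R) f g : (forall n, measurable_fun setT (f_ n)) ->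
  measurable_fun setT f -> Int g -> (forall n x, `|f_ n x| <= g x) ->
  {ae mu, forall x, f_ n x @[n --> \oo] --> f x} ->
  \int[mu]_x (f_ n x) @[n --> \oo] --> \int[mu]_x f x.
Proof.
move=> mf_ mf Ig fg fcv.
have m1 n : measurable_fun setT (fun x => (f_ n x)%:E) by exact/measurable_EFinP.
have m2 : measurable_fun setT (EFin \o f) by exact/measurable_EFinP.
have h3 : {ae mu, forall x, setT x -> (f_ n x)%:E @[n --> \oo] --> (EFin \o f) x}.
  by apply: ae_mp fcv => x fx _; apply: cvg_EFin => //; exact: nearW.
have h5 : {ae mu, forall x n, setT x -> (`|(f_ n x)%:E| <= (EFin \o g) x)%E}.
  by apply: ae_all => x n _; rewrite lee_fin.
have [If _ H] := @dominated_convergence _ _ _ mu setT measurableT (fun n x => (f_ n x)%:E) (EFin \o f) (EFin \o g) m1 m2 h3 Ig h5.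
apply: fine_cvg; rewrite fineK//.
exact: integrable_fin_num.
Qed.

(** The pushforward of Lebesgue measure, rescaled by c, has the right value on half-open intervals,
    hence is Lebesgue measure by uniqueness. *)
Lemma ge0_int_affine (c a : R) (f : R -> \bar R) : 0 < c ->
  measurable_fun setT f -> (forall x, 0 <= f x)%E ->
  (\int[mu]_x f (c * x + a)%R = c^-1%:E * \int[mu]_x f x)%E.
Proof.
move=> c0 mf f0.
pose phi := fun x : R => c * x + a.
have mphi : measurable_fun setT (phi : R -> measurableTypeR R) by rewrite /phi; mea.
have cn : 0 <= c by exact: ltW.
pose pm := measure_function_pushforward__canonical__measure_function_Measure mu mphi.
pose nu : {measure set (measurableTypeR R) -> \bar R} := mscale (NngNum cn) pm.
have nuE A : measurable A -> mu A = nu A.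
  move=> mA; apply: (@lebesgue_measure_unique R nu _ A mA) => X [[x y] _ <-] /=.
  rewrite /mscale/= /pushforward.
  have -> : phi @^-1` `]x, y] = `](x - a) / c, (y - a) / c]%classic.
    apply/seteqP; split => z /=; rewrite !in_itv /= /phi;
    by rewrite ltr_pdivrMr// ler_pdivlMr// ltrBlDr lerBrDr mulrC.
  rewrite !lebesgue_measure_itv/= !lte_fin ltr_pM2r ?invr_gt0// ltrD2r.
  case: ifPn => // xy; last by rewrite mule0.
  by rewrite -!EFinB -EFinM -mulrBl opprB addrA subrK mulrCA divff ?mulr1// gt_eqF.
have -> : (\int[mu]_x f x = \int[nu]_x f x)%E.
  by apply: eq_measure_integral => A mA _; exact: nuE.
rewrite ge0_integral_mscale//= muleA -EFinM mulVf ?gt_eqF// mul1e.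
by rewrite ge0_integral_pushforward.
Qed.

Lemma ge0_int_opp (f : R -> \bar R) : measurable_fun setT f ->
  (forall x, 0 <= f x)%E -> (\int[mu]_x f (- x)%R = \int[mu]_x f x)%E.
Proof.
move=> mf f0.
have mphi : measurable_fun (setT : set (measurableTypeR R))
  ((fun x : R => - x) : measurableTypeR R -> measurableTypeR R) by mea.
pose pm := measure_function_pushforward__canonical__measure_function_Measure mu mphi.
transitivity (\int[pm]_x f x)%E; first by rewrite (ge0_integral_pushforward mphi).
by apply: eq_measure_integral => A mA _; exact: lebesgue_measureN.
Qed.

Lemma Int_affine (c a : R) f : 0 < c -> Int f -> Int (fun x => f (c * x + a)).
Proof.
move=> c0 If; have mf := Int_meas If; apply: IntP; first by mea.
rewrite (@ge0_int_affine c a (fun x => (`|f x|)%:E))//.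
- by rewrite Int_fin ?ltry//; exact: Int_norm.
- by apply/measurable_EFinP; mea.
Qed.

Lemma Int_opp f : Int f -> Int (fun x => f (- x)).
Proof.
move=> If; have mf := Int_meas If; apply: IntP; first by mea.
rewrite (@ge0_int_opp (fun x => (`|f x|)%:E))//.
- by rewrite Int_fin ?ltry//; exact: Int_norm.
- by apply/measurable_EFinP; mea.
Qed.

(** Writes f as a difference of nonnegative functions, which are integrable along with f; a change
    of variables is thereby reduced to the nonnegative case. *)
Lemma norm_split f x : f x = 2^-1 * (`|f x| + f x) - 2^-1 * (`|f x| - f x).
Proof. by lra. Qed.

Lemma RI_affine (c a : R) f : 0 < c -> Int f ->
  \int[mu]_x f (c * x + a) = c^-1 * \int[mu]_x f x.
Proof.
move=> c0.
have pos g : Int g -> (forall x, 0 <= g x) ->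
    \int[mu]_x g (c * x + a) = c^-1 * \int[mu]_x g x.
  move=> Ig g0; have mg := Int_meas Ig; have Ia := Int_affine a c0 Ig.
  apply: EFin_inj; rewrite EFinM -!Int_fin//.
  rewrite (@ge0_int_affine c a (EFin \o g))//; first exact/measurable_EFinP.
move=> If; have I1 := IntD (Int_norm If) If; have I2 := IntB (Int_norm If) If.
have p1 x : 0 <= `|f x| + f x by have := ler_norm (- f x); rewrite normrN; lra.
have p2 x : 0 <= `|f x| - f x by have := ler_norm (f x); lra.
have J1 := Int_affine a c0 I1; have J2 := Int_affine a c0 I2.
rewrite (eq_RI (norm_split f)) (eq_RI (fun x => norm_split f (c * x + a))).
rewrite !RIB; [|exact: IntZ..].
by rewrite !RIZ// (pos _ I1 p1) (pos _ I2 p2); ring.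
Qed.

Lemma RI_opp f : Int f -> \int[mu]_x f (- x) = \int[mu]_x f x.
Proof.
have pos g : Int g -> (forall x, 0 <= g x) ->
    \int[mu]_x g (- x) = \int[mu]_x g x.
  move=> Ig g0; have mg := Int_meas Ig; have Ia := Int_opp Ig.
  apply: EFin_inj; rewrite -!Int_fin//.
  rewrite (@ge0_int_opp (EFin \o g))//; first exact/measurable_EFinP.
move=> If; have I1 := IntD (Int_norm If) If; have I2 := IntB (Int_norm If) If.
have p1 x : 0 <= `|f x| + f x by have := ler_norm (- f x); rewrite normrN; lra.
have p2 x : 0 <= `|f x| - f x by have := ler_norm (f x); lra.
have J1 := Int_opp I1; have J2 := Int_opp I2.
rewrite (eq_RI (norm_split f)) (eq_RI (fun x => norm_split f (- x))).
rewrite !RIB; [|exact: IntZ..].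
by rewrite !RIZ// (pos _ I1 p1) (pos _ I2 p2).
Qed.

Lemma Int_shift a f : Int f -> Int (fun x => f (x + a)).
Proof. by move=> /(Int_affine a ltr01); apply: eq_Int => x; rewrite mul1r. Qed.

Lemma RI_shift a f : Int f -> \int[mu]_x f (x + a) = \int[mu]_x f x.
Proof.
move=> /(RI_affine a ltr01); rewrite invr1 mul1r => <-.
by apply: eq_RI => x; rewrite mul1r.
Qed.

Definition Int2 (F : R -> R -> R) :=
  (mu \x mu)%E.-integrable setT (fun z : R * R => (F z.1 z.2)%:E).

Definition meas2 (F : R -> R -> R) := measurable_fun setT (fun z : R * R => F z.1 z.2).

Lemma Int2_meas F : Int2 F -> meas2 F.
Proof. by move=> /measurable_int /measurable_EFinP. Qed.

(** Tonelli's criterion: the slice norms need only an integrable majorant [G]. Most interchanges of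
    integrals below are justified by it. *)
Lemma Int2P (G : R -> R) F : meas2 F -> (forall x, Int (F x)) -> Int G ->
  (forall x, \int[mu]_y `|F x y| <= G x) -> Int2 F.
Proof.
move=> mF IF IG FG.
apply/integrable12ltyP; first exact/measurable_EFinP.
apply: le_lt_trans (Int_lty IG).
apply: ge0_le_integral => //.
- by move=> x _; apply: integral_ge0 => y _; rewrite abse_ge0.
- have mG : measurable_fun setT (fun z : R * R => `|F z.1 z.2|).
    by rewrite /meas2 in mF; mea.
  have mE : measurable_fun setT (fun z : R * R => (`|F z.1 z.2|)%:E).
    exact/measurable_EFinP.
  exact: (@measurable_fun_fubini_tonelli_F _ _ (measurableTypeR R) (measurableTypeR R) R mu _ mE).
- apply/measurable_EFinP; have := Int_meas IG => mG; mea.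
- move=> x _; rewrite (@Int_fin (fun y => `|F x y|)); last exact: Int_norm.
  by rewrite lee_fin (le_trans (FG x))// ler_norm.
Qed.

Lemma meas_RI_gen d (T : measurableType d) (F : T -> R -> R) :
  measurable_fun setT (fun z : T * R => F z.1 z.2) -> (forall x, Int (F x)) ->
  measurable_fun setT (fun x => \int[mu]_y F x y).
Proof.
move=> mF IF.
have pos (G : T -> R -> R) : measurable_fun setT (fun z : T * R => G z.1 z.2) ->
    (forall x y, 0 <= G x y) -> measurable_fun setT (fun x => \int[mu]_y G x y).
  move=> mG G0.
  have mE : measurable_fun setT (fun z : T * R => (G z.1 z.2)%:E).
    exact/measurable_EFinP.
  have mI := @measurable_fun_fubini_tonelli_F _ _ T
     (measurableTypeR R) R mu _ mE (fun z => G0 z.1 z.2).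
  by apply: measurableT_comp => //; exact: mI.
have -> : (fun x => \int[mu]_y F x y) = (fun x =>
    2^-1 * \int[mu]_y (`|F x y| + F x y) - 2^-1 * \int[mu]_y (`|F x y| - F x y)).
  apply/funext => x; rewrite -!RIZ; last 2 first.
  - exact: IntB (Int_norm (IF x)) (IF x).
  - exact: IntD (Int_norm (IF x)) (IF x).
  rewrite -RIB; last 2 first.
  - exact/IntZ/(IntD (Int_norm (IF x)) (IF x)).
  - exact/IntZ/(IntB (Int_norm (IF x)) (IF x)).
  by apply: eq_RI => y; exact: (norm_split (F x)).
apply: measurable_funB; (apply: measurable_funM; first by mea); apply: pos.
- by mea.
- by move=> x y; have := ler_norm (- F x y); rewrite normrN; lra.
- by mea.
- by move=> x y; have := ler_norm (F x y); lra.
Qed.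

Lemma meas_RI F : meas2 F -> (forall x, Int (F x)) ->
  measurable_fun setT (fun x => \int[mu]_y F x y).
Proof. exact: meas_RI_gen. Qed.

Lemma Int2_swap F : Int2 F -> Int2 (fun y x => F x y).
Proof.
move=> IF; have mF := Int2_meas IF; rewrite /meas2 in mF.
have mS : measurable_fun setT (fun z : R * R => F z.2 z.1) by mea.
apply/integrable12ltyP; first exact/measurable_EFinP.
by move/integrable21ltyP : IF; apply; exact/measurable_EFinP.
Qed.

Lemma le_Int2 G F : meas2 F -> (forall x y, `|F x y| <= G x y) ->
  Int2 G -> Int2 F.
Proof.
move=> mF FG; apply: le_integrable => //; first exact/measurable_EFinP.
by move=> x _ /=; rewrite lee_fin (le_trans (FG _ _))// ler_norm.
Qed.

Lemma Int2D F G : Int2 F -> Int2 G -> Int2 (fun x y => F x y + G x y).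
Proof. by move=> If Ig; have := integrableD measurableT If Ig. Qed.

Lemma Int2Z c F : Int2 F -> Int2 (fun x y => c * F x y).
Proof. by move=> If; have := integrableZl measurableT c If. Qed.

Lemma Int2_prod f g : Int f -> Int g -> Int2 (fun x y => f x * g y).
Proof.
move=> If Ig; have mf := Int_meas If; have mg := Int_meas Ig.
apply: (@Int2P (fun x => \int[mu]_y `|g y| * `|f x|)).
- by rewrite /meas2; mea.
- by move=> x; exact: IntZ.
- exact/IntZ/Int_norm.
- move=> x; under eq_Rintegral do rewrite normrM.
  rewrite (RIZ `|f x| (Int_norm Ig)) mulrC; exact: lexx.
Qed.

Lemma Int2_ae F : Int2 F -> {ae mu, forall x, Int (F x)}.
Proof. by move=> IF; exact: (ae_integrable1 IF). Qed.

Lemma Int2_Int F : Int2 F -> Int (fun x => \int[mu]_y F x y).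
Proof.
move=> IF; have IFF := integrable_fubini_F IF.
have mFF : measurable_fun setT (fun x => \int[mu]_y F x y).
  by apply: measurableT_comp => //; exact: measurable_int IFF.
apply: IntP => //.
have /integrableP[_] := IFF; apply: le_lt_trans.
apply: ge0_le_integral => //.
- by apply/measurable_EFinP; mea.
- by apply: measurableT_comp => //; exact: measurable_int IFF.
(* Where the slice integral is infinite its real version is 0, so the comparison holds there too. *)
- move=> x _; rewrite /fubini_F /Rintegral /=.
  by case: (integral _ _ _) => //= [|]; rewrite ?normr0// leey.
Qed.

Lemma Int2_RI F : Int2 F ->
  (\int[mu]_x \int[mu]_y F x y)%:E =
  (\int[(mu \x mu)%E]_z (F z.1 z.2)%:E)%E.
Proof.
move=> IF; rewrite -integral12_prod_meas1//.
rewrite -Int_fin; last exact: Int2_Int.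
apply: ae_eq_integral => //.
- by apply/measurable_EFinP; apply: Int_meas; exact: Int2_Int.
- exact: measurable_int (integrable_fubini_F IF).
- by apply: ae_mp (Int2_ae IF) => x IFx _; rewrite /fubini_F -Int_fin.
Qed.

Lemma fub F : Int2 F ->
  \int[mu]_x \int[mu]_y F x y = \int[mu]_y \int[mu]_x F x y.
Proof.
move=> IF; have IF' := Int2_swap IF.
apply: EFin_inj; rewrite Int2_RI// (Int2_RI IF').
rewrite -integral12_prod_meas1// -[RHS]integral12_prod_meas1//.
exact: Fubini.
Qed.

End integration.

(** * Weighted L2 spaces *)

Section weighted_L2.
Context {R : realType}.
Notation mu := (@lebesgue_measure R).
Implicit Types (f g rho : R -> R).

(** A weight vanishing outside (-1,1) turns integrals over the interval into integrals over the
    line, and the constant weight 1 gives L2(R): one set of lemmas covers both parts of the inner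
    product. *)
Definition wt rho := measurable_fun setT rho /\ forall x, 0 <= rho x.

Definition L2 rho f := measurable_fun setT f /\ Int (fun x => f x ^+ 2 * rho x).

Definition ip rho f g := \int[mu]_x (f x * g x * rho x).

Lemma L2_Int rho f g : wt rho -> L2 rho f -> L2 rho g ->
  Int (fun x => f x * g x * rho x).
Proof.
move=> [mr r0] [mf If] [mg Ig].
apply: (le_Int _ _ (IntD If Ig)); first by mea.
move=> x; rewrite !normrM (ger0_norm (r0 x)) -mulrDl ler_wpM2r//.
rewrite -(real_normK (num_real (f x))) -(real_normK (num_real (g x))).
have := sqr_ge0 (`|f x| - `|g x|); have := normr_ge0 (f x).
have := normr_ge0 (g x); nra.
Qed.

Lemma L2D rho f g : wt rho -> L2 rho f -> L2 rho g -> L2 rho (fun x => f x + g x).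
Proof.
move=> wr Lf Lg; have If := L2_Int wr Lf Lf; have Ig := L2_Int wr Lg Lg.
have Ifg := L2_Int wr Lf Lg; case: Lf Lg => mf _ [mg _]; split; first by mea.
apply: (eq_Int _ (IntD (IntD If Ig) (IntZ 2 Ifg))) => x; ring.
Qed.

Lemma L2Z rho c f : L2 rho f -> L2 rho (fun x => c * f x).
Proof.
move=> [mf If]; split; first by mea.
by apply: (eq_Int _ (IntZ (c ^+ 2) If)) => x; ring.
Qed.

Lemma L2B rho f g : wt rho -> L2 rho f -> L2 rho g -> L2 rho (fun x => f x - g x).
Proof.
move=> wr Lf /(L2Z (-1)) Lg; have [mf If] := L2D wr Lf Lg.
by split; [move: mf|move: If]; under eq_fun do rewrite mulN1r.
Qed.

Lemma L2_0 rho : L2 rho (fun=> 0).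
Proof.
by split; [mea|apply: eq_Int Int0 => x; rewrite expr0n mul0r].
Qed.

Lemma ipC rho f g : ip rho f g = ip rho g f.
Proof. by apply: eq_RI => x; rewrite (mulrC (f x)). Qed.

Lemma ipDl rho f g h : wt rho -> L2 rho f -> L2 rho g -> L2 rho h ->
  ip rho (fun x => f x + g x) h = ip rho f h + ip rho g h.
Proof.
move=> wr Lf Lg Lh; rewrite /ip -RID; try exact: L2_Int.
by apply: eq_RI => x; rewrite -mulrDl -mulrDl.
Qed.

Lemma ipZl rho c f h : wt rho -> L2 rho f -> L2 rho h ->
  ip rho (fun x => c * f x) h = c * ip rho f h.
Proof.
move=> wr Lf Lh; rewrite /ip -RIZ; last exact: L2_Int.
by apply: eq_RI => x; rewrite -!mulrA.
Qed.

Lemma ipBl rho f g h : wt rho -> L2 rho f -> L2 rho g -> L2 rho h ->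
  ip rho (fun x => f x - g x) h = ip rho f h - ip rho g h.
Proof.
move=> wr Lf Lg Lh; rewrite /ip -RIB; try exact: L2_Int.
by apply: eq_RI => x; rewrite -mulrBl -mulrBl.
Qed.

Lemma ip_ge0 rho f : wt rho -> 0 <= ip rho f f.
Proof. by move=> [mr r0]; apply: RI_ge0 => x; rewrite mulr_ge0// -expr2 sqr_ge0. Qed.

Lemma ip_sqr rho f : ip rho f f = \int[mu]_x (f x ^+ 2 * rho x).
Proof. by []. Qed.

Lemma ip_expand rho f g (c : R) : wt rho -> L2 rho f -> L2 rho g ->
  ip rho (fun x => f x - c * g x) (fun x => f x - c * g x) =
  ip rho f f - 2 * c * ip rho f g + c ^+ 2 * ip rho g g.
Proof.
move=> wr Lf Lg; have Lcg := L2Z c Lg; have Lfg := L2B wr Lf Lcg.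
rewrite ipBl// (ipC rho f) (ipC rho (fun x => c * g x)) !ipBl// (ipC rho f (fun x => c * g x)).
by rewrite !ipZl// (ipC rho g (fun x => c * g x)) ipZl// (ipC rho g f); ring.
Qed.

Lemma CS rho f g : wt rho -> L2 rho f -> L2 rho g ->
  ip rho f g ^+ 2 <= ip rho f f * ip rho g g.
Proof.
move=> wr Lf Lg.
have H c : 0 <= ip rho f f - 2 * c * ip rho f g + c ^+ 2 * ip rho g g.
  by rewrite -ip_expand// ip_ge0.
have := ip_ge0 g wr; rewrite le_eqVlt => /predU1P[g0|g0].
  suff -> : ip rho f g = 0 by rewrite -g0 expr0n mulr0.
  apply/eqP/negPn/negP => fg0.
  (* When g has norm 0 the quadratic in c is affine; this c makes it equal to -1. *)
  have := H ((ip rho f f + 1) / (2 * ip rho f g)); rewrite -g0 mulr0 addr0.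
  have -> : 2 * ((ip rho f f + 1) / (2 * ip rho f g)) * ip rho f g = ip rho f f + 1.
    by field.
  by lra.
have := H (ip rho f g / ip rho g g).
have -> : ip rho f f - 2 * (ip rho f g / ip rho g g) * ip rho f g +
   (ip rho f g / ip rho g g) ^+ 2 * ip rho g g =
   (ip rho f f * ip rho g g - ip rho f g ^+ 2) / ip rho g g.
  by field; rewrite gt_eqF.
by rewrite pmulr_lge0 ?invr_gt0// subr_ge0.
Qed.

Lemma CS_sqrt rho f g : wt rho -> L2 rho f -> L2 rho g ->
  `|ip rho f g| <= Num.sqrt (ip rho f f) * Num.sqrt (ip rho g g).
Proof.
move=> wr Lf Lg; rewrite -sqrtrM ?ip_ge0// -sqrtr_sqr ler_wsqrtr//.
exact: CS.
Qed.

Lemma bessel rho (e : nat -> R -> R) u N : wt rho -> (forall n, L2 rho (e n)) ->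
  (forall i j, (i < j)%N -> ip rho (e i) (e j) = 0) -> L2 rho u ->
  \sum_(i < N) ip rho u (e i) ^+ 2 / ip rho (e i) (e i) <= ip rho u u.
Proof.
move=> wr Le orth; elim: N u => [|N IH] u Lu; first by rewrite big_ord0 ip_ge0.
rewrite big_ord_recr/=.
have [eN0|eN0] := eqVneq (ip rho (e N) (e N)) 0.
  by rewrite eN0 invr0 mulr0 addr0 IH.
pose c := ip rho u (e N) / ip rho (e N) (e N).
have Lu' : L2 rho (fun x => u x - c * e N x) by apply: L2B => //; exact: L2Z.
have := IH _ Lu'; rewrite ip_expand//.
have -> : \sum_(i < N) ip rho (fun x => u x - c * e N x) (e i) ^+ 2 / ip rho (e i) (e i) =
    \sum_(i < N) ip rho u (e i) ^+ 2 / ip rho (e i) (e i).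
  apply: eq_bigr => i _; rewrite ipBl//; last exact: L2Z.
  by rewrite ipZl// (ipC rho (e N)) orth// mulr0 subr0.
have -> : ip rho u u - 2 * c * ip rho u (e N) + c ^+ 2 * ip rho (e N) (e N) =
   ip rho u u - ip rho u (e N) ^+ 2 / ip rho (e N) (e N).
  by rewrite /c; field.
by rewrite lerBrDr.
Qed.

End weighted_L2.

(** * Indicators of intervals, local averages and weak lower semicontinuity *)

Definition box {R : realType} (a b x : R) : R := if (a < x) && (x < b) then 1 else 0.

Lemma meas_box (R : realType) d (T : measurableType d) (a b c : T -> R) :
  measurable_fun setT a -> measurable_fun setT b -> measurable_fun setT c ->
  measurable_fun setT (fun x => box (a x) (b x) (c x)).
Proof. by move=> ma mb mc; rewrite /box; mea. Qed.

Ltac mea_box ::= match goal with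
  | |- measurable_fun _ (fun x => box (@?a x) (@?b x) (@?c x)) =>
        apply: (@meas_box _ _ _ a b c)
  | |- measurable_fun _ (box ?a ?b) =>
        apply: (@meas_box _ _ _ (fun=> a) (fun=> b) (fun x => x))
  end.

Section box_averages.
Context {R : realType}.
Notation mu := (@lebesgue_measure R).
Implicit Types (f g rho : R -> R) (a b : R).

Lemma box_ge0 a b x : 0 <= box a b x.
Proof. by rewrite /box; case: ifP. Qed.

Lemma box_le1 a b x : box a b x <= 1.
Proof. by rewrite /box; case: ifP. Qed.

Lemma norm_box a b x : `|box a b x| <= 1.
Proof. by rewrite ger0_norm ?box_ge0// box_le1. Qed.

Lemma box_patch f a b : (fun x => f x * box a b x) = f \_ `]a, b[.
Proof.
apply/funext => x; rewrite /box patchE.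
have -> : (x \in `]a, b[%classic) = (a < x) && (x < b).
  by rewrite mem_setE in_itv.
by case: ifP; rewrite ?mulr1 ?mulr0.
Qed.

Lemma RI_box f a b : \int[mu]_x (f x * box a b x) = \int[mu]_(x in `]a, b[) f x.
Proof. by rewrite box_patch -Rintegral_mkcond. Qed.

Lemma Int_boxE f a b : Int (fun x => f x * box a b x) <->
  mu.-integrable `]a, b[ (EFin \o f).
Proof.
rewrite /Int box_patch; split => h.
  by apply/(integrable_mkcond _ _).2 => //; rewrite restrict_EFin.
by rewrite -restrict_EFin; apply/(integrable_mkcond _ _).1.
Qed.

Lemma Int_box a b : Int (box a b).
Proof.
have : Int (fun x => 1 * box a b x).
  apply/Int_boxE; apply: measurable_bounded_integrable => //.
    by rewrite /= lebesgue_measure_itv/=; case: ifP => // _; rewrite -EFinB ltry.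
  by exists 1; split => // M M1 x _ /=; rewrite normr1 ltW.
by apply: eq_Int => x; rewrite mul1r.
Qed.

Lemma RI_box1 a b : a <= b -> \int[mu]_x box a b x = b - a.
Proof.
move=> ab; have -> : \int[mu]_x box a b x = \int[mu]_x (1 * box a b x).
  by apply: eq_RI => x; rewrite mul1r.
rewrite RI_box Rintegral_cst//= mul1r lebesgue_measure_itv/= lte_fin.
by case: ifPn => //=; rewrite -leNgt => ba; apply/eqP; rewrite eq_sym subr_eq0 eq_le ab ba.
Qed.

Definition locInt f := measurable_fun setT f /\
  forall a b, Int (fun x => f x * box a b x).

Lemma locInt_loc f : locInt f -> locally_integrable setT f.
Proof.
move=> [mf If]; split => //; first exact: openT.
move=> K _ cK; have /compact_bounded [M [_ MK]] := cK.
have KM : K `<=` `]-(`|M| + 2), (`|M| + 2)[%classic.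
  move=> x Kx; rewrite /= in_itv/=.
  have : `|x| <= `|M| + 1 by apply: MK => //; rewrite (le_lt_trans (ler_norm M))// ltrDl.
  by rewrite ler_norml => /andP[h1 h2]; apply/andP; split; lra.
have mK : measurable K by exact: compact_measurable.
have /Int_boxE/integrableP[_] := If (-(`|M| + 2)) (`|M| + 2).
apply: le_lt_trans; apply: ge0_subset_integral => //.
by apply/measurable_EFinP; apply: measurable_funTS; mea.
Qed.

(** The same null sequence serves as radii of averages and as small times of the heat flow. *)
Definition rad (n : nat) : R := n.+1%:R^-1.

Lemma rad_gt0 n : 0 < rad n.
Proof. by rewrite invr_gt0 ltr0n. Qed.

Lemma rad_le1 n : rad n <= 1.
Proof. by rewrite /rad invf_le1 ?ltr0n// ler1n. Qed.

Lemma rad_cvg : rad n @[n --> \oo] --> (0 : R).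
Proof. exact: cvg_harmonic. Qed.

Lemma avg_cvg f : locInt f -> {ae mu, forall x,
  (2 * rad n)^-1 * \int[mu]_y (f y * box (x - rad n) (x + rad n) y) @[n --> \oo] --> f x}.
Proof.
move=> lf; have lf' := locInt_loc lf; have [mf If] := lf.
pose E (x : R) (n : nat) : set R := ball x (rad n).
have hE x : nicely_shrinking x (E x).
  split; first by move=> n; exact: measurable_ball.
  exists (1, fun n => PosNum (rad_gt0 n)) => /=; split => //.
  - exact: rad_cvg.
  - by move=> n y.
  - by move=> n; rewrite mul1e.
apply: ae_mp (lebesgue_differentiation lf') => x /(nice_lebesgue_differentiation hE lf').
have -> : (fun n : nat => ((mu (E x n))^-1 * \int[mu]_(y in E x n) (f y)%:E)%E) =
   (fun n : nat => ((2 * rad n)^-1 * \int[mu]_y (f y * box (x - rad n) (x + rad n) y))%:E).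
  apply/funext => n; rewrite /E lebesgue_measure_ball ?ltW ?rad_gt0//.
  rewrite EFinM inver; case: ifPn => [/eqP h|_].
    by exfalso; have := rad_gt0 n; move: h; rewrite -(mulr_natl (rad n)); lra.
  congr (_ * _)%E; first by rewrite mulr_natl.
  have Ib := (If (x - rad n) (x + rad n)).
  rewrite RI_box ball_itv fineK//; apply: integrable_fin_num => //.
  exact/Int_boxE.
by move/fine_cvg.
Qed.

Lemma locInt_eq0 f : locInt f ->
  (forall a b, a < b -> \int[mu]_x (f x * box a b x) = 0) ->
  {ae mu, forall x, f x = 0}.
Proof.
move=> lf f0; apply: ae_mp (avg_cvg lf) => x.
have -> : (fun n => (2 * rad n)^-1 * \int[mu]_y (f y * box (x - rad n) (x + rad n) y)) =
   (fun=> 0).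
  by apply/funext => n; rewrite f0 ?mulr0//; have := rad_gt0 n; lra.
by move=> /cvg_lim <-//; rewrite lim_cst.
Qed.

(** Weak convergence is tested on intervals only. By Cauchy-Schwarz, (int_I f_k rho)^2 is at most
    int_I rho times int_I f_k^2 rho, and averaging over the centre of I costs nothing. Fatou in k
    treats a fixed radius; Lebesgue differentiation and a second Fatou then let the radius tend to
    0. *)
Lemma lsc rho (f_ : nat -> R -> R) f (S : R) : wt rho -> locInt rho ->
  measurable_fun setT f -> locInt (fun x => f x * rho x) ->
  (forall k, L2 rho (f_ k)) -> (forall k, ip rho (f_ k) (f_ k) <= S) ->
  (forall a b, a < b -> \int[mu]_x (f_ k x * rho x * box a b x) @[k --> \oo] -->
     \int[mu]_x (f x * rho x * box a b x)) ->
  L2 rho f /\ ip rho f f <= S.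
Proof.
move=> wr [mr lr] mf lf Lf_ IS cv.
have [_ r0] := wr; have [mfr Ifr] := lf.
have mfk k := (Lf_ k).1.
have mb n : measurable_fun setT (fun z : R * R => box (z.1 - rad n) (z.1 + rad n) z.2).
  by apply: meas_box; mea.
have mb1 x n : measurable_fun setT (fun y => box (x - rad n) (x + rad n) y).
  by apply: meas_box; mea.
have Ifk k a b : Int (fun x => f_ k x * rho x * box a b x).
  apply: (le_Int _ _ (IntD (Lf_ k).2 (lr a b))).
    by have := mfk k; mea.
  move=> x; rewrite !normrM (ger0_norm (r0 x)) (ger0_norm (box_ge0 _ _ _)).
  rewrite /box; case: ifP => _; rewrite ?mulr0 ?addr0 ?mulr1; last first.
    by rewrite mulr_ge0// sqr_ge0.
  rewrite -[X in _ + X]mul1r -mulrDl ler_wpM2r//.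
  by rewrite -(real_normK (num_real (f_ k x))); have := sqr_ge0 (`|f_ k x| - 1); nra.
(* [F n k] is the Cauchy-Schwarz minorant at radius [rad n], normalised so that its total mass stays
   below that of f_k^2 rho; [N n] is its limit in k and tends to f^2 rho almost everywhere where rho
   is positive. *)
pose B n x := 2 * rad n * \int[mu]_y (rho y * box (x - rad n) (x + rad n) y).
pose F n k x := (\int[mu]_y (f_ k y * rho y * box (x - rad n) (x + rad n) y)) ^+ 2 / B n x.
pose N n x := (\int[mu]_y (f y * rho y * box (x - rad n) (x + rad n) y)) ^+ 2 / B n x.
have B0 n x : 0 <= B n x.
  rewrite mulr_ge0//; first by have := rad_gt0 n; lra.
  by apply: RI_ge0 => y; rewrite mulr_ge0 ?box_ge0.
have mB n : measurable_fun setT (B n).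
  apply: measurable_funM; first by mea.
  by apply: meas_RI => [|x]; [have := mb n; rewrite /meas2; mea|exact: lr].
have mF n k : measurable_fun setT (F n k).
  apply: measurable_funM; last by have := mB n; mea.
  apply: measurable_funX.
  by apply: meas_RI => [|x]; [have := mb n; have := mfk k; rewrite /meas2; mea|exact: Ifk].
have mN n : measurable_fun setT (N n).
  apply: measurable_funM; last by have := mB n; mea.
  apply: measurable_funX.
  by apply: meas_RI => [|x]; [have := mb n; rewrite /meas2; mea|exact: Ifr].
have F0 n k x : 0 <= F n k x by rewrite mulr_ge0 ?sqr_ge0 ?invr_ge0.
have N0 n x : 0 <= N n x by rewrite mulr_ge0 ?sqr_ge0 ?invr_ge0.
have boxC n x y : box (x - rad n) (x + rad n) y = box (y - rad n) (y + rad n) x.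
  by rewrite /box; congr (if _ then _ else _); apply/idP/idP => /andP[h1 h2];
    apply/andP; split; lra.
(* Tonelli: averaging preserves the total mass. *)
have I2 n k : Int2 (fun y x => f_ k y ^+ 2 * rho y * box (y - rad n) (y + rad n) x).
  have [mk Ik] := Lf_ k.
  apply: (@Int2P _ (fun y => 2 * rad n * (f_ k y ^+ 2 * rho y))).
  - by have := mb n; rewrite /meas2; mea.
  - by move=> y; apply: IntZ; exact: Int_box.
  - exact: IntZ.
  - move=> y; under eq_Rintegral do rewrite normrM (ger0_norm (box_ge0 _ _ _)).
    rewrite RIZ; last exact: Int_box.
    rewrite RI_box1; last by have := rad_gt0 n; lra.
    rewrite ger0_norm; last by rewrite mulr_ge0// sqr_ge0.
    by rewrite le_eqVlt; apply/orP; left; apply/eqP; ring.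
have dom n k x : F n k x <=
    (2 * rad n)^-1 * \int[mu]_y (f_ k y ^+ 2 * rho y * box (y - rad n) (y + rad n) x).
  have rn := rad_gt0 n.
  pose w y := rho y * box (x - rad n) (x + rad n) y.
  have mw : measurable_fun setT w by rewrite /w; have := mb1 x n; mea.
  have ww : wt w by split => // y; rewrite mulr_ge0 ?box_ge0.
  have mk := mfk k.
  have Lk : L2 w (f_ k).
    split => //; apply: le_Int (Lf_ k).2; first by mea.
    move=> y; rewrite /w mulrA normrM (ger0_norm (box_ge0 _ _ _)) ger0_norm; last first.
      by rewrite mulr_ge0// sqr_ge0.
    by rewrite ler_piMr ?box_le1// mulr_ge0// sqr_ge0.
  have L1 : L2 w (fun=> 1).
    split; first by mea.
    by apply: eq_Int (lr (x - rad n) (x + rad n)) => y; rewrite expr1n mul1r.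
  have := CS ww Lk L1; rewrite /F.
  have -> : ip w (f_ k) (fun=> 1) =
      \int[mu]_y (f_ k y * rho y * box (x - rad n) (x + rad n) y).
    by apply: eq_RI => y; rewrite /w mulr1 mulrA.
  have -> : ip w (fun=> 1) (fun=> 1) = \int[mu]_y (rho y * box (x - rad n) (x + rad n) y).
    by apply: eq_RI => y; rewrite !mul1r.
  have -> : \int[mu]_y (f_ k y ^+ 2 * rho y * box (y - rad n) (y + rad n) x) = ip w (f_ k) (f_ k).
    by rewrite ip_sqr; apply: eq_RI => y; rewrite /w mulrA boxC.
  set c := (X in X ^+ 2 <= _); set b := (X in _ * X) => h.
  have b0 : 0 <= b by apply: RI_ge0 => y; rewrite mulr_ge0 ?box_ge0.
  have i0 : 0 <= ip w (f_ k) (f_ k) by exact: ip_ge0.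
  rewrite /B -/b; have [->|bn] := eqVneq b 0.
    by rewrite mulr0 invr0 mulr0 mulr_ge0// invr_ge0; lra.
  have bp : 0 < b by rewrite lt_def bn.
  rewrite ler_pdivrMr; last by rewrite mulr_gt0//; lra.
  have -> : (2 * rad n)^-1 * ip w (f_ k) (f_ k) * (2 * rad n * b) =
    ip w (f_ k) (f_ k) * b by field; rewrite gt_eqF.
  exact: h.
have IF n k : Int (F n k) /\ \int[mu]_x F n k x <= S.
  have := Int2_Int (Int2_swap (I2 n k)) => Ig.
  have [IFnk le] := le_RI_ge0 (mF n k) (F0 n k) (IntZ (2 * rad n)^-1 Ig) (dom n k).
  split => //; apply: le_trans le _.
  rewrite RIZ// -(fub (I2 n k)).
  have -> : \int[mu]_x \int[mu]_y (f_ k x ^+ 2 * rho x * box (x - rad n) (x + rad n) y) =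
     \int[mu]_x (2 * rad n * (f_ k x ^+ 2 * rho x)).
    apply: eq_RI => x; rewrite RIZ ?RI_box1; [|by have := rad_gt0 n; lra|exact: Int_box].
    by ring.
  rewrite RIZ; last exact: (Lf_ k).2.
  rewrite mulrA mulVf ?mul1r; first exact: IS.
  by have := rad_gt0 n => h; rewrite gt_eqF//; lra.
have IN n : Int (N n) /\ \int[mu]_x N n x <= S.
  apply: (@fatou_bound _ (F n)) => //.
  - by move=> k; exact: (IF n k).1.
  - apply: ae_all => x e e0.
    have rn := rad_gt0 n.
    have : F n k x @[k --> \oo] --> N n x.
      apply: cvgM; last exact: cvg_cst.
      by rewrite expr2; under eq_fun do rewrite expr2; apply: cvgM; apply: cv; lra.
    move=> /cvgrPdist_lt /(_ e e0); apply: filterS => k.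
    by rewrite ltr_distlC => /andP[h1 h2]; lra.
  - by move=> k; exact: (IF n k).2.
have [If2 le] : Int (fun x => f x ^+ 2 * rho x) /\
    \int[mu]_x (f x ^+ 2 * rho x) <= S.
  apply: (@fatou_bound _ N) => //.
  - by move=> n; exact: (IN n).1.
  - by mea.
  - by move=> x; rewrite mulr_ge0 ?sqr_ge0.
  - apply: ae_mp (ae_and (avg_cvg lf) (avg_cvg (conj mr lr))) => x [h1 h2] e e0.
    have := r0 x; rewrite le_eqVlt => /predU1P[rx|rx].
      by rewrite -rx mulr0 sub0r; apply: nearW => n; rewrite (le_trans _ (N0 n x))//; lra.
    have : N n x @[n --> \oo] --> f x ^+ 2 * rho x.
      have -> : N^~ x = (fun n => ((2 * rad n)^-1 *
          \int[mu]_y (f y * rho y * box (x - rad n) (x + rad n) y)) ^+ 2 /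
          ((2 * rad n)^-1 * \int[mu]_y (rho y * box (x - rad n) (x + rad n) y))).
        have key (u v r : R) : 0 < r ->
            u ^+ 2 / (2 * r * v) = ((2 * r)^-1 * u) ^+ 2 / ((2 * r)^-1 * v).
          move=> rp; have [->|v0] := eqVneq v 0; first by rewrite !mulr0 invr0 !mulr0.
          by field; rewrite v0 gt_eqF.
        by apply/funext => n; exact: (key _ _ _ (rad_gt0 n)).
      have -> : f x ^+ 2 * rho x = (f x * rho x) ^+ 2 / rho x.
        by field; rewrite gt_eqF.
      apply: cvgM; last by apply: cvgV => //; rewrite gt_eqF.
      by rewrite expr2; under eq_fun do rewrite expr2; apply: cvgM.
    move=> /cvgrPdist_lt /(_ e e0); apply: filterS => k.
    by rewrite ltr_distlC => /andP[h3 h4]; lra.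
  - by move=> n; exact: (IN n).2.
by split.
Qed.

End box_averages.

(** * The heat kernel *)

Section real_facts.
Context {R : realType}.
Notation mu := (@lebesgue_measure R).

Lemma expR_ge1D (y : R) : 1 + y <= expR y.
Proof. exact: expR_ge1Dx. Qed.

Lemma mul_expRN_le1 (y : R) : y * expR (- y) <= 1.
Proof.
rewrite expRN ler_pdivrMr ?expR_gt0// mul1r.
by have := expR_ge1D y; lra.
Qed.

Lemma sqr_mul_expRN_le1 (x : R) : `|x| * expR (- (x ^+ 2) / 2) <= 1.
Proof.
rewrite -(@ler_pXn2r _ 2) ?nnegrE ?mulr_ge0 ?expR_ge0//.
rewrite expr1n exprMn real_normK ?num_real// [expR _ ^+ 2]expr2 -expRD.
have -> : - x ^+ 2 / 2 + - x ^+ 2 / 2 = - x ^+ 2 by field.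
exact: mul_expRN_le1.
Qed.

Lemma FTC_box (F f : R -> R) (a b : R) : a < b ->
  (forall x, a <= x <= b -> is_derive x (1 : R) F (f x)) ->
  (forall x, a <= x <= b -> {for x, continuous f}) -> measurable_fun setT f ->
  Int (fun x => f x * box a b x) /\ \int[mu]_x (f x * box a b x) = F b - F a.
Proof.
move=> ab dF cf mf.
have cw : {within `[a, b], continuous f}.
  by apply: continuous_in_subspaceT => x; rewrite inE /= in_itv /= => /cf.
have cF x : a <= x <= b -> {for x, continuous F}.
  by move=> h; apply: differentiable_continuous; apply/derivable1_diffP; have [] := dF x h.
have dc : derivable_oo_LRcontinuous F a b.
  split.
  - by move=> x; rewrite in_itv /= => /andP[h1 h2]; have [] := dF x; rewrite ?(ltW h1) ?(ltW h2).
  - by apply: cvg_at_right_filter; apply: cF; rewrite lexx ltW.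
  - by apply: cvg_at_left_filter; apply: cF; rewrite lexx ltW.
have E1 : {in `]a, b[, (F^`())%classic =1 f}.
  move=> x; rewrite in_itv /= => /andP[h1 h2].
  by rewrite derive1E; have [] := dF x; rewrite ?(ltW h1) ?(ltW h2).
have E := continuous_FTC2 ab cw dc E1; split.
  apply/Int_boxE; apply: (@integrableS _ _ _ mu `[a, b]) => //.
    by apply: subset_itv_oo_cc.
  by apply: continuous_compact_integrable => //; exact: segment_compact.
rewrite RI_box /Rintegral -(@integral_itv_bndoo _ _ _ _ true false) /= ?E//.
by apply/measurable_EFinP; exact: measurable_funTS.
Qed.

Section exhaustion.
Variables (D : R -> bool) (F f : R -> R) (a b : nat -> R).
Hypotheses (dF : forall x, D x -> is_derive x (1 : R) F (f x))
  (cf : forall x, D x -> {for x, continuous f}) (mf : measurable_fun setT f)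
  (mD : measurable_fun setT (fun x => if D x then f x else 0))
  (ab : forall n, a n < b n) (abD : forall n x, a n <= x <= b n -> D x)
  (Dab : forall x, D x -> \forall n \near \oo, a n < x < b n).

Let bx n x : f x * box (a n) (b n) x = (if D x then f x else 0) * box (a n) (b n) x.
Proof.
rewrite /box; case: ifP => [/andP[h1 h2]|_]; last by rewrite !mulr0.
by rewrite (@abD n)// !ltW.
Qed.

Let cvg_bx x : f x * box (a n) (b n) x @[n --> \oo] --> (if D x then f x else 0).
Proof.
apply: cvg_near_cst; case: ifPn => [/Dab|nD].
  by apply: filterS => n h; rewrite /box h mulr1.
by apply: nearW => n; rewrite bx (negPf nD) mul0r.
Qed.

(** The fundamental theorem on an open interval, possibly unbounded or with singular ends, exhausted
    by compact intervals. For a nonnegative integrand, integrability itself follows by Fatou from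
    bounded increments of the antiderivative. *)
Lemma FTC_exhaust_Int (S : R) : (forall x, D x -> 0 <= f x) ->
  (forall x y, D x -> D y -> F y - F x <= S) ->
  Int (fun x => if D x then f x else 0) /\
  \int[mu]_x (if D x then f x else 0) <= S.
Proof.
move=> f0 FS.
have H n := FTC_box (ab n) (fun x h => dF (abD h)) (fun x h => cf (abD h)) mf.
apply: (@fatou_bound _ (fun n x => f x * box (a n) (b n) x)).
- by move=> n; exact: (H n).1.
- by move=> n x; rewrite bx mulr_ge0 ?box_ge0//; case: ifP => // /f0.
- by [].
- by move=> x; case: ifP => // /f0.
- apply: ae_all => x e e0; have h := @cvg_bx x; move/cvgrPdist_lt : h => /(_ e e0).
  by apply: filterS => n; rewrite ltr_distlC => /andP[h1 h2]; exact: ltW.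
- move=> n; rewrite (H n).2.
  have Da : D (a n) by apply: (@abD n); rewrite lexx ltW.
  have Db : D (b n) by apply: (@abD n); rewrite lexx ltW.
  exact: FS.
Qed.

(** Here integrability is known beforehand and dominated convergence replaces Fatou, so the
    integrand may change sign. *)
Lemma FTC_exhaust (la lb : R) : Int (fun x => if D x then f x else 0) ->
  F (a n) @[n --> \oo] --> la -> F (b n) @[n --> \oo] --> lb ->
  \int[mu]_x (if D x then f x else 0) = lb - la.
Proof.
move=> If Fa Fb.
have H n := FTC_box (ab n) (fun x h => dF (abD h)) (fun x h => cf (abD h)) mf.
have h1 : F (b n) - F (a n) @[n --> \oo] --> lb - la by apply: cvgB.
have h2 : \int[mu]_x (f x * box (a n) (b n) x) @[n --> \oo] -->
    \int[mu]_x (if D x then f x else 0).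
  apply: (@dct _ _ _ (fun x => `|if D x then f x else 0|)) => //.
  - by move=> n; mea.
  - exact: Int_norm.
  - by move=> n x; rewrite bx normrM ler_piMr// norm_box.
  - by apply: ae_all => x; exact: (@cvg_bx x).
move: h2; under eq_fun do rewrite (H _).2.
by move/cvg_lim => <-//; move/cvg_lim : h1 => ->.
Qed.

End exhaustion.

End real_facts.

(* The kernel is locked because unification against its unfolded form is
   prohibitively slow. *)
Fact G_key : unit. Proof. by []. Qed.

Definition G {R : realType} : R -> R -> R := locked_with G_key
  (fun t x => (2 * Num.sqrt (pi * t))^-1 * expR (- (x ^+ 2) / (4 * t))).

Lemma GE {R : realType} (t x : R) :
  G t x = (2 * Num.sqrt (pi * t))^-1 * expR (- (x ^+ 2) / (4 * t)).
Proof. by rewrite /G unlock. Qed.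

Lemma GE1 {R : realType} (t : R) :
  G t = fun x => (2 * Num.sqrt (pi * t))^-1 * expR (- (x ^+ 2) / (4 * t)).
Proof. by apply/funext => x; rewrite GE. Qed.

Definition dG {R : realType} (t x : R) : R := - (x / (2 * t)) * G t x.

(** By the heat equation this is both the second space derivative and the time derivative of [G]. *)
Definition ddG {R : realType} (t x : R) : R :=
  (x ^+ 2 / (4 * t ^+ 2) - (2 * t)^-1) * G t x.

Section heat_kernel_measurable.
Context {R : realType} {d : measure_display} {T : measurableType d} (a b : T -> R).
Hypotheses (ma : measurable_fun setT a) (mb : measurable_fun setT b).

Lemma meas_G : measurable_fun setT (fun z => G (a z) (b z)).
Proof.
have -> : (fun z => G (a z) (b z)) = fun z => (2 * Num.sqrt (pi * a z))^-1 *
    expR (- (b z ^+ 2) / (4 * a z)) by apply/funext => z; rewrite GE.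
by mea.
Qed.

Lemma meas_dG : measurable_fun setT (fun z => dG (a z) (b z)).
Proof. by rewrite /dG; have := meas_G; mea. Qed.

Lemma meas_ddG : measurable_fun setT (fun z => ddG (a z) (b z)).
Proof. by rewrite /ddG; have := meas_G; mea. Qed.

End heat_kernel_measurable.

Ltac mea_heat ::= match goal with
  | |- measurable_fun _ (fun x => G (@?a x) (@?b x)) => apply: (@meas_G _ _ _ a b)
  | |- measurable_fun _ (fun x => dG (@?a x) (@?b x)) => apply: (@meas_dG _ _ _ a b)
  | |- measurable_fun _ (fun x => ddG (@?a x) (@?b x)) => apply: (@meas_ddG _ _ _ a b)
  | |- measurable_fun _ (G ?a) => apply: (@meas_G _ _ _ (fun=> a) (fun x => x))
  end.

Section heat_kernel.
Context {R : realType}.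
Notation mu := (@lebesgue_measure R).
Implicit Types (t x y : R).

Lemma G_gt0 t x : 0 < t -> 0 < G t x.
Proof.
move=> t0; rewrite GE mulr_gt0 ?expR_gt0// invr_gt0 mulr_gt0// sqrtr_gt0 mulr_gt0//.
exact: pi_gt0.
Qed.

Lemma G_ge0 t x : 0 <= G t x.
Proof. by rewrite GE mulr_ge0 ?expR_ge0// invr_ge0 mulr_ge0// sqrtr_ge0. Qed.

Lemma G_even t x : G t (- x) = G t x.
Proof. by rewrite !GE sqrrN. Qed.

Lemma GC t x y : G t (x - y) = G t (y - x).
Proof. by rewrite -G_even opprB. Qed.

Lemma G_le_max t x : 0 < t -> G t x <= (2 * Num.sqrt (pi * t))^-1.
Proof.
move=> t0; rewrite GE ler_piMr ?invr_ge0 ?mulr_ge0 ?sqrtr_ge0// -[leRHS]expR0 ler_expR.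
by rewrite mulNr oppr_le0 mulr_ge0 ?sqr_ge0// invr_ge0; lra.
Qed.

Lemma G_scale t x : 0 < t -> G t x = (Num.sqrt t)^-1 * G 1 ((Num.sqrt t)^-1 * x).
Proof.
move=> t0; rewrite !GE mulr1 sqrtrM ?pi_ge0// exprMn exprVn sqr_sqrtr ?ltW//.
rewrite [RHS]mulrA; congr (_ * expR _).
  by field; rewrite !gt_eqF// sqrtr_gt0// pi_gt0.
by field; rewrite gt_eqF.
Qed.

Lemma Int_RI_G1 : Int (G (1 : R)) /\ \int[mu]_x G (1:R) x = 1.
Proof.
have Ig : Int (@gauss_fun R) by exact: integrableT_gauss.
have RIg : \int[mu]_x (@gauss_fun R x) = Num.sqrt pi.
  by rewrite /Rintegral integralT_gauss.
have h0 : (0 : R) < 2^-1 by [].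
have E x : G 1 x = (2 * Num.sqrt pi)^-1 * gauss_fun (2^-1 * x + 0).
  by rewrite GE /gauss_fun !mulr1 addr0 exprMn; congr (_ * expR _); field.
have Ia := Int_affine 0 h0 Ig.
split.
  by apply: (eq_Int _ (IntZ (2 * Num.sqrt pi)^-1 Ia)) => x; rewrite E.
rewrite (eq_RI E) RIZ// RI_affine// RIg invrK.
by field; rewrite gt_eqF// sqrtr_gt0 pi_gt0.
Qed.

Lemma Int_G0 t : 0 < t -> Int (G t).
Proof.
move=> t0; have st : 0 < (Num.sqrt t)^-1 by rewrite invr_gt0 sqrtr_gt0.
apply: (eq_Int _ (IntZ (Num.sqrt t)^-1 (Int_affine 0 st Int_RI_G1.1))) => x.
by rewrite [RHS]G_scale// addr0.
Qed.

Lemma RI_G0 t : 0 < t -> \int[mu]_x G t x = 1.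
Proof.
move=> t0; have st : 0 < (Num.sqrt t)^-1 by rewrite invr_gt0 sqrtr_gt0.
under eq_Rintegral do rewrite G_scale// -[X in G 1 X]addr0.
rewrite RIZ; last exact: Int_affine Int_RI_G1.1.
by rewrite RI_affine ?Int_RI_G1.2 ?mulr1 ?divff ?gt_eqF//; exact: Int_RI_G1.1.
Qed.

Lemma Int_G t a : 0 < t -> Int (fun x => G t (x - a)).
Proof. by move=> t0; exact: (Int_shift (- a) (Int_G0 t0)). Qed.

Lemma RI_G t a : 0 < t -> \int[mu]_x G t (x - a) = 1.
Proof. by move=> t0; rewrite (RI_shift (- a) (Int_G0 t0)) RI_G0. Qed.

Lemma Int_Gr t a : 0 < t -> Int (fun x => G t (a - x)).
Proof. by move=> t0; apply: eq_Int (Int_G a t0) => x; rewrite GC. Qed.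

Lemma RI_Gr t a : 0 < t -> \int[mu]_x G t (a - x) = 1.
Proof. by move=> t0; rewrite -(RI_G a t0); apply: eq_RI => x; rewrite GC. Qed.

(* Completing the square. *)
Lemma G_mul s t x y : 0 < s -> 0 < t ->
  G s (x - y) * G t y = G (s + t) x * G (s * t / (s + t)) (y - x * t / (s + t)).
Proof.
move=> s0 t0; have st0 : 0 < s + t by exact: addr_gt0.
rewrite !GE mulrACA [RHS]mulrACA -!expRD -!invfM; congr (_^-1 * expR _).
  rewrite !mulrA ![2 * _ * 2]mulrAC -!mulrA -!sqrtrM ?mulr_ge0 ?pi_ge0 ?ltW//.
  by congr (2 * (2 * Num.sqrt _)); field; rewrite gt_eqF.
by field; rewrite !gt_eqF.
Qed.

Lemma G_conv s t x : 0 < s -> 0 < t ->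
  Int (fun y => G s (x - y) * G t y) /\ \int[mu]_y (G s (x - y) * G t y) = G (s + t) x.
Proof.
move=> s0 t0; have r0 : 0 < s * t / (s + t) by rewrite !mulr_gt0// invr_gt0 addr_gt0.
have E y := G_mul x y s0 t0.
split.
  by apply: eq_Int (IntZ (G (s + t) x) (Int_G (x * t / (s + t)) r0)) => y; rewrite E.
by rewrite (eq_RI E) RIZ ?RI_G ?mulr1//; exact: Int_G.
Qed.

Lemma G_conv2 s t a b : 0 < s -> 0 < t ->
  Int (fun y => G s (a - y) * G t (y - b)) /\
  \int[mu]_y (G s (a - y) * G t (y - b)) = G (s + t) (a - b).
Proof.
move=> s0 t0; have [I1 E1] := G_conv (a - b) s0 t0.
have := Int_shift (- b) I1; have := RI_shift (- b) I1; rewrite E1 => <- I2.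
have E y : G s (a - b - (y + - b)) * G t (y + - b) = G s (a - y) * G t (y - b).
  by congr (G _ _ * _); ring.
by split; [apply: eq_Int I2|apply: eq_RI].
Qed.

Lemma is_derive_G t x : 0 < t -> is_derive x 1 (G t) (dG t x).
Proof.
move=> t0; rewrite GE1; apply: is_derive_eq.
rewrite /dG GE /GRing.scale /=; field.
by rewrite !gt_eqF// ?sqrtr_gt0 ?mulr_gt0 ?pi_gt0.
Qed.

Lemma is_derive_dG t x : 0 < t -> is_derive x 1 (dG t) (ddG t x).
Proof.
move=> t0; have d := is_derive_G x t0; rewrite /dG; apply: is_derive_eq.
rewrite /ddG /dG /GRing.scale /=; field.
by rewrite !gt_eqF.
Qed.

Lemma is_derive_Gt t x : 0 < t -> is_derive t 1 (G ^~ x) (ddG t x).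
Proof.
move=> t0; rewrite /ddG GE; under eq_fun do rewrite GE.
have pt : 0 < pi * t by rewrite mulr_gt0// pi_gt0.
have s0 : 2 * Num.sqrt (pi * t) != 0 by rewrite gt_eqF// mulr_gt0// sqrtr_gt0.
have d1 := is_derive1_sqrt pt.
have d2 : is_derive t (1 : R) (fun u => pi * u) pi.
  by apply: is_derive_eq; rewrite /GRing.scale /=; ring.
have d3 : is_derive t (1 : R) (fun u => 2 * Num.sqrt (pi * u))
    (2 * ((2 * Num.sqrt (pi * t))^-1 * pi)).
  have d4 := @is_derive1_comp _ Num.sqrt (fun u => pi * u) _ _ _ d1 d2.
  by apply: is_derive_eq; rewrite /GRing.scale /=; ring.
have d5 := @is_deriveV _ (fun u => 2 * Num.sqrt (pi * u)) t _ _ s0 d3.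
have d6 : is_derive t (1 : R) (fun u => 4 * u) 4.
  by apply: is_derive_eq; rewrite /GRing.scale /=; ring.
have t4 : 4 * t != 0 by rewrite gt_eqF// mulr_gt0.
have d7 := @is_deriveV _ (fun u => 4 * u) t _ _ t4 d6.
apply: is_derive_eq.
rewrite /GRing.scale /=.
have E : pi = Num.sqrt (pi * t) ^+ 2 / t :> R.
  by rewrite sqr_sqrtr ?ltW//; field; rewrite gt_eqF.
have q0 : Num.sqrt (pi * t) != 0 by rewrite gt_eqF// sqrtr_gt0.
move: (Num.sqrt (pi * t)) q0 E => q q0 ->.
by field; rewrite q0 gt_eqF.
Qed.

(** Half of the Gaussian decay is kept as a kernel at doubled time; the other half is free to absorb
    polynomial factors. This is the source of the bounds on [dG] and [ddG]. *)
Lemma G_double t x : 0 < t ->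
  G t x = Num.sqrt 2 * expR (- (x ^+ 2) / (8 * t)) * G (2 * t) x.
Proof.
move=> t0; rewrite !GE [RHS]mulrACA -expRD [pi * (2 * t)]mulrCA (@sqrtrM _ 2)//; congr (_ * expR _).
  by field; rewrite !gt_eqF// sqrtr_gt0// mulr_gt0// pi_gt0.
by field; rewrite gt_eqF.
Qed.

Lemma sqrt2_le2 : Num.sqrt (2 : R) <= 2.
Proof.
rewrite -(@ler_pXn2r _ 2) ?nnegrE ?sqrtr_ge0// sqr_sqrtr//; lra.
Qed.

Lemma dG_le t x : 0 < t -> `|dG t x| <= 4 * (Num.sqrt t)^-1 * G (2 * t) x.
Proof.
move=> t0; have st : 0 < Num.sqrt t by rewrite sqrtr_gt0.
rewrite /dG normrM normrN (ger0_norm (G_ge0 _ _)) G_double// mulrA ler_wpM2r ?G_ge0//.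
set u := (2 * Num.sqrt t)^-1 * x.
have -> : `|x / (2 * t)| = (Num.sqrt t)^-1 * `|u|.
  rewrite /u normrM [in RHS]normrM (gtr0_norm (x := (2 * t)^-1)) ?invr_gt0 ?mulr_gt0//.
  rewrite (gtr0_norm (x := (2 * Num.sqrt t)^-1)) ?invr_gt0 ?mulr_gt0//.
  by rewrite -[t in LHS]sqr_sqrtr ?ltW//; field; rewrite gt_eqF.
have -> : - x ^+ 2 / (8 * t) = - u ^+ 2 / 2.
  rewrite /u exprMn exprVn exprMn sqr_sqrtr ?ltW//; field.
  by rewrite gt_eqF.
have := sqr_mul_expRN_le1 u; have := sqrt2_le2; have := sqrtr_ge0 (2 : R) => h1 h2 h3.
rewrite [X in _ <= X]mulrC.
have -> : (Num.sqrt t)^-1 * `|u| * (Num.sqrt 2 * expR (- u ^+ 2 / 2)) =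
  (Num.sqrt t)^-1 * (Num.sqrt 2 * (`|u| * expR (- u ^+ 2 / 2))) by ring.
rewrite ler_pM2l ?invr_gt0//.
by have := ler_pM h1 (mulr_ge0 (normr_ge0 u) (expR_ge0 (- u ^+ 2 / 2))) h2 h3; lra.
Qed.

Lemma ddG_le t x : 0 < t -> `|ddG t x| <= 5 * t^-1 * G (2 * t) x.
Proof.
move=> t0.
rewrite /ddG normrM (ger0_norm (G_ge0 _ _)) G_double// mulrA ler_wpM2r ?G_ge0//.
set u := x ^+ 2 / (8 * t).
have u0 : 0 <= u by rewrite mulr_ge0 ?sqr_ge0// invr_ge0; lra.
have -> : x ^+ 2 / (4 * t ^+ 2) - (2 * t)^-1 = t^-1 * (2 * u - 2^-1).
  by rewrite /u; field; rewrite gt_eqF.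
rewrite mulNr -/u normrM (gtr0_norm (x := t^-1)) ?invr_gt0// [5 * _]mulrC.
rewrite -mulrA ler_pM2l ?invr_gt0//.
have h1 := mul_expRN_le1 u; have h2 := sqrt2_le2; have h3 := sqrtr_ge0 (2 : R).
have h4 : `|2 * u - 2^-1| <= 2 * u + 2^-1.
  by rewrite ler_norml; apply/andP; split; lra.
have h5 : expR (- u) <= 1 by rewrite -expR0 ler_expR; lra.
have h6 := expR_ge0 (- u).
have : `|2 * u - 2^-1| * expR (- u) <= 5 / 2.
  by apply: le_trans (ler_wpM2r h6 h4) _; lra.
have -> : `|2 * u - 2^-1| * (Num.sqrt 2 * expR (- u)) = Num.sqrt 2 * (`|2 * u - 2^-1| * expR (- u)) by ring.
move=> h7.
by have := ler_pM h3 (mulr_ge0 (normr_ge0 _) h6) h2 h7; lra.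
Qed.

End heat_kernel.

(** * Integrals of powers near 0 and near infinity *)

Section power_integrals.
Context {R : realType}.
Notation mu := (@lebesgue_measure R).
Implicit Types (a c x t : R).

Lemma continuous_powR_gt0 a x : 0 < x -> {for x, continuous (fun y : R => y `^ a)}.
Proof.
move=> x0; apply: differentiable_continuous; apply/derivable1_diffP.
by have [] := is_derive1_powR a x0.
Qed.

Lemma is_derive_pow a x : 0 < x -> a != 0 ->
  is_derive x (1 : R) (fun y : R => a^-1 * y `^ a) (x `^ (a - 1)).
Proof.
move=> x0 a0; have d := is_derive1_powR a x0.
by apply: is_derive_eq; rewrite /GRing.scale /= mulrA mulVf// mul1r.
Qed.

Lemma Int_pow0 a c : -1 < a -> 0 < c ->
  Int (fun x => if (0 < x) && (x < c) then x `^ a else 0) /\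
  \int[mu]_x (if (0 < x) && (x < c) then x `^ a else 0) <= (a + 1)^-1 * c `^ (a + 1).
Proof.
move=> a1 c0; have a10 : 0 < a + 1 by lra.
(* Dividing by at least 3 keeps the cut-off interval between c/(n+3) and c - c/(n+3) nonempty. *)
have r3 n : 0 < c / n.+3%:R by rewrite divr_gt0.
have r3' n : c / n.+3%:R <= c / 3.
  by rewrite ler_wpM2l ?(ltW c0)// lef_pV2 ?posrE// ler_nat.
apply: (@FTC_exhaust_Int _ (fun x => (0 < x) && (x < c)) (fun x => (a + 1)^-1 * x `^ (a + 1))
   (fun x => x `^ a) (fun n => c / n.+3%:R) (fun n => c - c / n.+3%:R)).
- move=> x /andP[x0 _]; rewrite -[X in _ `^ X](addrK 1 a); apply: is_derive_pow => //.
  by rewrite gt_eqF.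
- by move=> x /andP[x0 _]; exact: continuous_powR_gt0.
- by mea.
- by mea.
- by move=> n; move: (c / n.+3%:R) (r3' n) => X; lra.
- by move=> n x; move: (c / n.+3%:R) (r3 n) => X X0 /andP[h1 h2]; apply/andP; split; lra.
- move=> x /andP[x0 xc].
  have h (e : R) : 0 < e -> \forall n \near \oo, c / n.+3%:R < e.
    move=> e0; have := nbhs_infty_gtr (c / e); apply: filterS => n cn.
    rewrite ltr_pdivrMr// mulrC -ltr_pdivrMr//; apply: lt_trans cn _.
    by rewrite ltr_nat -addn3 -[ltnLHS]addn0 ltn_add2l.
  have cx0 : 0 < c - x by lra.
  have h1 := h _ x0; have h2 := h _ cx0; near=> n; apply/andP; split.
    by near: n.
  have : c / n.+3%:R < c - x by near: n.
  by move: (c / n.+3%:R) => X; lra.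
- by move=> x _; exact: powR_ge0.
- move=> x y /andP[x0 xc] /andP[y0 yc].
  have : y `^ (a + 1) <= c `^ (a + 1) by apply: ge0_ler_powR; rewrite ?nnegrE; lra.
  have := powR_ge0 x (a + 1); rewrite -mulrBr => h1 h2.
  by rewrite ler_pM2l ?invr_gt0//; lra.
Unshelve. all: by end_near. Qed.

Lemma Int_powy a c : a < -1 -> 0 < c ->
  Int (fun x => if c < x then x `^ a else 0) /\
  \int[mu]_x (if c < x then x `^ a else 0) <= - (a + 1)^-1 * c `^ (a + 1).
Proof.
move=> a1 c0; have a10 : a + 1 < 0 by lra.
apply: (@FTC_exhaust_Int _ (fun x => c < x) (fun x => (a + 1)^-1 * x `^ (a + 1))
   (fun x => x `^ a) (fun n => c + rad n) (fun n => c + n.+2%:R)).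
- move=> x x0; rewrite -[X in _ `^ X](addrK 1 a); apply: is_derive_pow; first by lra.
  by rewrite lt_eqF.
- by move=> x x0; apply: continuous_powR_gt0; lra.
- by mea.
- by mea.
- move=> n; have := rad_le1 (R := R) n; have : (1:R) < n.+2%:R by rewrite ltr1n.
  by lra.
- by move=> n x /andP[h1 h2]; have := rad_gt0 (R := R) n; lra.
- move=> x xc; have cx0 : 0 < x - c by lra.
  have h1 : \forall n \near \oo, rad n < x - c.
    have /cvgrPdist_lt /(_ _ cx0) := @rad_cvg R; apply: filterS => n.
    by rewrite sub0r normrN gtr0_norm// rad_gt0.
  have h2 := nbhs_infty_gtr (x - c); near=> n; apply/andP; split.
    by have : rad n < x - c by [near: n]; lra.
  have : x - c < n%:R by near: n.
  have : n%:R <= n.+2%:R :> R by rewrite ler_nat -addn2 leq_addr.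
  by lra.
- by move=> x _; exact: powR_ge0.
- move=> x y x0 y0.
  have p1 : x `^ (a + 1) <= c `^ (a + 1).
    have xp : 0 < x by lra.
    have e z : z `^ (a + 1) = (z `^ (- (a + 1)))^-1 by rewrite powRN invrK.
    rewrite !e lef_pV2 ?posrE ?powR_gt0//.
    by apply: ge0_ler_powR; rewrite ?nnegrE; lra.
  have p2 := powR_ge0 y (a + 1).
  rewrite -mulrBr mulNr -mulrN ler_nM2l ?invr_lt0//; lra.
Unshelve. all: by end_near. Qed.

End power_integrals.

(** * The Fourier transform of the Gaussian *)

Section gauss_fourier.
Context {R : realType}.
Notation mu := (@lebesgue_measure R).
Implicit Types (a c x t : R).

Lemma Int_gauss t : 0 < t -> Int (fun x : R => expR (- (t * x ^+ 2))).
Proof.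
move=> t0; have t1 : 0 < (4 * t)^-1 by rewrite invr_gt0 mulr_gt0.
have s0 : 0 < 2 * Num.sqrt (pi * (4 * t)^-1) :> R.
  by rewrite mulr_gt0// sqrtr_gt0 mulr_gt0// pi_gt0.
apply: (eq_Int _ (IntZ (2 * Num.sqrt (pi * (4 * t)^-1)) (Int_G0 t1))) => x.
rewrite GE mulrA divff ?gt_eqF// mul1r; congr expR.
by field; rewrite gt_eqF.
Qed.

(** Near 0 the power is integrable because -1 < a; for 1 <= |x| it is at most x^2, which half of the
    exponent absorbs. The range up to 2 leaves room for a full Laplacian. *)
Lemma Int_pow_gauss a t : -1 < a -> a <= 2 -> 0 < t ->
  Int (fun x : R => `|x| `^ a * expR (- (t * x ^+ 2))).
Proof.
move=> a1 a2 t0.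
have t2 : 0 < t / 2 by lra.
have [I1 _] := Int_pow0 a1 (ltr01 : (0 : R) < 1).
have I2 := Int_opp I1; have I3 := IntZ (4 / t) (Int_gauss t2); have I4 := Int_gauss t0.
apply: (le_Int _ _ (IntD (IntD I1 I2) (IntD I3 I4))); first by mea.
move=> x; rewrite ger0_norm; last by rewrite mulr_ge0 ?powR_ge0 ?expR_ge0.
have e0 := expR_ge0 (- (t * x ^+ 2)); have e2 := expR_ge0 (- (t / 2 * x ^+ 2)).
have t4 : 0 <= 4 / t by rewrite divr_ge0// ltW.
have e1 : expR (- (t * x ^+ 2)) <= 1.
  by rewrite -[leRHS]expR0 ler_expR oppr_le0 mulr_ge0 ?sqr_ge0 ?ltW.
have := powR_ge0 `|x| a => p0; have p1 := powR_ge0 x a; have p2 := powR_ge0 (- x) a.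
have [x1|x1] := leP 1 `|x|.
  have : `|x| `^ a <= x ^+ 2.
    rewrite -(real_normK (num_real x)) -powR_mulrn//.
    by apply: ler_powR.
  have : x ^+ 2 * expR (- (t * x ^+ 2)) <= 4 / t * expR (- (t / 2 * x ^+ 2)).
    have -> : expR (- (t * x ^+ 2)) = expR (- (t / 2 * x ^+ 2)) * expR (- (t / 2 * x ^+ 2)).
      by rewrite -expRD; congr expR; field.
    rewrite mulrA ler_wpM2r//.
    have := mul_expRN_le1 (t / 2 * x ^+ 2).
    have -> : t / 2 * x ^+ 2 * expR (- (t / 2 * x ^+ 2)) = t / 2 * (x ^+ 2 * expR (- (t / 2 * x ^+ 2))) by ring.
    rewrite -ler_pdivlMl// => /le_trans; apply.
    by rewrite mulr1 invf_div ler_pM2r ?invr_gt0//; lra.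
  move=> h1 h2; apply: (@le_trans _ _ (4 / t * expR (- (t / 2 * x ^+ 2)))).
    by apply: le_trans h1; rewrite ler_wpM2r.
  by do 2 case: ifP => _; lra.
have [->|xn] := eqVneq x 0.
  rewrite normr0 ltxx /= oppr0 ltxx/= expr0n /= mulr0 oppr0 expR0 mulr1.
  have : (0 : R) `^ a <= 1.
    by have [->|a0] := eqVneq a 0; rewrite ?powRr0 ?powR0.
  by rewrite !mulr0 oppr0 expR0 mulr1; lra.
move: x1; rewrite ltr_norml => /andP[x1 x2].
have [x0|x0] := ltP 0 x.
  rewrite x2 gtr0_norm//= [0 < - x]ltNge oppr_le0 (ltW x0)/=.
  by rewrite addr0; apply: (@le_trans _ _ (x `^ a)); [rewrite ler_piMr|nra].
have xx : 0 < - x by rewrite oppr_gt0 lt_neqAle xn.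
rewrite ler0_norm// xx /= add0r; have -> : - x < 1 by lra.
by apply: (@le_trans _ _ ((- x) `^ a)); [rewrite ler_piMr|nra].
Qed.

Lemma Int_gauss1 t : 0 < t -> Int (fun x : R => `|x| * expR (- (t * x ^+ 2))).
Proof.
move=> t0; have h1 : -1 < (1 : R) by lra. have h2 : (1 : R) <= 2 by lra.
by apply: eq_Int (Int_pow_gauss h1 h2 t0) => x; rewrite powRr1.
Qed.

(** Let F be the cosine integral and S the sine integral. Integration by parts gives S(q) = q F(q) /
    (2 t), and differentiation under the integral gives F' = - S; so F(q) exp(q^2 / (4 t)) is
    constant, with value at 0 the Gaussian integral. *)
Lemma fourier_gauss t r : 0 < t ->
  \int[mu]_x (expR (- (t * x ^+ 2)) * cos (r * x)) = 2 * pi * G t r /\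
  \int[mu]_x (x * expR (- (t * x ^+ 2)) * sin (r * x)) = - (2 * pi * dG t r).
Proof.
move=> t0; set E := fun x : R => expR (- (t * x ^+ 2)).
have IE : Int E by exact: Int_gauss.
have mE : measurable_fun setT E by exact: Int_meas.
have IxE : Int (fun x => x * E x).
  by apply: (le_Int _ _ (Int_gauss1 t0)) => [|x]; [mea|rewrite normrM (ger0_norm (expR_ge0 _))].
have sin1 (y : R) : `|sin y| <= 1 by rewrite ler_norml sin_geN1 sin_le1.
have cos1 (y : R) : `|cos y| <= 1 by rewrite ler_norml cos_geN1 cos_le1.
have IEc q : Int (fun x => E x * cos (q * x)).
  by apply: (le_Int _ _ (Int_norm IE)) => [|x]; [mea|rewrite normrM ler_piMr].
have IEs q : Int (fun x => E x * sin (q * x)).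
  by apply: (le_Int _ _ (Int_norm IE)) => [|x]; [mea|rewrite normrM ler_piMr].
have IxEs q : Int (fun x => x * E x * sin (q * x)).
  by apply: (le_Int _ _ (Int_norm IxE)) => [|x]; [mea|rewrite normrM ler_piMr].
pose F q := \int[mu]_x (E x * cos (q * x)).
pose S q := \int[mu]_x (x * E x * sin (q * x)).
have SF q : S q = q / (2 * t) * F q.
  have d x : is_derive x (1 : R) (fun x => E x * sin (q * x))
      (q * (E x * cos (q * x)) - 2 * t * (x * E x * sin (q * x))).
    by rewrite /E; apply: is_derive_eq; rewrite /GRing.scale /=; ring.
  have I1 : Int (fun x => q * (E x * cos (q * x)) - 2 * t * (x * E x * sin (q * x))).
    by apply: IntB; exact: IntZ.
  have E0 : E n.+1%:R @[n --> \oo] --> (0 : R).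
    apply: (@squeeze_cvgr _ _ _ _ (fun=> 0) (fun n => t^-1 * rad n)).
    - apply: nearW => n; rewrite expR_ge0 /=.
      rewrite /rad -invfM -[leRHS]mulr1 ler_pdivlMl ?mulr_gt0//.
      apply: le_trans (mul_expRN_le1 (t * n.+1%:R ^+ 2)).
      by rewrite ler_wpM2r ?expR_ge0// ler_pM2l// expr2 ler_peMl// ler1n.
    - exact: cvg_cst.
    - by rewrite -[X in _ --> X](mulr0 t^-1); apply: cvgM; [exact: cvg_cst|exact: rad_cvg].
  have Es (a : nat -> R) : (forall n, E (a n) = E n.+1%:R) ->
      E (a n) * sin (q * a n) @[n --> \oo] --> (0 : R).
    move=> aE; apply/cvgr0Pnorm_lt => e e0.
    have /cvgr0Pnorm_lt /(_ e e0) := E0; apply: filterS => n; rewrite aE.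
    by apply: le_lt_trans; rewrite normrM ler_piMr.
  have H : \int[mu]_x (q * (E x * cos (q * x)) - 2 * t * (x * E x * sin (q * x))) = 0.
    have cf x : xpredT x ->
        {for x, continuous (fun x => q * (E x * cos (q * x)) - 2 * t * (x * E x * sin (q * x)))}.
      move=> _; apply: differentiable_continuous; apply/derivable1_diffP.
      by rewrite /E; apply: ex_derive.
    have mf := Int_meas I1.
    have ab n : - n.+1%:R < n.+1%:R :> R by rewrite gtrN// ltr0n.
    have Dab (x : R) : xpredT x -> \forall n \near \oo, - n.+1%:R < x < n.+1%:R.
      move=> _; have := nbhs_infty_gtr `|x|; apply: filterS => n h.
      by rewrite -ltr_norml (lt_trans h)// ltr_nat.
    have := @FTC_exhaust _ xpredT _ _ (fun n => - n.+1%:R) (fun n => n.+1%:R)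
      (fun x _ => d x) cf mf mf ab (fun _ _ _ => isT) Dab 0 0 I1.
    rewrite subr0; apply; apply: Es => // n.
    by rewrite /E sqrrN.
  move: H; rewrite RIB; [|exact: IntZ..]; rewrite !RIZ// -/(F q) -/(S q) => /subr0_eq h.
  have -> : q / (2 * t) * F q = q * F q / (2 * t) by ring.
  by rewrite h; field; rewrite gt_eqF.
have dE x q : is_derive q (1 : R) (fun q => E x * cos (q * x)) (- (x * E x * sin (q * x))).
  by apply: is_derive_eq; rewrite /GRing.scale /=; ring.
have dF q : is_derive q (1 : R) F (- S q).
  have Ia : `]q - 1, q + 1[%classic q by rewrite /= in_itv /=; lra.
  have pE x q' : partial1of2 (fun q x => E x * cos (q * x)) q' x = - (x * E x * sin (q' * x)).
    by rewrite partial1of2E; have [] := dE x q'.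
  have intf q' : `]q - 1, q + 1[%classic q' -> mu.-integrable setT (EFin \o (fun x => E x * cos (q' * x))).
    by move=> _; exact: IEc.
  have derf q' x : `]q - 1, q + 1[%classic q' -> setT x -> derivable (fun q : R => E x * cos (q * x)) q' (1 : R).
    by move=> _ _; have [] := dE x q'.
  have ub q' x : `]q - 1, q + 1[%classic q' -> setT x ->
      `|partial1of2 (fun q x : R => E x * cos (q * x)) q' x| <= `|x * E x|.
    by move=> _ _; rewrite pE normrN normrM ler_piMr.
  have G0 x : 0 <= `|x * E x| by [].
  have h1 := derivable_under_integral measurableT Ia intf derf G0 (Int_norm IxE) ub.
  have h2 := differentiation_under_integral measurableT Ia intf derf G0 (Int_norm IxE) ub.
  apply: DeriveDef; first exact: h1.
  rewrite -derive1E h2 -RIN; last exact: IxEs.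
  by apply: eq_RI => x; rewrite pE.
have FE q : F q = 2 * pi * G t q.
  have t1 : 0 < (4 * t)^-1 by rewrite invr_gt0 mulr_gt0.
  have dh x : is_derive x (1 : R) (fun q => F q * expR (q ^+ 2 / (4 * t))) 0.
    have dFx := dF x.
    apply: is_derive_eq; rewrite SF /GRing.scale /=; field.
    by rewrite gt_eqF.
  have := is_derive_0_is_cst q 0 dh.
  rewrite expr0n mul0r expR0 mulr1 => h.
  have -> : F q = F 0 * expR (- q ^+ 2 / (4 * t)).
    by rewrite -h -mulrA -expRD mulNr subrr expR0 mulr1.
  have -> : F 0 = 2 * Num.sqrt (pi * (4 * t)^-1).
    transitivity (\int[mu]_x (2 * Num.sqrt (pi * (4 * t)^-1) * G (4 * t)^-1 x)); last first.
      by rewrite RIZ ?RI_G0 ?mulr1//; exact: Int_G0.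
    apply: eq_RI => x; rewrite mul0r cos0 mulr1 GE mulrA divff ?mul1r; last first.
      by rewrite gt_eqF// mulr_gt0// sqrtr_gt0 mulr_gt0// pi_gt0.
    by congr expR; field; rewrite gt_eqF.
  rewrite GE mulrA; congr (_ * _).
  have pp : 0 < pi * t by rewrite mulr_gt0// pi_gt0.
  apply: (@mulIf _ (2 * Num.sqrt (pi * t))); first by rewrite gt_eqF// mulr_gt0// sqrtr_gt0.
  rewrite divfK; last by rewrite gt_eqF// mulr_gt0// sqrtr_gt0.
  rewrite mulrACA -sqrtrM; last by rewrite mulr_ge0 ?pi_ge0 ?ltW.
  have -> : pi / (4 * t) * (pi * t) = (pi / 2) ^+ 2.
    by field; rewrite gt_eqF.
  rewrite sqrtr_sqr ger0_norm; last by rewrite divr_ge0 ?pi_ge0.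
  by field.
split; first exact: FE.
by rewrite -/(S r) SF FE /dG; field; rewrite gt_eqF.
Qed.

End gauss_fourier.

(** * Testing against Gaussians *)

Section gauss_tests.
Context {R : realType}.
Notation mu := (@lebesgue_measure R).
Implicit Types (a b c x t M : R) (h : R -> R).

Lemma gaussE t x : 0 < t -> expR (- (t * x ^+ 2)) =
  2 * Num.sqrt (pi * (4 * t)^-1) * G (4 * t)^-1 x.
Proof.
move=> t0; rewrite GE [RHS]mulrA divff ?mul1r; last first.
  by rewrite gt_eqF// mulr_gt0// sqrtr_gt0 mulr_gt0 ?pi_gt0// invr_gt0 mulr_gt0.
by congr expR; field; rewrite gt_eqF.
Qed.

Lemma GE4 t x : 0 < t -> G t x = (2 * Num.sqrt (pi * t))^-1 * expR (- ((4 * t)^-1 * x ^+ 2)).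
Proof. by move=> t0; rewrite GE; congr (_ * expR _); rewrite mulNr mulrC. Qed.

(** A kernel with bounded centre is dominated by one centred kernel at doubled time, because (x -
    c)^2 + c^2 - x^2 / 2 = (x - 2 c)^2 / 2 is nonnegative. *)
Lemma G_shift_le t x c M : 0 < t -> `|c| <= M ->
  G t (x - c) <= Num.sqrt 2 * expR (M ^+ 2 / (4 * t)) * G (2 * t) x.
Proof.
move=> t0 cM.
have -> : G (2 * t) x = (Num.sqrt 2)^-1 * ((2 * Num.sqrt (pi * t))^-1 * expR (- (x ^+ 2) / (8 * t))).
  rewrite GE [pi * _]mulrCA (@sqrtrM _ 2)// [RHS]mulrA -invfM; congr (_^-1 * expR _).
    by ring.
  by field; rewrite gt_eqF.
set A := (2 * _)^-1 * _; have s2 : Num.sqrt 2 != 0 :> R by rewrite gt_eqF// sqrtr_gt0.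
have -> : Num.sqrt 2 * expR (M ^+ 2 / (4 * t)) * ((Num.sqrt 2)^-1 * A) =
  expR (M ^+ 2 / (4 * t)) * A by field.
rewrite /A mulrCA GE -expRD ler_pM2l; last first.
  by rewrite invr_gt0 mulr_gt0// sqrtr_gt0 mulr_gt0// pi_gt0.
rewrite ler_expR.
have -> : M ^+ 2 / (4 * t) + - x ^+ 2 / (8 * t) = (M ^+ 2 - x ^+ 2 / 2) / (4 * t).
  by field; rewrite gt_eqF.
rewrite ler_pM2r ?invr_gt0 ?mulr_gt0//.
have : c ^+ 2 <= M ^+ 2.
  by rewrite -(real_normK (num_real c)) ler_pXn2r ?nnegrE ?(le_trans _ cM).
by have := sqr_ge0 (x - 2 * c); nra.
Qed.

(** The functions whose heat flow exists at every positive time. The class contains bounded and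
    integrable functions, and everything that pairs integrably with Schwartz functions, so it is the
    natural domain of the uniqueness argument. *)
Definition gtest h := forall t a, 0 < t -> Int (fun x => h x * G t (x - a)).

Lemma gtest_meas h : gtest h -> measurable_fun setT h.
Proof.
move=> gh; have m1 := Int_meas (gh 1 0 ltr01).
have -> : h = (fun x => h x * G 1 (x - 0) / G 1 (x - 0)).
  by apply/funext => x; rewrite mulfK// gt_eqF// G_gt0.
by mea.
Qed.

Lemma gtest_gauss h t : gtest h -> 0 < t -> Int (fun x => h x * expR (- (t * x ^+ 2))).
Proof.
move=> gh t0; have t1 : 0 < (4 * t)^-1 by rewrite invr_gt0 mulr_gt0.
apply: (eq_Int _ (IntZ (2 * Num.sqrt (pi * (4 * t)^-1)) (gh _ 0 t1))) => x.
by rewrite gaussE// subr0; ring.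
Qed.

Lemma gtest_box h a b : gtest h -> Int (fun x => h x * box a b x).
Proof.
move=> gh; have mh := gtest_meas gh.
pose M := `|a| + `|b|.
apply: (@le_Int _ (fun x => expR (M ^+ 2) * `|h x * expR (- (1 * x ^+ 2))|)).
- by mea.
- move=> x; rewrite !normrM (ger0_norm (box_ge0 _ _ _)) (ger0_norm (expR_ge0 _)) mul1r.
  rewrite mulrCA ler_wpM2l// -expRD /box; case: ifP => [/andP[h1 h2]|_]; last exact: expR_ge0.
  rewrite -[leLHS]expR0 ler_expR subr_ge0.
  rewrite -(real_normK (num_real x)) ler_pXn2r ?nnegrE ?addr_ge0// /M.
  have := ler_norm b; have := ler_norm (- a); rewrite normrN => h3 h4.
  by rewrite ler_norml; apply/andP; split; have := normr_ge0 a; have := normr_ge0 b; lra.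
- by apply: IntZ; apply: Int_norm; exact: gtest_gauss.
Qed.

Lemma gtest_locInt h : gtest h -> locInt h.
Proof. by move=> gh; split; [exact: gtest_meas|move=> a b; exact: gtest_box]. Qed.

Lemma Int_smooth_box a b t x : 0 < t -> Int (fun c => box a b c * G t (x - c)).
Proof.
by move=> t0; apply: (IntMb _ (norm_box a b) (Int_Gr x t0)); mea.
Qed.

Lemma smooth_box_ge0 a b t x : 0 <= \int[mu]_c (box a b c * G t (x - c)).
Proof. by apply: RI_ge0 => c; rewrite mulr_ge0 ?box_ge0 ?G_ge0. Qed.

Lemma smooth_box_le1 a b t x : 0 < t -> \int[mu]_c (box a b c * G t (x - c)) <= 1.
Proof.
move=> t0; rewrite -(RI_Gr x t0); apply: le_RI; [exact: Int_smooth_box|exact: Int_Gr|].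
by move=> c; rewrite ler_piMl ?G_ge0// box_le1.
Qed.

Lemma smooth_box_cvg a b x : a != x -> b != x ->
  \int[mu]_c (box a b c * G (rad n) (x - c)) @[n --> \oo] --> box a b x.
Proof.
move=> ax bx.
(* Rescaling moves the time from the kernel into the indicator, so that [G 1] dominates. The end
   points are excluded, since the limit there is one half. *)
have E n : \int[mu]_c (box a b c * G (rad n) (x - c)) =
    \int[mu]_y (box a b (x - Num.sqrt (rad n) * y) * G 1 y).
  set s := Num.sqrt (rad n).
  have s0 : 0 < s by rewrite sqrtr_gt0 rad_gt0.
  pose f y := box a b (x - s * y) * G 1 y.
  have If : Int f.
    have m1 : measurable_fun setT (fun y => box a b (x - s * y)) by mea.
    exact: (IntMb m1 (fun y => norm_box a b (x - s * y)) Int_RI_G1.1).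
  have s1 : 0 < s^-1 by rewrite invr_gt0.
  have := RI_affine (- (s^-1 * x)) s1 (Int_opp If).
  rewrite (RI_opp If) invrK -/f => H.
  rewrite -[RHS]mul1r -(mulVf (lt0r_neq0 s0)) -mulrA -H -RIZ; last first.
    exact: Int_affine (Int_opp If).
  apply: eq_RI => c; rewrite /f G_scale ?rad_gt0// -/s.
  have -> : x - s * - (s^-1 * c - s^-1 * x) = c by field; rewrite gt_eqF.
  have -> : - (s^-1 * c - s^-1 * x) = s^-1 * (x - c) by ring.
  by ring.
under eq_fun do rewrite E.
have -> : box a b x = \int[mu]_y (box a b x * G 1 y).
  by rewrite RIZ ?RI_G0 ?mulr1//; exact: Int_G0.
apply: (@dct _ _ _ (G 1)).
- by move=> n; mea.
- by mea.
- exact: Int_G0.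
- by move=> n y; rewrite normrM (ger0_norm (G_ge0 _ _)) ler_piMl ?G_ge0 ?norm_box.
- apply: ae_all => y; apply: cvgM; last exact: cvg_cst.
  have cx : x - Num.sqrt (rad n) * y @[n --> \oo] --> x.
    rewrite -[X in _ --> X]subr0 -(mul0r y) -sqrtr0.
    apply: cvgB; first exact: cvg_cst.
    apply: cvgM; last exact: cvg_cst.
    exact: (cvg_comp _ _ (@rad_cvg R) (@sqrt_continuous R 0)).
  apply: cvg_near_cst; rewrite /box.
  have [xa|xa] := ltP x a.
    rewrite [a < x]ltNge (ltW xa)/=.
    have h1 : \forall n \near \oo, x - Num.sqrt (rad n) * y < a by exact: cvgr_lt cx a xa.
    near=> n.
    have h : x - Num.sqrt (rad n) * y < a by near: n.
    by rewrite [a < _]ltNge (ltW h).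
  have xa' : a < x by rewrite lt_neqAle ax.
  rewrite xa' /=.
  have [xb|xb] := ltP b x.
    rewrite [x < b]ltNge (ltW xb)/=.
    have h1 : \forall n \near \oo, b < x - Num.sqrt (rad n) * y by exact: cvgr_gt cx b xb.
    near=> n.
    have h : b < x - Num.sqrt (rad n) * y by near: n.
    by rewrite [_ < b]ltNge (ltW h) andbF.
  have xb' : x < b by rewrite lt_neqAle eq_sym bx.
  rewrite xb'.
  have h1 : \forall n \near \oo, x - Num.sqrt (rad n) * y < b by exact: cvgr_lt cx b xb'.
  have h2 : \forall n \near \oo, a < x - Num.sqrt (rad n) * y by exact: cvgr_gt cx a xa'.
  by near=> n; have -> : a < x - Num.sqrt (rad n) * y by [near: n];
    have -> : x - Num.sqrt (rad n) * y < b by near: n.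
Unshelve. all: by end_near. Qed.

(** One Gaussian dominates the smoothed indicators at all times up to 1, as is needed against a
    merely [gtest] function. With M = |a| + |b| and |x| beyond 2 M + 2, every c in the interval
    satisfies (x - c)^2 >= x^2/4 + 1. Divided by 4 t, the first term leaves x^2/16 and the second
    beats the factor t^(-1/2). *)
Lemma smooth_box_dom a b : exists2 C : R, 0 <= C & forall t x, 0 < t -> t <= 1 ->
  \int[mu]_c (box a b c * G t (x - c)) <= C * expR (- (16^-1 * x ^+ 2)).
Proof.
pose M := `|a| + `|b|; have M0 : 0 <= M by rewrite addr_ge0.
pose C1 := expR (16^-1 * (2 * M + 2) ^+ 2).
have Iab := RI_ge0 (box_ge0 (R := R) a b).
exists (C1 + 2 * \int[mu]_c box a b c); first by rewrite addr_ge0 ?expR_ge0// mulr_ge0.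
move=> t x t0 t1; have e0 := expR_ge0 (- (16^-1 * x ^+ 2)).
have [xM|xM] := leP `|x| (2 * M + 2).
  apply: (@le_trans _ _ 1); first exact: smooth_box_le1.
  apply: (@le_trans _ _ (C1 * expR (- (16^-1 * x ^+ 2)))); last first.
    by rewrite mulrDl lerDl mulr_ge0// mulr_ge0.
  rewrite -expRD -[leLHS]expR0 ler_expR -mulrBr mulr_ge0// subr_ge0.
  by rewrite -(real_normK (num_real x)) ler_pXn2r ?nnegrE//; lra.
apply: (@le_trans _ _ (2 * (\int[mu]_c box a b c) * expR (- (16^-1 * x ^+ 2)))); last first.
  by rewrite [leRHS]mulrDl lerDr mulr_ge0// expR_ge0.
rewrite mulrAC -RIZ; last exact: Int_box.
apply: le_RI; [exact: Int_smooth_box|by apply: IntZ; exact: Int_box|] => c.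
rewrite [leRHS]mulrC; rewrite /box; case: ifP => [/andP[h1 h2]|_]; last by rewrite !mul0r.
rewrite !mul1r.
have cM : `|c| <= M.
  have := ler_norm b; have := ler_norm (- a); rewrite normrN => h3 h4.
  by rewrite ler_norml /M; apply/andP; split; have := normr_ge0 a; have := normr_ge0 b; lra.
have xc : x ^+ 2 / 4 + 1 <= (x - c) ^+ 2.
  have h5 : `|x| / 2 + 1 <= `|x - c|.
    have := ler_normD (x - c) c; rewrite subrK => h6.
    by lra.
  have h7 : (`|x| / 2 + 1) ^+ 2 <= (x - c) ^+ 2.
    rewrite -[leRHS](real_normK (num_real _)) ler_pXn2r ?nnegrE ?addr_ge0//.
  apply: le_trans h7; rewrite -(real_normK (num_real x)).
  by have := normr_ge0 x; nra.
pose y := (Num.sqrt t)^-1.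
have st : 0 < Num.sqrt t by rewrite sqrtr_gt0.
have y0 : 0 < y by rewrite invr_gt0.
have tE : t = y ^- 2 by rewrite /y exprVn sqr_sqrtr ?invrK ?ltW.
have y1 : 1 <= y ^+ 2 by rewrite -(invrK (y ^+ 2)) -tE invf_ge1.
have E1 : G t (x - c) <= y * (2 * Num.sqrt pi)^-1 * expR (- (y ^+ 2 / 4) - 16^-1 * x ^+ 2).
  rewrite GE sqrtrM ?pi_ge0//.
  have -> : (2 * (Num.sqrt pi * Num.sqrt t))^-1 = y * (2 * Num.sqrt pi)^-1.
    by rewrite mulrA invfM mulrC.
  rewrite ler_pM2l; last by rewrite mulr_gt0// invr_gt0 mulr_gt0// sqrtr_gt0 pi_gt0.
  rewrite ler_expR tE.
  have -> : - (x - c) ^+ 2 / (4 * y ^- 2) = - (y ^+ 2 / 4 * (x - c) ^+ 2).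
    by field; rewrite gt_eqF.
  rewrite -opprD lerN2.
  have : y ^+ 2 / 4 * (x ^+ 2 / 4 + 1) <= y ^+ 2 / 4 * (x - c) ^+ 2.
    by rewrite ler_wpM2l// divr_ge0// sqr_ge0.
  by have := sqr_ge0 x; nra.
apply: le_trans E1 _; rewrite expRD mulrA ler_wpM2r ?expR_ge0//.
have p1 : (2 * Num.sqrt pi)^-1 <= 1 :> R.
  rewrite invf_le1 ?mulr_gt0 ?sqrtr_gt0 ?pi_gt0//.
  have : 1 <= Num.sqrt pi :> R.
    by rewrite -(sqrtr1 R) ler_sqrt ?pi_ge0//; have := pi_ge2 R; lra.
  by lra.
have p0 : 0 <= (2 * Num.sqrt pi)^-1 :> R by rewrite invr_ge0 mulr_ge0 ?sqrtr_ge0.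
have := sqr_mul_expRN_le1 ((Num.sqrt 2)^-1 * y).
have s2 : 0 < Num.sqrt 2 :> R by rewrite sqrtr_gt0.
rewrite normrM !gtr0_norm ?invr_gt0// exprMn exprVn sqr_sqrtr//.
have -> : - (2^-1 * y ^+ 2) / 2 = - (y ^+ 2 / 4) by field.
rewrite -[X in X <= 1]mulrA ler_pdivrMl// mulr1 => h8.
rewrite mulrAC; apply: (le_trans (ler_piMr (mulr_ge0 (ltW y0) (expR_ge0 _)) p1)).
by apply: (le_trans h8); exact: sqrt2_le2.
Qed.

(** Fubini moves the smoothing from h, about which little is known, to the indicator, whose
    smoothing converges under a Gaussian majorant. *)
Lemma gauss_box_cvg h a b : gtest h ->
  \int[mu]_c ((\int[mu]_x (h x * G (rad n) (x - c))) * box a b c) @[n --> \oo] -->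
  \int[mu]_x (h x * box a b x).
Proof.
move=> gh; have mh := gtest_meas gh.
have I2 t : 0 < t -> Int2 (fun c x => h x * G t (x - c) * box a b c).
  move=> t0; pose M := `|a| + `|b|.
  have t2 : 0 < 2 * t by lra.
  have IG : Int (fun x => h x * G (2 * t) x).
    by apply: eq_Int (gh _ 0 t2) => x; rewrite subr0.
  apply: (le_Int2 _ _ (Int2Z (Num.sqrt 2 * expR (M ^+ 2 / (4 * t)))
     (Int2_prod (Int_box a b) (Int_norm IG)))).
    by rewrite /meas2; mea.
  have gG s z := ger0_norm (G_ge0 (R := R) s z).
  move=> c x.
  rewrite !normrM (ger0_norm (box_ge0 _ _ _)) !gG.
  rewrite /box; case: ifP => [/andP[h1 h2]|_]; last by rewrite mulr0 mul0r mulr0.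
  rewrite mulr1 mul1r mulrCA ler_wpM2l// G_shift_le//.
  have := ler_norm b; have := ler_norm (- a); rewrite normrN => h3 h4.
  by rewrite ler_norml /M; apply/andP; split; have := normr_ge0 a; have := normr_ge0 b; lra.
have E n : \int[mu]_c ((\int[mu]_x (h x * G (rad n) (x - c))) * box a b c) =
    \int[mu]_x (h x * \int[mu]_c (box a b c * G (rad n) (x - c))).
  have rn := rad_gt0 (R := R) n.
  transitivity (\int[mu]_c \int[mu]_x (h x * G (rad n) (x - c) * box a b c)).
    by apply: eq_RI => c; rewrite RIZr//; exact: gh.
  rewrite (fub (I2 _ rn)); apply: eq_RI => x.
  by rewrite -RIZ; [apply: eq_RI => c; ring|exact: Int_smooth_box].
under eq_fun do rewrite E.
have [C C0 HC] := smooth_box_dom a b.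
have e16 : (0 : R) < 16^-1 by rewrite invr_gt0.
apply: (@dct _ _ _ (fun x => C * `|h x * expR (- (16^-1 * x ^+ 2))|)).
- move=> n; have rn := rad_gt0 (R := R) n.
  have : measurable_fun setT (fun x => \int[mu]_c (box a b c * G (rad n) (x - c))).
    by apply: meas_RI => [|x]; [rewrite /meas2; mea|exact: Int_smooth_box].
  by mea.
- by mea.
- by apply: IntZ; apply: Int_norm; exact: gtest_gauss.
- move=> n x; rewrite !normrM (ger0_norm (expR_ge0 _)) (ger0_norm (smooth_box_ge0 a b (rad n) x)).
  by rewrite mulrCA ler_wpM2l// HC// ?rad_gt0// rad_le1.
- have null (c : R) : {ae mu, forall x, c != x}.
    exists [set c]; split => //; first exact: lebesgue_measure_set1.
    by move=> x /= /negP; rewrite negbK => /eqP ->.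
  apply: ae_mp (ae_and (null a) (null b)) => x [ax bx].
  by apply: cvgM; [exact: cvg_cst|exact: smooth_box_cvg].
Qed.

(** This takes the place of injectivity of the Fourier transform: all later identifications of
    functions, up to null sets, go through it. *)
Lemma gtest_eq0 h : gtest h ->
  (forall t a, 0 < t -> \int[mu]_x (h x * G t (x - a)) = 0) ->
  {ae mu, forall x, h x = 0}.
Proof.
move=> gh h0; apply: locInt_eq0; first exact: gtest_locInt.
move=> a b ab; have := @gauss_box_cvg h a b gh.
have -> : (fun n => \int[mu]_c ((\int[mu]_x (h x * G (rad n) (x - c))) * box a b c)) = (fun=> 0).
  apply/funext => n; rewrite -[RHS](@RI0 R); apply: eq_RI => c.
  by rewrite h0 ?mul0r// rad_gt0.
by move/cvg_lim => <-//; rewrite lim_cst.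
Qed.

End gauss_tests.

(** * Heat flow and subordination *)

Section heat_flow.
Context {R : realType}.
Notation mu := (@lebesgue_measure R).
Implicit Types (a b c s t x y : R) (q v h : R -> R).

Lemma ae_neq c : {ae mu, forall x, x != c}.
Proof.
exists [set c]; split => //; first exact: lebesgue_measure_set1.
by move=> x /= /negP; rewrite negbK => /eqP ->.
Qed.

Lemma RI_gt0 (f : R -> R) (a b c : R) : Int f -> (forall x, 0 <= f x) -> a < b -> 0 < c ->
  (forall x, a < x < b -> c <= f x) -> 0 < \int[mu]_x f x.
Proof.
move=> If f0 ab c0 cf; have Ib := Int_box (R := R) a b.
apply: (@lt_le_trans _ _ (\int[mu]_x (c * box a b x))).
  by rewrite RIZ// RI_box1 ?ltW// mulr_gt0 ?subr_gt0.
apply: le_RI => //; first exact: IntZ.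
move=> x; rewrite /box; case: ifP => [/cf|_]; first by rewrite mulr1.
by rewrite mulr0.
Qed.

Lemma derive_lip (F f : R -> R) (M : R) : (forall x, is_derive x (1 : R) F (f x)) ->
  (forall x, `|f x| <= M) -> forall x y, `|F x - F y| <= M * `|x - y|.
Proof.
move=> dF fM.
have cF : continuous F.
  by move=> x; apply/differentiable_continuous/derivable1_diffP; exact: (@ex_derive _ _ _ _ _ _ _ (dF x)).
have W x y : x < y -> `|F y - F x| <= M * `|y - x|.
  move=> xy; have [|z _ ->] := @MVT R F f x y xy (fun z _ => dF z).
    exact: continuous_subspaceT.
  by rewrite normrM ler_wpM2r.
move=> x y; have [xy|xy|->] := ltgtP x y; last by rewrite !subrr normr0 mulr0.
  by rewrite distrC [`|x - y|]distrC; exact: W.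
exact: W.
Qed.

(** Square roots of negative numbers and the inverse of 0 are 0 by convention, so the flow makes
    sense at all times and is jointly measurable on the plane. *)
Lemma G_neg t x : t <= 0 -> G t x = 0.
Proof.
by move=> t0; rewrite GE ler0_sqrtr ?mulr0 ?invr0 ?mul0r// mulr_ge0_le0 ?pi_ge0.
Qed.

Lemma G_le_sqrt t x : 0 < t -> G t x <= (Num.sqrt t)^-1.
Proof.
move=> t0; apply: (le_trans (G_le_max x t0)).
have st : 0 < Num.sqrt t by rewrite sqrtr_gt0.
rewrite lef_pV2 ?posrE ?mulr_gt0 ?sqrtr_gt0 ?mulr_gt0 ?pi_gt0//.
rewrite sqrtrM ?pi_ge0// mulrA ler_peMl// ?ltW//.
have : 1 <= Num.sqrt pi :> R.
  by rewrite -(sqrtr1 R) ler_sqrt ?pi_ge0//; have := pi_ge2 R; lra.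
by lra.
Qed.

Lemma Int_gtest q : Int q -> gtest q.
Proof.
move=> Iq t a t0; have mq := Int_meas Iq.
have mG : measurable_fun setT (fun x => G t (x - a)) by mea.
have hG x : `|G t (x - a)| <= (Num.sqrt t)^-1 by rewrite ger0_norm ?G_ge0// G_le_sqrt.
by apply: eq_Int (IntMb mG hG Iq) => x; rewrite mulrC.
Qed.

Lemma bounded_gtest (M : R) v : measurable_fun setT v -> (forall x, `|v x| <= M) -> gtest v.
Proof. by move=> mv vM t a t0; exact: (IntMb mv vM (Int_G a t0)). Qed.

Lemma le_gtest v h : measurable_fun setT h -> (forall x, `|h x| <= v x) -> gtest v -> gtest h.
Proof.
move=> mh hv gv t a t0; apply: (le_Int _ _ (gv t a t0)); first by mea.
by move=> x; rewrite normrM (ger0_norm (G_ge0 _ _)) ler_wpM2r ?G_ge0.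
Qed.

Lemma gtestD v h : gtest v -> gtest h -> gtest (fun x => v x + h x).
Proof.
by move=> gv gh t a t0; apply: eq_Int (IntD (gv t a t0) (gh t a t0)) => x; rewrite mulrDl.
Qed.

Lemma gtestZ c v : gtest v -> gtest (fun x => c * v x).
Proof. by move=> gv t a t0; apply: eq_Int (IntZ c (gv t a t0)) => x; rewrite mulrA. Qed.

Lemma gtest_norm v : gtest v -> gtest (fun x => `|v x|).
Proof.
move=> gv t a t0; apply: eq_Int (Int_norm (gv t a t0)) => x.
by rewrite normrM (ger0_norm (G_ge0 _ _)).
Qed.

Lemma gtest_slice v t a : gtest v -> Int (fun x => v x * G t (x - a)).
Proof.
move=> gv; have [t0|t0] := ltP 0 t; first exact: gv.
by apply: eq_Int (Int0 (R := R)) => x; rewrite G_neg// mulr0.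
Qed.

(** The heat semigroup e^(t Delta) applied to q, at the point a. *)
Definition H q t a : R := \int[mu]_y (q y * G t (y - a)).

Lemma meas_H v : gtest v -> measurable_fun setT (fun z : R * R => H v z.1 z.2).
Proof.
move=> gv; have mv := gtest_meas gv.
apply: (@meas_RI_gen _ _ _ (fun (z : R * R) y => v y * G z.1 (y - z.2))).
  have m1 : measurable_fun setT (fun z : (R * R) * R => z.1.1).
    exact: measurableT_comp measurable_fst measurable_fst.
  have m2 : measurable_fun setT (fun z : (R * R) * R => z.1.2).
    exact: measurableT_comp measurable_snd measurable_fst.
  by mea.
by move=> z; exact: gtest_slice.
Qed.

Lemma H_norm_le v t a : gtest v -> `|H v t a| <= H (fun y => `|v y|) t a.
Proof.
move=> gv; apply: norm_RI_le; [exact: gtest_slice|exact: gtest_slice (gtest_norm gv)|].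
by move=> x; rewrite normrM (ger0_norm (G_ge0 _ _)).
Qed.

Lemma le_H v h t a : gtest v -> gtest h -> (forall x, v x <= h x) -> H v t a <= H h t a.
Proof.
by move=> gv gh vh; apply: le_RI; [exact: gtest_slice..|move=> x; rewrite ler_wpM2r ?G_ge0].
Qed.

Lemma H_ge0 v t a : (forall x, 0 <= v x) -> 0 <= H v t a.
Proof. by move=> v0; apply: RI_ge0 => x; rewrite mulr_ge0 ?G_ge0. Qed.

Lemma HD v h t a : gtest v -> gtest h -> H (fun x => v x + h x) t a = H v t a + H h t a.
Proof.
move=> gv gh; rewrite -RID; [|exact: gtest_slice..].
by apply: eq_RI => x; rewrite mulrDl.
Qed.

Lemma HZ c v t a : gtest v -> H (fun x => c * v x) t a = c * H v t a.
Proof.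
by move=> gv; rewrite -RIZ; [apply: eq_RI => x; rewrite mulrA|exact: gtest_slice].
Qed.

Lemma H_bounded (M : R) v t a : measurable_fun setT v -> (forall x, `|v x| <= M) -> 0 < t ->
  `|H v t a| <= M.
Proof.
move=> mv vM t0; have M0 : 0 <= M := le_trans (normr_ge0 _) (vM 0).
rewrite -[leRHS]mulr1 -(RI_G a t0) -RIZ; last exact: Int_G.
apply: norm_RI_le; [exact: (bounded_gtest mv vM)|exact/IntZ/Int_G|] => x.
by rewrite normrM (ger0_norm (G_ge0 _ _)) ler_wpM2r ?G_ge0.
Qed.

Lemma H_le q t a : Int q -> 0 < t -> `|H q t a| <= (Num.sqrt t)^-1 * \int[mu]_x `|q x|.
Proof.
move=> Iq t0; have Iq' := Int_norm Iq; rewrite -RIZ//.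
apply: norm_RI_le; [exact: Int_gtest|exact: IntZ|] => x.
by rewrite normrM (ger0_norm (G_ge0 _ _)) mulrC ler_wpM2r// G_le_sqrt.
Qed.

Lemma Int2_H q t : Int q -> 0 < t -> Int2 (fun y a => q y * G t (y - a)).
Proof.
move=> Iq t0; have mq := Int_meas Iq.
apply: (Int2P _ _ (Int_norm Iq)); first by rewrite /meas2; mea.
  by move=> y; apply: IntZ; exact: Int_Gr.
move=> y; under eq_RI do rewrite normrM (ger0_norm (G_ge0 _ _)).
by rewrite RIZ ?RI_Gr ?mulr1//; exact: Int_Gr.
Qed.

Lemma Int_Ht q t : Int q -> 0 < t -> Int (H q t).
Proof. by move=> Iq t0; have := Int2_Int (Int2_swap (Int2_H Iq t0)). Qed.

Lemma RI_H q t : Int q -> 0 < t -> \int[mu]_a H q t a = \int[mu]_y q y.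
Proof.
move=> Iq t0; rewrite -(fub (Int2_H Iq t0)); apply: eq_RI => y.
by rewrite RIZ ?RI_Gr ?mulr1//; exact: Int_Gr.
Qed.

Lemma RI_norm_H q t : Int q -> 0 < t -> \int[mu]_a `|H q t a| <= \int[mu]_y `|q y|.
Proof.
move=> Iq t0; rewrite -(RI_H (Int_norm Iq) t0); apply: le_RI.
- exact/Int_norm/Int_Ht.
- exact/Int_Ht/t0/Int_norm.
- by move=> a; apply: H_norm_le; exact: Int_gtest.
Qed.

Lemma H_semigroup v s t a : gtest v -> 0 < s -> 0 < t ->
  Int (fun x => H v s x * G t (x - a)) /\ H (H v s) t a = H v (s + t) a.
Proof.
move=> gv s0 t0; have mv := gtest_meas gv; have st0 := addr_gt0 s0 t0.
have I2 : Int2 (fun y x => v y * (G s (y - x) * G t (x - a))).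
  apply: (Int2P _ _ (Int_norm (gv _ a st0))); first by rewrite /meas2; mea.
    by move=> y; apply: IntZ; exact: (G_conv2 y a s0 t0).1.
  move=> y; under eq_RI do rewrite normrM (ger0_norm (mulr_ge0 (G_ge0 _ _) (G_ge0 _ _))).
  have [I E] := G_conv2 y a s0 t0.
  by rewrite RIZ// E normrM (ger0_norm (G_ge0 _ _)).
have E x : \int[mu]_y (v y * (G s (y - x) * G t (x - a))) = H v s x * G t (x - a).
  by rewrite -RIZr; [apply: eq_RI => y; rewrite mulrA|exact: gv].
split; first by apply: eq_Int (Int2_Int (Int2_swap I2)) => x; rewrite E.
rewrite /H; under eq_RI do rewrite -/(H _ _ _) -E.
rewrite -(fub I2); apply: eq_RI => y.
have [I E2] := G_conv2 y a s0 t0.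
by rewrite RIZ// E2.
Qed.

Lemma dG_le_sup t x : 0 < t -> `|dG t x| <= 4 * t^-1.
Proof.
move=> t0; apply: (le_trans (dG_le x t0)).
have t2 : 0 < 2 * t by lra.
have st : 0 < Num.sqrt t by rewrite sqrtr_gt0.
rewrite -mulrA ler_pM2l// -[X in _ <= X^-1](sqr_sqrtr (ltW t0)) expr2 invfM.
rewrite ler_pM2l ?invr_gt0//; apply: (le_trans (G_le_sqrt x t2)).
by rewrite lef_pV2 ?posrE ?sqrtr_gt0// ler_sqrt; lra.
Qed.

Lemma G_lip t x y : 0 < t -> `|G t x - G t y| <= 4 * t^-1 * `|x - y|.
Proof.
by move=> t0; apply: derive_lip => z; [exact: is_derive_G|exact: dG_le_sup].
Qed.

(** With mean 0 the kernel may be replaced by G t (y - a) - G t (- a), and on the support |y| <= 1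
    its Lipschitz constant 4/t replaces the supremum of order t^(-1/2). *)
Lemma H_mean0_le q t a : Int q -> (forall x, 1 < `|x| -> q x = 0) ->
  \int[mu]_x q x = 0 -> 0 < t -> `|H q t a| <= 4 * t^-1 * \int[mu]_x `|q x|.
Proof.
move=> Iq sq q0 t0; have Iq' := Int_norm Iq; have gq := Int_gtest Iq.
have -> : H q t a = \int[mu]_y (q y * G t (y - a) - q y * G t (0 - a)).
  rewrite RIB ?RIZr ?q0 ?mul0r ?subr0//; first exact: gq.
  by apply: eq_Int (IntZ (G t (0 - a)) Iq) => x; rewrite mulrC.
rewrite -RIZ//; apply: norm_RI_le; last first.
- move=> y; rewrite -mulrBr normrM; have [y1|y1] := ltP 1 `|y|.
    by rewrite sq// normr0 mul0r mulr0.
  rewrite [leLHS]mulrC ler_wpM2r//; apply: (le_trans (G_lip _ _ t0)).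
  have -> : y - a - (0 - a) = y by ring.
  by rewrite ler_piMr// mulr_ge0// invr_ge0 ltW.
- exact: IntZ.
- apply: IntB; first exact: gq.
  by apply: eq_Int (IntZ (G t (0 - a)) Iq) => x; rewrite mulrC.
Qed.

End heat_flow.

(** * Subordination: powers of the Laplacian as integrals over time *)

Section subordination.
Context {R : realType}.
Notation mu := (@lebesgue_measure R).
Implicit Types (a b c s t x y : R) (q v h m : R -> R).

Lemma powD x a b : 0 < x -> x `^ (a + b) = x `^ a * x `^ b.
Proof. by move=> x0; rewrite powRD// (gt_eqF x0) implybT. Qed.

(** The density of the Gamma and Beta integrals, extended by 0 to negative times so that time
    integrals run over the line. A negative b is used with differences, for positive powers of
    -Delta. *)
Definition pk b t : R := if 0 < t then t `^ (b - 1) else 0.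

Lemma meas_pk b : measurable_fun setT (pk b).
Proof. by rewrite /pk; mea. Qed.

Lemma pk_ge0 b t : 0 <= pk b t.
Proof. by rewrite /pk; case: ifP => // _; exact: powR_ge0. Qed.

Lemma pkM b l t : 0 < l -> pk b (l * t) = l `^ (b - 1) * pk b t.
Proof.
move=> l0; rewrite /pk pmulr_rgt0//; case: ifP => [t0|]; last by rewrite mulr0.
by rewrite powRM ?ltW.
Qed.

Lemma pk_scale b l (f : R -> R) : 0 < l -> Int (fun t => pk b t * f t) ->
  Int (fun t => pk b t * f (l * t)) /\
  \int[mu]_t (pk b t * f (l * t)) = l `^ (- b) * \int[mu]_t (pk b t * f t).
Proof.
move=> l0 If; have l1 : 0 < l `^ (1 - b) by rewrite powR_gt0.
have E t : pk b t * f (l * t) = l `^ (1 - b) * (pk b (l * t + 0) * f (l * t + 0)).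
  rewrite addr0 pkM// !mulrA -powD//.
  by rewrite (_ : 1 - b + (b - 1) = 0) ?powRr0 ?mul1r//; ring.
have Ia := Int_affine 0 l0 If.
split; first by apply: eq_Int (IntZ (l `^ (1 - b)) Ia) => t; rewrite E.
under eq_RI do rewrite E.
rewrite RIZ// (RI_affine 0 l0 If) mulrA; congr (_ * _).
by rewrite -(powR_inv1 (ltW l0)) -powD//; congr (_ `^ _); ring.
Qed.

Lemma Int_pk_split b (f : R -> R) (M N d : R) : measurable_fun setT f ->
  -1 < d -> b < 1 -> 0 <= M -> 0 <= N ->
  (forall t, 0 < t -> t <= 1 -> `|f t| <= M * t `^ d) ->
  (forall t, 1 <= t -> `|f t| <= N * t `^ (b - 2)) -> Int (fun t => if 0 < t then f t else 0).
Proof.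
move=> mf d1 b1 M0 N0 h0 h1.
have b2 : b - 2 < -1 by lra.
have [I0 _] := Int_pow0 d1 (ltr0n R 2).
have h2 : (0 : R) < 2^-1 by rewrite invr_gt0.
have [I1 _] := Int_powy b2 h2.
apply: (le_Int _ _ (IntD (IntZ M I0) (IntZ N I1))); first by mea.
- move=> t; case: ifP => t0; last first.
    by rewrite normr0 addr_ge0// mulr_ge0//; case: ifP => // _; exact: powR_ge0.
  have [t1|t1] := leP t 1.
    rewrite (_ : t < 2) ?(le_lt_trans t1) ?ltr1n//=.
    rewrite (le_trans (h0 _ t0 t1))// lerDl mulr_ge0//.
    by case: ifP => // _; exact: powR_ge0.
  rewrite (_ : 2^-1 < t); last by lra.
  rewrite (le_trans (h1 _ (ltW t1)))// lerDr mulr_ge0//.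
  by case: ifP => // _; exact: powR_ge0.
Qed.

Lemma pk_if b (f : R -> R) t : pk b t * f t = if 0 < t then t `^ (b - 1) * f t else 0.
Proof. by rewrite /pk; case: ifP => // _; rewrite mul0r. Qed.

Lemma powR_le1 t b : 1 <= t -> b <= 0 -> t `^ b <= 1.
Proof. by move=> t1 b0; rewrite -(powRr0 t) ler_powR. Qed.

Lemma expRN_le_inv2 t : 0 < t -> expR (- t) <= 4 * t `^ (- 2).
Proof.
move=> t0; have := mul_expRN_le1 (t / 2).
rewrite (_ : t `^ (- 2) = (t ^+ 2)^-1); last by rewrite powRN powR_mulrn ?ltW.
move=> h; rewrite ler_pdivlMr ?exprn_gt0//; move: h.
have -> : - t = - (t / 2) + - (t / 2) by field.
rewrite expRD => h; have := expR_ge0 (- (t / 2)); set e := expR _ in h *.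
have : 0 <= t / 2 * e by rewrite mulr_ge0 ?expR_ge0// divr_ge0// ltW.
by nra.
Qed.

Definition gamma_c b : R := \int[mu]_t (pk b t * expR (- t)).

Lemma Int_gamma b : 0 < b -> b <= 1 -> Int (fun t => pk b t * expR (- t)).
Proof.
move=> b0 b1; apply: (eq_Int (fun t => esym (pk_if b (fun t => expR (- t)) t))).
have b' : -1 < b - 1 by lra.
apply: (@Int_pk_split 0 _ 1 4 (b - 1)) => //; first by mea.
- move=> t t0 t1; rewrite ger0_norm ?mulr_ge0 ?powR_ge0 ?expR_ge0//.
  by rewrite mul1r ler_piMr ?powR_ge0// -[leRHS]expR0 ler_expR; lra.
- move=> t t1; have t0 : 0 < t by apply: lt_le_trans t1.
  rewrite ger0_norm ?mulr_ge0 ?powR_ge0 ?expR_ge0//.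
  rewrite sub0r; apply: le_trans (expRN_le_inv2 t0).
  by rewrite ler_piMl ?expR_ge0// powR_le1//; lra.
Qed.

Lemma gamma_c_gt0 b : 0 < b -> b <= 1 -> 0 < gamma_c b.
Proof.
move=> b0 b1.
apply: (RI_gt0 (a := 1) (b := 2) (c := 2 `^ (b - 1) * expR (- 2)) (Int_gamma b0 b1)).
- by move=> t; rewrite mulr_ge0 ?pk_ge0 ?expR_ge0.
- by lra.
- by rewrite mulr_gt0 ?powR_gt0 ?expR_gt0.
move=> t /andP[t1 t2]; have t0 : 0 < t by lra.
rewrite /pk t0 ler_pM ?powR_ge0 ?expR_ge0//; last by rewrite ler_expR; lra.
rewrite -(opprB 1 b) !powRN lef_pV2 ?posrE ?powR_gt0//.
by apply: ge0_ler_powR; rewrite ?nnegrE; lra.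
Qed.

(** Equal to minus the Gamma function at -b, the constant in the representation of |x|^(2 b) by
    differences of Gaussians. *)
Definition gamma_d b : R := \int[mu]_t (pk (- b) t * (1 - expR (- t))).

Lemma Int_gamma_d b : 0 < b -> b < 1 -> Int (fun t => pk (- b) t * (1 - expR (- t))).
Proof.
move=> b0 b1; apply: (eq_Int (fun t => esym (pk_if (- b) (fun t => 1 - expR (- t)) t))).
have b' : -1 < - b by lra.
apply: (@Int_pk_split (1 - b) _ 1 1 (- b)) => //; first by mea.
- by lra.
- move=> t t0 t1; have h := expR_ge1D (- t).
  have h2 : expR (- t) <= 1 by rewrite -[leRHS]expR0 ler_expR; lra.
  rewrite ger0_norm ?mulr_ge0 ?powR_ge0 ?subr_ge0// mul1r.
  rewrite [X in _ <= t `^ X](_ : - b = (- b - 1) + 1); last by ring.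
  rewrite [X in _ <= X]powD// [X in _ <= _ * X](powRr1 (ltW t0)).
  by apply: ler_wpM2l; [exact: powR_ge0|lra].
- move=> t t1; have t0 : 0 < t by apply: lt_le_trans t1.
  have h2 : expR (- t) <= 1 by rewrite -[leRHS]expR0 ler_expR; lra.
  rewrite ger0_norm ?mulr_ge0 ?powR_ge0 ?subr_ge0// mul1r.
  rewrite (_ : 1 - b - 2 = - b - 1); last by ring.
  by rewrite ler_piMr ?powR_ge0//; have := expR_ge0 (- t); lra.
Qed.

(** The Fubini argument common to all subordination formulas: the weight g is a superposition over
    time of the nonnegative functions psi t. *)
Lemma fubini_weight (psi : R -> R -> R) (g f : R -> R) : meas2 psi ->
  (forall t x, 0 <= psi t x) ->
  (forall x, x != 0 -> Int (psi ^~ x) /\ \int[mu]_t psi t x = g x) ->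
  measurable_fun setT f -> Int (fun x => g x * f x) ->
  Int (fun t => \int[mu]_x (psi t x * f x)) /\
  \int[mu]_t \int[mu]_x (psi t x * f x) = \int[mu]_x (g x * f x).
Proof.
move=> mpsi p0 hpsi mf Igf; have Ig := Int_meas Igf; rewrite /meas2 in mpsi.
(* The indicator of x <> 0: the representation of the weight fails at its singular point, a null set
   that must be removed before Fubini. *)
pose c x : R := if x <= 0 then if 0 <= x then 0 else 1 else 1.
have mc : measurable_fun setT c by rewrite /c; mea.
have cE x : x != 0 -> c x = 1.
  by rewrite /c; case: ltgtP.
have c0 : c 0 = 0 by rewrite /c lexx.
have I2 : Int2 (fun x t => psi t x * (f x * c x)).
  apply: (Int2P _ _ (Int_norm Igf)); first by rewrite /meas2; mea.
    move=> x; have [->|x0] := eqVneq x 0.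
      by apply: eq_Int (Int0 (R := R)) => t; rewrite c0 !mulr0.
    by apply: eq_Int (IntZ (f x * c x) (hpsi x x0).1) => t; rewrite mulrC.
  move=> x; have [->|x0] := eqVneq x 0.
    under eq_RI do rewrite c0 !mulr0 normr0.
    by rewrite RI0 normr_ge0.
  have [I E] := hpsi x x0; rewrite cE// mulr1.
  under eq_RI do rewrite normrM (ger0_norm (p0 _ _)).
  rewrite RIZr// E normrM (ger0_norm (_ : 0 <= g x))// -E.
  by apply: RI_ge0 => t; exact: p0.
have E t : \int[mu]_x (psi t x * f x) = \int[mu]_x (psi t x * (f x * c x)).
  apply: ae_eq_RI; [by mea|by mea|].
  by apply: ae_mp (ae_neq 0) => x x0; rewrite cE// mulr1.
split; first by apply: eq_Int (Int2_Int (Int2_swap I2)) => t; rewrite E.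
under eq_RI do rewrite E.
rewrite -(fub I2).
have mR : measurable_fun setT (fun x => \int[mu]_t (psi t x * (f x * c x))).
  exact: Int_meas (Int2_Int I2).
apply: ae_eq_RI => //.
apply: ae_mp (ae_neq 0) => x x0; have [I <-] := hpsi x x0.
by rewrite cE// mulr1 RIZr.
Qed.

(** The Fourier side of the heat flow: m is a transform, |x|^al the multiplier, and the Gaussian is
    the flow to time t. Singular multipliers are allowed as long as these integrals converge. *)
Definition adm (al : R) m := forall t, 0 < t ->
  Int (fun x => `|x| `^ al * expR (- (t * x ^+ 2)) * m x).
Definition MM (al : R) m t : R :=
  \int[mu]_x (`|x| `^ al * expR (- (t * x ^+ 2)) * m x).

Lemma le_adm al (d C : R) m : measurable_fun setT m ->
  (forall x, `|m x| <= C * `|x| `^ d) -> -1 < al + d -> al + d <= 2 -> adm al m.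
Proof.
move=> mm hm a1 a2 t t0; apply: (le_Int _ _ (IntZ C (Int_pow_gauss a1 a2 t0))).
  by mea.
move=> x; rewrite !normrM (ger0_norm (powR_ge0 _ _)) (ger0_norm (expR_ge0 _)).
rewrite [leLHS]mulrAC mulrA ler_wpM2r ?expR_ge0//.
have C0 : 0 <= C by have := hm 1; rewrite normr1 powR1 mulr1; exact: le_trans.
apply: (@le_trans _ _ (`|x| `^ al * (C * `|x| `^ d))); first by rewrite ler_wpM2l ?powR_ge0.
rewrite mulrCA ler_wpM2l//.
have [->|x0] := eqVneq x 0; last by rewrite -powD// normr_gt0.
have [->|al0] := eqVneq al 0; first by rewrite powRr0 mul1r add0r.
by rewrite normr0 powR0// mul0r powR_ge0.
Qed.

Lemma heat_expD t u x : expR (- ((t + u) * x ^+ 2)) =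
  expR (- (u * x ^+ 2)) * expR (- (t * x ^+ 2)).
Proof. by rewrite -expRD; congr expR; ring. Qed.

Lemma pk_heat b x : 0 < b -> b <= 1 -> x != 0 ->
  Int (fun t => pk b t * expR (- (t * x ^+ 2))) /\
  \int[mu]_t (pk b t * expR (- (t * x ^+ 2))) = gamma_c b * `|x| `^ (- (2 * b)).
Proof.
move=> b0 b1 x0; have x2 : 0 < x ^+ 2 by rewrite exprn_even_gt0.
have [I E] := pk_scale x2 (Int_gamma b0 b1).
split; first by apply: eq_Int I => t; rewrite [x ^+ 2 * t]mulrC.
under eq_RI do rewrite [_ * x ^+ 2]mulrC.
rewrite E mulrC; congr (_ * _).
rewrite -(real_normK (num_real x)) -powR_mulrn// -powRrM.
by congr (_ `^ _); ring.
Qed.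

Lemma pk_heat_d b x : 0 < b -> b < 1 -> x != 0 ->
  Int (fun t => pk (- b) t * (1 - expR (- (t * x ^+ 2)))) /\
  \int[mu]_t (pk (- b) t * (1 - expR (- (t * x ^+ 2)))) = gamma_d b * `|x| `^ (2 * b).
Proof.
move=> b0 b1 x0; have x2 : 0 < x ^+ 2 by rewrite exprn_even_gt0.
have [I E] := pk_scale (f := fun t => 1 - expR (- t)) x2 (Int_gamma_d b0 b1).
split; first by apply: eq_Int I => t; rewrite [x ^+ 2 * t]mulrC.
under eq_RI do rewrite [_ * x ^+ 2]mulrC.
rewrite E mulrC; congr (_ * _).
rewrite -(real_normK (num_real x)) -powR_mulrn// -powRrM.
by congr (_ `^ _); ring.
Qed.

Lemma adm_shift_ae (al be t : R) m x : x != 0 ->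
  `|x| `^ be * (`|x| `^ al * expR (- (t * x ^+ 2)) * m x) =
  `|x| `^ (al + be) * expR (- (t * x ^+ 2)) * m x.
Proof. by move=> x0; rewrite [X in _ = X * _ * _]powD ?normr_gt0//; ring. Qed.

(** Since int u^(b-1) exp(- u x^2) du is a constant times |x|^(-2 b), integrating the flow over
    later times lowers the exponent by 2 b. *)
Lemma subordination_neg al b m t : 0 < b -> b <= 1 -> adm al m ->
  adm (al - 2 * b) m -> 0 < t ->
  Int (fun u => pk b u * MM al m (t + u)) /\
  \int[mu]_u (pk b u * MM al m (t + u)) = gamma_c b * MM (al - 2 * b) m t.
Proof.
move=> b0 b1 am am2 t0.
have I1 := am _ t0; have I2 := am2 _ t0.
have m1 := Int_meas I1; have mb := meas_pk b.
pose f x := `|x| `^ al * expR (- (t * x ^+ 2)) * m x.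
have e : {ae mu, forall x, gamma_c b * (`|x| `^ (al - 2 * b) * expR (- (t * x ^+ 2)) * m x) =
    gamma_c b * `|x| `^ (- (2 * b)) * f x}.
  by apply: ae_mp (ae_neq 0) => x x0; rewrite -[RHS]mulrA /f adm_shift_ae.
have Ig : Int (fun x => gamma_c b * `|x| `^ (- (2 * b)) * f x).
  by apply: ae_eq_Int e (IntZ _ I2); rewrite /f; mea.
have [||J E] := @fubini_weight (fun u x => pk b u * expR (- (u * x ^+ 2)))
  (fun x => gamma_c b * `|x| `^ (- (2 * b))) f _ _ (fun x => @pk_heat b x b0 b1) m1 Ig.
- by rewrite /meas2; mea.
- by move=> u x; rewrite mulr_ge0 ?pk_ge0 ?expR_ge0.
have EM u : \int[mu]_x (pk b u * expR (- (u * x ^+ 2)) * f x) = pk b u * MM al m (t + u).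
  have [u0|u0] := ltP 0 u; last first.
    rewrite /pk ltNge u0/= mul0r -[RHS](@RI0 R); apply: eq_RI => x.
    by rewrite !mul0r.
  rewrite -RIZ; last by apply: am; rewrite addr_gt0.
  by apply: eq_RI => x; rewrite heat_expD /f; ring.
split; first exact: eq_Int EM J.
rewrite -(eq_RI EM) E /MM -(RIZ _ I2).
by apply: ae_eq_RI; [exact: Int_meas Ig|exact: Int_meas (IntZ _ I2)|apply: ae_mp e => x ->].
Qed.

(** Raising the exponent needs the difference 1 - exp(- u x^2), which compensates the singularity of
    u^(-b-1) at u = 0. *)
Lemma subordination_pos al b m t : 0 < b -> b < 1 -> adm al m ->
  adm (al + 2 * b) m -> 0 < t ->
  Int (fun u => pk (- b) u * (MM al m t - MM al m (t + u))) /\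
  \int[mu]_u (pk (- b) u * (MM al m t - MM al m (t + u))) = gamma_d b * MM (al + 2 * b) m t.
Proof.
move=> b0 b1 am am2 t0.
have I1 := am _ t0; have I2 := am2 _ t0.
have m1 := Int_meas I1; have mb := meas_pk (- b).
pose f x := `|x| `^ al * expR (- (t * x ^+ 2)) * m x.
have e : {ae mu, forall x, gamma_d b * (`|x| `^ (al + 2 * b) * expR (- (t * x ^+ 2)) * m x) =
    gamma_d b * `|x| `^ (2 * b) * f x}.
  by apply: ae_mp (ae_neq 0) => x x0; rewrite -[RHS]mulrA /f adm_shift_ae.
have Ig : Int (fun x => gamma_d b * `|x| `^ (2 * b) * f x).
  by apply: ae_eq_Int e (IntZ _ I2); rewrite /f; mea.
have [||J E] := @fubini_weight (fun u x => pk (- b) u * (1 - expR (- (u * x ^+ 2))))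
  (fun x => gamma_d b * `|x| `^ (2 * b)) f _ _ (fun x => @pk_heat_d b x b0 b1) m1 Ig.
- by rewrite /meas2; mea.
- move=> u x; rewrite /pk; case: ifP => u0; last by rewrite mul0r.
  rewrite mulr_ge0 ?powR_ge0// subr_ge0 -[leRHS]expR0 ler_expR oppr_le0.
  by rewrite mulr_ge0 ?sqr_ge0// ltW.
have EM u : \int[mu]_x (pk (- b) u * (1 - expR (- (u * x ^+ 2))) * f x) =
    pk (- b) u * (MM al m t - MM al m (t + u)).
  have [u0|u0] := ltP 0 u; last first.
    rewrite /pk ltNge u0/= mul0r -[RHS](@RI0 R); apply: eq_RI => x.
    by rewrite !mul0r.
  have I3 : Int (fun x => `|x| `^ al * expR (- ((t + u) * x ^+ 2)) * m x).
    by apply: am; rewrite addr_gt0.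
  rewrite -RIB// -RIZ; last exact: IntB.
  by apply: eq_RI => x; rewrite heat_expD /f; ring.
split; first exact: eq_Int EM J.
rewrite -(eq_RI EM) E /MM -(RIZ _ I2).
by apply: ae_eq_RI; [exact: Int_meas Ig|exact: Int_meas (IntZ _ I2)|apply: ae_mp e => x ->].
Qed.

End subordination.

(** * Fourier transforms of integrable functions, seen through the heat flow *)

Section fourier.
Context {R : realType}.
Notation mu := (@lebesgue_measure R).
Implicit Types (a b c s t x y al : R) (q v h m : R -> R).

(* [fm q a] is the Fourier transform of the part of [q] even about [a], so that
   [MM al (fm q a) t] is the value at [a] of the heat flow of the multiplier
   [|x|^al] applied to [q], up to the factor [2 * pi]. *)
Definition fm q a x : R := \int[mu]_y (q y * cos ((y - a) * x)).

Lemma norm_cos_le1 x : `|cos x| <= 1 :> R.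
Proof. by rewrite ler_norml cos_geN1 cos_le1. Qed.

Lemma norm_sin_le1 x : `|sin x| <= 1 :> R.
Proof. by rewrite ler_norml sin_geN1 sin_le1. Qed.

Lemma Int_cos q (f : R -> R) : measurable_fun setT f -> Int q -> Int (fun y => q y * cos (f y)).
Proof.
move=> mf Iq; have mc : measurable_fun setT (fun y => cos (f y)) by mea.
by apply: eq_Int (IntMb mc (fun y => norm_cos_le1 (f y)) Iq) => y; rewrite mulrC.
Qed.

Lemma Int_sin q (f : R -> R) : measurable_fun setT f -> Int q -> Int (fun y => q y * sin (f y)).
Proof.
move=> mf Iq; have mc : measurable_fun setT (fun y => sin (f y)) by mea.
by apply: eq_Int (IntMb mc (fun y => norm_sin_le1 (f y)) Iq) => y; rewrite mulrC.
Qed.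

Lemma meas_fm q a : Int q -> measurable_fun setT (fm q a).
Proof.
move=> Iq; have mq := Int_meas Iq.
apply: (@meas_RI _ (fun x y => q y * cos ((y - a) * x))); first by rewrite /meas2; mea.
by move=> x; apply: Int_cos => //; mea.
Qed.

Lemma fmE q a x : Int q ->
  fm q a x = fourier_cos q x * cos (a * x) + fourier_sin q x * sin (a * x).
Proof.
move=> Iq; rewrite -!RIZr; [|apply: Int_sin => //; mea|apply: Int_cos => //; mea].
rewrite -RID.
- by apply: eq_RI => y; rewrite mulrBl cosB; ring.
- have Ic : Int (fun y => q y * cos (y * x)) by apply: Int_cos => //; mea.
  by apply: eq_Int (IntZ (cos (a * x)) Ic) => y; rewrite mulrC.
- have Is : Int (fun y => q y * sin (y * x)) by apply: Int_sin => //; mea.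
  by apply: eq_Int (IntZ (sin (a * x)) Is) => y; rewrite mulrC.
Qed.

Lemma fm_le q a x : Int q -> `|fm q a x| <= \int[mu]_y `|q y|.
Proof.
move=> Iq; apply: norm_RI_le; [by apply: Int_cos => //; mea|exact: Int_norm|].
by move=> y; rewrite normrM ler_piMr// norm_cos_le1.
Qed.

Lemma cos_lip x y : `|cos x - cos y| <= `|x - y| :> R.
Proof.
rewrite -[leRHS]mul1r; apply: (derive_lip (f := fun z => - sin z)) => z.
by rewrite normrN norm_sin_le1.
Qed.

Lemma fm_adm q a al : Int q -> -1 < al -> al <= 2 -> adm al (fm q a).
Proof.
move=> Iq a1 a2; apply: (@le_adm _ al 0 (\int[mu]_y `|q y|)); rewrite ?addr0//.
  exact: meas_fm.
by move=> x; rewrite powRr0 mulr1; exact: fm_le.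
Qed.

Lemma MM0 q a t : Int q -> 0 < t -> MM 0 (fm q a) t = 2 * pi * H q t a.
Proof.
move=> Iq t0; have mq := Int_meas Iq.
have I2 : Int2 (fun x y => expR (- (t * x ^+ 2)) * (q y * cos ((y - a) * x))).
  apply: (le_Int2 _ _ (Int2_prod (Int_gauss t0) (Int_norm Iq))); first by rewrite /meas2; mea.
  move=> x y; rewrite !normrM (ger0_norm (expR_ge0 _)) mulrA ler_piMr ?norm_cos_le1//.
transitivity (\int[mu]_x \int[mu]_y (expR (- (t * x ^+ 2)) * (q y * cos ((y - a) * x)))).
  apply: eq_RI => x; rewrite powRr0 mul1r -RIZ//.
  by apply: Int_cos => //; mea.
rewrite (fub I2) -RIZ; last exact: Int_gtest.
apply: eq_RI => y; have [E _] := fourier_gauss (y - a) t0.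
rewrite mulrCA -E -RIZ; first by apply: eq_RI => x; rewrite mulrCA.
apply: (le_Int _ _ (Int_gauss t0)); first by mea.
by move=> x; rewrite normrM (ger0_norm (expR_ge0 _)) ler_piMr ?expR_ge0 ?norm_cos_le1.
Qed.

(* Integration by parts trades two derivatives on the kernel for one on [q]. *)
Lemma MM2 q q' a t : Int q -> Int q' -> 0 < t ->
  (forall x, x * fm q a x = - \int[mu]_y (q' y * sin ((y - a) * x))) ->
  MM 2 (fm q a) t = 2 * pi * \int[mu]_y (q' y * dG t (y - a)).
Proof.
move=> Iq Iq' t0 parts; have mq := Int_meas Iq'.
have I2 : Int2 (fun x y => x * expR (- (t * x ^+ 2)) * (q' y * sin ((y - a) * x))).
  apply: (le_Int2 _ _ (Int2_prod (Int_gauss1 t0) (Int_norm Iq'))); first by rewrite /meas2; mea.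
  move=> x y; rewrite !normrM (ger0_norm (expR_ge0 _)) [leLHS]mulrA ler_piMr ?norm_sin_le1//.
transitivity (- \int[mu]_x \int[mu]_y (x * expR (- (t * x ^+ 2)) * (q' y * sin ((y - a) * x)))).
  rewrite -RIN; last exact: Int2_Int I2.
  apply: eq_RI => x; rewrite RIZ; last by apply: Int_sin => //; mea.
  rewrite -[RHS]mulrN -parts powR_mulrn// real_normK ?num_real//.
  by ring.
have Id : Int (fun y => q' y * dG t (y - a)).
  have md : measurable_fun setT (fun y => dG t (y - a)) by mea.
  by apply: eq_Int (IntMb md (fun y => dG_le_sup (y - a) t0) Iq') => y; rewrite mulrC.
rewrite (fub I2) -RIZ// -RIN; last exact: Int2_Int (Int2_swap I2).
apply: eq_RI => y; have [_ E] := fourier_gauss (y - a) t0.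
under eq_RI do rewrite mulrCA.
rewrite RIZ ?E; first by ring.
apply: (le_Int _ _ (Int_gauss1 t0)); first by mea.
by move=> x; rewrite !normrM (ger0_norm (expR_ge0 _)) ler_piMr ?mulr_ge0 ?expR_ge0 ?norm_sin_le1.
Qed.

End fourier.

(** * The fractional Laplacian on Gaussians *)

Section kernel.
Context {R : realType}.
Notation mu := (@lebesgue_measure R).
Implicit Types (a b c s t x y h L M : R) (f v phi : R -> R).

(** The kernel of (-Delta)^(s/2). For s < 1 it is integrable near 0 against increments of order
    |h|^a with s < a. *)
Definition ker s h : R := `|h| `^ (- 1 - s).

Lemma meas_ker s : measurable_fun setT (ker s).
Proof. by rewrite /ker; mea. Qed.

Lemma ker_ge0 s h : 0 <= ker s h.
Proof. exact: powR_ge0. Qed.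

Lemma kerN s h : ker s (- h) = ker s h.
Proof. by rewrite /ker normrN. Qed.

Lemma ker0 s : 0 < s -> ker s 0 = 0.
Proof. by move=> s0; rewrite /ker normr0 powR0//; apply/eqP; lra. Qed.

(** The constant depends only on s and a, which gives bounds uniform in the point at which
    increments are taken. *)
Lemma Int_ker s a : 0 < s -> s < a -> exists2 C, 0 <= C & forall L M f,
  0 <= L -> 0 <= M -> measurable_fun setT f ->
  (forall h, `|f h| <= L * `|h| `^ a) -> (forall h, `|f h| <= M) ->
  Int (fun h => f h * ker s h) /\ \int[mu]_h `|f h * ker s h| <= C * (L + M).
Proof.
move=> s0 sa.
pose P1 h : R := if (0 < h) && (h < 2) then h `^ (a - 1 - s) else 0.
pose P2 h : R := if 2^-1 < h then h `^ (- 1 - s) else 0.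
have I1 : Int P1 by apply: (Int_pow0 _ _).1 => //; lra.
have I2 : Int P2 by apply: (Int_powy _ _).1 => //; lra.
have P10 h : 0 <= P1 h by rewrite /P1; case: ifP => // _; exact: powR_ge0.
have P20 h : 0 <= P2 h by rewrite /P2; case: ifP => // _; exact: powR_ge0.
have r1 := RI_ge0 P10; have r2 := RI_ge0 P20.
exists (2 * \int[mu]_h P1 h + 2 * \int[mu]_h P2 h).
  by rewrite addr_ge0// mulr_ge0.
move=> L M f L0 M0 mf fL fM; have mk := meas_ker s.
pose D h := L * (P1 h + P1 (- h)) + M * (P2 h + P2 (- h)).
have J1 : Int (fun h => P1 h + P1 (- h)) by apply: IntD => //; exact: Int_opp.
have J2 : Int (fun h => P2 h + P2 (- h)) by apply: IntD => //; exact: Int_opp.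
have ID : Int D by apply: IntD; exact: IntZ.
have fD h : `|f h * ker s h| <= D h.
  rewrite normrM (ger0_norm (ker_ge0 _ _)).
  have [->|h0] := eqVneq h 0.
    by rewrite ker0// mulr0 /D addr_ge0// mulr_ge0// addr_ge0.
  have h0' : 0 < `|h| by rewrite normr_gt0.
  have E1 : P1 `|h| <= P1 h + P1 (- h) by case: (ger0P h) => _; rewrite ?lerDl ?lerDr.
  have E2 : P2 `|h| <= P2 h + P2 (- h) by case: (ger0P h) => _; rewrite ?lerDl ?lerDr.
  have [h1|h1] := leP `|h| 1.
    apply: (@le_trans _ _ (L * (P1 h + P1 (- h)))); last first.
      by rewrite /D lerDl mulr_ge0// addr_ge0.
    apply: (@le_trans _ _ (L * P1 `|h|)); last by rewrite ler_wpM2l.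
    rewrite /P1 h0' (_ : `|h| < 2)/=; last by lra.
    rewrite (_ : a - 1 - s = a + (- 1 - s)); last by ring.
    by rewrite powD// mulrA ler_wpM2r ?ker_ge0.
  apply: (@le_trans _ _ (M * (P2 h + P2 (- h)))); last first.
    by rewrite /D lerDr mulr_ge0// addr_ge0.
  apply: (@le_trans _ _ (M * P2 `|h|)); last by rewrite ler_wpM2l.
  rewrite /P2 (_ : 2^-1 < `|h|)/=; last by lra.
  by rewrite ler_wpM2r ?ker_ge0.
have If : Int (fun h => f h * ker s h) by apply: (le_Int _ fD ID); mea.
split=> //; apply: (le_trans (le_RI (Int_norm If) ID fD)).
rewrite RID; [|exact: IntZ|exact: IntZ].
rewrite !RIZ// !RID//; [|exact: Int_opp|exact: Int_opp].
rewrite !RI_opp//; nra.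
Qed.

Definition LK s phi x : R := \int[mu]_h ((phi x - phi (x - h)) * ker s h).

Lemma lip_ker L M phi x : measurable_fun setT phi -> (forall x, `|phi x| <= M) ->
  (forall x y, `|phi x - phi y| <= L * `|x - y|) ->
  [/\ 0 <= L, 0 <= 2 * M, measurable_fun setT (fun h => phi x - phi (x - h)),
   forall h, `|phi x - phi (x - h)| <= L * `|h| `^ 1 &
   forall h, `|phi x - phi (x - h)| <= 2 * M].
Proof.
move=> mp pM pL; split.
- by have := pL 1 0; rewrite subr0 normr1 mulr1; exact: le_trans.
- by rewrite mulr_ge0//; exact: le_trans (pM 0).
- by mea.
- move=> h; rewrite powRr1//; apply: (le_trans (pL _ _)).
  by rewrite (_ : x - (x - h) = h)//; ring.
- by move=> h; apply: (le_trans (ler_normB _ _)); rewrite mulr_natl mulr2n lerD.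
Qed.

Lemma LK_bound s : 0 < s -> s < 1 -> exists2 C, 0 <= C & forall L M phi,
  measurable_fun setT phi -> (forall x, `|phi x| <= M) ->
  (forall x y, `|phi x - phi y| <= L * `|x - y|) ->
  forall x, [/\ Int (fun h => (phi x - phi (x - h)) * ker s h),
    \int[mu]_h `|(phi x - phi (x - h)) * ker s h| <= C * (L + 2 * M) &
    `|LK s phi x| <= C * (L + 2 * M)].
Proof.
move=> s0 s1; have [C C0 HC] := Int_ker s0 s1; exists C => //.
move=> L M phi mp pM pL x; have [L0 M0 m h1 h2] := lip_ker x mp pM pL.
have [I E] := HC L (2 * M) _ L0 M0 m h1 h2.
by split => //; apply: le_trans (norm_RI I) E.
Qed.

(** For bounded Lipschitz functions the integrand is absolutely integrable, so the truncations
    converge by dominated convergence and no cancellation is involved. *)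
Lemma fracLap_pvE s phi L M x : 0 < s -> s < 1 -> measurable_fun setT phi ->
  (forall x, `|phi x| <= M) -> (forall x y, `|phi x - phi y| <= L * `|x - y|) ->
  fracLap_pv (s / 2) phi x = fracLap_const (s / 2) * LK s phi x.
Proof.
move=> s0 s1 mp pM pL; rewrite /fracLap_pv; congr (_ * _).
have [C C0 /(_ L M phi mp pM pL x)[I _ _]] := LK_bound s0 s1.
have mk := meas_ker s; have mI := Int_meas I.
pose F (e h : R) : R := if e < `|h| then (phi x - phi (x - h)) * ker s h else 0.
have mF e : measurable_fun setT (F e) by rewrite /F; mea.
have FI e h : `|F e h| <= `|(phi x - phi (x - h)) * ker s h|.
  by rewrite /F; case: ifP => // _; rewrite normr0.
have E e : \int[mu]_(y in [set y | (e < `|x - y|)%R])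
    ((phi x - phi y) / `|x - y| `^ (1 + 2 * (s / 2))) = \int[mu]_h F e h.
  have IF : Int (F e) by apply: (le_Int _ (FI e) (Int_norm I)).
  rewrite -(RI_opp IF) -(RI_shift (- x) (Int_opp IF)) Rintegral_mkcond.
  apply: eq_RI => y; rewrite patchE /F opprD opprK [- y + x]addrC.
  have -> : (y \in [set y | e < `|x - y|]) = (e < `|x - y|) by apply/idP/idP; rewrite in_setE.
  case: ifP => // _; rewrite (_ : x - (x - y) = y); last by ring.
  by rewrite /ker -powRN; congr (_ * _ `^ _); field.
under eq_fun do rewrite E.
apply: cvg_lim => //; apply/cvg_at_rightP => u [u0 ul].
apply: (dct _ _ (Int_norm I)) => //.
apply: ae_mp (ae_neq 0) => h h0; apply: cvg_near_cst.
have h1 : \forall n \near \oo, u n < `|h| by apply: (cvgr_lt _ ul); rewrite normr_gt0.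
by near=> n; rewrite /F; have -> : u n < `|h| by near: n.
Unshelve. all: by end_near. Qed.

End kernel.

(** * The fractional Laplacian of the heat kernel *)

Section gauss_kernel.
Context {R : realType}.
Notation mu := (@lebesgue_measure R).
Implicit Types (a b c s t u x y h L M : R) (f v phi : R -> R).

(** The flow of |v| must stay bounded at late times: this is what the far end of the subordination
    integral requires when v is paired with (-Delta)^(s/2) of a Gaussian. Bounded, integrable and L2
    functions all qualify. *)
Definition tame v := gtest v /\
  forall t, 0 < t -> exists B : R, forall u a, t <= u -> H (fun x => `|v x|) u a <= B.

Lemma tame_bounded M v : measurable_fun setT v -> (forall x, `|v x| <= M) -> tame v.
Proof.
move=> mv vM; split; first exact: bounded_gtest vM.
move=> t t0; exists M => u a tu; apply: le_trans (ler_norm _) _.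
by apply: H_bounded; [mea|move=> x; rewrite normr_id|exact: lt_le_trans tu].
Qed.

Lemma tame_Int v : Int v -> tame v.
Proof.
move=> Iv; split; first exact: Int_gtest.
move=> t t0; exists ((Num.sqrt t)^-1 * \int[mu]_x `|v x|) => u a tu.
have u0 := lt_le_trans t0 tu.
apply: le_trans (ler_norm _) _; apply: (le_trans (H_le a (Int_norm Iv) u0)).
under eq_RI do rewrite normr_id.
rewrite ler_wpM2r//; first by apply: RI_ge0.
by rewrite lef_pV2 ?posrE ?sqrtr_gt0// ler_sqrt// ltW.
Qed.

Lemma le_tame v f : measurable_fun setT f -> (forall x, `|f x| <= v x) -> tame v -> tame f.
Proof.
move=> mf fv [gv hv]; have gf := le_gtest mf fv gv; split => //.
move=> t t0; have [B HB] := hv t t0; exists B => u a tu.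
apply: le_trans (HB u a tu); apply: le_H; [exact: gtest_norm..|] => x.
exact: le_trans (fv x) (ler_norm _).
Qed.

Lemma tameD v f : tame v -> tame f -> tame (fun x => v x + f x).
Proof.
move=> [gv hv] [gf hf]; split; first exact: gtestD.
move=> t t0; have [B HB] := hv t t0; have [B' HB'] := hf t t0; exists (B + B') => u a tu.
apply: le_trans (lerD (HB u a tu) (HB' u a tu)).
have gv' := gtest_norm gv; have gf' := gtest_norm gf.
rewrite -HD//; apply: le_H => [||x]; [exact/gtest_norm/gtestD|exact: gtestD|exact: ler_normD].
Qed.

(** From |f| <= 1 + f^2, a bounded function plus an integrable one. *)
Lemma tame_L2 f : L2 (fun=> 1) f -> tame f.
Proof.
move=> [mf If].
have I2 : Int (fun x => f x ^+ 2) by apply: eq_Int If => x; rewrite mulr1.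
have t1 : tame (fun=> (1 : R)) by apply: (@tame_bounded 1) => // x; rewrite normr1.
apply: (le_tame mf _ (tameD t1 (tame_Int I2))) => x.
rewrite -[X in 1 + X](real_normK (num_real _)).
by have := sqr_ge0 (`|f x| - 1); nra.
Qed.

Lemma G_le_G t u x : 0 < t -> t <= u -> G t x <= Num.sqrt (u / t) * G u x.
Proof.
move=> t0 tu; have u0 : 0 < u by apply: lt_le_trans tu.
rewrite !GE [leRHS]mulrA (sqrtrM _ (ltW u0)) (sqrtrV (ltW t0)) (sqrtrM t (pi_ge0 R)) (sqrtrM u (pi_ge0 R)).
have p0 : 0 < Num.sqrt pi :> R by rewrite sqrtr_gt0 pi_gt0.
have st : 0 < Num.sqrt t by rewrite sqrtr_gt0.
have su : 0 < Num.sqrt u by rewrite sqrtr_gt0.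
have -> : Num.sqrt u / Num.sqrt t * (2 * (Num.sqrt pi * Num.sqrt u))^-1 =
  (2 * (Num.sqrt pi * Num.sqrt t))^-1 by field; rewrite !gt_eqF.
apply: ler_wpM2l; first by rewrite invr_ge0 !mulr_ge0 ?sqrtr_ge0.
rewrite ler_expR !mulNr lerN2 ler_wpM2l ?sqr_ge0// lef_pV2 ?posrE ?mulr_gt0//.
by rewrite ler_wpM2l.
Qed.

(** The mean value theorem in time. The gain of one factor u cancels the singularity of u^(-1 -
    s/2), and a single kernel at time 2 (t + 1) dominates all intermediate times. *)
Lemma G_diff_small t : 0 < t -> exists2 K, 0 <= K & forall u x, 0 < u -> u <= 1 ->
  `|G t x - G (t + u) x| <= K * u * G (2 * (t + 1)) x.
Proof.
move=> t0; pose r := Num.sqrt ((t + 1) / t).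
exists (5 * t^-1 * r); first by rewrite !mulr_ge0 ?invr_ge0 ?sqrtr_ge0 ?ltW.
move=> u x u0 u1; have tu : t < t + u by rewrite ltrDl.
have dG' z : t <= z -> is_derive z (1 : R) (G ^~ x) (ddG z x).
  by move=> tz; apply: is_derive_Gt; apply: lt_le_trans tz.
have [y|y|z] := @MVT R (G ^~ x) (fun z => ddG z x) t (t + u) tu.
- by rewrite in_itv/= => /andP[ty _]; exact/dG'/ltW.
- apply: derivable_within_continuous => y'; rewrite in_itv/= => /andP[ty _].
  exact: (@ex_derive _ _ _ _ _ _ _ (dG' y' ty)).
rewrite in_itv/= => /andP[tz zu] E.
have z0 : 0 < z := lt_trans t0 tz.
rewrite distrC E normrM (_ : t + u - t = u); last by ring.
rewrite (gtr0_norm u0) [leRHS](_ : _ = 5 / t * r * G (2 * (t + 1)) x * u); last by ring.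
apply: ler_wpM2r; first exact: ltW.
apply: (le_trans (ddG_le x z0)); rewrite -[leRHS]mulrA.
apply: ler_pM; rewrite ?G_ge0 ?mulr_ge0 ?invr_ge0 ?(ltW z0)//.
  by rewrite ler_pM2l// lef_pV2 ?posrE// ltW.
have h1 : 0 < 2 * z by lra.
have h2 : 2 * z <= 2 * (t + 1) by lra.
apply: (le_trans (G_le_G x h1 h2)); rewrite ler_wpM2r ?G_ge0//.
rewrite ler_wsqrtr// -mulf_div divff ?mul1r ?pnatr_eq0//.
by rewrite ler_wpM2l ?addr_ge0 ?(ltW t0)// lef_pV2 ?posrE// ltW.
Qed.

Definition cG s : R := \int[mu]_u (pk (- (s / 2)) u * G u 1).

Lemma Int_cG s : 0 < s -> s < 1 -> Int (fun u => pk (- (s / 2)) u * G u 1).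
Proof.
move=> s0 s1; apply: (eq_Int (fun t => esym (pk_if (- (s / 2)) (fun u => G u 1) t))).
have d1 : -1 < - (s / 2) by lra.
apply: (@Int_pk_split _ (1 - s / 2) _ 64 1 (- (s / 2))) => //; [by mea|by lra| |].
- move=> t t0 t1; rewrite ger0_norm ?mulr_ge0 ?powR_ge0 ?G_ge0//.
  rewrite [X in _ <= _ * t `^ X](_ : - (s / 2) = (- (s / 2) - 1) + 1); last by ring.
  rewrite [X in _ <= _ * X]powD// [X in _ <= _ * (_ * X)](powRr1 (ltW t0)) mulrCA.
  apply: ler_wpM2l; first exact: powR_ge0.
  (* With y = 1/(4 t), exp(- y) <= 4 y^(-2) = 64 t^2, which outweighs the factor t^(-1/2) of the
     kernel. *)
  have t4 : 0 < (4 * t)^-1 by rewrite invr_gt0 mulr_gt0.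
  have E4 : (4 * t)^-1 `^ (- 2) = 16 * t ^+ 2.
    by rewrite powRN powR_mulrn ?(ltW t4)// exprVn invrK; ring.
  have := expRN_le_inv2 t4; rewrite E4 => h.
  have p0 : 0 < Num.sqrt pi :> R by rewrite sqrtr_gt0 pi_gt0.
  have p1 : 1 <= Num.sqrt pi :> R.
    by rewrite -(sqrtr1 R) ler_sqrt ?pi_ge0//; have := pi_ge2 R; lra.
  have st : 0 < Num.sqrt t by rewrite sqrtr_gt0.
  rewrite GE expr1n sqrtrM ?pi_ge0// mulNr mul1r ler_pdivrMl; last by rewrite !mulr_gt0.
  apply: (le_trans h).
  have tE : t = Num.sqrt t ^+ 2 by rewrite sqr_sqrtr ?ltW.
  have st1 : Num.sqrt t <= 1 by rewrite -(sqrtr1 R) ler_sqrt.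
  apply: (@le_trans _ _ (2 * (1 * Num.sqrt t) * (64 * t))); last first.
    by rewrite ler_pM2r ?mulr_gt0// ler_pM2l// ler_pM2r.
  rewrite mul1r; move: (Num.sqrt t) tE st st1 => r -> r0 r1.
  have := mulr_ge0 (mulr_ge0 (ltW r0) (sqr_ge0 r)) (_ : 0 <= 1 - r); nra.
- move=> t t1; have t0 : 0 < t by apply: lt_le_trans t1.
  rewrite ger0_norm ?mulr_ge0 ?powR_ge0 ?G_ge0// mul1r.
  rewrite (_ : 1 - s / 2 - 2 = - (s / 2) - 1); last by ring.
  rewrite ler_piMr ?powR_ge0//; apply: (le_trans (G_le_sqrt 1 t0)).
  rewrite invf_le1 ?sqrtr_gt0//.
  by rewrite -(sqrtr1 R) ler_sqrt// ltW.
Qed.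

Lemma cG_gt0 s : 0 < s -> s < 1 -> 0 < cG s.
Proof.
move=> s0 s1.
apply: (RI_gt0 (a := 1) (b := 2) (c := 2 `^ (- (s / 2) - 1) *
   ((Num.sqrt (2 / 1))^-1 * G 1 1)) (Int_cG s0 s1)).
- by move=> t; rewrite mulr_ge0 ?pk_ge0 ?G_ge0.
- by lra.
- by rewrite !mulr_gt0 ?powR_gt0 ?invr_gt0 ?sqrtr_gt0 ?G_gt0.
move=> t /andP[t1 t2]; have t0 : 0 < t by lra.
rewrite /pk t0 ler_pM ?mulr_ge0 ?powR_ge0 ?invr_ge0 ?sqrtr_ge0 ?G_ge0//.
  rewrite (_ : - (s / 2) - 1 = - (s / 2 + 1)); last by ring.
  rewrite !powRN lef_pV2 ?posrE ?powR_gt0//.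
  by apply: ge0_ler_powR; rewrite ?nnegrE; lra.
rewrite ler_pdivrMl ?sqrtr_gt0//; apply: (le_trans (G_le_G 1 ltr01 (ltW t1))).
rewrite ler_wpM2r ?G_ge0// ler_wsqrtr//.
by rewrite ler_pM2r ?invr_gt0// ltW.
Qed.

(** The substitution u = h^2 v reduces to h = 1: the singular kernel is a superposition of heat
    kernels. *)
Lemma pk_G_ker s h : 0 < s -> s < 1 -> h != 0 ->
  Int (fun u => pk (- (s / 2)) u * G u h) /\
  \int[mu]_u (pk (- (s / 2)) u * G u h) = cG s * ker s h.
Proof.
move=> s0 s1 h0; have h0' : 0 < `|h| by rewrite normr_gt0.
have l0 : 0 < `|h| ^- 2 by rewrite invr_gt0 exprn_gt0.
have [I E] := pk_scale l0 (Int_cG s0 s1).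
have GE' u : pk (- (s / 2)) u * G u h =
    `|h|^-1 * (pk (- (s / 2)) u * G (`|h| ^- 2 * u) 1).
  rewrite [RHS]mulrCA; case: (ltP 0 u) => u0; last by rewrite /pk ltNge u0/= !mul0r.
  congr (_ * _); rewrite !GE.
  have -> : Num.sqrt (pi * (`|h| ^- 2 * u)) = `|h|^-1 * Num.sqrt (pi * u).
    rewrite mulrCA (sqrtrM _ (ltW l0)) -exprVn sqrtr_sqr normfV normr_id//.
  rewrite expr1n -[X in _ * expR (- X / _) = _](real_normK (num_real h)).
  rewrite mulrA; congr (_ * expR _); last by field; rewrite !gt_eqF.
  have su : 0 < Num.sqrt (pi * u) by rewrite sqrtr_gt0 mulr_gt0 ?pi_gt0.
  by field; rewrite !gt_eqF.
split; first by apply: eq_Int (IntZ `|h|^-1 I) => u; rewrite GE'.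
rewrite (eq_RI GE') RIZ// E opprK [in RHS]mulrC mulrA; congr (_ * _).
rewrite /ker -exprVn -powR_mulrn ?invr_ge0// -powRrM.
rewrite -(powR_inv1 (ltW h0')) -powRrM -powD//; congr (_ `^ _); by field.
Qed.

Definition LG s t x : R := LK s (G t) x.

Lemma G_lip_bdd t : 0 < t -> [/\ measurable_fun setT (G t),
  (forall x, `|G t x| <= (Num.sqrt t)^-1) &
  (forall x y, `|G t x - G t y| <= 4 * t^-1 * `|x - y|)].
Proof.
move=> t0; split; first by mea.
  by move=> x; rewrite ger0_norm ?G_ge0 ?G_le_sqrt.
by move=> x y; exact: G_lip.
Qed.

(** Writing the singular kernel as a superposition of [G u] and using that [G t] convolved with
    [G u] is [G (t + u)] turns the integral over increments into one over time. *)
Lemma LG_sub s t x : 0 < s -> s < 1 -> 0 < t ->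
  Int (fun u => pk (- (s / 2)) u * (G t x - G (t + u) x)) /\
  \int[mu]_u (pk (- (s / 2)) u * (G t x - G (t + u) x)) = cG s * LG s t x.
Proof.
move=> s0 s1 t0; have [mG GM GL] := G_lip_bdd t0.
have [C C0 /(_ _ _ _ mG GM GL x)[I _ _]] := LK_bound s0 s1.
have mf : measurable_fun setT (fun h => G t x - G t (x - h)) by mea.
have Ig : Int (fun h => cG s * ker s h * (G t x - G t (x - h))).
  by apply: eq_Int (IntZ (cG s) I) => h; ring.
have mpk := meas_pk (- (s / 2)).
have [||J E] := @fubini_weight _ (fun u h => pk (- (s / 2)) u * G u h)
  (fun h => cG s * ker s h) _ _ _ (fun h => @pk_G_ker s h s0 s1) mf Ig.
- by rewrite /meas2; mea.
- by move=> u h; rewrite mulr_ge0 ?pk_ge0 ?G_ge0.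
have EM u : \int[mu]_h (pk (- (s / 2)) u * G u h * (G t x - G t (x - h))) =
    pk (- (s / 2)) u * (G t x - G (t + u) x).
  have [u0|u0] := ltP 0 u; last first.
    rewrite /pk ltNge u0/= mul0r -[RHS](@RI0 R); apply: eq_RI => h.
    by rewrite !mul0r.
  have [I1 E1] := G_conv x t0 u0.
  have I2 := IntZ (G t x) (Int_G0 u0).
  rewrite -E1 -[X in _ * (X - _)]mulr1 -(RI_G0 u0) -[G t x * _]RIZ; last exact: Int_G0.
  rewrite -RIB// -RIZ; last exact: IntB.
  by apply: eq_RI => h; ring.
split; first exact: eq_Int EM J.
rewrite -(eq_RI EM) E /LG /LK -(RIZ _ I).
by apply: eq_RI => h; ring.
Qed.

Lemma LG_even s t x : 0 < s -> s < 1 -> 0 < t -> LG s t (- x) = LG s t x.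
Proof.
move=> s0 s1 t0; have [mG GM GL] := G_lip_bdd t0.
have [C C0 /(_ _ _ _ mG GM GL (- x))[I _ _]] := LK_bound s0 s1.
rewrite /LG /LK -(RI_opp I); apply: eq_RI => h.
by rewrite kerN G_even -(G_even t (- x - - h)); congr ((_ - G _ _) * _); ring.
Qed.

Lemma meas_LG s t : 0 < s -> s < 1 -> 0 < t -> measurable_fun setT (LG s t).
Proof.
move=> s0 s1 t0; have [mG GM GL] := G_lip_bdd t0; have mk := meas_ker s.
apply: (@meas_RI _ (fun x h => (G t x - G t (x - h)) * ker s h)); first by rewrite /meas2; mea.
by move=> x; have [C C0 /(_ _ _ _ mG GM GL x)[]] := LK_bound s0 s1.
Qed.

Lemma LG_bounded s t : 0 < s -> s < 1 -> 0 < t -> exists M, forall x, `|LG s t x| <= M.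
Proof.
move=> s0 s1 t0; have [mG GM GL] := G_lip_bdd t0.
have [C C0 HC] := LK_bound s0 s1; eexists => x.
by have [_ _] := HC _ _ _ mG GM GL x; exact.
Qed.

(** Fubini needs integrability in u of the slice norms: for u <= 1 it comes from [G_diff_small], for
    1 <= u from the uniform bound on the flow of |v|. *)
Lemma tame_LG s t v a : 0 < s -> s < 1 -> 0 < t -> tame v ->
  Int (fun x => v x * LG s t (x - a)) /\
  cG s * \int[mu]_x (v x * LG s t (x - a)) =
    \int[mu]_u (pk (- (s / 2)) u * (H v t a - H v (t + u) a)).
Proof.
move=> s0 s1 t0 [gv hv]; have mv := gtest_meas gv.
have [K K0 HK] := G_diff_small t0; have [B HB] := hv t t0.
have mpk := meas_pk (- (s / 2)); have gv' := gtest_norm gv.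
have mL := meas_LG s0 s1 t0.
pose B2 := H (fun x => `|v x|) (2 * (t + 1)) a.
have B20 : 0 <= B2 by apply: H_ge0.
have B0 : 0 <= B := le_trans (H_ge0 t a (fun x => normr_ge0 (v x))) (HB t a (lexx t)).
have t2 : 0 < 2 * (t + 1) by lra.
pose F u x := v x * (pk (- (s / 2)) u * (G t (x - a) - G (t + u) (x - a))).
have IF u : 0 < u -> Int (fun x => v x * (G t (x - a) - G (t + u) (x - a))).
  move=> u0; apply: eq_Int (IntB (gv _ a t0) (gv _ a (addr_gt0 t0 u0))) => x.
  by rewrite mulrBr.
have FE u x : F u x = pk (- (s / 2)) u * (v x * (G t (x - a) - G (t + u) (x - a))).
  by rewrite /F mulrCA.
have IFu u : Int (F u).
  have [u0|u0] := ltP 0 u; first by apply: eq_Int (IntZ _ (IF u u0)) => x; rewrite FE.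
  by apply: eq_Int (Int0 (R := R)) => x; rewrite FE /pk ltNge u0 mul0r.
have mF : measurable_fun setT (fun z : R * R => `|F z.1 z.2|) by rewrite /F; mea.
have mN : measurable_fun setT (fun u => \int[mu]_x `|F u x|).
  by apply: (@meas_RI _ (fun u x => `|F u x|)) => // u; exact: Int_norm.
have NE u : 0 < u -> \int[mu]_x `|F u x| =
    u `^ (- (s / 2) - 1) * \int[mu]_x `|v x * (G t (x - a) - G (t + u) (x - a))|.
  move=> u0; rewrite -RIZ; last exact/Int_norm/IF.
  by apply: eq_RI => x; rewrite FE /pk u0 normrM (ger0_norm (powR_ge0 _ _)).
have IN : Int (fun u => if 0 < u then \int[mu]_x `|F u x| else 0).
  have d1 : -1 < - (s / 2) by lra.
  apply: (@Int_pk_split _ (1 - s / 2) _ (K * B2) (2 * B) (- (s / 2))) => //.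
  - by lra.
  - by rewrite mulr_ge0.
  - by rewrite mulr_ge0.
  - move=> u u0 u1; rewrite ger0_norm; last by apply: RI_ge0.
    rewrite [X in _ <= _ * u `^ X](_ : - (s / 2) = (- (s / 2) - 1) + 1); last by ring.
    rewrite [X in _ <= _ * X]powD// [X in _ <= _ * (_ * X)](powRr1 (ltW u0)) mulrCA NE//.
    apply: ler_wpM2l; first exact: powR_ge0.
    rewrite (_ : K * B2 * u = K * u * B2); last by ring.
    have Ig := gv' _ a t2.
    rewrite -RIZ//; apply: le_RI; [exact/Int_norm/IF|exact: IntZ|] => x.
    by rewrite normrM [leRHS]mulrCA; apply: ler_wpM2l => //; exact: HK.
  - move=> u u1; have u0 : 0 < u by apply: lt_le_trans u1.
    rewrite ger0_norm; last by apply: RI_ge0.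
    rewrite (_ : 1 - s / 2 - 2 = - (s / 2) - 1); last by ring.
    rewrite mulrC NE//; apply: ler_wpM2l; first exact: powR_ge0.
    have I1 := gv' _ a t0; have I2 := gv' _ a (addr_gt0 t0 u0).
    apply: (@le_trans _ _ (H (fun x => `|v x|) t a + H (fun x => `|v x|) (t + u) a)).
      rewrite -RID//; apply: le_RI; [exact/Int_norm/IF|exact: IntD|] => x.
      rewrite normrM -mulrDr ler_wpM2l//; apply: (le_trans (ler_normB _ _)).
      by rewrite !(ger0_norm (G_ge0 _ _)).
    by rewrite mulr_natl mulr2n lerD// HB// lerDl ltW.
have I2 : Int2 F.
  apply: (Int2P _ IFu IN); first by rewrite /meas2 /F; mea.
  move=> u; case: ifP => // /negbT; rewrite -leNgt => u0.
  rewrite (eq_RI (g := fun=> 0)) ?RI0// => x.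
  by rewrite FE /pk ltNge u0 mul0r normr0.
have E1 x : \int[mu]_u F u x = cG s * (v x * LG s t (x - a)).
  have [I E] := LG_sub (x - a) s0 s1 t0.
  by rewrite RIZ// E mulrCA.
have E2 u : \int[mu]_x F u x = pk (- (s / 2)) u * (H v t a - H v (t + u) a).
  have [u0|u0] := ltP 0 u; last first.
    rewrite [pk _ _]/pk ltNge u0/= mul0r -[RHS](@RI0 R); apply: eq_RI => x.
    by rewrite FE /pk ltNge u0 mul0r.
  rewrite (eq_RI (FE u)) RIZ; last exact: IF.
  congr (_ * _); rewrite -RIB; [|exact: gv|by apply: gv; rewrite addr_gt0].
  by apply: eq_RI => x; rewrite mulrBr.
have IL : Int (fun x => v x * LG s t (x - a)).
  have c0 := cG_gt0 s0 s1.
  apply: eq_Int (IntZ (cG s)^-1 (Int2_Int (Int2_swap I2))) => x.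
  by rewrite E1 mulKf// gt_eqF.
split=> //; rewrite -RIZ// -(eq_RI E1) -(eq_RI E2).
by rewrite (fub I2).
Qed.

(** On the Fourier side, pairing with (-Delta)^(s/2) of a Gaussian raises the exponent of the
    multiplier by s; all the constants are carried along unevaluated. *)
Lemma tame_LG_MM s t v a al m c : 0 < s -> s < 1 -> 0 < t -> tame v ->
  (forall u, 0 < u -> H v u a = c * MM al m u) -> adm al m -> adm (al + s) m ->
  \int[mu]_x (v x * LG s t (x - a)) = c * gamma_d (s / 2) / cG s * MM (al + s) m t.
Proof.
move=> s0 s1 t0 tv Hv am am2; have [I E] := tame_LG a s0 s1 t0 tv.
have c0 := cG_gt0 s0 s1.
have b0 : 0 < s / 2 by rewrite divr_gt0.
have b1 : s / 2 < 1 by lra.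
have sE : al + s = al + 2 * (s / 2) by field.
rewrite sE in am2 *; have [J S] := subordination_pos b0 b1 am am2 t0.
have -> : c * gamma_d (s / 2) / cG s * MM (al + 2 * (s / 2)) m t =
  (cG s)^-1 * (c * (gamma_d (s / 2) * MM (al + 2 * (s / 2)) m t)) by ring.
rewrite -S -RIZ//; apply: (canRL (mulKf (lt0r_neq0 c0))); rewrite E.
apply: eq_RI => u; case: (ltP 0 u) => u0; last by rewrite /pk ltNge u0 !mul0r mulr0.
by rewrite !Hv ?addr_gt0// -mulrBr mulrCA.
Qed.

End gauss_kernel.

(** * Gaussian test functions *)

Section schwartz_gaussians.
Context {R : realType}.
Notation mu := (@lebesgue_measure R).
Implicit Types (a b c s t u x y h : R) (f v phi : R -> R) (p q : {poly R}).

(** A class closed under differentiation that contains the translated Gaussians and their products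
    with cosines and sines, which replace complex exponentials since test functions are real. *)
Definition trig_gauss t a b p q x : R :=
  (p.[x] * cos (b * x) + q.[x] * sin (b * x)) * expR (- (t * (x - a) ^+ 2)).

Let D1 t a b p q := p^`() + b *: q - (2 * t) *: (('X - a%:P) * p).
Let D2 t a b p q := q^`() - b *: p - (2 * t) *: (('X - a%:P) * q).

Lemma is_derive_poly p x : is_derive x (1 : R) (horner p) p^`().[x].
Proof.
split; first exact: derivable_horner.
by rewrite -derive1E -derivE.
Qed.

Lemma is_derive_trig_gauss t a b p q x :
  is_derive x (1 : R) (trig_gauss t a b p q) (trig_gauss t a b (D1 t a b p q) (D2 t a b p q) x).
Proof.
have dp := is_derive_poly p x; have dq := is_derive_poly q x.
apply: is_derive_eq; rewrite /trig_gauss /D1 /D2.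
by rewrite !(hornerD, hornerN, hornerZ, hornerM, hornerX, hornerC) /GRing.scale /=; ring.
Qed.

Lemma derive1n_trig_gauss t a b k p q :
  exists p' q', derive1n k (trig_gauss t a b p q) = trig_gauss t a b p' q'.
Proof.
elim: k => [|k [p' [q' IH]]]; first by exists p, q.
exists (D1 t a b p' q'), (D2 t a b p' q').
rewrite derive1nS IH; apply/funext => x; rewrite derive1E.
exact: (@derive_val _ _ _ _ _ _ _ (is_derive_trig_gauss t a b p' q' x)).
Qed.

(** Each factor X spends half of the remaining exponent, so the induction on the polynomial must
    hold for all positive t. *)
Lemma poly_gauss_bounded t a p : 0 < t ->
  exists M, forall x, `|p.[x] * expR (- (t * (x - a) ^+ 2))| <= M.
Proof.
elim/poly_ind: p t => [|p c IH] t t0; first by exists 0 => x; rewrite horner0 mul0r normr0.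
have t2 : 0 < t / 2 by rewrite divr_gt0.
have [M HM] := IH _ t2.
have st : 0 < Num.sqrt t by rewrite sqrtr_gt0.
have X1 x : `|x * expR (- (t / 2 * (x - a) ^+ 2))| <= (Num.sqrt t)^-1 + `|a|.
  have e1 : expR (- (t / 2 * (x - a) ^+ 2)) <= 1.
    by rewrite -[leRHS]expR0 ler_expR oppr_le0 mulr_ge0 ?sqr_ge0 ?ltW.
  rewrite normrM (ger0_norm (expR_ge0 _)) -{1}(subrK a x).
  apply: (@le_trans _ _ ((`|x - a| + `|a|) * expR (- (t / 2 * (x - a) ^+ 2)))).
    by rewrite ler_wpM2r ?expR_ge0 ?ler_normD.
  rewrite mulrDl lerD//; last by rewrite ler_piMr.
  have := sqr_mul_expRN_le1 (Num.sqrt t * (x - a)).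
  rewrite normrM (gtr0_norm st) exprMn (sqr_sqrtr (ltW t0)).
  rewrite (_ : - (t * (x - a) ^+ 2) / 2 = - (t / 2 * (x - a) ^+ 2)); last by field.
  by move=> h; rewrite -[leRHS]mulr1 ler_pdivlMl// mulrA.
exists (M * ((Num.sqrt t)^-1 + `|a|) + `|c|) => x.
have -> : (p * 'X + c%:P).[x] * expR (- (t * (x - a) ^+ 2)) =
    p.[x] * expR (- (t / 2 * (x - a) ^+ 2)) * (x * expR (- (t / 2 * (x - a) ^+ 2))) +
    c * expR (- (t * (x - a) ^+ 2)).
  have -> : expR (- (t * (x - a) ^+ 2)) =
      expR (- (t / 2 * (x - a) ^+ 2)) * expR (- (t / 2 * (x - a) ^+ 2)).
    by rewrite -expRD; congr expR; field.
  by rewrite hornerMXaddC; ring.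
apply: (le_trans (ler_normD _ _)); rewrite lerD//.
  by rewrite normrM ler_pM.
rewrite normrM ler_piMr// ger0_norm ?expR_ge0// -[leRHS]expR0 ler_expR.
by rewrite oppr_le0 mulr_ge0 ?sqr_ge0 ?(ltW t0).
Qed.

Lemma schwartz_trig_gauss t a b p q : 0 < t -> schwartz (trig_gauss t a b p q).
Proof.
move=> t0; split=> [k x|m k]; have [p' [q' ->]] := derive1n_trig_gauss t a b k p q.
  exact: (@ex_derive _ _ _ _ _ _ _ (is_derive_trig_gauss t a b p' q' x)).
have [M HM] := poly_gauss_bounded a ('X^m * p') t0.
have [N HN] := poly_gauss_bounded a ('X^m * q') t0.
exists (M + N) => x; have := HM x; have := HN x.
rewrite /trig_gauss !hornerM !hornerXn; set e := expR _ => hN hM.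
have -> : x ^+ m * ((p'.[x] * cos (b * x) + q'.[x] * sin (b * x)) * e) =
  x ^+ m * p'.[x] * e * cos (b * x) + x ^+ m * q'.[x] * e * sin (b * x) by ring.
apply: (le_trans (ler_normD _ _)).
by rewrite lerD// normrM; [apply: le_trans hM|apply: le_trans hN]; rewrite ler_piMr ?norm_cos_le1 ?norm_sin_le1.
Qed.

Lemma schwartz_gauss_cos t b : 0 < t -> schwartz (fun x => expR (- (t * x ^+ 2)) * cos (b * x)).
Proof.
move=> t0; have := schwartz_trig_gauss 0 b 1 0 t0; congr schwartz.
by apply/funext => x; rewrite /trig_gauss !hornerE subr0 mulrC.
Qed.

Lemma schwartz_gauss_sin t b : 0 < t -> schwartz (fun x => expR (- (t * x ^+ 2)) * sin (b * x)).
Proof.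
move=> t0; have := schwartz_trig_gauss 0 b 0 1 t0; congr schwartz.
by apply/funext => x; rewrite /trig_gauss !hornerE subr0 mulrC.
Qed.

Lemma schwartz_G t a : 0 < t -> schwartz (fun x => G t (x - a)).
Proof.
move=> t0; have t4 : 0 < (4 * t)^-1 by rewrite invr_gt0 mulr_gt0.
have := schwartz_trig_gauss a 0 ((2 * Num.sqrt (pi * t))^-1)%:P 0 t4; congr schwartz.
apply/funext => x; rewrite (GE4 _ t0) /trig_gauss !hornerC mul0r cos0 mulr1 mul0r addr0.
by [].
Qed.

Lemma schwartz_lip phi : schwartz phi -> [/\ measurable_fun setT phi,
  exists M, forall x, `|phi x| <= M &
  exists L, forall x y, `|phi x - phi y| <= L * `|x - y|].
Proof.
move=> [dphi bphi].
have d0 x : is_derive x (1 : R) phi (derive1n 1 phi x).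
  split; first exact: (dphi 0%N x).
  by rewrite derive1n1 derive1E.
split.
- apply: continuous_measurable_fun => x.
  exact/differentiable_continuous/derivable1_diffP/(dphi 0%N x).
- have [M HM] := bphi 0%N 0%N; exists M => x.
  by have := HM x; rewrite expr0 mul1r.
- have [L HL] := bphi 0%N 1%N; exists L.
  by apply: (derive_lip d0) => x; have := HL x; rewrite expr0 mul1r.
Qed.

End schwartz_gaussians.

(** * The weak fractional Laplacian tested on Gaussians *)

Section weak_fracLap.
Context {R : realType}.
Notation mu := (@lebesgue_measure R).
Implicit Types (a s t x : R) (f g u : R -> R).

Lemma fracLap_weak_gtest sg u g : is_fracLap_weak sg u g -> gtest g.
Proof. by move=> h t a t0; have [] := h _ (schwartz_G a t0). Qed.

Lemma fracLap_weak_heat s u g t a : 0 < s -> s < 1 -> 0 < t ->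
  is_fracLap_weak (s / 2) u g ->
  H g t a = fracLap_const (s / 2) * \int[mu]_x (u x * LG s t (x - a)).
Proof.
move=> s0 s1 t0 h; have [I _ E] := h _ (schwartz_G a t0).
have [mG GM GL] := G_lip_bdd t0.
have P x : fracLap_pv (s / 2) (fun x => G t (x - a)) x =
    fracLap_const (s / 2) * LG s t (x - a).
  rewrite (@fracLap_pvE _ _ _ (4 * t^-1) (Num.sqrt t)^-1)//.
  - by congr (_ * _); apply: eq_RI => k; congr ((_ - G _ _) * _); ring.
  - by mea.
  - by move=> y z; rewrite (le_trans (GL _ _))// (_ : y - a - (z - a) = y - z)//; ring.
(* Integrability of u against the kernel is recovered by dividing by the constant; treating a
   vanishing constant separately avoids evaluating Gamma. *)
rewrite /H E; have [k0|k0] := eqVneq (fracLap_const (s / 2) : R) 0.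
  by rewrite k0 mul0r -[RHS](@RI0 R); apply: eq_RI => x; rewrite P k0 mul0r mulr0.
rewrite -RIZ; first by apply: eq_RI => x; rewrite P mulrCA.
apply: eq_Int (IntZ (fracLap_const (s / 2))^-1 I) => x.
by rewrite P mulrCA mulKf.
Qed.

Lemma gtest_uniq f g : gtest f -> gtest g ->
  (forall t a, 0 < t -> H f t a = H g t a) -> {ae mu, forall x, f x = g x}.
Proof.
move=> gf gg e; have := @gtest_eq0 R (fun x => f x + (- 1) * g x).
have gN := gtestZ (- 1) gg; move=> /(_ (gtestD gf gN)) h.
apply: ae_mp (h _) => [x|t a t0]; first by move/eqP; rewrite mulN1r subr_eq0 => /eqP.
by rewrite -/(H (fun x => f x + (- 1) * g x) t a) HD// HZ// e// mulN1r subrr.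
Qed.

Lemma fracLap_weak_uniq sg u f g : is_fracLap_weak sg u f -> is_fracLap_weak sg u g ->
  {ae mu, forall x, f x = g x}.
Proof.
move=> hf hg; apply: gtest_uniq; [exact: fracLap_weak_gtest hf|exact: fracLap_weak_gtest hg|].
move=> t a t0; have [_ _ e1] := hf _ (schwartz_G a t0); have [_ _ e2] := hg _ (schwartz_G a t0).
by rewrite /H e1 e2.
Qed.

End weak_fracLap.

(** * Jacobi polynomials *)

Lemma meas_weight (R : realType) d (T : measurableType d) (th : R) (f : T -> R) :
  measurable_fun setT f -> measurable_fun setT (fun x => weight th (f x)).
Proof. by move=> mf; rewrite /weight; mea. Qed.

Lemma meas_horner (R : realType) d (T : measurableType d) (p : {poly R}) (f : T -> R) :
  measurable_fun setT f -> measurable_fun setT (fun x => p.[f x]).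
Proof.
move=> mf; apply: (@measurableT_comp _ _ _ _ _ _ (horner p)) => //.
by apply: continuous_measurable_fun => x; exact: continuous_horner.
Qed.

Ltac mea_poly ::= match goal with
  | |- measurable_fun _ (fun x => weight ?a (@?b x)) => apply: (@meas_weight _ _ _ a b)
  | |- measurable_fun _ (fun x => horner ?a (@?b x)) => apply: (@meas_horner _ _ _ a b)
  | |- measurable_fun _ (weight ?a) => apply: (@meas_weight _ _ _ a (fun x => x))
  | |- measurable_fun _ (horner ?a) => apply: (@meas_horner _ _ _ a (fun x => x))
  end.

Section weights.
Context {R : realType}.
Notation mu := (@lebesgue_measure R).
Implicit Types (a b c t x y z th : R) (f g : R -> R) (p q : {poly R}).

Lemma weight_ge0 th x : 0 <= weight th x.
Proof. by rewrite /weight; case: ifP => // _; exact: powR_ge0. Qed.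

Lemma weight_out th x : 1 <= `|x| -> weight th x = 0.
Proof. by rewrite /weight ltNge => ->. Qed.

Lemma sqr_lt1 x : `|x| < 1 -> 0 < 1 - x ^+ 2.
Proof.
move=> x1; rewrite subr_gt0 -(real_normK (num_real x)) expr_lt1//.
Qed.

Lemma sqr_le1 x : `|x| <= 1 -> 0 <= 1 - x ^+ 2 <= 1.
Proof.
move=> x1; rewrite subr_ge0 lerBlDr lerDl sqr_ge0 andbT.
by rewrite -(real_normK (num_real x)) expr_le1.
Qed.

Lemma weight_le_pow th x : 0 < th ->
  weight th x <= `|x - 1| `^ (- th) + `|x + 1| `^ (- th).
Proof.
move=> th0; rewrite /weight; case: ifP => [x1|_]; last by rewrite addr_ge0 ?powR_ge0.
have E u v : 0 < v -> v <= u -> u `^ (- th) <= v `^ (- th).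
  move=> v0 vu; rewrite !powRN lef_pV2 ?posrE ?powR_gt0//; last exact: lt_le_trans vu.
  by apply: ge0_ler_powR; rewrite ?nnegrE ?(ltW th0) ?(ltW v0) ?(le_trans (ltW v0) vu).
move: x1; rewrite ltr_norml => /andP[xm x1].
have [x0|x0] := leP 0 x.
  apply: (@le_trans _ _ (`|x - 1| `^ (- th))); last by rewrite lerDl powR_ge0.
  by rewrite ltr0_norm ?opprB; [apply: E; nra|lra].
apply: (@le_trans _ _ (`|x + 1| `^ (- th))); last by rewrite lerDr powR_ge0.
by rewrite gtr0_norm; [apply: E; nra|lra].
Qed.

(* Splitting at distance [l] from the singularity. *)
Lemma pow_sing_bound th b (psi : R -> R) (S l : R) : 0 < th -> th < 1 -> 0 < l ->
  Int psi -> (forall x, 0 <= psi x <= S) ->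
  Int (fun x => `|x - b| `^ (- th) * psi x) /\
  \int[mu]_x (`|x - b| `^ (- th) * psi x) <=
    2 / (1 - th) * (S * l `^ (1 - th)) + l `^ (- th) * \int[mu]_x psi x.
Proof.
move=> th0 th1 l0 Ip hp; have mp := Int_meas Ip.
have S0 : 0 <= S by have /andP[] := hp 0; exact: le_trans.
have tm : -1 < - th by lra.
have [I0 E0] := Int_pow0 tm l0.
set P := (fun x => _) in I0 E0.
have P0 x : 0 <= P x by rewrite /P; case: ifP => // _; exact: powR_ge0.
have I1 := Int_opp I0.
have J : Int (fun x => P x + P (- x)) by exact: IntD.
have J2 := Int_shift (- b) J.
pose g x := S * (P (x - b) + P (- (x - b))) + l `^ (- th) * psi x.
have Ig : Int g by apply: IntD; exact: IntZ.
have fg x : `| `|x - b| `^ (- th) * psi x| <= g x.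
  have /andP[p0 pS] := hp x.
  rewrite ger0_norm ?mulr_ge0 ?powR_ge0// /g.
  have [xl|xl] := ltP `|x - b| l.
    apply: (@le_trans _ _ (S * (P (x - b) + P (- (x - b))))); last first.
      by rewrite lerDl mulr_ge0 ?powR_ge0.
    rewrite mulrC ler_pM ?powR_ge0//.
    have [->|x0] := eqVneq (x - b) 0.
      by rewrite normr0 powR0 ?addr_ge0// oppr_eq0 gt_eqF.
    have : P `|x - b| <= P (x - b) + P (- (x - b)).
      by case: (ger0P (x - b)) => _; rewrite ?lerDl ?lerDr.
    by rewrite {1}/P normr_gt0 x0 xl.
  apply: (@le_trans _ _ (l `^ (- th) * psi x)); last first.
    by rewrite lerDr mulr_ge0 ?addr_ge0.
  rewrite ler_wpM2r// !powRN lef_pV2 ?posrE ?powR_gt0//; last exact: lt_le_trans xl.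
  by apply: ge0_ler_powR; rewrite ?nnegrE ?(ltW th0) ?(ltW l0).
have mf : measurable_fun setT (fun x => `|x - b| `^ (- th) * psi x) by mea.
have If := le_Int mf fg Ig; split => //.
apply: (@le_trans _ _ (\int[mu]_x g x)).
  by apply: le_RI => // x; exact: le_trans (ler_norm _) (fg x).
rewrite RID; [|exact: IntZ|exact: IntZ].
rewrite !RIZ// (RI_shift (- b) J) RID// (RI_opp I0) lerD2r.
have -> : 2 / (1 - th) * (S * l `^ (1 - th)) = S * (2 * ((1 - th)^-1 * l `^ (1 - th))) by ring.
rewrite (_ : \int[mu]_x P x + \int[mu]_x P x = 2 * \int[mu]_x P x); last by ring.
apply: ler_wpM2l => //; apply: ler_wpM2l => //.
by rewrite [1 - th]addrC.
Qed.

(** The length l is left free: it will be sqrt t for the heat kernel at time t, and the length of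
    the interval when psi is an indicator. *)
Lemma weight_conv th (psi : R -> R) (S l : R) : 0 < th -> th < 1 -> 0 < l ->
  Int psi -> (forall x, 0 <= psi x <= S) ->
  Int (fun x => weight th x * psi x) /\
  \int[mu]_x (weight th x * psi x) <=
    2 * (2 / (1 - th) * (S * l `^ (1 - th)) + l `^ (- th) * \int[mu]_x psi x).
Proof.
move=> th0 th1 l0 Ip hp; have mp := Int_meas Ip.
have [I1 E1] := pow_sing_bound 1 th0 th1 l0 Ip hp.
have [I2 E2] := pow_sing_bound (- 1) th0 th1 l0 Ip hp.
have fg x : `|weight th x * psi x| <=
    `|x - 1| `^ (- th) * psi x + `|x - - 1| `^ (- th) * psi x.
  have /andP[p0 pS] := hp x.
  rewrite ger0_norm ?mulr_ge0 ?weight_ge0// -mulrDl ler_wpM2r// opprK.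
  exact: weight_le_pow.
have mf : measurable_fun setT (fun x => weight th x * psi x) by mea.
have If := le_Int mf fg (IntD I1 I2); split => //.
rewrite mulr_natl mulr2n; apply: le_trans (lerD E1 E2); rewrite -RID//.
by apply: le_RI => //; [exact: IntD|move=> x; exact: le_trans (ler_norm _) (fg x)].
Qed.

Lemma Int_weight th : th < 1 -> Int (weight th).
Proof.
move=> th1; have Ib := Int_box (R := R) (-1) 1.
have wE x : weight th x = weight th x * box (-1) 1 x.
  rewrite /box -ltr_norml; case: ifP => [|/negbT]; first by rewrite mulr1.
  by rewrite -leNgt => h; rewrite weight_out// mul0r.
have [th0|th0] := ltP 0 th.
  have [|I _] := weight_conv th0 th1 ltr01 Ib (S := 1).
    by move=> x; rewrite box_ge0 box_le1.
  by apply: eq_Int I => x; rewrite -wE.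
apply: (le_Int _ _ Ib); first by mea.
move=> x; rewrite wE normrM (ger0_norm (box_ge0 _ _ _)) ler_piMl ?box_ge0//.
rewrite ger0_norm ?weight_ge0// /weight; case: ifP => // /ltW/sqr_le1/andP[h0 h1].
have [->|h] := eqVneq th 0; first by rewrite oppr0 powRr0.
have := ge0_ler_powR (_ : 0 <= - th) _ _ h1; rewrite powR1; apply; rewrite ?nnegrE//.
by rewrite oppr_ge0.
Qed.

Lemma wt_weight th : wt (weight th : R -> R).
Proof. by split; [mea|exact: weight_ge0]. Qed.

Lemma poly_bounded p : exists2 C, 0 <= C & forall x, `|x| <= 1 -> `|p.[x]| <= C.
Proof.
elim/poly_ind: p => [|p c [C C0 IH]]; first by exists 0 => // x _; rewrite horner0 normr0.
exists (C + `|c|) => [|x x1]; first by rewrite addr_ge0.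
rewrite hornerMXaddC (le_trans (ler_normD _ _))// lerD2r normrM.
by apply: (@le_trans _ _ (C * 1)); [rewrite ler_pM ?IH|rewrite mulr1].
Qed.

Lemma poly_lip p : exists2 C, 0 <= C & forall x y, `|x| <= 1 -> `|y| <= 1 ->
  `|p.[x] - p.[y]| <= C * `|x - y|.
Proof.
elim/poly_ind: p => [|p c [C C0 IH]].
  by exists 0 => // x y _ _; rewrite !horner0 subrr normr0 mul0r.
have [D D0 HD] := poly_bounded p.
exists (C + D) => [|x y x1 y1]; first by rewrite addr_ge0.
rewrite !hornerMXaddC.
have -> : p.[x] * x + c - (p.[y] * y + c) = (p.[x] - p.[y]) * x + p.[y] * (x - y) by ring.
rewrite (le_trans (ler_normD _ _))// [leRHS]mulrDl !normrM lerD//.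
  by apply: (le_trans _ (IH _ _ x1 y1)); rewrite ler_piMr.
by rewrite ler_wpM2r// HD.
Qed.

Lemma Int_weightM th f (M : R) : th < 1 -> measurable_fun setT f ->
  (forall x, `|x| <= 1 -> `|f x| <= M) -> Int (fun x => weight th x * f x).
Proof.
move=> th1 mf fM; apply: (le_Int _ _ (IntZ M (Int_weight th1))); first by mea.
move=> x; rewrite normrM (ger0_norm (weight_ge0 _ _)) mulrC.
have [x1|x1] := leP `|x| 1; first by rewrite ler_wpM2r ?weight_ge0 ?fM.
by rewrite weight_out ?mulr0// ltW.
Qed.

Lemma Int_weight_poly th p : th < 1 -> Int (fun x => weight th x * p.[x]).
Proof.
move=> th1; have [C C0 HC] := poly_bounded p.
by apply: (Int_weightM th1 _ HC); mea.
Qed.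

Lemma L2_weight th f (M : R) : th < 1 -> measurable_fun setT f ->
  (forall x, `|x| <= 1 -> `|f x| <= M) -> L2 (weight th) f.
Proof.
move=> th1 mf fM; split => //.
apply: (@eq_Int _ (fun x => weight th x * f x ^+ 2)); first by move=> x; rewrite mulrC.
apply: (@Int_weightM _ _ (M ^+ 2)) => //; first by mea.
move=> x x1; rewrite normrX ler_pXn2r ?nnegrE ?fM//.
exact: le_trans (fM x x1).
Qed.

Lemma L2_weight_poly th p : th < 1 -> L2 (weight th) (horner p).
Proof.
move=> th1; have [C C0 HC] := poly_bounded p.
by apply: (L2_weight th1 _ HC); mea.
Qed.

Lemma locInt_Int f : Int f -> locInt f.
Proof.
move=> If; have mf := Int_meas If; split => // a b.
have mb : measurable_fun setT (box a b) by mea.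
by apply: eq_Int (IntMb mb (norm_box a b) If) => x; rewrite mulrC.
Qed.

Definition heat_sup th : R := 2 * (2 / (1 - th) + 1).

Lemma sqrt_pow t b : 0 <= t -> Num.sqrt t `^ b = t `^ (b / 2).
Proof. by move=> t0; rewrite -powR12_sqrt// -powRrM mulrC. Qed.

(** With l = sqrt t both terms have order t^(-th/2). This short-time rate is better than the rate
    t^(-1/2) of general integrable functions, and th/2 < th makes the Riesz potential of order th
    bounded. *)
Lemma H_weight_le th t a : 0 < th -> th < 1 -> 0 < t ->
  H (weight th) t a <= heat_sup th * t `^ (- th / 2).
Proof.
move=> th0 th1 t0; have st : 0 < Num.sqrt t by rewrite sqrtr_gt0.
have [|I E] := weight_conv th0 th1 st (Int_G a t0) (S := (Num.sqrt t)^-1).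
  by move=> x; rewrite G_ge0 G_le_sqrt.
apply: (le_trans E); rewrite RI_G// mulr1 -(powR_inv1 (ltW st)) -powD//.
rewrite (_ : -1 + (1 - th) = - th); last by ring.
rewrite sqrt_pow ?(ltW t0)// /heat_sup.
by rewrite le_eqVlt; apply/orP; left; apply/eqP; ring.
Qed.

End weights.

(** * Symmetry of the Jacobi operator *)

Section sturm_liouville.
Context {R : realType}.
Notation mu := (@lebesgue_measure R).
Implicit Types (a b c t x y z th m : R) (f g : R -> R) (p q : {poly R}).

(* The Jacobi equation for the weight [(1 - x^2)^(- th)]. *)
Definition eigp th m p := forall x,
  (1 - x ^+ 2) * p^`()^`().[x] - 2 * (1 - th) * x * p^`().[x] + m * p.[x] = 0.

Let Dn (n : nat) : R := 1 - n.+2%:R^-1.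

Let Dn_bd n : 0 < Dn n < 1.
Proof.
rewrite /Dn subr_gt0 invf_lt1 ?ltr0n// ltr1n/=.
by rewrite ltrBlDr ltrDl invr_gt0.
Qed.

Let Dn_cvg : Dn n @[n --> \oo] --> (1 : R).
Proof.
rewrite -[X in _ --> X]subr0; apply: cvgB; first exact: cvg_cst.
have := @rad_cvg R; rewrite -(cvg_shiftS (@rad R)); exact.
Qed.

(** Lagrange's identity: the integrand is the derivative of (1 - x^2)^(1 - th) (e' p - e p'), which
    vanishes at both ends because th < 1. The function e is arbitrary, so that polynomials and heat
    kernels can both be inserted. *)
Lemma sturm_liouville th m p (e e1 e2 : R -> R) (M : R) : th < 1 -> eigp th m p ->
  (forall x, is_derive x (1 : R) e (e1 x)) -> (forall x, is_derive x (1 : R) e1 (e2 x)) ->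
  continuous e2 ->
  (forall x, `|x| <= 1 -> [/\ `|e x| <= M, `|e1 x| <= M & `|e2 x| <= M]) ->
  Int (fun x => weight th x * (((1 - x ^+ 2) * e2 x - 2 * (1 - th) * x * e1 x + m * e x) * p.[x])) /\
  \int[mu]_x (weight th x *
    (((1 - x ^+ 2) * e2 x - 2 * (1 - th) * x * e1 x + m * e x) * p.[x])) = 0.
Proof.
move=> th1 ep de de1 ce2 eM.
have ce : continuous e.
  by move=> x; apply/differentiable_continuous/derivable1_diffP; exact: (@ex_derive _ _ _ _ _ _ _ (de x)).
have ce1 : continuous e1.
  by move=> x; apply/differentiable_continuous/derivable1_diffP; exact: (@ex_derive _ _ _ _ _ _ _ (de1 x)).
have me := continuous_measurable_fun ce.
have me1 := continuous_measurable_fun ce1.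
have me2 := continuous_measurable_fun ce2.
have [C C0 HC] := poly_bounded p; have [C' C'0 HC'] := poly_bounded p^`().
have M0 : 0 <= M by have [|+ _ _] := eM 0; [rewrite normr0|exact: le_trans].
pose h x := ((1 - x ^+ 2) * e2 x - 2 * (1 - th) * x * e1 x + m * e x) * p.[x].
pose F x := (1 - x ^+ 2) `^ (1 - th) * (e1 x * p.[x] - e x * p^`().[x]).
pose f x := (1 - x ^+ 2) `^ (- th) * h x.
have mh : measurable_fun setT h by rewrite /h; mea.
have Ih : Int (fun x => weight th x * h x).
  apply: (@Int_weightM _ th h ((M + 2 * (1 - th) * M + `|m| * M) * C)) => // x x1.
  have [h1 h2 h3] := eM x x1; have /andP[x2 x3] := sqr_le1 x1.
  rewrite normrM ler_pM ?HC//.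
  apply: (le_trans (ler_normD _ _)); rewrite lerD//; last by rewrite normrM ler_wpM2l.
  apply: (le_trans (ler_normB _ _)); rewrite lerD//.
    by rewrite normrM (ger0_norm x2) -[leRHS]mul1r ler_pM.
  rewrite !normrM (ger0_norm (_ : 0 <= 2 :> R))// (ger0_norm (_ : 0 <= 1 - th)); last by lra.
  rewrite -mulrA; apply: ler_wpM2l; first by rewrite mulr_ge0//; lra.
  by rewrite -[leRHS]mul1r ler_pM.
split; first exact: Ih.
have fE x : (if `|x| < 1 then f x else 0) = weight th x * h x.
  by rewrite /f /weight; case: ifP => // _; rewrite mul0r.
have Hlim (u : nat -> R) : (forall n, `|u n| = Dn n) -> F (u n) @[n --> \oo] --> (0 : R).
  move=> uD; suff N0 : `|F (u n)| @[n --> \oo] --> (0 : R) by exact: norm_cvg0.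
  have B n : 0 <= `|F (u n)| <= (1 - Dn n ^+ 2) `^ (1 - th) * (M * C + M * C').
    have /andP[d0 d1] := Dn_bd n.
    have u1 : `|u n| <= 1 by rewrite uD ltW.
    have [h1 h2 h3] := eM _ u1.
    rewrite normr_ge0 /F normrM (ger0_norm (powR_ge0 _ _)).
    rewrite -(real_normK (num_real (u n))) uD ler_wpM2l ?powR_ge0//.
    apply: (le_trans (ler_normB _ _)); rewrite !normrM lerD// ler_pM//.
      exact: HC.
    exact: HC'.
  apply: (@squeeze_cvgr _ _ _ _ (fun=> 0) (fun n => (1 - Dn n ^+ 2) `^ (1 - th) * (M * C + M * C'))).
  - by near=> n; exact: B.
  - exact: cvg_cst.
  - rewrite -(mul0r (M * C + M * C')); apply: cvgM; last exact: cvg_cst.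
    have E0 : 0 = (0 : R) `^ (1 - th) by rewrite powR0//; apply/eqP; lra.
    rewrite [X in _ --> X]E0.
    have c1 : 1 - Dn n ^+ 2 @[n --> \oo] --> (0 : R).
      rewrite -[X in _ --> X](subrr 1) -[X in 1 - X](expr1n R 2).
      apply: cvgB; first exact: cvg_cst.
      by rewrite expr2; apply: cvgM; exact: Dn_cvg.
    apply/cvgrPdist_le => eps eps0.
    have t1 : 0 < 1 - th by lra.
    have p0 : 0 < eps `^ (1 - th)^-1 by rewrite powR_gt0.
    have l1 : \forall n \near \oo, 1 - Dn n ^+ 2 < eps `^ (1 - th)^-1 by exact: cvgr_lt c1 _ p0.
    near=> n; rewrite -E0 sub0r normrN ger0_norm ?powR_ge0//.
    have l2 : 1 - Dn n ^+ 2 < eps `^ (1 - th)^-1 by near: n.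
    rewrite [leRHS](_ : eps = (eps `^ (1 - th)^-1) `^ (1 - th)); last first.
      by rewrite -powRrM mulVf ?powRr1 ?(ltW eps0)// gt_eqF.
    apply: ge0_ler_powR; rewrite ?nnegrE ?(ltW t1) ?(ltW p0) ?(ltW l2)//.
    have /andP[d0 d1] := Dn_bd n.
    by rewrite subr_ge0 expr_le1// ltW.
rewrite -(eq_RI fE) -[RHS](subrr (0 : R)).
apply: (@FTC_exhaust _ (fun x => `|x| < 1) F f (fun n => - Dn n) Dn).
- move=> x x1; have x2 := sqr_lt1 x1.
  have d1 : is_derive x (1 : R) (fun y : R => 1 - y ^+ 2) (- (2 * x)).
    by apply: is_derive_eq; rewrite /GRing.scale /=; ring.
  have t0 : 1 - th != 0 by apply/eqP; lra.
  have d2 : is_derive x (1 : R) (fun y : R => (1 - y ^+ 2) `^ (1 - th))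
      (- (2 * x) * ((1 - th) * (1 - x ^+ 2) `^ (- th))).
    have dp : is_derive (1 - x ^+ 2) (1 : R) (fun z : R => z `^ (1 - th))
        ((1 - th) * (1 - x ^+ 2) `^ (- th)).
      have -> : (fun z : R => z `^ (1 - th)) = (fun z => (1 - th) * ((1 - th)^-1 * z `^ (1 - th))).
        by apply/funext => z; rewrite mulVKf.
      have dq := is_derive_pow x2 t0.
      rewrite (_ : 1 - th - 1 = - th) in dq; last by ring.
      by apply: is_derive_eq.
    have dc := @is_derive1_comp R (fun z : R => z `^ (1 - th)) (fun y : R => 1 - y ^+ 2) x _ _ dp d1.
    by apply: (is_derive_eq dc); rewrite /GRing.scale /=; ring.
  have d3 := is_derive_poly p x; have d4 := is_derive_poly p^`() x.
  have d5 := de x; have d6 := de1 x.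
  apply: is_derive_eq; rewrite /GRing.scale /= /f /h.
  have := ep x.
  have -> : (1 - x ^+ 2) `^ (1 - th) = (1 - x ^+ 2) * (1 - x ^+ 2) `^ (- th).
    by rewrite powD// powRr1// ltW.
  move: (p^`()^`().[x]) (p^`().[x]) (p.[x]) ((1 - x ^+ 2) `^ (- th)) => P2 P1 P0 W E.
  have E' : m * P0 = 2 * (1 - th) * x * P1 - (1 - x ^+ 2) * P2 by lra.
  transitivity (W * (((1 - x ^+ 2) * e2 x - 2 * (1 - th) * x * e1 x) * P0 + e x * (m * P0))).
    by rewrite E'; ring.
  by ring.
- move=> x x1; have c0 : 1 - y ^+ 2 @[y --> x] --> 1 - x ^+ 2.
    by apply: cvgB; [exact: cvg_cst|rewrite expr2; apply: cvgM; exact: cvg_id].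
  apply: cvgM; first exact: (cvg_comp _ _ c0 (continuous_powR_gt0 (sqr_lt1 x1))).
  apply: cvgM; last exact: continuous_horner.
  apply: cvgD; last by apply: cvgM; [exact: cvg_cst|exact: ce].
  apply: cvgB; first by apply: cvgM; [exact: c0|exact: ce2].
  by apply: cvgM; [apply: cvgM; [exact: cvg_cst|exact: cvg_id]|exact: ce1].
- by rewrite /f /h; mea.
- by rewrite (_ : (fun x => _) = (fun x => weight th x * h x)); [mea|exact/funext].
- by move=> n; have /andP[] := Dn_bd n; lra.
- move=> n x; have /andP[d0 d1] := Dn_bd n => /andP[h1 h2].
  by rewrite ltr_norml; apply/andP; split; lra.
- move=> x x1; near=> n.
  have : `|x| < Dn n by near: n; exact: (cvgr_gt _ Dn_cvg).
  by rewrite ltr_norml.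
- by apply: eq_Int Ih => x; rewrite fE.
- by apply: Hlim => n; rewrite normrN gtr0_norm//; have /andP[] := Dn_bd n.
- by apply: Hlim => n; rewrite gtr0_norm//; have /andP[] := Dn_bd n.
Unshelve. all: by end_near. Qed.

Lemma eigp_mean0 th m p : th < 1 -> eigp th m p -> m != 0 ->
  \int[mu]_x (weight th x * p.[x]) = 0.
Proof.
move=> th1 ep m0; have I := Int_weight_poly p th1.
have [||J E] := @sturm_liouville th m p (fun=> 1) (fun=> 0) (fun=> 0) 1 th1 ep.
- by move=> x; exact: cvg_cst.
- by move=> x _; rewrite normr1 normr0 ler01.
apply/eqP; have : m * \int[mu]_x (weight th x * p.[x]) = 0.
  by rewrite -RIZ// -[RHS]E; apply: eq_RI => x; ring.
by move/eqP; rewrite mulf_eq0 (negPf m0).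
Qed.

Lemma eigp_orth th m m' p q : th < 1 -> eigp th m p -> eigp th m' q -> m != m' ->
  ip (weight th) (horner p) (horner q) = 0.
Proof.
move=> th1 ep eq mm'.
have [C C0 HC] := poly_bounded q; have [C' C'0 HC'] := poly_bounded q^`().
have [C2 C20 HC2] := poly_bounded q^`()^`().
have [||J E] := @sturm_liouville th m p (horner q) (horner q^`()) (horner q^`()^`())
  (C + C' + C2) th1 ep (is_derive_poly q) (is_derive_poly q^`()).
- exact: continuous_horner.
- move=> x x1; have h0 := HC x x1; have h1 := HC' x x1; have h2 := HC2 x x1.
  by split; lra.
have I := L2_Int (wt_weight th) (L2_weight_poly p th1) (L2_weight_poly q th1).
apply/eqP; have : (m - m') * ip (weight th) (horner p) (horner q) = 0.
  rewrite -RIZ// -[RHS]E; apply: eq_RI => x; have := eq x => eqx.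
  have -> : (1 - x ^+ 2) * q^`()^`().[x] - 2 * (1 - th) * x * q^`().[x] + m * q.[x] =
    (m - m') * q.[x] by lra.
  by ring.
by move/eqP; rewrite mulf_eq0 subr_eq0 (negPf mm').
Qed.

Definition eigval th (n : nat) : R := n%:R * (n%:R + 1 - 2 * th).

Lemma eigval_lt th i j : th < 1 -> (i < j)%N -> eigval th i < eigval th j.
Proof.
move=> th1; elim: j => // j IH; rewrite ltnS leq_eqVlt => /orP[/eqP ->|/IH h]; last first.
  apply: lt_trans h _; rewrite /eigval -[j.+1%:R]natr1.
  by have : 0 <= j%:R :> R by []; nra.
by rewrite /eigval -[j.+1%:R]natr1; have : 0 <= j%:R :> R by []; nra.
Qed.

Lemma eigval_inj th i j : th < 1 -> i != j -> eigval th i != eigval th j.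
Proof.
move=> th1; rewrite neq_ltn => /orP[] /(eigval_lt th1) h; first by rewrite lt_eqF.
by rewrite gt_eqF.
Qed.

Lemma eigval_neq0 th n : th < 1 -> (0 < n)%N -> eigval th n != 0.
Proof.
move=> th1 n0; have := eigval_lt th1 n0.
by rewrite {1}/eigval mul0r => /gt_eqF ->.
Qed.

End sturm_liouville.

(** * Approximation of indicators by polynomials *)

Section steps.
Context {R : realType}.
Notation mu := (@lebesgue_measure R).
Implicit Types (a b c t x y z th m : R) (f g : R -> R) (p q : {poly R}).

(** The polynomials (1 - y^k)^(2^k) with y = 1/2 - z/4. For |z| <= 2 one has 0 <= y <= 1, and 2^k
    y^k tends to 0 or to infinity as z is positive or negative; Bernoulli's inequality then gives
    the limits 1 and 0. *)
Definition step (k : nat) : {poly R} := (1 - ((1 / 2)%:P - (1 / 4) *: 'X) ^+ k) ^+ (2 ^ k).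

Lemma stepE k z : (step k).[z] = (1 - (1 / 2 - z / 4) ^+ k) ^+ (2 ^ k).
Proof.
rewrite /step horner_exp hornerD hornerN hornerC horner_exp hornerD hornerN hornerC.
by rewrite hornerZ hornerX; congr ((1 - (_ - _) ^+ _) ^+ _); field.
Qed.

Lemma bernoulli (u : R) n : 0 <= u -> u <= 1 -> 1 - n%:R * u <= (1 - u) ^+ n.
Proof.
move=> u0 u1; elim: n => [|n IH]; first by rewrite mul0r subr0 expr0.
rewrite exprS -natr1.
have h : 0 <= n%:R :> R by [].
have v0 : 0 <= (1 - u) ^+ n by rewrite exprn_ge0 ?subr_ge0.
have [h1|h1] := leP (1 - n%:R * u) 0; first by nra.
by nra.
Qed.

Lemma bernoulli2 (u : R) n : 0 <= u -> 1 + n%:R * u <= (1 + u) ^+ n.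
Proof.
move=> u0; elim: n => [|n IH]; first by rewrite mul0r addr0 expr0.
rewrite exprS -natr1.
have h : 0 <= n%:R :> R by [].
have : (1 + u) * (1 + n%:R * u) <= (1 + u) * (1 + u) ^+ n by rewrite ler_wpM2l//; lra.
by nra.
Qed.

Lemma step_bd k z : `|z| <= 2 -> 0 <= (step k).[z] <= 1.
Proof.
rewrite ler_norml => /andP[z1 z2]; rewrite stepE.
have y0 : 0 <= 1 / 2 - z / 4 by lra.
have y1 : 1 / 2 - z / 4 <= 1 by lra.
have h0 : 0 <= (1 / 2 - z / 4) ^+ k by rewrite exprn_ge0.
have h1 : (1 / 2 - z / 4) ^+ k <= 1 by rewrite exprn_ile1.
by rewrite exprn_ge0 ?subr_ge0// exprn_ile1 ?subr_ge0//; lra.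
Qed.

Lemma step_cvg z : `|z| <= 2 -> z != 0 ->
  (step k).[z] @[k --> \oo] --> (if 0 < z then 1 else 0 : R).
Proof.
move=> z2 z0; have bd := step_bd _ z2.
move: z2; rewrite ler_norml => /andP[z1 z2].
have y0 : 0 <= 1 / 2 - z / 4 by lra.
have y1 : 1 / 2 - z / 4 <= 1 by lra.
have h0 k : 0 <= (1 / 2 - z / 4) ^+ k by rewrite exprn_ge0.
have h1 k : (1 / 2 - z / 4) ^+ k <= 1 by rewrite exprn_ile1.
have E k : (2 ^ k)%:R * (1 / 2 - z / 4) ^+ k = (1 - z / 2) ^+ k :> R.
  by rewrite natrX -exprMn; congr (_ ^+ _); field.
case: ifPn => [zp|]; last rewrite -leNgt => zn.
  have g0 : geometric (1 : R) (1 - z / 2) k @[k --> \oo] --> (0 : R).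
    by apply: cvg_geometric; rewrite ltr_norml; apply/andP; split; lra.
  apply: (@squeeze_cvgr _ _ _ _ (fun k => 1 - geometric (1 : R) (1 - z / 2) k) (fun=> 1)).
  - near=> k; have /andP[_ ->] := bd k; rewrite andbT /geometric/= mul1r stepE -E.
    exact: bernoulli.
  - by rewrite -[X in _ --> X]subr0; apply: cvgB => //; exact: cvg_cst.
  - exact: cvg_cst.
have zn' : z < 0 by rewrite lt_neqAle z0.
have zp : 0 < (1 - z / 2)^-1 by rewrite invr_gt0; lra.
have g0 : geometric (1 : R) (1 - z / 2)^-1 k @[k --> \oo] --> (0 : R).
  apply: cvg_geometric; rewrite gtr0_norm// invf_lt1; lra.
apply: (@squeeze_cvgr _ _ _ _ (fun=> 0) (geometric (1 : R) (1 - z / 2)^-1)).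
- near=> k; have /andP[-> _] := bd k; rewrite andTb /geometric/= mul1r stepE.
  have p0 : 0 < (1 - z / 2) ^+ k by rewrite exprn_gt0//; lra.
  rewrite exprVn -[leRHS]mul1r ler_pdivlMr//.
  have h := bernoulli2 (2 ^ k) (h0 k); rewrite E in h.
  apply: (@le_trans _ _ ((1 - (1 / 2 - z / 4) ^+ k) ^+ (2 ^ k) * (1 + (1 / 2 - z / 4) ^+ k) ^+ (2 ^ k))).
    by rewrite ler_wpM2l ?exprn_ge0 ?subr_ge0//; lra.
  rewrite -exprMn; apply: exprn_ile1; have := h0 k; have := h1 k; nra.
- exact: cvg_cst.
- exact: g0.
Unshelve. all: by end_near. Qed.

Lemma box_poly_approx th a b e : th < 1 -> 0 < e -> exists p : {poly R},
  ip (weight th) (fun x => box a b x - p.[x]) (fun x => box a b x - p.[x]) < e.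
Proof.
move=> th1 e0.
(* Only the trace of the interval on (-1,1) matters, and the steps are controlled for |x - a| <= 2,
   so the end points are clamped to [-1,1]. *)
wlog : a b / `|a| <= 1 /\ `|b| <= 1.
  move=> W; pose cl (c : R) := Num.min 1 (Num.max (-1) c).
  have clb c : `|cl c| <= 1.
    by rewrite ler_norml /cl /Num.min /Num.max; do 2![case: ifPn]; lra.
  have [p Hp] := W (cl a) (cl b) (conj (clb a) (clb b)); exists p.
  rewrite (_ : ip _ _ _ = ip (weight th) (fun x => box (cl a) (cl b) x - p.[x])
    (fun x => box (cl a) (cl b) x - p.[x]))//.
  apply: eq_RI => x; have [x1|x1] := leP 1 `|x|; first by rewrite weight_out// !mulr0.
  move: x1; rewrite ltr_norml => /andP[x1 x2].
  have cx c : (c < x) = (cl c < x).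
    by rewrite /cl /Num.min /Num.max; do 2![case: ifPn]; move=> *; apply/idP/idP; lra.
  have xc c : (x < c) = (x < cl c).
    by rewrite /cl /Num.min /Num.max; do 2![case: ifPn]; move=> *; apply/idP/idP; lra.
  by rewrite /box -cx -xc.
move=> [a1 b1].
have [ab|ba] := leP b a.
  exists 0; rewrite (_ : ip _ _ _ = 0)// -[RHS](@RI0 R); apply: eq_RI => x.
  rewrite /box; case: ifPn => [/andP[h1 h2]|_]; last by rewrite horner0 subrr !mul0r.
  by have := lt_trans h1 h2; rewrite ltNge ab.
pose p k := (step k \Po ('X - a%:P)) - (step k \Po ('X - b%:P)).
have pE k x : (p k).[x] = (step k).[x - a] - (step k).[x - b].
  by rewrite /p hornerD hornerN !horner_comp !hornerXsubC.
have xa c x : `|c| <= 1 -> `|x| <= 1 -> `|x - c| <= 2.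
  by move=> c1 x1; apply: (le_trans (ler_normB _ _)); lra.
have bd k x : `|x| <= 1 -> (box a b x - (p k).[x]) ^+ 2 <= 4.
  move=> x1; have /andP[h1 h2] := step_bd k (xa a x a1 x1).
  have /andP[h3 h4] := step_bd k (xa b x b1 x1).
  by have := box_ge0 a b x; have := box_le1 a b x; rewrite pE; nra.
have C : ip (weight th) (fun x => box a b x - (p k).[x]) (fun x => box a b x - (p k).[x])
    @[k --> \oo] --> (0 : R).
  rewrite -[X in _ --> X](@RI0 R).
  apply: (@dct _ _ _ (fun x => 4 * weight th x)).
  - by move=> k; mea.
  - by mea.
  - by apply: IntZ; exact: Int_weight.
  - move=> k x; rewrite -expr2 normrM (ger0_norm (weight_ge0 _ _)) (ger0_norm (sqr_ge0 _)).
    have [x1|x1] := leP `|x| 1; first by rewrite ler_wpM2r ?weight_ge0 ?bd.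
    by rewrite weight_out ?mulr0// ltW.
  - apply: ae_mp (ae_and (ae_neq a) (ae_neq b)) => x [xna xnb].
    have [x1|x1] := leP `|x| 1; last first.
      rewrite weight_out ?(ltW x1)//; under eq_fun do rewrite mulr0; exact: cvg_cst.
    rewrite -(mul0r (weight th x)); apply: cvgM; last exact: cvg_cst.
    have ca : (p k).[x] @[k --> \oo] --> box a b x.
      under eq_fun do rewrite pE.
      have -> : box a b x = (if 0 < x - a then 1 else 0) - (if 0 < x - b then 1 else 0).
        rewrite /box !subr_gt0; case: (ltgtP x b) xnb => // xb _.
          by rewrite andbT subr0.
        by rewrite andbF (lt_trans ba xb) subrr.
      by apply: cvgB; apply: step_cvg; rewrite ?subr_eq0// xa.
    have c0 : box a b x - (p k).[x] @[k --> \oo] --> (0 : R).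
      by rewrite -(subrr (box a b x)); apply: cvgB => //; exact: cvg_cst.
    by rewrite -(mul0r (0 : R)); exact: cvgM.
have : \forall k \near \oo, ip (weight th) (fun x => box a b x - (p k).[x])
  (fun x => box a b x - (p k).[x]) < e by exact: cvgr_lt C _ e0.
by move=> [N _ HN]; exists (p N); exact: (HN N (leqnn N)).
Qed.

End steps.

(** * Parseval's identity for orthogonal polynomials *)

Section parseval.
Context {R : realType}.
Notation mu := (@lebesgue_measure R).
Implicit Types (a b c t x y z th m : R) (f g : R -> R) (p q : {poly R}).
Variables (th : R) (E : nat -> {poly R}).
Hypotheses (th1 : th < 1) (sE : forall n, size (E n) = n.+1)
  (oE : forall i j, i != j -> ip (weight th) (horner (E i)) (horner (E j)) = 0).
Let w := weight th.
Let ww : wt w := wt_weight th.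

Let LP p : L2 w (horner p) := L2_weight_poly p th1.
Let h i := ip w (horner (E i)) (horner (E i)).

Lemma ip_poly_span g N p : L2 w g ->
  (forall i, (i < N)%N -> ip w g (horner (E i)) = 0) -> (size p <= N)%N ->
  ip w g (horner p) = 0.
Proof.
move=> Lg; elim: N p => [|N IH] p hN sp.
  move: sp; rewrite leqn0 size_poly_eq0 => /eqP ->.
  by rewrite -[RHS](@RI0 R); apply: eq_RI => x; rewrite horner0 mulr0 mul0r.
pose c := p`_N / (E N)`_N.
have EN : (E N)`_N != 0.
  have := lead_coef_eq0 (E N); rewrite lead_coefE sE /= => ->.
  by rewrite -size_poly_eq0 sE.
have sp' : (size (p - c *: E N)%R <= N)%N.
  apply/leq_sizeP => j; rewrite leq_eqVlt => /orP[/eqP <-|Nj].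
    by rewrite coefB coefZ /c divfK// subrr.
  rewrite coefB coefZ nth_default ?(leq_trans sp)// nth_default ?sE//.
  by rewrite mulr0 subrr.
rewrite (_ : ip w g (horner p) =
    ip w (fun x => (p - c *: E N).[x] + c * (E N).[x]) g); last first.
  rewrite ipC; apply: eq_RI => x.
  by rewrite hornerD hornerN hornerZ subrK.
rewrite (ipDl ww (LP _) (L2Z c (LP _)) Lg) (ipZl c ww (LP _) Lg).
rewrite ipC IH//; last by move=> i iN; apply: hN; rewrite ltnS ltnW.
by rewrite ipC hN// mulr0 addr0.
Qed.

Variables (f : R -> R).
Hypothesis Lf : L2 w f.
Let al i := ip w f (horner (E i)) / h i.
Definition fourier_sum N : {poly R} := \sum_(i < N) al i *: E i.

Let al_h i : al i * h i = ip w f (horner (E i)).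
Proof.
have [h0|h0] := eqVneq (h i) 0; last by rewrite divfK.
rewrite h0 mulr0; have := CS ww Lf (LP (E i)); rewrite -/(h i) h0 mulr0 => e.
apply/eqP; rewrite eq_sym -sqrf_eq0 eq_le e sqr_ge0//.
Qed.

Let PSS N x : (fourier_sum N.+1).[x] = (fourier_sum N).[x] + al N * (E N).[x].
Proof. by rewrite /fourier_sum big_ord_recr/= hornerD hornerZ. Qed.

Lemma ip_fourier_sum N i : ip w (horner (fourier_sum N)) (horner (E i)) =
  if (i < N)%N then ip w f (horner (E i)) else 0.
Proof.
elim: N => [|N IH].
  rewrite ltn0 -[RHS](@RI0 R); apply: eq_RI => x.
  by rewrite /fourier_sum big_ord0 horner0 !mul0r.
rewrite (_ : ip _ _ _ = ip w (fun x => (fourier_sum N).[x] + al N * (E N).[x]) (horner (E i)));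
  last by apply: eq_RI => x; rewrite PSS.
rewrite (ipDl ww (LP _) (L2Z (al N) (LP _)) (LP _)) (ipZl (al N) ww (LP _) (LP _)).
rewrite IH [(i < N.+1)%N]ltnS [(i <= N)%N]leq_eqVlt.
have [->|iN] := eqVneq i N; first by rewrite ltnn/= add0r -/(h N) al_h.
by rewrite oE ?mulr0 ?addr0// eq_sym.
Qed.

Let Lr N : L2 w (fun x => f x - (fourier_sum N).[x]).
Proof. by apply: L2B => //; exact: LP. Qed.

Lemma ip_residual N i : (i < N)%N ->
  ip w (fun x => f x - (fourier_sum N).[x]) (horner (E i)) = 0.
Proof.
move=> iN; rewrite (ipBl ww Lf (LP _) (LP _)).
by rewrite ip_fourier_sum iN subrr.
Qed.

Lemma residual_sqr N :
  ip w (fun x => f x - (fourier_sum N).[x]) (fun x => f x - (fourier_sum N).[x]) =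
  ip w f f - \sum_(i < N) ip w f (horner (E i)) ^+ 2 / h i.
Proof.
elim: N => [|N IH].
  rewrite big_ord0 subr0; apply: eq_RI => x.
  by rewrite /fourier_sum big_ord0 horner0 subr0.
rewrite (_ : ip _ _ _ = ip w (fun x => (f x - (fourier_sum N).[x]) - al N * (E N).[x])
   (fun x => (f x - (fourier_sum N).[x]) - al N * (E N).[x])); last first.
  by apply: eq_RI => x; rewrite PSS opprD addrA.
rewrite (ip_expand (al N) ww (Lr N) (LP _)).
rewrite IH big_ord_recr/= (ipBl ww Lf (LP _) (LP _)).
rewrite ip_fourier_sum ltnn subr0 -/(h N) opprD addrA -[LHS]addrA; congr (_ + _).
have [h0|h0] := eqVneq (h N) 0; last by rewrite /al; field.
by rewrite -al_h h0 !mulr0 expr0n/= mul0r addr0.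
Qed.

Lemma fourier_sum_sqr N : ip w (horner (fourier_sum N)) (horner (fourier_sum N)) =
  \sum_(i < N) ip w f (horner (E i)) ^+ 2 / h i.
Proof.
have := ip_expand (-1) ww (Lr N) (LP (fourier_sum N)).
rewrite (@ip_poly_span _ N)//; last first.
- rewrite /fourier_sum (leq_trans (size_sum _ _ _))//; apply/bigmax_leqP => i _.
  by rewrite (leq_trans (size_scale_leq _ _))// sE.
- by move=> i; exact: ip_residual.
rewrite residual_sqr mulr0 subr0 sqrrN expr1n mul1r.
rewrite (_ : ip _ _ _ = ip w f f); last by apply: eq_RI => x; ring.
by lra.
Qed.

Let S N := \sum_(i < N) ip w f (horner (E i)) ^+ 2 / h i.

Let S_nd : nondecreasing_seq S.
Proof.
apply/nondecreasing_seqP => n; rewrite /S big_ord_recr/= lerDl.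
by rewrite divr_ge0 ?sqr_ge0 ?ip_ge0.
Qed.

Lemma fourier_sum_le N : S N <= ip w f f.
Proof. by rewrite -subr_ge0 -residual_sqr ip_ge0. Qed.

(** Bessel gives one inequality. For the other, the partial sums converge weakly on intervals: an
    indicator is close to a polynomial, and the residual is orthogonal to all polynomials of smaller
    degree. Weak lower semicontinuity concludes. *)
Lemma parseval : \sum_(i < N) ip w f (horner (E i)) ^+ 2 / h i @[N --> \oo] --> ip w f f.
Proof.
have cS : cvgn S.
  apply: nondecreasing_is_cvgn => //; exists (ip w f f) => _ [N _ <-]; exact: fourier_sum_le.
have Sl N : S N <= limn S by exact: nondecreasing_cvgn_le.
have lS : limn S <= ip w f f.
  by apply: limr_le => //; near=> N; exact: fourier_sum_le.
suff fS : ip w f f <= limn S.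
  by have <- : limn S = ip w f f by apply/eqP; rewrite eq_le lS fS.
have If : Int (fun x => f x * w x).
  have L1 : L2 w (fun=> 1) by apply: (@L2_weight _ _ _ 1) => // x _; rewrite normr1.
  by apply: eq_Int (L2_Int ww Lf L1) => x; rewrite mulr1.
apply: (proj2 (@lsc R w (fun N => horner (fourier_sum N)) f (limn S) ww _ Lf.1 _ _ _ _)).
- exact/locInt_Int/Int_weight.
- exact: locInt_Int.
- by move=> k; exact: LP.
- by move=> k; rewrite fourier_sum_sqr; exact: Sl.
move=> a b ab; apply/cvgrPdist_le => e e0.
(* [D] is positive and bounds the squared residual, so the tolerance e^2 / D for the polynomial
   makes the Cauchy-Schwarz product at most e^2. *)
pose D := ip w f f + 1.
have D0 : 0 < D by rewrite ltr_wpDl ?ip_ge0.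
have [p Hp] := box_poly_approx a b th1 (divr_gt0 (exprn_gt0 2 e0) D0).
have mb : measurable_fun setT (box a b) by mea.
have Lb : L2 w (box a b) by apply: (@L2_weight _ _ _ 1) => // x _; exact: norm_box.
near=> N.
have Np : (size p <= N)%N by near: N; exact: nbhs_infty_ge.
have Lbp : L2 w (fun x => box a b x - p.[x]) by apply: L2B => //; exact: LP.
rewrite (_ : _ - _ = ip w (fun x => f x - (fourier_sum N).[x]) (fun x => box a b x - p.[x])).
  have c := CS ww (Lr N) Lbp.
  rewrite -[leRHS](ger0_norm (ltW e0)) -ler_sqr ?nnegrE// !real_normK ?num_real//.
  apply: (le_trans c); rewrite residual_sqr.
  have h1 : ip w f f - S N <= D.
    rewrite /D lerD// (@le_trans _ _ 0)// oppr_le0.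
    by apply: sumr_ge0 => i _; rewrite divr_ge0 ?sqr_ge0 ?ip_ge0.
  have h2 := fourier_sum_le N.
  apply: (@le_trans _ _ (D * (e ^+ 2 / D))); last by rewrite mulrC divfK// gt_eqF.
  by rewrite ler_pM ?ip_ge0 ?subr_ge0 ?(ltW Hp).
rewrite ipC (ipBl ww Lb (LP p) (Lr N)).
rewrite [X in _ = _ - X]ipC (@ip_poly_span _ N p (Lr N) (fun i => @ip_residual N i) Np).
rewrite subr0 ipC (ipBl ww Lf (LP _) Lb).
by congr (_ - _); apply: eq_RI => x; ring.
Unshelve. all: by end_near. Qed.

Lemma residual_cvg0 :
  ip w (fun x => f x - (fourier_sum N).[x]) (fun x => f x - (fourier_sum N).[x])
    @[N --> \oo] --> (0 : R).
Proof.
rewrite (_ : (fun N => _) = fun N => ip w f f - \sum_(i < N) ip w f (horner (E i)) ^+ 2 / h i);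
  last by apply/funext => N; exact: residual_sqr.
rewrite -[X in _ --> X](subrr (ip w f f)); apply: cvgB; first exact: cvg_cst.
exact: parseval.
Qed.

(** Beyond index n the partial sums no longer change, so the residual has norm 0. The weight is
    positive on (-1,1), which gives equality almost everywhere there. *)
Lemma one_mode n : (forall i, i != n -> ip w f (horner (E i)) = 0) ->
  exists c, {ae mu, forall x, `|x| < 1 -> f x = c * (E n).[x]}.
Proof.
move=> hi; exists (al n).
have FE N x : (n < N)%N -> (fourier_sum N).[x] = al n * (E n).[x].
  move=> nN; rewrite /fourier_sum (bigD1 (Ordinal nN))//= big1 ?addr0 ?hornerZ// => i.
  by rewrite -val_eqE/= => /hi; rewrite /al => ->; rewrite mul0r scale0r.
pose g x := f x - al n * (E n).[x].
have Lg : L2 w g by apply: L2B => //; apply: L2Z; exact: LP.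
have g0 : ip w g g = 0.
  have := residual_cvg0; apply: cvg_unique => //.
  apply: cvg_near_cst; near=> N.
  have nN : (n < N)%N by near: N; exact: nbhs_infty_gt.
  by apply: eq_RI => x; rewrite FE.
have Ig : Int (fun x => g x * g x * w x) by exact: L2_Int.
have gn x : 0 <= g x * g x * w x.
  by rewrite mulr_ge0 ?weight_ge0// -expr2 sqr_ge0.
apply: ae_mp (RI_eq0 Ig gn g0) => x + x1.
have wx : 0 < w x by rewrite /w /weight x1 powR_gt0 ?sqr_lt1.
by move/eqP; rewrite !mulf_eq0 (gt_eqF wx) orbF orbb subr_eq0 => /eqP.
Unshelve. all: by end_near. Qed.

End parseval.

(** * Jacobi polynomials from the hypergeometric series *)

Section jacobi_polynomials.
Context {R : realType}.
Implicit Types (a b c x z th m : R) (n k : nat) (p q : {poly R}).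

Lemma pochhammerS a k : pochhammer a k.+1 = pochhammer a k * (a + k%:R).
Proof. by rewrite /pochhammer big_ord_recr. Qed.

Lemma pochhammer_gt0 a k : 0 < a -> 0 < pochhammer a k.
Proof.
move=> a0; apply: prodr_gt0 => i _.
by apply: lt_le_trans a0 _; rewrite lerDl.
Qed.

Lemma pochhammer_negn n k : (n < k)%N -> pochhammer (- n%:R : R) k = 0.
Proof.
move=> nk; rewrite /pochhammer (bigD1 (Ordinal nk))//= addNr mul0r//.
Qed.

Variables (a : R) (n : nat).
Hypothesis a1 : -1 < a.

Let d k : R := pochhammer (- n%:R) k * pochhammer (1 + a + a + n%:R) k /
  (pochhammer (a + 1) k * k`!%:R).
Let F : {poly R} := \poly_(k < n.+1) d k.

Let dE k : F`_k = d k.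
Proof.
rewrite coef_poly; case: ltnP => // nk.
by rewrite /d pochhammer_negn// !mul0r.
Qed.

Let d_rec k : d k.+1 * ((a + 1 + k%:R) * k.+1%:R) =
  d k * ((- n%:R + k%:R) * (1 + a + a + n%:R + k%:R)).
Proof.
have a0 : 0 < a + 1 by rewrite -ltrBlDr sub0r.
have p0 : pochhammer (a + 1) k != 0 by rewrite gt_eqF ?pochhammer_gt0.
have k0 : a + 1 + k%:R != 0 by rewrite gt_eqF// ltr_wpDr.
have f0 : k`!%:R != 0 :> R by rewrite pnatr_eq0 -lt0n fact_gt0.
have s0 : k.+1%:R != 0 :> R by rewrite pnatr_eq0.
rewrite /d !pochhammerS factS natrM.
move: (k.+1%:R : R) s0 (k`!%:R : R) f0 => K s0 Fk f0.
by field; rewrite p0 f0 s0 k0.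
Qed.

(** Coefficient by coefficient, the hypergeometric equation is the two-term recursion [d_rec]. *)
Let hyper_ode : ('X - 'X^2) * F^`()^`() + ((a + 1)%:P - (2 * a + 2) *: 'X) * F^`() +
  (n%:R * (n%:R + 2 * a + 1)) *: F = 0.
Proof.
have C1 k : ('X * F^`()^`())`_k = (k%:R * k.+1%:R) * d k.+1.
  rewrite coefXM; case: k => [|k]/=; first by rewrite !mul0r.
  by rewrite !coef_deriv dE -mulrA [RHS]mulr_natl [k.+2%:R * _]mulr_natl.
have C2 k : ('X^2 * F^`()^`())`_k = (k%:R * (k%:R - 1)) * d k.
  rewrite coefXnM; case: k => [|[|k]]/=; rewrite ?mul0r//; first by rewrite subrr mulr0 mul0r.
  have -> : k.+2%:R - 1 = k.+1%:R :> R by rewrite -[k.+2%:R]natr1 addrK.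
  rewrite [k.+2%:R * _]mulrC !coef_deriv subn2/= dE -mulrA [RHS]mulr_natl.
  by rewrite [k.+2%:R * _]mulr_natl.
have C3 k : ('X * F^`())`_k = k%:R * d k.
  rewrite coefXM; case: k => [|k]/=; first by rewrite mul0r.
  by rewrite coef_deriv dE mulr_natl.
have C4 k : (F^`())`_k = k.+1%:R * d k.+1 by rewrite coef_deriv dE mulr_natl.
apply/polyP => k.
have E5 : (2 * a + 2) *: 'X * F^`() = (2 * a + 2) *: ('X * F^`()) by rewrite scalerAl.
rewrite coef0 !coefD !mulrBl E5 !coefB C1 C2 coefCM C4 !coefZ C3 dE.
have e := d_rec k.
have e1 : (a + 1) * (k.+1%:R * d k.+1) =
  d k * ((- n%:R + k%:R) * (1 + a + a + n%:R + k%:R)) - k%:R * k.+1%:R * d k.+1.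
  by rewrite -e; ring.
by rewrite [(a + 1) * _]e1; ring.
Qed.

Definition jacp : {poly R} := (pochhammer (a + 1) n / n`!%:R) *:
  (F \Po ((1 / 2)%:P - (1 / 2) *: 'X)).

Lemma jacpE x : -1 <= x <= 1 -> jacobi a a n x = jacp.[x].
Proof.
move=> x1; rewrite /jacobi x1 /jacp hornerZ horner_comp; congr (_ * _).
have -> : ((1 / 2)%:P - (1 / 2) *: 'X : {poly R}).[x] = (1 - x) / 2.
  by rewrite hornerD hornerN hornerC hornerZ hornerX; field.
rewrite /hyp2F1; apply: cvg_lim => //; apply: cvg_near_cst; near=> N.
have nN : (n < N)%N by near: N; exact: nbhs_infty_gt.
rewrite /series/= big_mkord horner_poly (big_ord_widen N (fun k => d k * ((1 - x) / 2) ^+ k) nN).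
rewrite [RHS]big_mkcond/=; apply: eq_bigr => k _; case: ltnP => // nk.
by rewrite pochhammer_negn// !mul0r.
Unshelve. all: by end_near. Qed.

(** The substitution z = (1 - x)/2 in the hypergeometric equation; the exponent a of the Jacobi
    weight is - th in the convention of [eigp]. *)
Lemma eigp_jacp : eigp (- a) (eigval (- a) n) jacp.
Proof.
move=> x; rewrite /jacp; set L := (_ - _ : {poly R}); set c := (_ / _).
have dL : L^`() = (- (1 / 2))%:P.
  by rewrite /L derivB derivC derivZ derivX sub0r scale_polyC mulr1 polyCN.
have Lx : L.[x] = (1 - x) / 2.
  by rewrite /L hornerD hornerN hornerC hornerZ hornerX; field.
have D1 : (c *: (F \Po L))^`() = (- (c / 2)) *: (F^`() \Po L).
  by rewrite derivZ deriv_comp dL [(_ \Po L) * _]mulrC mul_polyC scalerA; congr (_ *: _); field.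
have D2 : ((- (c / 2)) *: (F^`() \Po L))^`() = (c / 4) *: (F^`()^`() \Po L).
  by rewrite derivZ deriv_comp dL [(_ \Po L) * _]mulrC mul_polyC scalerA; congr (_ *: _); field.
rewrite D1 D2 !hornerZ !horner_comp Lx.
have := congr1 (fun p => p.[(1 - x) / 2]) hyper_ode.
rewrite horner0 !hornerD !hornerM !hornerZ !hornerD !hornerN !hornerC hornerZ hornerX hornerXn.
rewrite /eigval; move: (F^`()^`().[_]) (F^`().[_]) (F.[_]) => P2 P1 P0 e.
transitivity (c * ((((1 - x) / 2 - ((1 - x) / 2) ^+ 2) * P2 +
  (a + 1 - (2 * a + 2) * ((1 - x) / 2)) * P1 + n%:R * (n%:R + 2 * a + 1) * P0))).
  by field.
by rewrite e mulr0.
Qed.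

Lemma size_jacp : size jacp = n.+1.
Proof.
have a0 : 0 < a + 1 by rewrite -ltrBlDr sub0r.
have f0 : n`!%:R != 0 :> R by rewrite pnatr_eq0 -lt0n fact_gt0.
rewrite /jacp size_scale; last by rewrite mulf_neq0 ?invr_eq0// gt_eqF ?pochhammer_gt0.
have h2 : (1 / 2 : R) != 0 by rewrite mulf_neq0 ?invr_eq0 ?oner_eq0 ?pnatr_eq0.
rewrite size_comp_poly2; last first.
  by rewrite addrC -scaleNr size_polyDl size_scale ?oppr_eq0// size_polyX// size_polyC h2.
rewrite size_poly_eq//.
rewrite mulf_neq0 ?invr_eq0 ?mulf_neq0//; first last.
- by rewrite gt_eqF ?pochhammer_gt0.
(* The factors 1 + 2 a + n + i of the leading coefficient: i < n forces 1 <= n, and -1 < a then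
   makes them positive. *)
- rewrite /pochhammer; apply/prodf_neq0 => i _.
  have : (i : nat)%:R + 1 <= n%:R :> R by rewrite natr1 ler_nat.
  have : 0 <= (i : nat)%:R :> R by [].
  by move=> h3 h4; apply/eqP; lra.
- rewrite /pochhammer; apply/prodf_neq0 => i _.
  by rewrite addrC subr_eq0 eqr_nat neq_ltn ltn_ord.
Qed.

End jacobi_polynomials.

(** * Derivatives of weighted eigenpolynomials *)

Section derived_family.
Context {R : realType}.
Implicit Types (x th m : R) (n k : nat) (p q : {poly R}).

(* [((1 - x^2)^s p)' = (1 - x^2)^(s - 1) r] where [r] is [lower_poly s p]. *)
Definition lower_poly (s : R) p : {poly R} :=
  (1 - 'X^2) * p^`() - (2 * s) *: ('X * p).

Lemma lower_polyE s p x : (lower_poly s p).[x] =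
  (1 - x ^+ 2) * p^`().[x] - 2 * s * x * p.[x].
Proof.
rewrite /lower_poly !(hornerD, hornerN, hornerM, hornerZ, hornerXn, hornerX, hornerC); ring.
Qed.

(** The Jacobi equation collapses the derivative to a multiple of p, since the eigenvalue of index n
    + 1 for 1 - s is the one of index n for - s, plus 2 s. *)
Lemma lower_poly_deriv s n p : eigp (- s) (eigval (- s) n) p ->
  forall x, (lower_poly s p)^`().[x] = - eigval (1 - s) n.+1 * p.[x].
Proof.
move=> ep x; have e := ep x.
have -> : (lower_poly s p)^`() = (1 - 'X^2) * p^`()^`() - 2%:P * 'X * p^`()
    - (2 * s) *: (p + 'X * p^`()).
  rewrite /lower_poly derivB derivM derivB derivC derivXn derivZ derivM derivX.
  by rewrite sub0r expr1 mul1r; congr (_ - _); rewrite -mulr_natl; ring.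
rewrite !(hornerD, hornerN, hornerM, hornerZ, hornerXn, hornerX, hornerC).
move: (p^`()^`().[x]) (p^`().[x]) (p.[x]) e => P2 P1 P0.
by rewrite /eigval -[n.+1%:R]natr1; lra.
Qed.

Lemma eigp_lower s n p : eigp (- s) (eigval (- s) n) p ->
  eigp (1 - s) (eigval (1 - s) n.+1) (lower_poly s p).
Proof.
move=> ep x; have e1 := lower_poly_deriv ep.
have E : (lower_poly s p)^`() = (- eigval (1 - s) n.+1) *: p.
  have cn : 1 - 1 = 1 - 1 :> R by [].
  apply/eqP; rewrite -subr_eq0; apply/eqP.
  set q := (_ - _).
  have q0 y : q.[y] = 0 by rewrite /q hornerD hornerN hornerZ e1 mulNr subrr.
  have [->//|qn] := eqVneq q 0.
  (* A nonzero polynomial cannot have as many distinct roots as its size; this turns the pointwise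
     identity into one of polynomials. *)
  have := max_poly_roots (rs := [seq i%:R | i <- iota 0 (size q)]) qn.
  rewrite size_map size_iota ltnn => h; exfalso.
  have /h : all (root q) [seq i%:R | i <- iota 0 (size q)].
    by apply/allP => y _; rewrite /root q0.
  suff -> : uniq [seq i%:R : R | i <- iota 0 (size q)] by move=> /(_ isT).
  by rewrite map_inj_uniq ?iota_uniq// => i j /eqP; rewrite eqr_nat => /eqP.
rewrite E derivZ !hornerZ lower_polyE; ring.
Qed.

Lemma size_lower s n p : 0 < s -> size p = n.+1 -> size (lower_poly s p) = n.+2.
Proof.
move=> s0 sp; have ln : p`_n != 0.
  have := lead_coef_eq0 p; rewrite lead_coefE sp /= => ->.
  by rewrite -size_poly_eq0 sp.
have C k : (lower_poly s p)`_k = k.+1%:R * p`_k.+1 -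
    (if k is k'.+1 then (k'%:R + 2 * s) * p`_k' else 0).
  rewrite /lower_poly coefB mulrBl mul1r coefB coefXnM coefZ coefXM coef_deriv.
  case: k => [|[|k]]/=; first by rewrite mulr0 !subr0 mulr_natl.
    by rewrite -[p`_2 *+ _]mulr_natl; ring.
  by rewrite coef_deriv subn2/= -[p`_k.+1 *+ _]mulr_natl -[p`_k.+3 *+ _]mulr_natl; ring.
apply/eqP; rewrite eqn_leq; apply/andP; split.
  have z k : (n < k)%N -> p`_k = 0 by move=> nk; rewrite nth_default ?sp.
  apply/leq_sizeP => -[//|j]; rewrite ltnS => nj.
  by rewrite C !z ?mulr0 ?subr0// (leq_trans nj)// ltnW.
rewrite ltnNge; apply/negP => /leq_sizeP/(_ n.+1 (leqnn _)).
rewrite C nth_default ?sp// mulr0 sub0r => /eqP; rewrite oppr_eq0 mulf_eq0 (negPf ln) orbF.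
by rewrite gt_eqF// ltr_wpDl// mulr_gt0.
Qed.

End derived_family.

(** * Riesz potentials *)

Opaque Rintegral.

Lemma meas_pkf (R : realType) d (T : measurableType d) (b : R) (f : T -> R) :
  measurable_fun setT f -> measurable_fun setT (fun x => pk b (f x)).
Proof. by move=> mf; rewrite /pk; mea. Qed.

Ltac mea_pk ::= match goal with
  | |- measurable_fun _ (fun x => x.1.1) => exact: measurableT_comp measurable_fst measurable_fst
  | |- measurable_fun _ (fun x => x.1.2) => exact: measurableT_comp measurable_snd measurable_fst
  | |- measurable_fun _ (fun x => pk ?a (@?b x)) => apply: (@meas_pkf _ _ _ a b)
  | |- measurable_fun _ (pk ?a) => apply: (@meas_pkf _ _ _ a (fun x => x))
  end.

Section riesz_potential.
Context {R : realType}.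
Notation mu := (@lebesgue_measure R).
Implicit Types (a b c s t u x y z th al ka : R) (f g q r v h : R -> R).

Transparent Rintegral.
(** No integrability is assumed: positive and negative parts are integrated separately and the
    default value at infinity is measurable. Slices known to be integrable only almost everywhere
    are thus covered. *)
Lemma meas_RIT d (T : measurableType d) (F : T -> R -> R) :
  measurable_fun setT (fun z : T * R => F z.1 z.2) ->
  measurable_fun setT (fun x : T => \int[mu]_y F x y).
Proof.
move=> mF; apply: measurableT_comp => //.
have mE : measurable_fun setT (fun z : T * R => (F z.1 z.2)%:E) by exact/measurable_EFinP.
have -> : (fun x : T => \int[mu]_y (F x y)%:E)%E =
    (fun x : T => \int[mu]_y ((fun z : T * R => (F z.1 z.2)%:E)^\+ (x, y)) -
              \int[mu]_y ((fun z : T * R => (F z.1 z.2)%:E)^\- (x, y)))%E.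
  by apply/funext => x; rewrite [LHS]integralE; congr (_ - _)%E;
    apply: eq_integral => y _; rewrite ?funeposE ?funenegE.
have m1 := @measurable_fun_fubini_tonelli_F _ _ T (measurableTypeR R) R mu _
  (measurable_funepos mE) (funepos_ge0 _).
have m2 := @measurable_fun_fubini_tonelli_F _ _ T (measurableTypeR R) R mu _
  (measurable_funeneg mE) (funeneg_ge0 _).
exact: emeasurable_funB m1 m2.
Qed.
Opaque Rintegral.

Lemma pk_neg b t : t <= 0 -> pk b t = 0.
Proof. by rewrite /pk ltNge => ->. Qed.

(** The bound with exponent al is used up to time l and the other one after it. The constant is
    independent of h and of l, so that l can later be optimised. *)
Lemma pk_two_sided b al ka : al < b -> b < ka -> exists2 C, 0 <= C &
  forall (A B l : R) h, 0 <= A -> 0 <= B -> 0 < l -> measurable_fun setT h ->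
  (forall t, 0 < t -> `|h t| <= A * t `^ (- al)) ->
  (forall t, 0 < t -> `|h t| <= B * t `^ (- ka)) ->
  Int (fun t => pk b t * h t) /\
  \int[mu]_t `|pk b t * h t| <= C * (A * l `^ (b - al) + B * l `^ (b - ka)).
Proof.
move=> ab bk; pose C1 := (b - al)^-1; pose C2 := - (b - ka)^-1 * 2^-1 `^ (b - ka).
have C10 : 0 <= C1 by rewrite invr_ge0; lra.
have C20 : 0 <= C2.
  by rewrite mulr_ge0 ?powR_ge0// oppr_ge0 invr_le0; lra.
exists (C1 + C2); first by rewrite addr_ge0.
move=> A B l h A0 B0 l0 mh hA hB.
have l2 : 0 < l / 2 by rewrite divr_gt0.
have a1 : -1 < b - 1 - al by lra.
have a2 : b - 1 - ka < -1 by lra.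
have [I1 E1] := Int_pow0 a1 l0; have [I2 E2] := Int_powy a2 l2.
set P1 := (fun x => if _ then _ else _) in I1 E1; set P2 := (fun x => if _ then _ else _) in I2 E2.
have P10 t : 0 <= P1 t by rewrite /P1; case: ifP => // _; exact: powR_ge0.
have P20 t : 0 <= P2 t by rewrite /P2; case: ifP => // _; exact: powR_ge0.
have ID := IntD (IntZ A I1) (IntZ B I2).
have hD t : `|pk b t * h t| <= A * P1 t + B * P2 t.
  rewrite normrM (ger0_norm (pk_ge0 _ _)) /pk; case: ifP => t0; last first.
    by rewrite mul0r addr_ge0// mulr_ge0.
  have [tl|tl] := ltP t l.
    apply: (@le_trans _ _ (A * P1 t)); last by rewrite lerDl mulr_ge0.
    rewrite /P1 t0 tl/= [X in _ <= A * X]powD// mulrCA; apply: ler_wpM2l; first exact: powR_ge0.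
    exact: hA.
  apply: (@le_trans _ _ (B * P2 t)); last by rewrite lerDr mulr_ge0.
  rewrite /P2 (_ : l / 2 < t)/=; last by lra.
  rewrite [X in _ <= B * X]powD// mulrCA; apply: ler_wpM2l; first exact: powR_ge0.
  exact: hB.
have mf : measurable_fun setT (fun t => pk b t * h t) by mea.
have If := le_Int mf hD ID; split => //.
apply: (le_trans (le_RI (Int_norm If) ID hD)).
rewrite RID ?RIZ//; [|exact: IntZ|exact: IntZ].
have e1 : (b - 1 - al + 1)^-1 * l `^ (b - 1 - al + 1) = C1 * l `^ (b - al).
  by rewrite /C1 (_ : b - 1 - al + 1 = b - al)//; ring.
have e2 : - (b - 1 - ka + 1)^-1 * (l / 2) `^ (b - 1 - ka + 1) = C2 * l `^ (b - ka).
  rewrite /C2 (_ : b - 1 - ka + 1 = b - ka); last by ring.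
  by rewrite mulrC powRM ?(ltW l0) ?invr_ge0//; ring.
rewrite e1 in E1; rewrite e2 in E2.
have p1 := powR_ge0 l (b - al); have p2 := powR_ge0 l (b - ka).
have h1 : A * \int[mu]_x P1 x <= A * (C1 * l `^ (b - al)) by rewrite ler_wpM2l.
have h2 : B * \int[mu]_x P2 x <= B * (C2 * l `^ (b - ka)) by rewrite ler_wpM2l.
have h3 : 0 <= C2 * (A * l `^ (b - al)) by exact: mulr_ge0 C20 (mulr_ge0 A0 p1).
have h4 : 0 <= C1 * (B * l `^ (b - ka)) by exact: mulr_ge0 C10 (mulr_ge0 B0 p2).
by lra.
Qed.

(** A decay rate of the flow, uniform in space. A small exponent is useful at short times and a
    large one at long times; a Riesz potential of order b needs one on each side of b. *)
Definition hdec ka q := exists2 C, 0 <= C & forall t a, 0 < t -> `|H q t a| <= C * t `^ (- ka).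

Lemma hdec_half q : Int q -> hdec 2^-1 q.
Proof.
move=> Iq; exists (\int[mu]_x `|q x|); first by apply: RI_ge0.
move=> t a t0; apply: (le_trans (H_le a Iq t0)).
by rewrite powRN powR12_sqrt ?(ltW t0)// mulrC.
Qed.

Lemma hdec_mean0 q : Int q -> (forall x, 1 < `|x| -> q x = 0) ->
  \int[mu]_x q x = 0 -> hdec 1 q.
Proof.
move=> Iq sq q0; exists (4 * \int[mu]_x `|q x|); first by rewrite mulr_ge0// RI_ge0.
move=> t a t0; apply: (le_trans (H_mean0_le a Iq sq q0 t0)).
by rewrite powRN powRr1 ?(ltW t0)// mulrAC.
Qed.

(** The Riesz potential (-Delta)^(-b) q, without the factor 1/Gamma(b). *)
Definition riesz b q x : R := \int[mu]_t (pk b t * H q t x).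

Lemma riesz_meas b q : Int q -> measurable_fun setT (riesz b q).
Proof.
move=> Iq; have mH := meas_H (Int_gtest Iq).
by apply: (@meas_RIT _ _ (fun x t => pk b t * H q t x)); mea.
Qed.

Lemma riesz_bounded b al ka q : Int q -> al < b -> b < ka -> hdec al q -> hdec ka q ->
  (forall x, Int (fun t => pk b t * H q t x)) /\
  exists M, forall x, `|riesz b q x| <= M.
Proof.
move=> Iq ab bk [A A0 hA] [B B0 hB]; have mH := meas_H (Int_gtest Iq).
have [C C0 HC] := pk_two_sided ab bk.
have P x : Int (fun t => pk b t * H q t x) /\ \int[mu]_t `|pk b t * H q t x| <= C * (A * 1 `^ (b - al) + B * 1 `^ (b - ka)).
  apply: HC => //; first by mea.
    by move=> t t0; exact: hA.
  by move=> t t0; exact: hB.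
split=> [x|]; first exact: (P x).1.
exists (C * (A * 1 `^ (b - al) + B * 1 `^ (b - ka))) => x; have [I E] := P x.
exact: le_trans (norm_RI I) E.
Qed.

Lemma riesz_pair b q g (D : R -> R) : Int q -> measurable_fun setT g ->
  Int (fun t => pk b t * D t) ->
  (forall t, 0 < t -> Int (fun x => H q t x * g x) /\ \int[mu]_x `|H q t x * g x| <= D t) ->
  [/\ Int (fun x => riesz b q x * g x),
      Int (fun t => pk b t * \int[mu]_x (H q t x * g x)) &
      \int[mu]_x (riesz b q x * g x) =
      \int[mu]_t (pk b t * \int[mu]_x (H q t x * g x))].
Proof.
move=> Iq mg ID hD; have mH := meas_H (Int_gtest Iq).
pose F t x := pk b t * (H q t x * g x).
have IF t : Int (F t).
  have [t0|t0] := ltP 0 t; first by apply: IntZ; exact: (hD t t0).1.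
  by apply: eq_Int (Int0 (R := R)) => x; rewrite /F /pk ltNge t0 mul0r.
have I2 : Int2 F.
  apply: (Int2P _ IF ID); first by rewrite /meas2 /F; mea.
  move=> t; have [t0|t0] := ltP 0 t; last first.
    rewrite /pk ltNge t0/= mul0r (eq_RI (g := fun=> 0)) ?RI0// => x.
    by rewrite /F /pk ltNge t0 mul0r normr0.
  have [I E] := hD t t0.
  rewrite (eq_RI (g := fun x => pk b t * `|H q t x * g x|)); last first.
    by move=> x; rewrite normrM (ger0_norm (pk_ge0 _ _)).
  by rewrite RIZ ?ler_wpM2l ?pk_ge0//; exact: Int_norm.
have Ix := Int2_Int (Int2_swap I2).
have mR := riesz_meas b Iq.
have e : {ae mu, forall x, \int[mu]_t F t x = riesz b q x * g x}.
  apply: ae_mp (Int2_ae (Int2_swap I2)) => x Ifx.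
  (* Fubini gives integrability of the slice only after multiplication by g x: divide if it is
     nonzero, otherwise both sides are 0. *)
  have [g0|g0] := eqVneq (g x) 0.
    rewrite g0 mulr0 -[RHS](@RI0 R); apply: eq_RI => t.
    by rewrite /F g0 !mulr0.
  have It : Int (fun t => pk b t * H q t x).
    apply: eq_Int (IntZ (g x)^-1 Ifx) => t.
    by rewrite /F; field.
  by rewrite -RIZr//; apply: eq_RI => t; rewrite /F mulrA.
have E t : \int[mu]_x F t x = pk b t * \int[mu]_x (H q t x * g x).
  have [t0|t0] := ltP 0 t; first by rewrite RIZ//; exact: (hD t t0).1.
  rewrite /pk ltNge t0/= mul0r -[RHS](@RI0 R); apply: eq_RI => x.
  by rewrite /F /pk ltNge t0 mul0r.
have mRg : measurable_fun setT (fun x => riesz b q x * g x) by mea.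
split; first exact: ae_eq_Int mRg e Ix.
- by apply: eq_Int (Int2_Int I2) => t; rewrite E.
- rewrite -(eq_RI E) (fub I2); apply: esym.
  apply: ae_eq_RI => //; exact: Int_meas Ix.
Qed.

Lemma riesz_pair_bounded b al ka q r : Int q -> Int r -> al < b -> b < ka ->
  hdec al q -> hdec ka q ->
  [/\ Int (fun x => riesz b q x * r x),
      Int (fun t => pk b t * \int[mu]_x (H q t x * r x)) &
      \int[mu]_x (riesz b q x * r x) =
      \int[mu]_t (pk b t * \int[mu]_x (H q t x * r x))].
Proof.
move=> Iq Ir ab bk [A A0 hA] [B B0 hB]; have mr := Int_meas Ir.
have mH := meas_H (Int_gtest Iq); have Ir' := Int_norm Ir.
have [C C0 HC] := pk_two_sided ab bk.
pose N := \int[mu]_x `|r x|.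
have N0 : 0 <= N by apply: RI_ge0.
pose D t := \int[mu]_x `|H q t x * r x|.
have IH t (B' : R) : (forall x, `|H q t x| <= B') -> Int (fun x => H q t x * r x).
  move=> hB'; have mHt : measurable_fun setT (fun x => H q t x) by mea.
  exact: (IntMb mHt hB' Ir).
have mD : measurable_fun setT D.
  by apply: (@meas_RIT _ _ (fun t x => `|H q t x * r x|)); mea.
have le t (B' : R) : (forall x, `|H q t x| <= B') -> D t <= B' * N.
  move=> hB'; rewrite -RIZ//; apply: le_RI; [exact/Int_norm/IH/hB'|exact: IntZ|] => x.
  by rewrite normrM ler_wpM2r.
have D0 t : 0 <= D t by apply: RI_ge0.
apply: (@riesz_pair _ _ _ D) => //.
- apply: (HC (A * N) (B * N) 1 D _ _ _ _ _ _).1; rewrite ?mulr_ge0//.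
  + move=> t t0; rewrite ger0_norm// mulrAC; apply: le => x; exact: hA.
  + move=> t t0; rewrite ger0_norm// mulrAC; apply: le => x; exact: hB.
- by move=> t t0; split => //; apply: IH => x; exact: hA.
Qed.

(* [riesz b q] has Fourier transform [gamma_c b * |xi|^(- 2 b) q^]. *)
Lemma heat_riesz_MM b q t a : Int q -> 0 < b -> b <= 1 -> 0 < t ->
  H (riesz b q) t a = \int[mu]_u (pk b u * H q (t + u) a) ->
  adm (- (2 * b)) (fm q a) ->
  2 * pi * H (riesz b q) t a = gamma_c b * MM (- (2 * b)) (fm q a) t.
Proof.
move=> Iq b0 b1 t0 -> am.
have am0 : adm 0 (fm q a) by apply: fm_adm => //; lra.
have am' : adm (0 - 2 * b) (fm q a) by rewrite sub0r.
have [I E] := subordination_neg b0 b1 am0 am' t0.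
rewrite sub0r in E; rewrite -E.
have P0 : 0 < 2 * pi :> R by rewrite mulr_gt0 ?pi_gt0.
have E1 u : pk b u * MM 0 (fm q a) (t + u) = 2 * pi * (pk b u * H q (t + u) a).
  have [u0|u0] := ltP 0 u; last by rewrite /pk ltNge u0 !mul0r mulr0.
  by rewrite MM0 ?addr_gt0//; ring.
rewrite (eq_RI E1) [RHS]RIZ//.
apply: eq_Int (IntZ (2 * pi)^-1 I) => u.
by rewrite E1 mulKf// gt_eqF.
Qed.

(* Beta integral. *)
Lemma pk_convolution b : 0 < b -> b <= 1 -> exists2 B : R, 0 <= B &
  forall z, Int (fun t => pk b t * pk b (z - t)) /\
    \int[mu]_t (pk b t * pk b (z - t)) = B * pk (2 * b) z.
Proof.
move=> b0 b1; pose F (y : R) := pk b y * pk b (1 - y).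
have F0 y : 0 <= F y by rewrite mulr_ge0 ?pk_ge0.
have b' : -1 < b - 1 by lra.
have [IP _] := Int_pow0 b' ltr01.
set P := (fun x => if _ then _ else _) in IP.
have P0 y : 0 <= P y by rewrite /P; case: ifP => // _; exact: powR_ge0.
have P1 := Int_shift (- 1) (Int_opp IP).
have half c : 2^-1 <= c -> c `^ (b - 1) <= 2^-1 `^ (b - 1).
  move=> h; have h2 : (0 : R) < 2^-1 by rewrite invr_gt0.
  rewrite -(opprB 1 b) !powRN lef_pV2 ?posrE ?powR_gt0 ?(lt_le_trans h2)//.
  apply: ge0_ler_powR; rewrite ?nnegrE//; first by lra.
  exact: le_trans (ltW h2) h.
have IF : Int F.
  apply: (le_Int _ _ (IntZ (2^-1 `^ (b - 1)) (IntD IP P1))); first by rewrite /F; mea.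
  move=> y; rewrite ger0_norm// /F /pk subr_gt0.
  have [y0|y0] := ltP 0 y; last by rewrite mul0r mulr_ge0 ?powR_ge0// addr_ge0.
  have [y1|y1] := ltP y 1; last by rewrite mulr0 mulr_ge0 ?powR_ge0// addr_ge0.
  have E1 : P y = y `^ (b - 1) by rewrite /P y0 y1.
  have E2 : P (- (y + -1)) = (1 - y) `^ (b - 1).
    rewrite /P opprD opprK addrC subr_gt0 y1 /= ltrBlDr ltrDl y0//.
  rewrite E1 E2; have [vh|vh] := leP y 2^-1.
    rewrite mulrC; apply: ler_pM; rewrite ?powR_ge0//.
      by apply: half; lra.
    by rewrite lerDl powR_ge0.
  apply: ler_pM; rewrite ?powR_ge0//; first by apply: half; lra.
  by rewrite lerDr powR_ge0.
exists (\int[mu]_y F y); first exact: RI_ge0.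
move=> z; have [z0|z0] := ltP 0 z; last first.
  have E t : pk b t * pk b (z - t) = 0.
    rewrite /pk; case: ifP => t0; last by rewrite mul0r.
    by rewrite subr_gt0 ltNge (le_trans z0 (ltW t0)) mulr0.
  split; first by apply: eq_Int (Int0 (R := R)) => t; rewrite E.
  by rewrite (eq_RI E) RI0 /pk ltNge z0 mulr0.
have z1 : 0 < z^-1 by rewrite invr_gt0.
have I := Int_affine 0 z1 IF; have S := RI_affine 0 z1 IF.
have E t : pk b t * pk b (z - t) = z `^ (2 * b - 2) * F (z^-1 * t + 0).
  have e1 : t = z * (z^-1 * t) by rewrite mulrA divff ?mul1r// gt_eqF.
  have e2 : z - t = z * (1 - z^-1 * t) by rewrite mulrBr mulr1 -e1.
  rewrite addr0 /F; transitivity (pk b (z * (z^-1 * t)) * pk b (z * (1 - z^-1 * t))).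
    by rewrite -e2 -e1.
  rewrite !pkM//.
  rewrite (_ : 2 * b - 2 = (b - 1) + (b - 1)); last by ring.
  by rewrite [z `^ (b - 1 + (b - 1))]powD//; ring.
split; first by apply: eq_Int (IntZ _ I) => t; rewrite E.
rewrite (eq_RI E) (RIZ _ I) S invrK /pk z0 mulrA mulrC; congr (_ * _).
rewrite -{2}(powRr1 (ltW z0)) -powD//; congr (_ `^ _); ring.
Qed.

End riesz_potential.

Opaque powR riesz H pk.

(** * L2 pairings of Riesz potentials *)

Section riesz_energy.
Context {R : realType}.
Notation mu := (@lebesgue_measure R).
Implicit Types (a b c s t u x y z th al ka : R) (f g q r v h : R -> R).

Lemma L2_HI q t M : Int q -> 0 < t -> (forall x, `|H q t x| <= M) ->
  L2 (fun=> 1) (H q t) /\ ip (fun=> 1) (H q t) (H q t) <= M * \int[mu]_x `|q x|.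
Proof.
move=> Iq t0 hM; have IH := Int_Ht Iq t0; have mH := Int_meas IH.
have M0 : 0 <= M := le_trans (normr_ge0 _) (hM 0).
have I1 : Int (fun x => H q t x * H q t x) := IntMb mH hM IH.
split.
  split => //; apply: eq_Int I1 => x; rewrite mulr1 expr2//.
apply: (@le_trans _ _ (\int[mu]_x (M * `|H q t x|))).
  apply: le_RI; [by apply: eq_Int I1 => x; rewrite mulr1|exact/IntZ/Int_norm|].
  move=> x; rewrite mulr1; apply: (le_trans (ler_norm _)).
  by rewrite normrM ler_wpM2r.
rewrite RIZ; last exact: Int_norm.
by rewrite ler_wpM2l// RI_norm_H.
Qed.

Definition hnorm q t : R := Num.sqrt (ip (fun=> 1) (H q t) (H q t)).

Lemma wt1 : wt (fun=> 1 : R).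
Proof. by split => // x; exact: ler01. Qed.

Lemma hdec_L2 ka q t : Int q -> hdec ka q -> 0 < t -> L2 (fun=> 1) (H q t).
Proof. by move=> Iq [C C0 hC] t0; apply: (L2_HI Iq t0 (fun x => hC t x t0)).1. Qed.

Lemma CS1 f g : L2 (fun=> 1) f -> L2 (fun=> 1) g ->
  Int (fun x => f x * g x) /\ \int[mu]_x `|f x * g x| <=
    Num.sqrt (ip (fun=> 1) f f) * Num.sqrt (ip (fun=> 1) g g).
Proof.
move=> Lf Lg; have w1 := wt1.
have N h : L2 (fun=> 1) h -> L2 (fun=> 1) (fun x => `|h x|).
  move=> [mh Ih]; split; first by mea.
  by apply: eq_Int Ih => x; rewrite real_normK ?num_real.
have Ns h : ip (fun=> 1) (fun x => `|h x|) (fun x => `|h x|) = ip (fun=> 1) h h.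
  by apply: eq_RI => x; rewrite -normrM ger0_norm// -expr2 sqr_ge0.
split; first by apply: eq_Int (L2_Int w1 Lf Lg) => x; rewrite mulr1.
have := CS_sqrt w1 (N _ Lf) (N _ Lg); rewrite !Ns; apply: le_trans.
apply: le_trans (ler_norm _).
by rewrite le_eqVlt; apply/orP; left; apply/eqP/eq_RI => x; rewrite mulr1 normrM.
Qed.

(** Interpolating the supremum with the L1 norm halves the decay rates in L2, whence the conditions
    on 2 b instead of b. *)
Lemma Int_hnorm b al ka q : Int q -> al < 2 * b -> 2 * b < ka -> hdec al q -> hdec ka q ->
  Int (fun t => pk b t * hnorm q t).
Proof.
move=> Iq ab bk [A A0 hA] [B B0 hB]; have mH := meas_H (Int_gtest Iq).
have ab' : al / 2 < b by lra.
have bk' : b < ka / 2 by lra.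
have [C C0 HC] := pk_two_sided ab' bk'.
pose N := \int[mu]_x `|q x|; have N0 : 0 <= N by apply: RI_ge0.
have mD : measurable_fun setT (hnorm q).
  have : measurable_fun setT (fun t => \int[mu]_x (H q t x * H q t x * 1)).
    by apply: (@meas_RIT _ _ _ (fun t x => H q t x * H q t x * 1)); mea.
  by rewrite /hnorm /ip; mea.
have le t (A' k : R) : 0 <= A' -> 0 < t -> (forall x, `|H q t x| <= A' * t `^ (- k)) ->
    `|hnorm q t| <= Num.sqrt (A' * N) * t `^ (- (k / 2)).
  move=> A'0 t0 hx; rewrite ger0_norm ?sqrtr_ge0//.
  have -> : t `^ (- (k / 2)) = Num.sqrt (t `^ (- k)).
    by rewrite -powR12_sqrt ?powR_ge0// -powRrM; congr (_ `^ _); field.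
  rewrite -sqrtrM ?mulr_ge0// ler_wsqrtr//.
  by have [_] := L2_HI Iq t0 hx; rewrite mulrAC.
apply: (HC (Num.sqrt (A * N)) (Num.sqrt (B * N)) 1 _ _ _ _ _ _ _).1 => //.
- by move=> t t0; apply: le => // x; exact: hA.
- by move=> t t0; apply: le => // x; exact: hB.
Qed.

Opaque hnorm ip.
Lemma H_pair q r t u : Int q -> Int r -> 0 < t -> 0 < u ->
  \int[mu]_x (H r u x * H q t x) = \int[mu]_x (H q (t + u) x * r x).
Proof.
move=> Iq Ir t0 u0; have IH := Int_Ht Iq t0.
have [mq mr] := (Int_meas Iq, Int_meas Ir); have mH := Int_meas IH.
have I2 : Int2 (fun y x => r y * (G u (y - x) * H q t x)).
  have B x : `|H q t x| <= (Num.sqrt t)^-1 * \int[mu]_x `|q x| by exact: H_le.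
  have B0 := le_trans (normr_ge0 _) (B 0).
  apply: (Int2P _ _ (IntZ ((Num.sqrt t)^-1 * \int[mu]_x `|q x|) (Int_norm Ir))).
  - by rewrite /meas2; mea.
  - move=> y; apply: IntZ; have mG : measurable_fun setT (fun x => G u (y - x)) by mea.
    apply: (IntMb mG _ IH) => x; rewrite ger0_norm ?G_ge0//; exact: G_le_sqrt.
  - move=> y; rewrite mulrC -[leRHS]mulr1 -(RI_Gr y u0) -RIZ; last exact: Int_Gr.
    apply: le_RI; last first.
    + move=> x; rewrite !normrM (ger0_norm (G_ge0 _ _)) -mulrA ler_wpM2l//.
      by rewrite mulrC ler_wpM2r ?G_ge0.
    + exact/IntZ/Int_Gr.
    + apply/Int_norm/IntZ; have mG : measurable_fun setT (fun x => G u (y - x)) by mea.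
      apply: (IntMb mG _ IH) => x; rewrite ger0_norm ?G_ge0//; exact: G_le_sqrt.
transitivity (\int[mu]_x \int[mu]_y (r y * (G u (y - x) * H q t x))).
  apply: eq_RI => x; rewrite -RIZr; first by apply: eq_RI => y; rewrite mulrA.
  exact: Int_gtest.
rewrite -(fub I2); apply: eq_RI => y.
have [I E] := H_semigroup y (Int_gtest Iq) t0 u0.
rewrite -E mulrC -RIZ//; apply: eq_RI => x.
by rewrite GC; ring.
Qed.

(** The composition rule of Riesz potentials: with z = t + u the two time weights convolve, by the
    Beta integral, to a multiple of z^(2 b - 1). The product bound on [Phi] justifies Fubini. *)
Lemma pk_double_integral b (Phi nq nr : R -> R) : 0 < b -> b <= 1 ->
  measurable_fun setT Phi -> Int (fun t => pk b t * nq t) -> Int (fun t => pk b t * nr t) ->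
  (forall t u, 0 < t -> 0 < u -> `|Phi (t + u)| <= nq t * nr u) ->
  \int[mu]_t (pk (2 * b) t * Phi t) = 0 ->
  \int[mu]_t \int[mu]_u (pk b t * (pk b u * Phi (t + u))) = 0.
Proof.
move=> b0 b1 mPhi INq INr PhiB zero.
have [B B0 HB] := pk_convolution b0 b1.
pose N := \int[mu]_u (pk b u * nr u).
have J t : Int (fun u => pk b t * (pk b u * Phi (t + u))) /\
   \int[mu]_u `|pk b t * (pk b u * Phi (t + u))| <= pk b t * nq t * N.
  have IB := IntZ (pk b t * nq t) INr.
  have le u : `|pk b t * (pk b u * Phi (t + u))| <= pk b t * nq t * (pk b u * nr u).
    rewrite !normrM !(ger0_norm (pk_ge0 _ _)).
    have [t0|t0] := ltP 0 t; last by rewrite (pk_neg b t0) !mul0r.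
    have [u0|u0] := ltP 0 u; last by rewrite (pk_neg b u0) !mul0r !mulr0.
    rewrite -mulrA [nq t * _]mulrCA; apply: ler_wpM2l; first exact: pk_ge0.
    by apply: ler_wpM2l; [exact: pk_ge0|exact: PhiB].
  have Ih : Int (fun u => pk b t * (pk b u * Phi (t + u))) by apply: (le_Int _ le IB); mea.
  by split => //; rewrite -RIZ//; apply: le_RI => //; exact: Int_norm.
have sh t z : pk b t * (pk b (z - t) * Phi z) =
    (fun u => pk b t * (pk b u * Phi (t + u))) (z - t) by rewrite /= [t + _]addrC subrK.
have I2 : Int2 (fun t z => pk b t * (pk b (z - t) * Phi z)).
  apply: (Int2P _ _ (IntZ N INq)).
  - by rewrite /meas2; mea.
  - by move=> t; apply: eq_Int (Int_shift (- t) (J t).1) => z; rewrite sh.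
  - move=> t; rewrite [leRHS]mulrC; apply: le_trans (J t).2.
    rewrite -(RI_shift (- t) (Int_norm (J t).1)) le_eqVlt; apply/orP; left; apply/eqP/eq_RI => z.
    by rewrite sh.
transitivity (\int[mu]_t \int[mu]_z (pk b t * (pk b (z - t) * Phi z))).
  apply: eq_RI => t; rewrite -[LHS](RI_shift (- t) (J t).1).
  by apply: eq_RI => z; rewrite [t + (z - t)]addrC subrK.
rewrite (fub I2).
have F z : \int[mu]_t (pk b t * (pk b (z - t) * Phi z)) = B * (pk (2 * b) z * Phi z).
  have [I E] := HB z.
  by rewrite mulrA -E -(RIZr _ I); apply: eq_RI => t; rewrite mulrA.
rewrite (eq_RI F); have [->|B00] := eqVneq B 0.
  by rewrite -[RHS](@RI0 R); apply: eq_RI => z; rewrite mul0r.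
rewrite RIZ ?zero ?mulr0//.
apply: eq_Int (IntZ B^-1 (Int2_Int (Int2_swap I2))) => z.
by rewrite F mulKf.
Qed.

(** By the semigroup law the pairing of the flows of q at time t and of r at time u depends on t + u
    only, so the pairing of two potentials of order b reduces to the time integral of order 2 b. *)
Lemma riesz_energy b al ka q r : 0 < b -> b <= 1 -> Int q -> Int r ->
  al < 2 * b -> 2 * b < ka -> hdec al q -> hdec ka q -> hdec al r -> hdec ka r ->
  \int[mu]_t (pk (2 * b) t * \int[mu]_x (H q t x * r x)) = 0 ->
  L2 (fun=> 1) (riesz b r) ->
  \int[mu]_x (riesz b q x * riesz b r x) = 0.
Proof.
move=> b0 b1 Iq Ir ab bk dq dq' dr dr' zero Lr.
have rot3 (x y z : R) : x * (y * z) = y * (z * x) by rewrite mulrCA [x * z]mulrC.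
have INq := Int_hnorm Iq ab bk dq dq'; have INr := Int_hnorm Ir ab bk dr dr'.
pose Phi t := \int[mu]_x (H q t x * r x).
have mPhi : measurable_fun setT Phi.
  have mr' := Int_meas Ir; have mq := meas_H (Int_gtest Iq).
  by apply: (@meas_RIT _ _ _ (fun t x => H q t x * r x)); mea.
have PhiB t u : 0 < t -> 0 < u -> `|Phi (t + u)| <= hnorm q t * hnorm r u.
  move=> t0 u0; rewrite /Phi -H_pair//.
  have [I E] := CS1 (hdec_L2 Ir dr u0) (hdec_L2 Iq dq t0).
  by apply: (le_trans (norm_RI I)); rewrite mulrC.
have [] := @riesz_pair _ b q (riesz b r)
  (fun t => hnorm q t * Num.sqrt (ip (fun=> 1) (riesz b r) (riesz b r))) Iq Lr.1.
- apply: eq_Int (IntZ (Num.sqrt (ip (fun=> 1) (riesz b r) (riesz b r))) INq) => t.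
  exact: rot3.
- by move=> t t0; exact: CS1 (hdec_L2 Iq dq t0) Lr.
move=> _ _ ->.
rewrite -(pk_double_integral b0 b1 mPhi INq INr PhiB zero); apply: eq_RI => t.
have [t0|t0] := ltP 0 t; last first.
  rewrite (pk_neg b t0) mul0r -[LHS](@RI0 R); apply: eq_RI => u.
  by rewrite mul0r.
have [] := @riesz_pair _ b r (H q t) (fun u => hnorm r u * hnorm q t) Ir.
- exact: (hdec_L2 Iq dq t0).1.
- apply: eq_Int (IntZ (hnorm q t) INr) => u.
  exact: rot3.
- by move=> u u0; exact: CS1 (hdec_L2 Ir dr u0) (hdec_L2 Iq dq t0).
move=> _ Iu E.
have F u : pk b u * \int[mu]_x (H r u x * H q t x) = pk b u * Phi (t + u).
  by have [u0|u0] := ltP 0 u; [rewrite /Phi -H_pair|rewrite (pk_neg b u0) !mul0r].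
rewrite RIZ; last by apply: eq_Int Iu => u; rewrite F.
congr (_ * _); apply: etrans (eq_RI F); apply: etrans E.
by apply: eq_RI => x; exact: mulrC.
Qed.

End riesz_energy.
Transparent Rintegral powR riesz H pk.

(** * Orthogonality of Riesz potentials of weighted eigenpolynomials *)

Section double_integrals.
Context {R : realType}.
Notation mu := (@lebesgue_measure R).
Implicit Types (a b c s t u x y z th m : R) (F K : R -> R -> R) (p r : {poly R}).

Lemma dintB F K : Int2 F -> Int2 K ->
  \int[mu]_y \int[mu]_x (F y x - K y x) =
  \int[mu]_y \int[mu]_x F y x - \int[mu]_y \int[mu]_x K y x.
Proof.
move=> IF IK; rewrite -RIB; [|exact: Int2_Int|exact: Int2_Int].
have mF := Int2_meas IF; have mK := Int2_meas IK; rewrite /meas2 in mF mK.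
apply: ae_eq_RI.
- by apply: (@meas_RIT _ _ _ (fun y x => F y x - K y x)); mea.
- by apply: measurable_funB; exact: Int_meas (Int2_Int _).
- by apply: ae_mp (ae_and (Int2_ae IF) (Int2_ae IK)) => y [If Ik]; rewrite RIB.
Qed.

Lemma dintZ c F : Int2 F ->
  \int[mu]_y \int[mu]_x (c * F y x) = c * \int[mu]_y \int[mu]_x F y x.
Proof.
move=> IF; rewrite -RIZ; last exact: Int2_Int.
have mF := Int2_meas IF; rewrite /meas2 in mF.
have mI := Int_meas (Int2_Int IF).
apply: ae_eq_RI.
- by apply: (@meas_RIT _ _ _ (fun y x => c * F y x)); mea.
- by mea.
- by apply: ae_mp (Int2_ae IF) => y If; rewrite RIZ.
Qed.

Lemma norm_dint F K : Int2 F -> Int2 K -> (forall y, Int (F y)) -> (forall y, Int (K y)) ->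
  (forall y x, `|F y x| <= K y x) ->
  `|\int[mu]_y \int[mu]_x F y x| <= \int[mu]_y \int[mu]_x K y x.
Proof.
move=> IF IK sF sK FK; apply: norm_RI_le; [exact: Int2_Int|exact: Int2_Int|].
by move=> y; apply: norm_RI_le.
Qed.

Lemma eq_Int2 F K : (forall y x, F y x = K y x) -> Int2 F -> Int2 K.
Proof. by move=> FK; congr Int2; apply/funext => y; apply/funext => x. Qed.

Lemma le_weight2 th F (C : R) : (forall y x, `|y| <= 1 -> `|x| <= 1 -> `|F y x| <= C) ->
  forall y x, `|weight th y * weight th x * F y x| <= C * (weight th y * weight th x).
Proof.
move=> FC y x; rewrite !normrM !(ger0_norm (weight_ge0 _ _)) mulrC.
have [y1|y1] := leP `|y| 1; last by rewrite (weight_out th (ltW y1)) !mul0r !mulr0.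
have [x1|x1] := leP `|x| 1; last by rewrite (weight_out th (ltW x1)) !mulr0.
by apply: ler_wpM2r; [rewrite mulr_ge0 ?weight_ge0|exact: FC].
Qed.

Lemma Int2_weight th F (C : R) : th < 1 -> meas2 F ->
  (forall y x, `|y| <= 1 -> `|x| <= 1 -> `|F y x| <= C) ->
  Int2 (fun y x => weight th y * weight th x * F y x).
Proof.
move=> th1 mF FC; rewrite /meas2 in mF.
have Iw := Int_weight (R := R) th1.
apply: (le_Int2 _ _ (Int2Z C (Int2_prod Iw Iw))); first by rewrite /meas2; mea.
exact: le_weight2.
Qed.

Lemma Int_weight2 th F (C : R) y : th < 1 -> meas2 F ->
  (forall y x, `|y| <= 1 -> `|x| <= 1 -> `|F y x| <= C) ->
  Int (fun x => weight th y * weight th x * F y x).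
Proof.
move=> th1 mF FC; rewrite /meas2 in mF.
have Iw := Int_weight (R := R) th1.
apply: (le_Int _ _ (IntZ C (IntZ (weight th y) Iw))); first by mea.
exact: le_weight2.
Qed.

(** Three exponents occur: th = s gives the densities of the dual functions, th = - s the weighted
    Jacobi polynomials, and th = 1 - s the derivatives of the latter. *)
Definition wp th p x : R := weight th x * p.[x].

Lemma Int_wp th p : th < 1 -> Int (wp th p).
Proof. exact: Int_weight_poly. Qed.

Lemma wp_out th p x : 1 < `|x| -> wp th p x = 0.
Proof. by move=> x1; rewrite /wp weight_out ?mul0r// ltW. Qed.

Lemma wp_le th p : exists2 C, 0 <= C & forall x, `|wp th p x| <= C * weight th x.
Proof.
have [C C0 HC] := poly_bounded p; exists C => // x.
rewrite /wp normrM (ger0_norm (weight_ge0 _ _)) mulrC.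
have [x1|x1] := leP `|x| 1; first by rewrite ler_wpM2r ?weight_ge0 ?HC.
by rewrite weight_out ?mulr0// ltW.
Qed.

Lemma hdec_wp th p : 0 < th -> th < 1 -> hdec (th / 2) (wp th p).
Proof.
move=> th0 th1; have [C C0 HC] := wp_le th p.
have gw := Int_gtest (Int_weight (R := R) th1).
have gp := Int_gtest (Int_wp p th1).
exists (C * heat_sup th) => [|t a t0].
  by rewrite mulr_ge0// /heat_sup mulr_ge0// addr_ge0// divr_ge0// subr_ge0 ltW.
apply: (le_trans (H_norm_le t a gp)).
apply: (@le_trans _ _ (H (fun x => C * weight th x) t a)).
  by apply: le_H HC; [exact: gtest_norm|exact: gtestZ].
rewrite HZ// -mulrA ler_wpM2l//; have := H_weight_le a th0 th1 t0.
by rewrite mulNr.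
Qed.

Lemma hdec_wp_mean0 th m p : th < 1 -> eigp th m p -> m != 0 -> hdec 1 (wp th p).
Proof.
move=> th1 ep m0; apply: hdec_mean0; [exact: Int_wp|exact: wp_out|].
exact: eigp_mean0 ep m0.
Qed.

End double_integrals.

(** * The Jacobi operator applied to the heat kernel *)

Section heat_sturm_liouville.
Context {R : realType}.
Notation mu := (@lebesgue_measure R).
Implicit Types (a b c s t u x y z th m : R) (F K : R -> R -> R) (p r : {poly R}).

Lemma G_derivs t y : 0 < t ->
  [/\ (forall x, is_derive x (1 : R) (fun x => G t (x - y)) (dG t (x - y))),
      (forall x, is_derive x (1 : R) (fun x => dG t (x - y)) (ddG t (x - y))) &
      continuous (fun x => ddG t (x - y))].
Proof.
move=> t0.
have ds x : is_derive x (1 : R) (fun x => x - y) 1 by apply: is_derive_eq; rewrite subr0.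
split=> x.
- have := @is_derive1_comp R (G t) (fun x => x - y) x _ _ (is_derive_G (x - y) t0) (ds x).
  by rewrite mulr1.
- have := @is_derive1_comp R (dG t) (fun x => x - y) x _ _ (is_derive_dG (x - y) t0) (ds x).
  by rewrite mulr1.
- have cs : x' - y @[x' --> x] --> x - y by apply: cvgB; [exact: cvg_id|exact: cvg_cst].
  have cG : {for x - y, continuous (G t)}.
    apply/differentiable_continuous/derivable1_diffP.
    exact: (@ex_derive _ _ _ _ _ _ _ (is_derive_G (x - y) t0)).
  apply: cvgM; last exact: (cvg_comp _ _ cs cG).
  apply: cvgB; last exact: cvg_cst.
  by apply: cvgM; [rewrite expr2; exact: cvgM|exact: cvg_cst].
Qed.

Lemma ddG_le_sup t x : 0 < t -> `|ddG t x| <= 5 * t^-1 * (Num.sqrt (2 * t))^-1.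
Proof.
move=> t0; apply: (le_trans (ddG_le x t0)).
by rewrite ler_wpM2l ?mulr_ge0 ?invr_ge0 ?(ltW t0)// G_le_sqrt// mulr_gt0.
Qed.

Lemma dG_odd t x : dG t (- x) = - dG t x.
Proof. by rewrite /dG G_even; ring. Qed.

Lemma ddG_even t x : ddG t (- x) = ddG t x.
Proof. by rewrite /ddG G_even sqrrN. Qed.

Lemma ddGC t x y : ddG t (x - y) = ddG t (y - x).
Proof. by rewrite -ddG_even opprB. Qed.

Lemma dGC t x y : dG t (x - y) = - dG t (y - x).
Proof. by rewrite -dG_odd opprB. Qed.

Lemma heat_sturm_liouville th m p t y : th < 1 -> eigp th m p -> 0 < t ->
  \int[mu]_x (weight th x * (((1 - x ^+ 2) * ddG t (x - y) -
     2 * (1 - th) * x * dG t (x - y) + m * G t (x - y)) * p.[x])) = 0.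
Proof.
move=> th1 ep t0; have [d1 d2 c2] := G_derivs y t0.
apply: (proj2 (sturm_liouville (M := (Num.sqrt t)^-1 + 4 * t^-1 + 5 * t^-1 * (Num.sqrt (2 * t))^-1)
  th1 ep d1 d2 c2 _)).
move=> x _; have h1 := G_le_sqrt (x - y) t0; have h2 := dG_le_sup (x - y) t0.
have h3 := ddG_le_sup (x - y) t0; have h4 := G_ge0 t (x - y).
rewrite ger0_norm//; move: h1 h2 h3 (normr_ge0 (dG t (x - y))) (normr_ge0 (ddG t (x - y))).
move: (Num.sqrt t)^-1 (4 * t^-1) (5 * t^-1 * _) => A B C h1 h2 h3 h5 h6.
by split; lra.
Qed.

(* The combination of derivatives arising from the difference of the two
   equations; it is a total derivative in time, see [D2_antiderivative]. *)
Definition D2 th t z : R := z * ddG t z + 2 * (1 - th) * dG t z.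

(** Subtract the equation of r, applied in y, from that of p, applied in x. In the second-order
    terms (1 - x^2) - (1 - y^2) = - (x - y) (x + y), and oddness of [dG] turns the first-order terms
    into a multiple of x + y as well. *)
Lemma heat_eigp_pair th m m' p r t : th < 1 -> eigp th m p -> eigp th m' r -> 0 < t ->
  (m - m') * \int[mu]_y \int[mu]_x
     (weight th y * weight th x * (p.[x] * r.[y] * G t (x - y))) =
  \int[mu]_y \int[mu]_x
     (weight th y * weight th x * (p.[x] * r.[y] * ((x + y) * D2 th t (x - y)))).
Proof.
move=> th1 ep er t0.
have [Cp Cp0 HCp] := poly_bounded p; have [Cr Cr0 HCr] := poly_bounded r.
pose gs := (Num.sqrt t)^-1; pose ds := 4 * t^-1; pose dds := 5 * t^-1 * (Num.sqrt (2 * t))^-1.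
have g0 : 0 <= gs by rewrite invr_ge0 sqrtr_ge0.
have d0 : 0 <= ds by rewrite mulr_ge0// invr_ge0 ltW.
have dd0 : 0 <= dds by rewrite !mulr_ge0// ?invr_ge0 ?sqrtr_ge0// ltW.
pose B1 k (x z : R) := (1 - x ^+ 2) * ddG t z - 2 * (1 - th) * x * dG t z + k * G t z.
have B1b k x z : `|x| <= 1 -> `|B1 k x z| <= dds + 2 * (1 - th) * ds + `|k| * gs.
  move=> x1; have /andP[x2 x3] := sqr_le1 x1.
  apply: (le_trans (ler_normD _ _)); apply: lerD; last first.
    by rewrite normrM ler_wpM2l// ger0_norm ?G_ge0// G_le_sqrt.
  apply: (le_trans (ler_normB _ _)); apply: lerD.
    rewrite normrM (ger0_norm x2) -[leRHS]mul1r; apply: ler_pM => //.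
    exact: ddG_le_sup.
  rewrite (normrM (2 * (1 - th) * x)) (normrM (2 * (1 - th))).
  rewrite (ger0_norm (_ : 0 <= 2 * (1 - th))); last by lra.
  rewrite -[leLHS]mulrA; apply: ler_wpM2l; first by lra.
  by rewrite -[leRHS]mul1r; apply: ler_pM => //; exact: dG_le_sup.
have mB k : measurable_fun setT (fun z : R * R => B1 k z.1 z.2) by rewrite /B1; mea.
have pr y x : `|y| <= 1 -> `|x| <= 1 -> `|p.[x] * r.[y]| <= Cp * Cr.
  by move=> y1 x1; rewrite normrM; apply: ler_pM => //; [exact: HCp|exact: HCr].
have I1 : Int2 (fun y x => weight th y * weight th x * (p.[x] * r.[y] * B1 m x (x - y))).
  apply: (Int2_weight (C := Cp * Cr * (dds + 2 * (1 - th) * ds + `|m| * gs)) th1).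
    by have := mB m; rewrite /meas2 => mBm; mea.
  by move=> y x y1 x1; rewrite normrM; apply: ler_pM => //; [exact: pr|exact: B1b].
have I2 : Int2 (fun y x => weight th y * weight th x * (p.[x] * r.[y] * B1 m' y (y - x))).
  apply: (Int2_weight (C := Cp * Cr * (dds + 2 * (1 - th) * ds + `|m'| * gs)) th1).
    by have := mB m'; rewrite /meas2 => mBm; mea.
  by move=> y x y1 x1; rewrite normrM; apply: ler_pM => //; [exact: pr|exact: B1b].
have I3 : Int2 (fun y x => weight th y * weight th x * (p.[x] * r.[y] * G t (x - y))).
  apply: (Int2_weight (C := Cp * Cr * gs) th1); first by rewrite /meas2; mea.
  move=> y x y1 x1; rewrite normrM; apply: ler_pM => //; first exact: pr.
  by rewrite ger0_norm ?G_ge0// G_le_sqrt.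
have Z1 : \int[mu]_y \int[mu]_x
    (weight th y * weight th x * (p.[x] * r.[y] * B1 m x (x - y))) = 0.
  rewrite -[RHS](@RI0 R); apply: eq_RI => y.
  have E := heat_sturm_liouville y th1 ep t0.
  have IE : Int (fun x => weight th x * (B1 m x (x - y) * p.[x])).
    have := mB m => mBm.
    apply: (@Int_weightM _ th _ ((dds + 2 * (1 - th) * ds + `|m| * gs) * Cp)) => //; first by mea.
    by move=> x x1; rewrite normrM; apply: ler_pM => //; [exact: B1b|exact: HCp].
  rewrite -[RHS](mulr0 (weight th y * r.[y])) -E -(RIZ _ IE).
  by apply: eq_RI => x; rewrite /B1; ring.
have Z2 : \int[mu]_y \int[mu]_x
    (weight th y * weight th x * (p.[x] * r.[y] * B1 m' y (y - x))) = 0.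
  rewrite (fub I2) -[RHS](@RI0 R); apply: eq_RI => x.
  have E := heat_sturm_liouville x th1 er t0.
  have IE : Int (fun y => weight th y * (B1 m' y (y - x) * r.[y])).
    have := mB m' => mBm.
    apply: (@Int_weightM _ th _ ((dds + 2 * (1 - th) * ds + `|m'| * gs) * Cr)) => //; first by mea.
    by move=> y y1; rewrite normrM; apply: ler_pM => //; [exact: B1b|exact: HCr].
  rewrite -[RHS](mulr0 (weight th x * p.[x])) -E -(RIZ _ IE).
  by apply: eq_RI => y; rewrite /B1; ring.
have := dintB I1 I2; rewrite Z1 Z2 subr0 => Z.
have J3 := Int2Z (m - m') I3.
pose F1 y x := weight th y * weight th x * (p.[x] * r.[y] * B1 m x (x - y)).
pose F2 y x := weight th y * weight th x * (p.[x] * r.[y] * B1 m' y (y - x)).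
have J12 : Int2 (fun y x => F1 y x - F2 y x).
  by apply: eq_Int2 (Int2D I1 (Int2Z (-1) I2)) => y x; rewrite mulN1r.
have := dintB J3 J12; rewrite Z subr0 (dintZ _ I3) => <-.
apply: eq_RI => y; apply: eq_RI => x; rewrite /F1 /F2 /B1 /D2.
rewrite (ddGC t y) (dGC t y) (GC t y).
by move: (ddG _ _) (dG _ _) (G _ _) => A2 A1 A0; ring.
Qed.

Lemma D2_le th a t z : th < 1 -> 0 < a -> a <= t -> `|z| <= 2 ->
  `|D2 th t z| <= 2 * (5 * a^-1 * (Num.sqrt (2 * a))^-1) + 2 * (1 - th) * (4 * a^-1).
Proof.
move=> th1 a0 at_ z2; have t0 := lt_le_trans a0 at_.
have i1 : t^-1 <= a^-1 by rewrite lef_pV2 ?posrE.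
have i2 : (Num.sqrt (2 * t))^-1 <= (Num.sqrt (2 * a))^-1.
  by rewrite lef_pV2 ?posrE ?sqrtr_gt0 ?mulr_gt0// ler_wsqrtr// ler_wpM2l.
apply: (le_trans (ler_normD _ _)); apply: lerD.
  rewrite normrM; apply: ler_pM => //; apply: (le_trans (ddG_le_sup z t0)).
  apply: ler_pM; rewrite ?mulr_ge0 ?invr_ge0 ?sqrtr_ge0 ?(ltW t0)//.
  by rewrite ler_wpM2l.
rewrite (normrM (2 * (1 - th))) (ger0_norm (_ : 0 <= 2 * (1 - th))); last by lra.
apply: ler_wpM2l; first by lra.
by apply: (le_trans (dG_le_sup z t0)); rewrite ler_wpM2l.
Qed.

Lemma is_derive_dGt t z : 0 < t ->
  is_derive t (1 : R) (fun t => dG t z) (- (t^-1 * dG t z) - z / (2 * t) * ddG t z).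
Proof.
move=> t0; have dGt := is_derive_Gt z t0; have tn : t != 0 by rewrite gt_eqF.
have di := @is_deriveV _ (fun t : R => t) t 1 1 tn (is_derive_id _ _).
have -> : (fun t => dG t z) = (fun t => (- (z / 2)) * (t^-1 * G t z)).
  by apply/funext => u; rewrite /dG invfM; ring.
apply: is_derive_eq; rewrite /GRing.scale /= /dG.
by move: (ddG t z) (G t z) => A B; field.
Qed.

(** Since d/dt [dG] = - dG/t - z ddG/(2 t), the derivative of - 2 t^th dG is t^(th - 1) (z ddG + 2
    (1 - th) dG). The coefficient 1 - th, which comes from the Jacobi weight, matches only if the
    time weight has the same exponent th. *)
Lemma D2_antiderivative th a b z : a < b -> 0 < a ->
  Int (fun t => pk th t * D2 th t z * box a b t) /\
  \int[mu]_t (pk th t * D2 th t z * box a b t) =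
    - 2 * (b `^ th * dG b z - a `^ th * dG a z).
Proof.
move=> ab a0.
pose F t := - 2 * (t `^ th * dG t z).
pose f t := pk th t * D2 th t z.
have [|||I E] := @FTC_box R F f a b ab.
- move=> t /andP[at_ _]; have t0 := lt_le_trans a0 at_.
  have tn : t != 0 by rewrite gt_eqF.
  have d1 := is_derive_dGt z t0.
  have d2 : is_derive t (1 : R) (fun t : R => t `^ th) (th * t `^ (th - 1)).
    have [->|th0] := eqVneq th 0.
      have -> : (fun t : R => t `^ 0) = fun=> 1 by apply/funext => u; rewrite powRr0.
      by rewrite mul0r; exact: is_derive_cst.
    have -> : (fun t : R => t `^ th) = (fun t => th * (th^-1 * t `^ th)).
      by apply/funext => u; rewrite mulVKf.
    by have d := is_derive_pow t0 th0; apply: is_derive_eq.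
  apply: is_derive_eq; rewrite /GRing.scale /= /f /D2 /pk t0.
  have -> : t `^ th = t * t `^ (th - 1).
    by rewrite -[X in _ = X * _](powRr1 (ltW t0)) -powD//; congr (_ `^ _); ring.
  by move: (ddG t z) (dG t z) (t `^ (th - 1)) => A B W; field.
- move=> t /andP[at_ _]; have t0 := lt_le_trans a0 at_.
  have tn : t != 0 by rewrite gt_eqF.
  have cG : {for t, continuous (G ^~ z)}.
    apply/differentiable_continuous/derivable1_diffP.
    exact: (@ex_derive _ _ _ _ _ _ _ (is_derive_Gt z t0)).
  have cd : {for t, continuous (fun t => dG t z)}.
    apply/differentiable_continuous/derivable1_diffP.
    exact: (@ex_derive _ _ _ _ _ _ _ (is_derive_dGt z t0)).
  have ci : {for t, continuous (fun t : R => t^-1)} by apply: cvgV => //; exact: cvg_id.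
  have cdd : {for t, continuous (fun t => ddG t z)}.
    have -> : (fun t => ddG t z) = (fun t => (z ^+ 2 / 4 * (t^-1 * t^-1) - 2^-1 * t^-1) * G t z).
      by apply/funext => u; rewrite /ddG !expr2 !invfM; ring.
    apply: cvgM; last exact: cG.
    apply: cvgB; apply: cvgM; [exact: cvg_cst| |exact: cvg_cst|exact: ci].
    by apply: cvgM; exact: ci.
  have cp : {for t, continuous (pk th)}.
    have e : pk th t = t `^ (th - 1) by rewrite /pk t0.
    rewrite /prop_for /continuous_at e.
    apply: cvg_trans (continuous_powR_gt0 (a := th - 1) t0).
    apply: near_eq_cvg; have lt : \forall x \near t, 0 < x by exact: lt_nbhsr.
    by near=> u; rewrite /pk; have -> : 0 < u by near: u.
  apply: cvgM; first exact: cp.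
  by apply: cvgD; apply: cvgM; try exact: cvg_cst.
- by rewrite /f /D2; mea.
by split => //; rewrite E /F; ring.
Unshelve. all: by end_near. Qed.

End heat_sturm_liouville.

(** * Vanishing of the time integral for different eigenvalues *)

Section riesz_orthogonality.
Context {R : realType}.
Notation mu := (@lebesgue_measure R).
Implicit Types (a b c s t u x y z : R) (F K : R -> R -> R).
Variables (th m m' ka : R) (p r : {poly R}).
Hypotheses (th0 : 0 < th) (th1 : th < 1) (ep : eigp th m p) (er : eigp th m' r).

Lemma powR_cvg0 (u : nat -> R) a : 0 < a -> (forall n, 0 <= u n) ->
  u n @[n --> \oo] --> (0 : R) -> u n `^ a @[n --> \oo] --> (0 : R).
Proof.
move=> a0 u0 ul; apply/cvgrPdist_le => e e0.
have p0 : 0 < e `^ a^-1 by rewrite powR_gt0.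
have h : \forall n \near \oo, u n < e `^ a^-1 by exact: cvgr_lt ul _ p0.
near=> n; have h2 : u n < e `^ a^-1 by near: n.
rewrite sub0r normrN ger0_norm ?powR_ge0//.
rewrite [leRHS](_ : e = (e `^ a^-1) `^ a); last first.
  by rewrite -powRrM mulVf ?powRr1 ?(ltW e0)// gt_eqF.
by apply: ge0_ler_powR; rewrite ?nnegrE ?(ltW a0) ?u0 ?(ltW p0) ?(ltW h2).
Unshelve. all: by end_near. Qed.

Let w : R -> R := weight th.
Let Phi t := \int[mu]_x (H (wp th p) t x * wp th r x).
Let B t := \int[mu]_y \int[mu]_x (w y * w x * (p.[x] * r.[y] * ((x + y) * dG t (x - y)))).

Let PhiE t : Phi t = \int[mu]_y \int[mu]_x (w y * w x * (p.[x] * r.[y] * G t (x - y))).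
Proof.
have gp := Int_gtest (Int_wp p th1).
apply: eq_RI => y; rewrite -RIZr; last exact: gtest_slice.
by apply: eq_RI => x; rewrite /wp /w; ring.
Qed.

Let mPhi : measurable_fun setT Phi.
Proof.
have mH := meas_H (Int_gtest (Int_wp p th1)).
have mr := Int_meas (Int_wp r th1).
by apply: (@meas_RIT _ _ _ (fun t x => H (wp th p) t x * wp th r x)); mea.
Qed.

Let xy2 x y : `|x| <= 1 -> `|y| <= 1 -> `|x + y| <= 2.
Proof. by move=> x1 y1; apply: (le_trans (ler_normD _ _)); lra. Qed.

Let x_y2 x y : `|x| <= 1 -> `|y| <= 1 -> `|x - y| <= 2.
Proof. by move=> x1 y1; apply: (le_trans (ler_normB _ _)); lra. Qed.

(** At late times the supremum bound on [dG] suffices: t^th times 1/t tends to 0 because th < 1. *)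
Let B_large : exists C, forall t, 0 < t -> `|B t| <= C * t^-1.
Proof.
have [Cp Cp0 HCp] := poly_bounded p; have [Cr Cr0 HCr] := poly_bounded r.
have Iw := Int_weight (R := R) th1.
exists (Cp * Cr * (2 * 4) * ((\int[mu]_x w x) * \int[mu]_x w x)) => t t0.
pose C := Cp * Cr * (2 * (4 * t^-1)).
have bd y x : `|y| <= 1 -> `|x| <= 1 -> `|p.[x] * r.[y] * ((x + y) * dG t (x - y))| <= C.
  move=> y1 x1; rewrite (normrM (p.[x] * r.[y])) (normrM (x + y)) (normrM p.[x]).
  apply: ler_pM; rewrite ?mulr_ge0//; apply: ler_pM; rewrite ?HCp ?HCr ?xy2//.
  exact: dG_le_sup.
have mF : meas2 (fun y x => p.[x] * r.[y] * ((x + y) * dG t (x - y))) by rewrite /meas2; mea.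
have IK := Int2Z C (Int2_prod Iw Iw).
have := norm_dint (Int2_weight th1 mF bd) IK (fun y => Int_weight2 y th1 mF bd) _ (le_weight2 th bd).
move=> /(_ (fun y => IntZ C (IntZ (weight th y) Iw))); move/le_trans; apply.
rewrite (dintZ _ (Int2_prod Iw Iw)).
rewrite (eq_RI (g := fun y => w y * \int[mu]_x w x)) ?RIZr//; last by move=> y; rewrite RIZ.
rewrite /C; move: (t^-1) (\int[mu]_x w x) => T W; rewrite le_eqVlt; apply/orP; left.
by apply/eqP; ring.
Qed.

(** At short times [dG] is too singular for absolute values. Exchanging x and y and averaging, its
    oddness produces p(x) r(y) - p(y) r(x), which is O(|x - y|); as |z| |dG| is bounded by a heat
    kernel, only the rate t^(-th/2) of the flow of the weight remains. *)
Let B_small : exists C, forall t, 0 < t -> `|B t| <= C * t `^ (- th / 2).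
Proof.
have [Cp Cp0 HCp] := poly_bounded p; have [Cr Cr0 HCr] := poly_bounded r.
have [Lp Lp0 HLp] := poly_lip p; have [Lr Lr0 HLr] := poly_lip r.
have Iw := Int_weight (R := R) th1; have w0 := @weight_ge0 R th.
have gw := Int_gtest Iw.
pose Q := Lp * Cr + Cp * Lr; pose W := \int[mu]_x w x.
have W0 : 0 <= W by exact: RI_ge0.
have Q0 : 0 <= Q by rewrite addr_ge0// mulr_ge0.
exists (2^-1 * (2 * Q * 12 * (W * heat_sup th))) => t t0.
have t2 : 0 < 2 * t by rewrite mulr_gt0.
pose F y x := p.[x] * r.[y] * ((x + y) * dG t (x - y)).
have mF : meas2 F by rewrite /meas2 /F; mea.
have bF y x : `|y| <= 1 -> `|x| <= 1 -> `|F y x| <= Cp * Cr * (2 * (4 * t^-1)).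
  move=> y1 x1; rewrite (normrM (p.[x] * r.[y])) (normrM (x + y)) (normrM p.[x]).
  apply: ler_pM; rewrite ?mulr_ge0//; apply: ler_pM; rewrite ?HCp ?HCr ?xy2//.
  exact: dG_le_sup.
have I1 := Int2_weight th1 mF bF; have I2 := Int2_swap I1.
have zdG z : `|z * dG t z| <= 12 * G (2 * t) z.
  have -> : z * dG t z = - (2 * t * ddG t z + G t z) by rewrite /dG /ddG; field; rewrite gt_eqF.
  rewrite normrN; apply: (le_trans (ler_normD _ _)).
  rewrite (normrM (2 * t)) (gtr0_norm t2) (ger0_norm (G_ge0 _ _)).
  have h1 := ddG_le z t0; have h2 := G_le_G z t0 (_ : t <= 2 * t).
  have s2 : Num.sqrt (2 * t / t) <= 2 :> R by rewrite mulfK ?gt_eqF// sqrt2_le2.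
  have h3 : G t z <= 2 * G (2 * t) z.
    by apply: (le_trans (h2 _)); [lra|rewrite ler_wpM2r ?G_ge0].
  have h4 : 2 * t * `|ddG t z| <= 2 * t * (5 * t^-1 * G (2 * t) z) by rewrite ler_wpM2l// ltW.
  have e4 : 2 * t * (5 * t^-1 * G (2 * t) z) = 10 * G (2 * t) z by field; rewrite gt_eqF.
  by lra.
pose K y x := 2 * Q * 12 * G (2 * t) (x - y).
(* The factor |x - y| comes from the Lipschitz bounds of p and r on [-1,1]. *)
have FK y x : `|y| <= 1 -> `|x| <= 1 -> `|F y x + F x y| <= K y x.
  move=> y1 x1.
  have -> : F y x + F x y = (x + y) *
      ((p.[x] - p.[y]) * r.[y] - p.[y] * (r.[x] - r.[y])) * dG t (x - y).
    by rewrite /F (dGC t y x); ring.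
  rewrite (normrM ((x + y) * _)) (normrM (x + y)).
  have h1 : `|(p.[x] - p.[y]) * r.[y] - p.[y] * (r.[x] - r.[y])| <= Q * `|x - y|.
    apply: (le_trans (ler_normB _ _)); rewrite !normrM /Q mulrDl; apply: lerD.
      by rewrite mulrAC; apply: ler_pM => //; [exact: HLp|exact: HCr].
    by rewrite -mulrA; apply: ler_pM => //; [exact: HCp|exact: HLr].
  apply: (@le_trans _ _ (2 * (Q * `|x - y|) * `|dG t (x - y)|)).
    by apply: ler_wpM2r => //; apply: ler_pM => //; exact: xy2.
  rewrite /K -!mulrA; apply: ler_wpM2l => //; apply: ler_wpM2l => //.
  by rewrite -normrM; exact: zdG.
have mFF : meas2 (fun y x => F y x + F x y).
  have := mF; rewrite /meas2 => mF'.
  have mS : measurable_fun setT (fun z : R * R => F z.2 z.1) by rewrite /F; mea.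
  by mea.
have bFF y x : `|y| <= 1 -> `|x| <= 1 ->
    `|F y x + F x y| <= 2 * Q * 12 * (Num.sqrt (2 * t))^-1.
  move=> y1 x1; apply: (le_trans (FK y x y1 x1)); apply: ler_wpM2l; first by rewrite !mulr_ge0.
  exact: G_le_sqrt.
have mK : meas2 K by rewrite /meas2 /K; mea.
have bK y x : `|y| <= 1 -> `|x| <= 1 -> `|K y x| <= 2 * Q * 12 * (Num.sqrt (2 * t))^-1.
  move=> y1 x1; rewrite ger0_norm; last by rewrite /K !mulr_ge0 ?G_ge0.
  by apply: ler_wpM2l; [rewrite !mulr_ge0|exact: G_le_sqrt].
have BE : 2 * B t = \int[mu]_y \int[mu]_x (w y * w x * (F y x + F x y)).
  have e1 : B t = \int[mu]_y \int[mu]_x (w y * w x * F x y).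
    by rewrite /B (fub I1); apply: eq_RI => y; apply: eq_RI => x; rewrite [w x * _]mulrC.
  have I2' : Int2 (fun y x => w y * w x * F x y).
    by apply: eq_Int2 I2 => y x; rewrite [weight th x * _]mulrC.
  have := dintB I1 (Int2Z (-1) I2'); rewrite (dintZ _ I2') -e1 -/(B t) mulN1r opprK -mulr2n mulr_natl => <-.
  by apply: eq_RI => y; apply: eq_RI => x; rewrite mulN1r opprK mulrDr.
have le2 y x : `|w y * w x * (F y x + F x y)| <= w y * w x * K y x.
  rewrite (normrM (w y * w x)) (ger0_norm (mulr_ge0 (w0 _) (w0 _))).
  have [y1|y1] := leP `|y| 1; last by rewrite /w (weight_out th (ltW y1)) !mul0r.
  have [x1|x1] := leP `|x| 1; last by rewrite /w (weight_out th (ltW x1)) !mulr0 !mul0r.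
  by apply: ler_wpM2l; [rewrite mulr_ge0|exact: FK].
have main := norm_dint (Int2_weight th1 mFF bFF) (Int2_weight th1 mK bK)
   (fun y => Int_weight2 y th1 mFF bFF) (fun y => Int_weight2 y th1 mK bK) le2.
have Kint : \int[mu]_y \int[mu]_x (w y * w x * K y x) <=
    2 * Q * 12 * (W * heat_sup th) * t `^ (- th / 2).
  have E y : \int[mu]_x (w y * w x * K y x) = 2 * Q * 12 * (w y * H w (2 * t) y).
    rewrite mulrA -RIZ; last exact: gtest_slice.
    by apply: eq_RI => x; rewrite /K; ring.
  have hb y : H w (2 * t) y <= heat_sup th * t `^ (- th / 2).
    apply: (le_trans (H_weight_le y th0 th1 t2)); apply: ler_wpM2l.
      by rewrite /heat_sup mulr_ge0// addr_ge0// divr_ge0// subr_ge0 ltW.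
    rewrite mulNr !powRN lef_pV2 ?posrE ?powR_gt0//.
    apply: ge0_ler_powR; rewrite ?nnegrE ?(ltW t0) ?(ltW t2)//; last by lra.
    by rewrite divr_ge0// ltW.
  have mH : measurable_fun setT (fun z : R * R => H w z.1 z.2) := meas_H gw.
  have IwH : Int (fun y => w y * H w (2 * t) y).
    have mHt : measurable_fun setT (fun y => H w (2 * t) y) by mea.
    apply: (Int_weightM th1 mHt (M := heat_sup th * t `^ (- th / 2))) => y _.
    by rewrite ger0_norm ?H_ge0.
  have le3 : \int[mu]_y (w y * H w (2 * t) y) <= W * (heat_sup th * t `^ (- th / 2)).
    rewrite /W -(RIZr _ Iw); apply: le_RI => //; last by move=> y; apply: ler_wpM2l.
    by apply: eq_Int (IntZ (heat_sup th * t `^ (- th / 2)) Iw) => y; exact: mulrC.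
  rewrite (eq_RI E) RIZ//.
  rewrite [leRHS](_ : _ = 2 * Q * 12 * (W * (heat_sup th * t `^ (- th / 2)))); last first.
    by rewrite -(mulrA (2 * Q * 12)) -(mulrA W).
  by apply: ler_wpM2l le3; rewrite mulr_ge0// mulr_ge0.
have : 2 * `|B t| <= 2 * Q * 12 * (W * heat_sup th) * t `^ (- th / 2).
  by rewrite -[X in X * _](ger0_norm (_ : 0 <= 2 :> R))// -normrM BE; exact: le_trans main Kint.
by rewrite -(mulrA 2^-1) ler_pdivlMl.
Qed.

(** Times are kept in a compact interval away from 0, where the kernel derivatives are bounded and
    Fubini in three variables is harmless; [B] is the boundary term left by the total derivative. *)
Let B_identity a b : 0 < a -> a < b ->
  (m - m') * \int[mu]_t (pk th t * Phi t * box a b t) =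
  - 2 * (b `^ th * B b - a `^ th * B a).
Proof.
move=> a0 ab.
have [Cp Cp0 HCp] := poly_bounded p; have [Cr Cr0 HCr] := poly_bounded r.
have Iw := Int_weight (R := R) th1; have w0 := @weight_ge0 R th.
have Ib := Int_box (R := R) a b.
pose D0 := 2 * (5 * a^-1 * (Num.sqrt (2 * a))^-1) + 2 * (1 - th) * (4 * a^-1).
have h1 := th1.
have D00 : 0 <= D0 by rewrite addr_ge0 ?mulr_ge0 ?invr_ge0 ?sqrtr_ge0 ?(ltW a0)//; lra.
pose M := a `^ (th - 1) * (Cp * Cr * (2 * D0)).
pose L t y x := p.[x] * r.[y] * ((x + y) * D2 th t (x - y)).
pose K t y x := pk th t * box a b t * (w y * w x * L t y x).
have Lb t y x : a <= t -> `|y| <= 1 -> `|x| <= 1 -> `|L t y x| <= Cp * Cr * (2 * D0).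
  move=> at_ y1 x1; rewrite (normrM (p.[x] * r.[y])) (normrM (x + y)) (normrM p.[x]).
  apply: ler_pM; rewrite ?mulr_ge0//; apply: ler_pM; rewrite ?HCp ?HCr ?xy2//.
  by apply: D2_le => //; exact: x_y2.
have Kb t y x : `|K t y x| <= M * (box a b t * (w y * w x)).
  rewrite (normrM (pk th t * _)) (normrM (pk th t)) (ger0_norm (pk_ge0 _ _)) (ger0_norm (box_ge0 _ _ _)).
  rewrite /box; case: ifP => [/andP[at_ tb]|_]; last by rewrite mulr0 !mul0r mulr0.
  rewrite mulr1 mul1r /M -(mulrA (a `^ _)); apply: ler_pM; [exact: pk_ge0|exact: normr_ge0| |].
    rewrite /pk (lt_trans a0 at_) -(opprB 1 th) !powRN lef_pV2 ?posrE ?powR_gt0 ?(lt_trans a0 at_)//.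
    by apply: ge0_ler_powR; rewrite ?nnegrE ?(ltW a0) ?(ltW at_) ?(ltW (lt_trans a0 at_))//; lra.
  by have := le_weight2 (F := L t) th (fun y x => @Lb t y x (ltW at_)) y x.
have mK : measurable_fun setT (fun z : (R * R) * R => K z.1.1 z.1.2 z.2).
  by rewrite /K /L /D2 /w; mea.
have mKI : meas2 (fun t y => \int[mu]_x K t y x).
  by apply: (@meas_RIT R _ _ (fun z : R * R => K z.1 z.2)).
have IK1 : Int2 (fun t y => \int[mu]_x K t y x).
  apply: (le_Int2 mKI _ (Int2Z (M * \int[mu]_x w x) (Int2_prod Ib Iw))) => t y.
  have IB : Int (fun x => M * (box a b t * (w y * w x))) by do 3! apply: IntZ.
  have mKx : measurable_fun setT (fun x => K t y x) by rewrite /K /L /D2 /w; mea.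
  have IKx := le_Int mKx (Kb t y) IB.
  apply: (le_trans (norm_RI_le IKx IB (Kb t y))).
  have [i1 i2] : Int (fun x => w y * w x) /\ Int (fun x => box a b t * (w y * w x)).
    by split; do 2? apply: IntZ.
  rewrite (RIZ M i2) (RIZ (box a b t) i1) (RIZ (w y) (Iw : Int w)).
  have E0 (c1 c2 c3 c4 : R) : c1 * (c2 * (c3 * c4)) = c1 * c4 * (c2 * c3) by ring.
  by rewrite E0.
have IK2 y : Int2 (fun t x => K t y x).
  apply: (le_Int2 _ _ (Int2Z (M * w y) (Int2_prod Ib Iw))).
    by rewrite /meas2 /K /L /D2 /w; mea.
  have E0 (c1 c2 c3 c4 : R) : c1 * (c2 * (c3 * c4)) = c1 * c3 * (c2 * c4) by ring.
  by move=> t x; apply: (le_trans (Kb t y x)); rewrite E0.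
have E1 t : (m - m') * (pk th t * Phi t * box a b t) = \int[mu]_y \int[mu]_x K t y x.
  have [t0|t0] := leP t a.
    have b0 : box a b t = 0 by rewrite /box ltNge t0.
    rewrite b0 !mulr0 -[LHS](@RI0 R); apply: eq_RI => y; rewrite -[LHS](@RI0 R).
    by apply: eq_RI => x; rewrite /K b0 mulr0 mul0r.
  have tp := lt_trans a0 t0.
  have mL : meas2 (L t) by rewrite /meas2 /L /D2; mea.
  have IL := Int2_weight th1 mL (fun y x => @Lb t y x (ltW t0)).
  transitivity (pk th t * box a b t * ((m - m') * Phi t)); first by ring.
  by rewrite PhiE (heat_eigp_pair th1 ep er tp) -(dintZ _ IL).
(* Integrability of the left side is recovered by dividing by m - m'; if this is 0 the identity is
   trivial. *)
have IPhi : Int (fun t => pk th t * Phi t * box a b t) \/ m - m' = 0.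
  have [->|mn] := eqVneq (m - m') 0; [by right|left].
  by apply: eq_Int (IntZ (m - m')^-1 (Int2_Int IK1)) => t; rewrite -E1 mulKf.
have -> : (m - m') * \int[mu]_t (pk th t * Phi t * box a b t) =
    \int[mu]_t \int[mu]_y \int[mu]_x K t y x.
  rewrite -(eq_RI E1); case: IPhi => [I|->]; first by rewrite RIZ.
  by rewrite mul0r -[LHS](@RI0 R); apply: eq_RI => t; rewrite mul0r.
rewrite (fub IK1).
have IB1 t : 0 < t -> Int2 (fun y x => w y * w x * (p.[x] * r.[y] * ((x + y) * dG t (x - y)))).
  move=> t0; apply: (Int2_weight (C := Cp * Cr * (2 * (4 * t^-1))) th1).
    by rewrite /meas2; mea.
  move=> y x y1 x1; rewrite (normrM (p.[x] * r.[y])) (normrM (x + y)) (normrM p.[x]).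
  apply: ler_pM; rewrite ?mulr_ge0//; apply: ler_pM; rewrite ?HCp ?HCr ?xy2//.
  exact: dG_le_sup.
have b0 := lt_trans a0 ab.
rewrite mulrBr (mulrA (- 2) (b `^ th)) (mulrA (- 2) (a `^ th)) -(dintZ _ (IB1 b b0)) -(dintZ _ (IB1 a a0)).
rewrite -(dintB (Int2Z _ (IB1 b b0)) (Int2Z _ (IB1 a a0))).
apply: eq_RI => y; rewrite (fub (IK2 y)); apply: eq_RI => x.
have [I E] := D2_antiderivative th (x - y) ab a0.
transitivity (\int[mu]_t (w y * w x * (p.[x] * r.[y] * (x + y)) *
    (pk th t * D2 th t (x - y) * box a b t))).
  by apply: eq_RI => t; rewrite /K /L; ring.
rewrite (RIZ _ I) E.
move: (dG b _) (dG a _) (b `^ th) (a `^ th) (w y) (w x) => d1 d2 p1 p2 w1 w2; ring.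
Qed.

Lemma riesz_orth : th < ka -> hdec ka (wp th p) -> m != m' ->
  \int[mu]_t (pk th t * \int[mu]_x (H (wp th p) t x * wp th r x)) = 0.
Proof.
move=> tk dp mm; rewrite -/Phi.
have Ip := Int_wp p th1; have Ir := Int_wp r th1.
have h0 := th0; have h1 := th1; have h2 : th / 2 < th by lra.
have [_ IPhi _] := riesz_pair_bounded Ip Ir h2 tk (hdec_wp p th0 th1) dp.
(* The factor 2 keeps [rad n] strictly below [T n] even for n = 0, where [rad n] is 1. *)
pose T n : R := 2 / rad n.
have T0 n : 0 < T n by rewrite divr_gt0 ?rad_gt0.
have aT n : rad n < T n :> R.
  rewrite /T ltr_pdivlMr ?rad_gt0//; have := rad_gt0 (R := R) n; have := rad_le1 (R := R) n; nra.
have L1 : (m - m') * \int[mu]_t (pk th t * Phi t * box (rad n) (T n) t) @[n --> \oo] -->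
    (m - m') * \int[mu]_t (pk th t * Phi t).
  apply: cvgM; first exact: cvg_cst.
  apply: (@dct _ _ _ (fun t => `|pk th t * Phi t|)).
  - by move=> n; mea.
  - exact: Int_meas IPhi.
  - exact: Int_norm.
  - by move=> n t; rewrite (normrM (pk th t * _)) ler_piMr// norm_box.
  - apply: ae_all => t; have [t0|t0] := ltP 0 t; last first.
      rewrite (pk_neg th t0) mul0r; under eq_fun do rewrite mul0r; exact: cvg_cst.
    apply: cvg_near_cst.
    have r1 : \forall n \near \oo, rad n < t by exact: cvgr_lt (@rad_cvg R) _ t0.
    have t1 : 0 < t^-1 by rewrite invr_gt0.
    have r2 : \forall n \near \oo, rad n < t^-1 by exact: cvgr_lt (@rad_cvg R) _ t1.
    near=> n; rewrite /box; have -> : rad n < t by near: n.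
    have h : rad n < t^-1 by near: n.
    have -> /= : t < T n; last by rewrite mulr1.
    rewrite /T ltr_pdivlMr ?rad_gt0//.
    have : t * rad n < 1 by rewrite mulrC -ltr_pdivlMr// div1r.
    by lra.
have L2 : - 2 * (T n `^ th * B (T n) - rad n `^ th * B (rad n)) @[n --> \oo] --> (0 : R).
  have [C1 HC1] := B_large; have [C2 HC2] := B_small.
  rewrite -[X in _ --> X](mulr0 (-2)) -[X in -2 * X](subr0 0).
  apply: cvgM; first exact: cvg_cst.
  have r0 n : 0 <= rad n :> R by rewrite ltW// rad_gt0.
  apply: cvgB; apply: norm_cvg0.
    apply: (@squeeze_cvgr _ _ _ _ (fun=> 0) (fun n => C1 * (rad n) `^ (1 - th))).
    - near=> n; rewrite normr_ge0 normrM (ger0_norm (powR_ge0 _ _)).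
      apply: (@le_trans _ _ (T n `^ th * (C1 * (T n)^-1))).
        by rewrite ler_wpM2l ?powR_ge0// HC1.
      have C10 : 0 <= C1.
        by have := le_trans (normr_ge0 _) (HC1 1 ltr01); rewrite invr1 mulr1.
      rewrite mulrCA; apply: ler_wpM2l => //.
      rewrite -(powR_inv1 (ltW (T0 n))) -powD//.
      have -> : T n `^ (th - 1) = (T n)^-1 `^ (1 - th).
        by rewrite -(powR_inv1 (ltW (T0 n))) -powRrM; congr (_ `^ _); ring.
      apply: ge0_ler_powR; rewrite ?nnegrE ?invr_ge0 ?(ltW (T0 n)) ?r0//; first by lra.
      by rewrite /T invf_div ler_pdivrMr// ler_peMr// ler1n.
    - exact: cvg_cst.
    - rewrite -[X in _ --> X](mulr0 C1); apply: cvgM; first exact: cvg_cst.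
      by apply: powR_cvg0 => //; [lra|exact: rad_cvg].
  apply: (@squeeze_cvgr _ _ _ _ (fun=> 0) (fun n => C2 * (rad n) `^ (th / 2))).
  - near=> n; rewrite normr_ge0 normrM (ger0_norm (powR_ge0 _ _)).
    apply: (@le_trans _ _ (rad n `^ th * (C2 * rad n `^ (- th / 2)))).
      by rewrite ler_wpM2l ?powR_ge0// HC2// rad_gt0.
    rewrite mulrCA -powD ?rad_gt0//.
    by rewrite (_ : th + - th / 2 = th / 2)//; field.
  - exact: cvg_cst.
  - rewrite -[X in _ --> X](mulr0 C2); apply: cvgM; first exact: cvg_cst.
    by apply: powR_cvg0 => //; [rewrite divr_gt0|exact: rad_cvg].
have Z : (m - m') * \int[mu]_t (pk th t * Phi t) = 0.
  apply: (cvg_unique _ L1); rewrite //.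
  rewrite (_ : (fun n => _) = fun n => - 2 * (T n `^ th * B (T n) - rad n `^ th * B (rad n)))//.
  by apply/funext => n; rewrite B_identity ?rad_gt0.
by apply/eqP; move/eqP: Z; rewrite mulf_eq0 subr_eq0 (negPf mm).
Unshelve. all: by end_near. Qed.

End riesz_orthogonality.

(** * The multiplier definition and the space Hs *)

Section riesz_modes.
Context {R : realType}.
Notation mu := (@lebesgue_measure R).
Implicit Types (a b c s t u x y z th ka : R) (f g q r v h : R -> R) (p : {poly R}).

(** Only late-time decay of q is required: pairing with a kernel at time t > 0 already makes the
    short-time part bounded, hence integrable against u^(b - 1). *)
Lemma heat_riesz_weak b ka q t a : Int q -> 0 < b -> b < ka -> hdec ka q -> 0 < t ->
  Int (fun x => riesz b q x * G t (x - a)) /\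
  H (riesz b q) t a = \int[mu]_u (pk b u * H q (t + u) a).
Proof.
move=> Iq b0 bk [C C0 hC] t0; have mH := meas_H (Int_gtest Iq).
have [D D0 HD] := pk_two_sided b0 bk.
pose N := \int[mu]_x `|q x|; have N0 : 0 <= N by apply: RI_ge0.
pose S := (Num.sqrt t)^-1; have S0 : 0 <= S by rewrite invr_ge0 sqrtr_ge0.
pose h u := \int[mu]_x `|H q u x * G t (x - a)|.
have h0 u : 0 <= h u by apply: RI_ge0.
have mG : measurable_fun setT (fun x => G t (x - a)) by mea.
have GS x : `|G t (x - a)| <= S by rewrite ger0_norm ?G_ge0// G_le_sqrt.
have IH u : 0 < u -> Int (fun x => H q u x * G t (x - a)).
  by move=> u0; apply: eq_Int (IntMb mG GS (Int_Ht Iq u0)) => x; rewrite mulrC.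
have mh : measurable_fun setT h.
  by apply: (@meas_RIT _ _ _ (fun u x => `|H q u x * G t (x - a)|)); mea.
have Ih : Int (fun u => pk b u * h u).
  apply: (HD (S * N) C 1 h _ _ _ _ _ _).1; rewrite ?mulr_ge0// => u u0; rewrite ger0_norm//.
    rewrite oppr0 powRr0 mulr1; apply: (@le_trans _ _ (\int[mu]_x (S * `|H q u x|))).
      apply: le_RI; [exact/Int_norm/IH|exact/IntZ/Int_norm/Int_Ht|] => x.
      by rewrite normrM mulrC ler_wpM2r.
    by rewrite RIZ ?ler_wpM2l ?RI_norm_H//; exact/Int_norm/Int_Ht.
  apply: (@le_trans _ _ (\int[mu]_x (C * u `^ (- ka) * G t (x - a)))).
    apply: le_RI; [exact/Int_norm/IH|exact/IntZ/Int_G|] => x.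
    by rewrite normrM (ger0_norm (G_ge0 _ _)) ler_wpM2r ?G_ge0 ?hC.
  by rewrite RIZ ?RI_G ?mulr1//; exact: Int_G.
have IHh u : 0 < u -> Int (fun x => H q u x * G t (x - a)) /\
    \int[mu]_x `|H q u x * G t (x - a)| <= h u by move=> u0; split; [exact: IH|exact: lexx].
have [I _ E] := riesz_pair Iq mG Ih IHh.
split; first exact: I.
apply: (etrans E); apply: eq_RI => u; have [u0|u0] := ltP 0 u; last by rewrite (pk_neg b u0) !mul0r.
by congr (_ * _); rewrite [t + u]addrC; have [_ <-] := H_semigroup a (Int_gtest Iq) u0 t0.
Qed.

Lemma gtest_riesz b ka q : Int q -> 0 < b -> b < ka -> hdec ka q -> gtest (riesz b q).
Proof. by move=> Iq b0 bk dq t a t0; have [] := heat_riesz_weak a Iq b0 bk dq t0. Qed.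

Lemma heat_riesz_MMw b ka q t a : Int q -> 0 < b -> b <= 1 -> b < ka -> hdec ka q ->
  adm (- (2 * b)) (fm q a) -> 0 < t ->
  2 * pi * H (riesz b q) t a = gamma_c b * MM (- (2 * b)) (fm q a) t.
Proof.
move=> Iq b0 b1 bk dq am t0; apply: heat_riesz_MM => //.
by have [] := heat_riesz_weak a Iq b0 bk dq t0.
Qed.

Section family.
Variables (th : R) (E : nat -> {poly R}).
Hypotheses (th0 : 0 < th) (th1 : th < 1) (sE : forall n, size (E n) = n.+1)
  (eE : forall n, eigp th (eigval th n) (E n)).

Lemma eig_family_orth i j : i != j -> ip (weight th) (horner (E i)) (horner (E j)) = 0.
Proof. by move=> ij; apply: (eigp_orth th1 (eE i) (eE j)); exact: eigval_inj. Qed.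

Lemma riesz_mode n p ka : eigp th (eigval th n) p -> th < ka -> hdec ka (wp th p) ->
  exists c, {ae mu, forall x, `|x| < 1 -> riesz th (wp th p) x = c * (E n).[x]}.
Proof.
move=> ep tk dp; have Ip := Int_wp p th1; have h0 := th0; have h2 : th / 2 < th by lra.
have dp2 := hdec_wp p th0 th1.
have [_ [M HM]] := riesz_bounded Ip h2 tk dp2 dp.
have LR : L2 (weight th) (riesz th (wp th p)).
  by apply: (L2_weight th1 (riesz_meas th Ip) (M := M)) => x _.
apply: (one_mode th1 sE eig_family_orth LR) => i ni.
have [_ _ e] := riesz_pair_bounded Ip (Int_wp (E i) th1) h2 tk dp2 dp.
have nn : eigval th n != eigval th i by apply: eigval_inj => //; rewrite eq_sym.
rewrite -(riesz_orth th0 th1 ep (eE i) tk dp nn) -e.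
by apply: eq_RI => x; rewrite /wp -mulrA [(E i).[x] * _]mulrC.
Qed.

End family.

End riesz_modes.

(** * The multiplier definition tested on Gaussians *)

Section multiplier.
Context {R : realType}.
Notation mu := (@lebesgue_measure R).
Implicit Types (a b c s t u x y z th ka : R) (f g q r v h : R -> R) (p : {poly R}).

Lemma Int_gauss_cos t b : 0 < t -> Int (fun x => expR (- (t * x ^+ 2)) * cos (b * x)).
Proof. by move=> t0; apply: Int_cos; [mea|exact: Int_gauss]. Qed.

Lemma fourier_gauss_cos t a x : 0 < t ->
  fourier_cos (fun y => expR (- (t * y ^+ 2)) * cos (a * y)) x = pi * (G t (a - x) + G t (a + x)).
Proof.
move=> t0; have [E1 _] := fourier_gauss (a - x) t0; have [E2 _] := fourier_gauss (a + x) t0.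
have -> : pi * (G t (a - x) + G t (a + x)) =
  2^-1 * (2 * pi * G t (a - x)) + 2^-1 * (2 * pi * G t (a + x)) by field.
rewrite -E1 -E2 -!RIZ; [|exact: Int_gauss_cos..].
rewrite -RID; [|exact/IntZ/Int_gauss_cos..].
by apply: eq_RI => y; rewrite mulrBl mulrDl cosB cosD [y * x]mulrC; field.
Qed.

Lemma fourier_gauss_sin t a x : 0 < t ->
  fourier_sin (fun y => expR (- (t * y ^+ 2)) * sin (a * y)) x = pi * (G t (a - x) - G t (a + x)).
Proof.
move=> t0; have [E1 _] := fourier_gauss (a - x) t0; have [E2 _] := fourier_gauss (a + x) t0.
have -> : pi * (G t (a - x) - G t (a + x)) =
  2^-1 * (2 * pi * G t (a - x)) - 2^-1 * (2 * pi * G t (a + x)) by field.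
rewrite -E1 -E2 -!RIZ; [|exact: Int_gauss_cos..].
rewrite -RIB; [|exact/IntZ/Int_gauss_cos..].
by apply: eq_RI => y; rewrite mulrBl mulrDl cosB cosD [y * x]mulrC; field.
Qed.

(** Inserting Gaussians times cos(a x) and times sin(a x) and adding the two identities recovers the
    transform centred at a, that is, the heat flow of g at a. *)
Lemma multiplier_heat s q g : is_fracLap_multiplier (- s) q g ->
  gtest g /\ forall a, adm (- (2 * s)) (fm q a) /\
    forall t, 0 < t -> 2 * pi * H g t a = MM (- (2 * s)) (fm q a) t.
Proof.
move=> [Iq h]; have gg : gtest g by move=> t a t0; have [] := h _ (schwartz_G a t0).
have e2 : 2 * - s = - (2 * s) by rewrite mulrN.
have K a t : 0 < t -> Int (fun x => `|x| `^ (- (2 * s)) * expR (- (t * x ^+ 2)) * fm q a x) /\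
    2 * pi * H g t a = MM (- (2 * s)) (fm q a) t.
  move=> t0; have [_ I1 _ E1 _] := h _ (schwartz_gauss_cos a t0).
  have [_ _ I2 _ E2] := h _ (schwartz_gauss_sin a t0).
  rewrite e2 in I1 I2 E1 E2.
  have F x : `|x| `^ (- (2 * s)) * fourier_cos q x * (expR (- (t * x ^+ 2)) * cos (a * x)) +
    `|x| `^ (- (2 * s)) * fourier_sin q x * (expR (- (t * x ^+ 2)) * sin (a * x)) =
    `|x| `^ (- (2 * s)) * expR (- (t * x ^+ 2)) * fm q a x.
    by rewrite fmE//; ring.
  split; first exact: eq_Int F (IntD I1 I2).
  rewrite /MM -(eq_RI F) RID// -E1 -E2.
  have Ja := gg t a t0; have Jb := gg t (- a) t0.
  (* Each transform is a combination of the kernels centred at a and at - a; the latter cancel in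
     the sum. *)
  have C1 x : g x * fourier_cos (fun y => expR (- (t * y ^+ 2)) * cos (a * y)) x =
      pi * (g x * G t (x - a)) + pi * (g x * G t (x - - a)).
    by rewrite fourier_gauss_cos// GC opprK [x + a]addrC; ring.
  have C2 x : g x * fourier_sin (fun y => expR (- (t * y ^+ 2)) * sin (a * y)) x =
      pi * (g x * G t (x - a)) - pi * (g x * G t (x - - a)).
    by rewrite fourier_gauss_sin// GC opprK [x + a]addrC; ring.
  rewrite (eq_RI C1) (eq_RI C2) RID ?RIB; [|exact: IntZ..].
  rewrite !RIZ// /H; ring.
by split=> // a; split=> [t t0|t t0]; have [] := K a t t0.
Qed.

(** Scaling by 2: if I were the finite integral of x^(b-1) over (0,1), the part over (1/2,1), which
    is positive, would equal (1 - 2^(-b)) I, which is at most 0. *)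
Lemma not_Int_pow b (f : R -> R) (c : R) : b <= 0 -> 0 < c ->
  (forall x, 0 < x < 1 -> c * x `^ (b - 1) <= f x) -> ~ Int f.
Proof.
move=> b0 c0 hf If.
pose i x : R := if x < 1 then 1 else 0.
have mf := Int_meas If.
have Ii : Int (fun x => pk b x * i x).
  apply: (le_Int _ _ (IntZ c^-1 (Int_norm If))); first by rewrite /pk /i; mea.
  move=> x; rewrite /pk /i; case: ifP => x0; last first.
    by rewrite mul0r normr0 mulr_ge0// invr_ge0 ltW.
  case: ifP => x1; last by rewrite mulr0 normr0 mulr_ge0// invr_ge0 ltW.
  rewrite mulr1 ger0_norm ?powR_ge0// ler_pdivlMl//.
  by apply: le_trans (ler_norm _); apply: hf; rewrite x0 x1.
have [J E] := pk_scale (l := 2) (f := i) (ltr0n R 2) Ii.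
have P : 0 < \int[mu]_x (pk b x * i x - pk b x * i (2 * x)).
  apply: (RI_gt0 (a := 2^-1) (b := 1) (c := 1) (IntB Ii J)) => //.
  - move=> x; rewrite -mulrBr mulr_ge0 ?pk_ge0// /i.
    case: (ltP x 1) => x1; case: (ltP (2 * x) 1) => x2; rewrite ?subrr ?subr0//.
    have : 0 <= 0 :> R by [].
    by move=> _; lra.
  - by lra.
  - move=> x /andP[x0 x1]; rewrite /i x1 (_ : 2 * x < 1 = false); last by apply/negbTE; rewrite -leNgt; lra.
    have x00 : 0 < x by lra.
    rewrite mulr0 subr0 mulr1 /pk x00.
    rewrite (_ : b - 1 = - (1 - b)); last by ring.
    rewrite powRN invf_ge1 ?powR_gt0//.
    have := ge0_ler_powR (_ : 0 <= 1 - b) _ _ (ltW x1); rewrite powR1; apply; rewrite ?nnegrE//; lra.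
move: P; rewrite RIB// E -{1}[X in X - _]mul1r -mulrBl.
have I0 : 0 <= \int[mu]_x (pk b x * i x).
  by apply: RI_ge0 => x; rewrite mulr_ge0 ?pk_ge0// /i; case: ifP.
apply/negP; rewrite -leNgt mulr_le0_ge0// subr_le0.
have l : (1 : R) <= 2 by lra.
have nb : 0 <= - b by lra.
by rewrite -[leLHS](powRr0 2) ler_powR.
Qed.

End multiplier.

Section weighted_jacobi_wp.
Context {R : realType}.
Implicit Types (a s x : R) (n : nat).

(** At the end points both sides vanish because 0 [^ a = 0 for a <> 0; for a = 0 the convention 0]^
    0 = 1 would break the equality there. *)
Lemma weighted_jacobiE a n : -1 < a -> a != 0 ->
  weighted_jacobi a a n = wp (- a) (jacp a n) :> (R -> R).
Proof.
move=> a1 a0; apply/funext => x; rewrite /weighted_jacobi /wp /weight opprK.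
case: ifPn => [|xn]; last first.
  rewrite ltr_norml; case: ifPn => [/andP[h1 h2]|]; last by rewrite mul0r.
  by move: xn; rewrite (ltW h1) (ltW h2).
move=> x1; have := x1 => /andP[xm xp]; rewrite jacpE//.
have -> : Num.max 0 (1 - x) = 1 - x by apply/max_idPr; rewrite subr_ge0.
have -> : Num.max 0 (1 + x) = 1 + x by apply/max_idPr; lra.
rewrite -powRM ?subr_ge0//; last by lra.
have -> : (1 - x) * (1 + x) = 1 - x ^+ 2 by ring.
rewrite ltr_norml; case: ifPn => //; rewrite negb_and -!leNgt => /orP[h|h].
  have -> : x = -1 by apply/eqP; rewrite eq_le h xm.
  by rewrite sqrrN expr1n subrr powR0 ?mul0r.
have -> : x = 1 by apply/eqP; rewrite eq_le xp h.
by rewrite expr1n subrr powR0 ?mul0r.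
Qed.

End weighted_jacobi_wp.

Section fracLap_uniqueness.
Context {R : realType}.
Notation mu := (@lebesgue_measure R).
Implicit Types (c s x : R) (u v g : R -> R).

Lemma is_fracLap_pos s u g : 0 < s -> is_fracLap s u g = is_fracLap_weak s u g.
Proof. by rewrite /is_fracLap => ->. Qed.

Lemma fracLap_witness s u g : is_fracLap s u g -> is_fracLap s u (fracLap s u).
Proof. by move=> h; rewrite /fracLap; apply: (@xgetPex _ (fun=> 0) [set g | is_fracLap s u g]); exists g. Qed.

Lemma fracLap_default s u : ~ (exists g, is_fracLap s u g) -> fracLap s u = fun=> 0.
Proof. by move=> h; apply: xgetPN => g gh; apply: h; exists g. Qed.

Lemma fracLap_weakZ s c v g : is_fracLap_weak s v g ->
  is_fracLap_weak s (fun x => c * v x) (fun x => c * g x).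
Proof.
move=> h phi sp; have [I1 I2 E] := h phi sp.
have F1 x : c * v x * fracLap_pv s phi x = c * (v x * fracLap_pv s phi x) by rewrite mulrA.
have F2 x : c * g x * phi x = c * (g x * phi x) by rewrite mulrA.
split; [exact: eq_Int (fun x => esym (F1 x)) (IntZ c I1)|exact: eq_Int (fun x => esym (F2 x)) (IntZ c I2)|].
by rewrite (eq_RI F1) (eq_RI F2) (RIZ c I1) (RIZ c I2) E.
Qed.

Lemma gtest_fracLap s v : 0 < s -> gtest (fracLap s v).
Proof.
move=> s0; have [[g h]|h] := pselect (exists g, is_fracLap s v g).
  by have := fracLap_witness h; rewrite is_fracLap_pos//; exact: fracLap_weak_gtest.
rewrite fracLap_default//; apply: (@bounded_gtest _ 0) => // x; rewrite normr0//.
Qed.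

(** Also true when v has no fractional Laplacian: both sides then take the default value 0, since
    for c <> 0 a Laplacian of c v would give one of v. The case c = 0 needs uniqueness. *)
Lemma fracLapZ s c v : 0 < s ->
  {ae mu, forall x, fracLap s (fun x => c * v x) x = c * fracLap s v x}.
Proof.
move=> s0; have [[g h]|h] := pselect (exists g, is_fracLap s v g).
  have w := fracLap_witness h; rewrite is_fracLap_pos// in w.
  have w2 := fracLap_weakZ c w.
  have w3 : is_fracLap s (fun x => c * v x) (fun x => c * fracLap s v x) by rewrite is_fracLap_pos.
  have := fracLap_witness w3; rewrite is_fracLap_pos// => w4.
  exact: fracLap_weak_uniq w4 w2.
rewrite (fracLap_default h).
have [->|c0] := eqVneq c 0.
  have w0 : is_fracLap_weak s (fun x => 0 * v x) (fun=> 0).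
    move=> phi sp; split.
    - by apply: eq_Int (Int0 (R := R)) => x; rewrite !mul0r.
    - by apply: eq_Int (Int0 (R := R)) => x; rewrite mul0r.
    - by apply: eq_RI => x; rewrite !mul0r.
  have w1 : is_fracLap s (fun x => 0 * v x) (fracLap s (fun x => 0 * v x)).
    by apply: (@fracLap_witness _ _ (fun=> 0)); rewrite is_fracLap_pos.
  rewrite is_fracLap_pos// in w1.
  by apply: ae_mp (fracLap_weak_uniq w1 w0) => x ->; rewrite mulr0.
rewrite fracLap_default; first by apply: ae_all => x; rewrite mulr0.
move=> [g]; rewrite is_fracLap_pos// => hg; apply: h; exists (fun x => c^-1 * g x).
rewrite is_fracLap_pos//; have := fracLap_weakZ c^-1 hg.
by congr is_fracLap_weak; apply/funext => x; rewrite mulKf.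
Qed.

End fracLap_uniqueness.

(** * Norm and inner product as integrals over the whole line *)

Section hs_space.
Context {R : realType}.
Notation mu := (@lebesgue_measure R).
Variable s : R.
Hypotheses (s0 : 0 < s) (s1 : s < 1).
Implicit Types (u v f g : R -> R).
Let w : R -> R := weight s.
Let ww : wt w := wt_weight s.
Let L := fracLap (s / 2).
Let s20 : 0 < s / 2. Proof. by rewrite divr_gt0. Qed.

Lemma meas_fracLap v : measurable_fun setT (fracLap (s / 2) v).
Proof. exact: gtest_meas (gtest_fracLap v s20). Qed.

Lemma weight_restrict f : (fun x => (f x * w x)%:E) =
  (fun x => (f x * w x)%:E) \_ `](-1)%R, 1%R[.
Proof.
apply/funext => x; rewrite patchE mem_setE in_itv/= -ltr_norml /w /weight.
by case: ifP => // _; rewrite mulr0.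
Qed.

Lemma int_restrict f : (\int[mu]_(x in `](-1)%R, 1%R[) (f x * w x)%:E =
  \int[mu]_x (f x * w x)%:E)%E.
Proof. by rewrite [LHS]integral_mkcond -weight_restrict. Qed.

Lemma RI_restrict f : \int[mu]_(x in `](-1)%R, 1%R[) (f x * w x) = \int[mu]_x (f x * w x).
Proof. by rewrite /Rintegral int_restrict. Qed.

Lemma Hs_innerE u v : Hs_inner s u v = ip w u v + ip (fun=> 1) (L u) (L v).
Proof.
rewrite /Hs_inner (RI_restrict (fun x => u x * v x)); congr (_ + _).
by apply: eq_RI => x; rewrite mulr1.
Qed.

Lemma int_fin_L2 rho f : wt rho -> measurable_fun setT f ->
  (\int[mu]_x (f x ^+ 2 * rho x)%:E < +oo)%E ->
  L2 rho f /\ (\int[mu]_x (f x ^+ 2 * rho x)%:E)%E = (ip rho f f)%:E.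
Proof.
move=> [mr r0] mf fin.
have I : Int (fun x => f x ^+ 2 * rho x).
  apply: IntP; first by mea.
  rewrite (_ : (fun x => _) = (fun x => (f x ^+ 2 * rho x)%:E))//; apply/funext => x.
  by rewrite ger0_norm// mulr_ge0 ?sqr_ge0.
by split=> //; rewrite Int_fin// ip_sqr.
Qed.

Lemma sqnorm_ge0 rho f : wt rho -> (0 <= \int[mu]_x (f x ^+ 2 * rho x)%:E)%E.
Proof. by move=> [mr r0]; apply: integral_ge0 => x _; rewrite lee_fin mulr_ge0 ?sqr_ge0. Qed.

Lemma Hs_sqnormE0 f : Hs_sqnorm s f = (\int[mu]_x (f x ^+ 2 * w x)%:E +
  \int[mu]_x (L f x ^+ 2 * 1)%:E)%E.
Proof.
rewrite /Hs_sqnorm (int_restrict (fun x => f x ^+ 2)); congr (_ + _)%E.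
by apply: eq_integral => x _; rewrite mulr1.
Qed.

Lemma Hs_sqnorm_fin f : measurable_fun setT f -> (Hs_sqnorm s f < +oo)%E ->
  [/\ L2 w f, L2 (fun=> 1) (L f) & Hs_sqnorm s f = (ip w f f + ip (fun=> 1) (L f) (L f))%:E].
Proof.
move=> mf; rewrite Hs_sqnormE0 => fin.
have p1 := sqnorm_ge0 f ww; have p2 := sqnorm_ge0 (L f) wt1.
have [L1 ->] : L2 w f /\ (\int[mu]_x (f x ^+ 2 * w x)%:E)%E = (ip w f f)%:E.
  by apply: int_fin_L2 => //; apply: le_lt_trans fin; rewrite leeDl.
have [L2' ->] : L2 (fun=> 1) (L f) /\
    (\int[mu]_x (L f x ^+ 2 * 1)%:E)%E = (ip (fun=> 1) (L f) (L f))%:E.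
  by apply: (int_fin_L2 wt1 (meas_fracLap f)); apply: le_lt_trans fin; rewrite leeDr.
by split => //; rewrite EFinD.
Qed.

Lemma Hs_facts u : Hs s u -> [/\ L2 w u, L2 (fun=> 1) (L u),
  Hs_sqnorm s u = (ip w u u + ip (fun=> 1) (L u) (L u))%:E,
  is_fracLap_weak (s / 2) u (L u) & {ae mu, forall x, 1 < `|x| -> u x = 0}].
Proof.
move=> [mu_ fin supp [g [hg mg fing]]].
have hL : is_fracLap_weak (s / 2) u (L u).
  by rewrite -is_fracLap_pos//; exact: fracLap_witness hg.
rewrite is_fracLap_pos// in hg.
have e := fracLap_weak_uniq hL hg.
have eL : (\int[mu]_x (L u x ^+ 2)%:E = \int[mu]_x (g x ^+ 2)%:E)%E.
  apply: ae_eq_integral => //.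
  - by apply/measurable_EFinP; have := meas_fracLap u; mea.
  - by apply/measurable_EFinP; mea.
  - by apply: ae_mp e => x -> _.
have [] := Hs_sqnorm_fin mu_.
  rewrite /Hs_sqnorm; apply: lte_add_pinfty => //.
  by rewrite -/L eL.
move=> L1 L2' E; split => //.
by apply: ae_mp supp => x h x1; apply: h => /andP[h1 h2]; move: x1; rewrite ltNge ler_norml h1 h2.
Qed.

(** When the norm of f is infinite the normalised function is 0 by convention, and the term simply
    drops out of the frame sum. *)
Lemma Hs_inner_normalize u f : measurable_fun setT f -> Hs s u ->
  Hs_inner s u (Hs_normalize s f) ^+ 2 =
  if (Hs_sqnorm s f < +oo)%E then
    (ip w u f + ip (fun=> 1) (L u) (L f)) ^+ 2 / (ip w f f + ip (fun=> 1) (L f) (L f))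
  else 0.
Proof.
move=> mf hu; have [Lu Lgu _ _ _] := Hs_facts hu.
pose c := (Num.sqrt (fine (Hs_sqnorm s f)))^-1.
have E1 : Hs_normalize s f = fun x => c * f x by apply/funext => x; rewrite /Hs_normalize mulrC.
have mc : measurable_fun setT (fun x => c * f x) by mea.
have mLf := meas_fracLap f; have mLu := meas_fracLap u.
have mLc := meas_fracLap (fun x => c * f x).
have E2 : Hs_inner s u (Hs_normalize s f) =
    \int[mu]_x (u x * (c * f x) * w x) + \int[mu]_x (L u x * (c * L f x) * 1).
  rewrite Hs_innerE E1; congr (_ + _); apply: ae_eq_RI.
  - by move: mLu mLc; rewrite /L; move: (fracLap _ u) (fracLap _ (fun x => c * f x)) => k k' mk mk'; mea.
  - by move: mLu mLf; rewrite /L; move: (fracLap _ u) (fracLap _ f) => k k' mk mk'; mea.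
  - by apply: ae_mp (fracLapZ c f s20) => x; rewrite /L => ->.
rewrite E2; case: ifPn => [fin|]; last first.
  rewrite -leNgt leye_eq => /eqP inf; rewrite /c inf/= sqrtr0 invr0.
  rewrite (eq_RI (g := fun=> 0)) => [|x]; last by rewrite mul0r mulr0 mul0r.
  rewrite [X in _ + X](eq_RI (g := fun=> 0)) => [|x]; last by rewrite mul0r mulr0 mul0r.
  by rewrite !RI0 addr0 expr0n.
have [Lf LLf EN] := Hs_sqnorm_fin mf fin.
have -> : \int[mu]_x (u x * (c * f x) * w x) = c * ip w u f.
  rewrite -RIZ; last exact: (L2_Int ww Lu Lf).
  by apply: eq_RI => x; rewrite [in LHS]mulrCA -[LHS]mulrA.
have -> : \int[mu]_x (L u x * (c * L f x) * 1) = c * ip (fun=> 1) (L u) (L f).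
  rewrite -RIZ; last exact: (L2_Int wt1 Lgu LLf).
  by apply: eq_RI => x; rewrite [in LHS]mulrCA -[LHS]mulrA.
rewrite -mulrDr exprMn mulrC /c EN/= exprVn sqr_sqrtr//.
by rewrite addr_ge0 ?ip_ge0//; exact: wt1.
Qed.

End hs_space.

(** * The dual system *)

Opaque Rintegral powR riesz H pk.

Lemma ip_ae_scale {R : realType} (w f g h k : R -> R) (a b : R) : wt w ->
  measurable_fun setT f -> measurable_fun setT g -> L2 w h -> L2 w k ->
  {ae @lebesgue_measure R, forall x, w x != 0 -> f x = a * h x} ->
  {ae @lebesgue_measure R, forall x, w x != 0 -> g x = b * k x} ->
  ip w f g = a * b * ip w h k.
Proof.
move=> ww mf mg Lh Lk ef eg; have mh := Lh.1; have mk := Lk.1; have mw := ww.1.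
rewrite -RIZ; last exact: (L2_Int ww).
apply: ae_eq_RI; [by mea|by mea|].
apply: ae_mp (ae_and ef eg) => x [e1 e2].
have [->|wx] := eqVneq (w x) 0; first by rewrite !mulr0.
by rewrite e1// e2//; ring.
Qed.

Lemma ip1_ae_scale {R : realType} (f g h k : R -> R) (a b : R) :
  L2 (fun=> 1) f -> L2 (fun=> 1) g ->
  {ae @lebesgue_measure R, forall x, f x = a * h x} ->
  {ae @lebesgue_measure R, forall x, g x = b * k x} ->
  measurable_fun setT h -> measurable_fun setT k ->
  (a != 0 -> b != 0 -> L2 (fun=> 1) h -> L2 (fun=> 1) k ->
   \int[@lebesgue_measure R]_x (h x * k x) = 0) ->
  ip (fun=> 1) f g = 0.
Proof.
move=> Lf Lg ef eg mh mk H0; have mf := Lf.1; have mg := Lg.1.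
have -> : ip (fun=> 1) f g = \int[@lebesgue_measure R]_x (a * b * (h x * k x)).
  apply: ae_eq_RI; [by mea|by mea|].
  by apply: ae_mp (ae_and ef eg) => x [-> ->]; ring.
have Z : a * b = 0 -> \int[@lebesgue_measure R]_x (a * b * (h x * k x)) = 0.
  by move=> ab; rewrite (eq_RI (g := fun=> 0)) ?RI0// => x; rewrite ab mul0r.
have [a0|a0] := eqVneq a 0; first by apply: Z; rewrite a0 mul0r.
have [b0|b0] := eqVneq b 0; first by apply: Z; rewrite b0 mulr0.
have Lr (g0 r : R -> R) (c : R) : c != 0 -> measurable_fun setT r -> L2 (fun=> 1) g0 ->
    {ae @lebesgue_measure R, forall x, g0 x = c * r x} -> L2 (fun=> 1) r.
  move=> c0 mr [_ Ig] e; split=> //.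
  apply: ae_eq_Int (IntZ (c^-1 ^+ 2) Ig); first by mea.
  by apply: ae_mp e => x ->; rewrite !mulr1 exprMn mulrA -exprMn mulVf// expr1n mul1r.
have Lh := Lr _ _ _ a0 mh Lf ef; have Lk := Lr _ _ _ b0 mk Lg eg.
rewrite RIZ ?H0 ?mulr0//.
by apply: eq_Int (L2_Int wt1 Lh Lk) => x; rewrite mulr1.
Qed.

(** The Engel form of the Cauchy-Schwarz inequality. The hypotheses on x and y force A or B to
    vanish with its denominator, which makes the convention 1/0 = 0 harmless. *)
Lemma titu {R : realType} (A B a b : R) : 0 <= a -> 0 <= b ->
  forall x y, A ^+ 2 <= x * a -> B ^+ 2 <= y * b ->
  (A + B) ^+ 2 / (a + b) <= A ^+ 2 / a + B ^+ 2 / b.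
Proof.
move=> a0 b0 x y hA hB.
have z c C d : C ^+ 2 <= d * c -> c = 0 -> C = 0 :> R.
  by move=> h c0; apply/eqP; rewrite -sqrf_eq0 eq_le sqr_ge0 andbT -(mulr0 d) -c0.
have [ae|an] := eqVneq a 0; first by rewrite (z _ _ _ hA ae) ae !add0r expr0n mul0r add0r.
have [be|bn] := eqVneq b 0; first by rewrite (z _ _ _ hB be) be !addr0 expr0n mul0r addr0.
have a1 : 0 < a by rewrite lt0r an.
have b1 : 0 < b by rewrite lt0r bn.
rewrite ler_pdivrMr ?addr_gt0// -subr_ge0.
have -> : (A ^+ 2 / a + B ^+ 2 / b) * (a + b) - (A + B) ^+ 2 = (A * b - B * a) ^+ 2 / (a * b).
  by field; rewrite an bn.
by rewrite divr_ge0 ?sqr_ge0 ?mulr_ge0.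
Qed.

Section dual_system.
Context {R : realType}.
Notation mu := (@lebesgue_measure R).
Variable s : R.
Hypotheses (s0 : 0 < s) (s1 : s < 1).
Implicit Types (a b c t x y z : R) (u v f g : R -> R) (n i j : nat).
Let w : R -> R := weight s.
Let ww : wt w := wt_weight s.
Let E n : {poly R} := jacp (- s) n.
Let q n : R -> R := wp s (E n).
Let p n : R -> R := ext_jacobi (- s) (- s) n.
Let f n : R -> R := fracLap (s / 2) (p n).
(** A rate above s is needed for long times. Below 1/2 the rate of integrable functions is enough;
    otherwise the density must have mean 0, which gives the rate 1. *)
Let ka : R := if s < 2^-1 then 2^-1 else 1.
Let one : R -> R := fun=> 1.

Let sm1 : -1 < - s. Proof. by rewrite ltrN2. Qed.
Let s2_gt0 : 0 < s / 2. Proof. by rewrite divr_gt0. Qed.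
Let s2_le1 : s / 2 <= 1. Proof. by have := s1; lra. Qed.
Let s2_lt : s / 2 < s. Proof. by have := s0; lra. Qed.
Let s_le1 : s <= 1. Proof. exact: ltW. Qed.
Let s_lt_ka : s < ka. Proof. by rewrite /ka; case: ifP. Qed.
Let s2_lt_ka : s / 2 < ka. Proof. by have := s_lt_ka; have := s0; lra. Qed.
Let sE n : size (E n) = n.+1. Proof. exact: size_jacp. Qed.
Let eE n : eigp s (eigval s n) (E n).
Proof. by have := eigp_jacp n sm1; rewrite opprK. Qed.
Let Iq n : Int (q n). Proof. exact: Int_wp. Qed.

Let pE n : p n = fracLap (- s) (q n).
Proof.
have sN : - s != 0 by rewrite oppr_eq0 gt_eqF.
by rewrite /p /ext_jacobi (weighted_jacobiE n sm1 sN) opprK.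
Qed.

(** The transform of the weight is nonzero at 0, and |x|^(- 2 s) is not integrable there. *)
Lemma dual_not_adm : 2^-1 <= s -> ~ adm (- (2 * s)) (fm (q 0) 0).
Proof.
move=> s2 /(_ 1 ltr01) I.
have [c c0 E0] : exists2 c, c != 0 & forall x, (E 0).[x] = c.
  have /size_poly1P[c c0 Ec] : size (E 0) == 1%N by rewrite sE.
  by exists c => // x; rewrite Ec hornerC.
have Iw : Int w by exact: Int_weight.
have W0 : 0 < \int[mu]_x w x.
  apply: (RI_gt0 (a := -1) (b := 1) (c := 1) Iw) => //.
  - by move=> x; exact: weight_ge0.
  - move=> x; rewrite -ltr_norml => x1; rewrite /w /weight x1.
    have /andP[h0 h1] := sqr_le1 (ltW x1).
    rewrite powRN invf_ge1 ?powR_gt0 ?sqr_lt1//.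
    by have := ge0_ler_powR (ltW s0) _ _ h1; rewrite powR1; apply; rewrite nnegrE.
pose W := \int[mu]_x w x.
(* On the support |y| <= 1, so cos(y x) >= 1 - |y x| >= 1/2 and the transform keeps at least half of
   its value at 0. *)
have hm x : 0 < x < 2^-1 -> `|c| * (2^-1 * W) <= `|fm (q 0) 0 x|.
  move=> /andP[x0 x2].
  have -> : fm (q 0) 0 x = c * \int[mu]_y (w y * cos (y * x)).
    rewrite -RIZ; last by apply: Int_cos => //; mea.
    by apply: eq_RI => y; rewrite /q /wp E0 subr0 mulrA [c * _]mulrC.
  rewrite normrM ler_wpM2l// -RIZ//; apply: le_trans (ler_norm _).
  apply: le_RI; [exact: IntZ|by apply: Int_cos => //; mea|move=> y].
  rewrite mulrC; have [y1|y1] := leP 1 `|y|; first by rewrite /w weight_out// !mul0r.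
  rewrite ler_wpM2l ?weight_ge0//.
  have := cos_lip (y * x) 0; rewrite cos0 subr0 ler_norml => /andP[h _].
  have : `|y * x| <= 1 * 2^-1 by rewrite normrM (gtr0_norm x0) ler_pM// ltW.
  by lra.
(* The argument is halved because the transform is controlled on (0,1/2), while the comparison takes
   place on (0,1). *)
apply: (@not_Int_pow _ (1 - 2 * s) (fun x => `| (`|2^-1 * x + 0| `^ (- (2 * s)) *
   expR (- (1 * (2^-1 * x + 0) ^+ 2)) * fm (q 0) 0 (2^-1 * x + 0)) |) (2^-1 * (`|c| * (2^-1 * W)))).
- by lra.
- by rewrite !mulr_gt0// normr_gt0.
- move=> x /andP[x0 x1]; rewrite addr0 mul1r; set y := 2^-1 * x.
  have y0 : 0 < y by rewrite mulr_gt0.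
  have y2 : y < 2^-1 by rewrite /y; lra.
  have yx : y <= x by rewrite /y; lra.
  move: y y0 y2 yx => y y0 y2 yx.
  rewrite [leLHS]mulrC mulrA normrM (normrM (_ `^ _)) (ger0_norm (powR_ge0 _ _)) (ger0_norm (expR_ge0 _)).
  rewrite (_ : 1 - 2 * s - 1 = - (2 * s)); last by ring.
  apply: ler_pM; rewrite ?mulr_ge0 ?powR_ge0//.
  + rewrite ltW//.
  + apply: ler_pM => //; rewrite ?powR_ge0//.
      rewrite (gtr0_norm y0) !powRN lef_pV2 ?posrE ?powR_gt0//.
      by rewrite ge0_ler_powR ?nnegrE ?(ltW y0) ?(ltW x0)// mulr_ge0 ?(ltW s0).
    apply: le_trans (expR_ge1D _); have : y ^+ 2 <= 2^-1 ^+ 2 by rewrite ler_pXn2r ?nnegrE ?ltW.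
    by lra.
  + by apply: hm; rewrite y0 y2.
- apply: Int_norm; apply: (@Int_affine _ 2^-1 0
    ( fun x => `|x| `^ (- (2 * s)) * expR (- (1 * x ^+ 2)) * fm (q 0) 0 x)) => //.
Qed.

(** For 1/2 <= s, admissibility excludes the index 0, and for positive index the density is
    orthogonal to constants. *)
Lemma dual_hdec n : (forall a, adm (- (2 * s)) (fm (q n) a)) -> hdec ka (q n).
Proof.
rewrite /ka; case: ifPn => [_ _|]; first exact: hdec_half.
rewrite -leNgt => s2 h; case: n h => [/(_ 0)/(dual_not_adm s2)//|n _].
exact: (hdec_wp_mean0 s1 (eE n.+1) (eigval_neq0 _ _)).
Qed.

Let good n := hdec ka (q n) /\ (forall a, adm (- (2 * s)) (fm (q n) a)) /\
  {ae mu, forall x, p n x = (gamma_c s)^-1 * riesz s (q n) x}.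

(** Either no function satisfies the multiplier definition and the default 0 is taken, or the
    Gaussian pairings identify the dual function with the Riesz potential; in the second case the
    decay needed for that potential comes with it. *)
Lemma dual_alt n : p n = (fun=> 0) \/ good n.
Proof.
rewrite pE; have [[g h]|h] := pselect (exists g, is_fracLap (- s) (q n) g); last first.
  by left; exact: fracLap_default.
right; have := fracLap_witness h; rewrite -pE /is_fracLap ltNge oppr_le0 (ltW s0)/=.
move=> /multiplier_heat[gp hp].
have ha a : adm (- (2 * s)) (fm (q n) a) by have [] := hp a.
have dq := dual_hdec ha; split => //; split => //.
have gr := gtest_riesz (Iq n) s0 s_lt_ka dq.
apply: gtest_uniq => //; first exact: gtestZ.
move=> t a t0; rewrite HZ//; have [_ /(_ _ t0) e1] := hp a.
have e2 := heat_riesz_MMw (Iq n) s0 s_le1 s_lt_ka dq (ha a) t0.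
have p0 : 2 * pi != 0 :> R by rewrite mulf_neq0 ?gt_eqF ?pi_gt0.
apply: (mulfI p0); rewrite e1 mulrCA e2 mulKf// gt_eqF//; exact: gamma_c_gt0.
Qed.

Let mp n : measurable_fun setT (p n).
Proof.
have [->|[dq [ha e]]] := dual_alt n; first exact: measurable_cst.
rewrite pE; have [[g h]|h] := pselect (exists g, is_fracLap (- s) (q n) g); last first.
  by rewrite fracLap_default//; exact: measurable_cst.
have := fracLap_witness h; rewrite /is_fracLap ltNge oppr_le0 (ltW s0)/=.
by move=> /multiplier_heat[gp _]; exact: gtest_meas.
Qed.

Lemma dual_orth i j : i != j -> ip w (p i) (p j) = 0.
Proof.
move=> ij; have [->|[di [_ ei]]] := dual_alt i.
  by rewrite /ip (eq_RI (g := fun=> 0)) ?RI0// => x; rewrite !mul0r.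
have [->|[dj [_ ej]]] := dual_alt j.
  by rewrite /ip (eq_RI (g := fun=> 0)) ?RI0// => x; rewrite mulr0 mul0r.
have [ci hi] := riesz_mode s0 s1 sE eE (eE i) s_lt_ka di.
have [cj hj] := riesz_mode s0 s1 sE eE (eE j) s_lt_ka dj.
have pm n c : {ae mu, forall x, p n x = (gamma_c s)^-1 * riesz s (q n) x} ->
    {ae mu, forall x, `|x| < 1 -> riesz s (q n) x = c * (E n).[x]} ->
    {ae mu, forall x, w x != 0 -> p n x = (gamma_c s)^-1 * c * (E n).[x]}.
  move=> h1 h2; apply: ae_mp (ae_and h1 h2) => x [e1 e2] wx.
  rewrite e1 e2 ?mulrA// ltNge; apply: contra wx => x1.
  by rewrite /w weight_out.
rewrite (ip_ae_scale ww (mp i) (mp j) (L2_weight_poly _ s1) (L2_weight_poly _ s1) (pm _ _ ei hi) (pm _ _ ej hj)).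
by rewrite (eig_family_orth s1 eE ij) mulr0.
Qed.

(** The rule (-Delta)^(s/2) (-Delta)^(-s) = (-Delta)^(-s/2), checked on Gaussian pairings, where the
    exponent - 2 s + s = - s appears on both sides. *)
Lemma dual_fracLap n : {ae mu, forall x, f n x = 0} \/
  good n /\ exists C, {ae mu, forall x, f n x = C * riesz (s / 2) (q n) x}.
Proof.
have [p0|gd] := dual_alt n.
  left; have -> : f n = fracLap (s / 2) (fun x => 0 * p n x).
    by rewrite /f; congr fracLap; apply/funext => x; rewrite p0 mul0r.
  by apply: ae_mp (fracLapZ 0 (p n) s2_gt0) => x ->; rewrite mul0r.
rewrite /f; have [[g h]|h] := pselect (exists g, is_fracLap (s / 2) (p n) g); last first.
  by left; apply: ae_all => x; rewrite fracLap_default.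
have := fracLap_witness h; rewrite is_fracLap_pos// => {g h} h.
right; split => //; have [dq [ha ep]] := gd.
have gf := fracLap_weak_gtest h.
have [_ [M hM]] := riesz_bounded (Iq n) s2_lt s_lt_ka (hdec_wp _ s0 s1) dq.
pose v x := (gamma_c s)^-1 * riesz s (q n) x.
have mr := riesz_meas s (Iq n).
have mv : measurable_fun setT v by rewrite /v; mea.
have tv : tame v.
  apply: (@tame_bounded _ ((gamma_c s)^-1 * M)) => // x; have c0 := gamma_c_gt0 s0 s_le1.
  by rewrite normrM (gtr0_norm (x := (gamma_c s)^-1)) ?invr_gt0// ler_wpM2l ?invr_ge0 ?(ltW c0).
have gv : gtest v := tv.1.
have gr2 := gtest_riesz (Iq n) s2_gt0 s2_lt_ka dq.
have am2 a : adm (- s) (fm (q n) a) by apply: fm_adm => //; have := s0; lra.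
have P0 : 2 * pi != 0 :> R by rewrite mulf_neq0 ?gt_eqF ?pi_gt0.
pose C1 := (2 * pi)^-1 : R.
pose K := fracLap_const (s / 2) * (C1 * gamma_d (s / 2) / cG s).
have Hf t a : 0 < t -> H (fracLap (s / 2) (p n)) t a = K * MM (- s) (fm (q n) a) t.
  move=> t0; rewrite (fracLap_weak_heat _ s0 s1 t0 h) /K -mulrA; congr (_ * _).
  have mL0 := meas_LG s0 s1 t0.
  transitivity (\int[mu]_x (v x * LG s t (x - a))).
    have mpn := mp n; apply: ae_eq_RI; [by mea|by mea|].
    by apply: ae_mp ep => x ->.
  have e2 : - s = - (2 * s) + s by ring.
  have am3 := am2 a; rewrite e2 in am3 |- *.
  apply: (tame_LG_MM s0 s1 t0 tv) => // u u0.
  rewrite /v HZ; last exact: gtest_riesz (Iq n) s0 s_lt_ka dq.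
  have e := heat_riesz_MMw (Iq n) s0 s_le1 s_lt_ka dq (ha a) u0.
  apply: (mulfI P0); rewrite mulrCA e mulKf ?gt_eqF ?gamma_c_gt0//.
  by rewrite /C1 mulrA divff// mul1r.
exists (K * (2 * pi) / gamma_c (s / 2)).
apply: (gtest_uniq gf (gtestZ _ gr2)) => t a t0; rewrite HZ// Hf//.
have e3 : - s = - (2 * (s / 2)) by field.
have am3 := am2 a; rewrite e3 in am3 |- *.
have e := heat_riesz_MMw (Iq n) s2_gt0 s2_le1 s2_lt_ka dq am3 t0.
have g0 : gamma_c (s / 2) != 0 by rewrite gt_eqF ?gamma_c_gt0.
have F (x y z k l : R) : z != 0 -> l * x = z * y -> l * (k * y) = l * (k * l / z * x).
  by move=> z0 e'; rewrite [RHS]mulrCA e'; field.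
by apply: (mulfI P0); exact: F.
Qed.

(** The potentials now have order s/2, and their L2 pairing reduces to the time integral of order 2
    (s/2) = s, the one known to vanish. *)
Lemma dual_fracLap_orth i j : i != j -> L2 one (f i) -> L2 one (f j) -> ip one (f i) (f j) = 0.
Proof.
move=> ij Li Lj.
have z g h : L2 one g -> L2 one h -> {ae mu, forall x, g x = 0} -> ip one g h = 0.
  move=> Lg Lh g0; apply: (@ip1_ae_scale _ _ _ g h 0 1 Lg Lh); rewrite ?eqxx//.
  - by apply: ae_mp g0 => x ->; rewrite mul0r.
  - by apply: ae_all => x; rewrite mul1r.
  - exact: Lg.1.
  - exact: Lh.1.
have [fi|[[di _] [ci hi]]] := dual_fracLap i; first exact: z.
have [fj|[[dj _] [cj hj]]] := dual_fracLap j; first by rewrite ipC z.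
apply: (ip1_ae_scale Li Lj hi hj); [exact: riesz_meas|exact: riesz_meas|].
move=> _ _ Lri Lrj.
have e2 : 2 * (s / 2) = s by field.
apply: (@riesz_energy _ _ (s / 2) ka) => //; rewrite ?e2//; [exact: hdec_wp|exact: hdec_wp|].
by apply: (riesz_orth s0 s1 (eE i) (eE j) s_lt_ka di); exact: eigval_inj.
Qed.

(** Members of infinite norm are replaced by 0, in agreement with the normalised functions, so that
    Bessel applies to two families that lie in L2. *)
Let T n : R -> R := if (Hs_sqnorm s (p n) < +oo)%E then p n else fun=> 0.
Let F n : R -> R := if (Hs_sqnorm s (p n) < +oo)%E then f n else fun=> 0.

Let TF n : [/\ (Hs_sqnorm s (p n) < +oo)%E, T n = p n & F n = f n] \/
  [/\ ~~ (Hs_sqnorm s (p n) < +oo)%E, T n = (fun=> 0) & F n = (fun=> 0)].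
Proof. rewrite /T /F; case: (Hs_sqnorm s (p n) < +oo)%E.
  by left; split; exact: erefl.
by right; split; exact: erefl. Qed.

Lemma dual_upper u N : Hs s u ->
  \sum_(i < N) Hs_inner s u (P_hat s i) ^+ 2 <=
  ip w u u + ip one (fracLap (s / 2) u) (fracLap (s / 2) u).
Proof.
move=> hu; have [Lu LLu _ _ _] := Hs_facts s0 hu.
have LT n : L2 w (T n).
  have [[fin -> _]|[_ -> _]] := TF n; last exact: L2_0.
  by have [Lp _ _] := Hs_sqnorm_fin s0 (mp n) fin; exact: Lp.
have LF n : L2 one (F n).
  have [[fin _ ->]|[_ _ ->]] := TF n; last exact: L2_0.
  by have [_ Lf _] := Hs_sqnorm_fin s0 (mp n) fin; exact: Lf.
have z1 rho g : ip rho (fun=> 0) g = 0.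
  by rewrite /ip (eq_RI (g := fun=> 0)) ?RI0// => x; rewrite !mul0r.
have oT i j : (i < j)%N -> ip w (T i) (T j) = 0.
  move=> ij; have ne : i != j by rewrite neq_ltn ij.
  have [[_ -> _]|[_ -> _]] := TF i; last exact: z1.
  by have [[_ -> _]|[_ -> _]] := TF j; [exact: dual_orth|rewrite ipC z1].
have oF i j : (i < j)%N -> ip one (F i) (F j) = 0.
  move=> ij; have ne : i != j by rewrite neq_ltn ij.
  have := LF i; have [[_ _ ->]|[_ _ ->]] := TF i; last by move=> _; exact: z1.
  have := LF j; have [[_ _ ->]|[_ _ ->]] := TF j; last by move=> *; rewrite ipC z1.
  by move=> Lj Li; exact: dual_fracLap_orth.
apply: le_trans (lerD (bessel N ww LT oT Lu) (bessel N wt1 LF oF LLu)).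
rewrite -big_split/=; apply: ler_sum => i _.
rewrite /P_hat (Hs_inner_normalize s0 (mp i) hu).
have := LT i; have := LF i; have [[fin -> ->]|[nf -> ->]] := TF i; last first.
  by rewrite (negbTE nf) !(ipC _ u) !(ipC _ (fracLap _ u)) !z1 expr0n !mul0r addr0.
move=> LFi LTi; rewrite fin.
by apply: (titu _ _ (CS ww Lu LTi) (CS wt1 LLu LFi)); rewrite ip_ge0//; exact: wt1.
Qed.

End dual_system.
Transparent Rintegral powR riesz H pk.

(** * Heat flow in L2 *)

Opaque Rintegral powR.

Section heat_L2.
Context {R : realType}.
Notation mu := (@lebesgue_measure R).
Implicit Types (a b c t x y z : R) (f g h : R -> R) (n : nat).
Let one : R -> R := fun=> 1.

(** Cauchy-Schwarz with the kernel as weight, of total mass 1, bounds the square of the flow by the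
    flow of the square. *)
Lemma heat_contraction h t : L2 one h -> 0 < t ->
  L2 one (H h t) /\ ip one (H h t) (H h t) <= ip one h h.
Proof.
move=> Lh t0; have [gh _] := tame_L2 Lh; have mh := Lh.1.
have Ih2 : Int (fun x => h x ^+ 2) by apply: eq_Int Lh.2 => x; rewrite mulr1.
have mH : measurable_fun setT (H h t).
  by have mH := meas_H gh; rewrite (_ : H h t = fun a => H h t a)//; mea.
have b a : H h t a ^+ 2 * one a <= H (fun x => h x ^+ 2) t a.
  have wG : wt (fun y => G t (y - a)) by split=> [|y]; [mea|exact: G_ge0].
  have L1 : L2 (fun y => G t (y - a)) h by split=> //; exact: Int_gtest Ih2 t a t0.
  have Lo : L2 (fun y => G t (y - a)) one.
    by split; [exact: measurable_cst|apply: eq_Int (Int_G a t0) => x; rewrite expr1n mul1r].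
  have := CS wG L1 Lo; rewrite /one mulr1 !ip_sqr.
  rewrite (_ : ip _ h _ = H h t a); last by apply: eq_RI => y; rewrite mulr1.
  rewrite (_ : \int[mu]_x (1 ^+ 2 * _) = 1) ?mulr1//.
  by rewrite -[RHS](RI_G a t0); apply: eq_RI => y; rewrite expr1n mul1r.
have IH := Int_Ht Ih2 t0.
have m2 : measurable_fun setT (fun a => H h t a ^+ 2 * one a) by rewrite /one; mea.
have [a|I E] := le_RI_ge0 m2 _ IH b; first by rewrite mulr_ge0 ?sqr_ge0 ?ler01.
split; first by split.
rewrite !ip_sqr; apply: (le_trans E); rewrite RI_H//.
by rewrite le_eqVlt; apply/orP; left; apply/eqP/eq_RI => x; rewrite mulr1.
Qed.

Lemma heat_sym f g t : L2 one f -> L2 one g -> 0 < t ->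
  \int[mu]_x (f x * H g t x) = \int[mu]_x (H f t x * g x).
Proof.
move=> Lf Lg t0; have mf := Lf.1; have mg := Lg.1.
have If : Int (fun x => f x ^+ 2) by apply: eq_Int Lf.2 => x; rewrite mulr1.
have Ig : Int (fun x => g x ^+ 2) by apply: eq_Int Lg.2 => x; rewrite mulr1.
have [gf _] := tame_L2 Lf; have [gg _] := tame_L2 Lg.
have I2 : Int2 (fun x y => f x * (g y * G t (y - x))).
  apply: (le_Int2 _ _ (Int2D (Int2_H If t0) (Int2_swap (Int2_H Ig t0)))).
    by rewrite /meas2; mea.
  move=> x y; rewrite mulrA normrM (ger0_norm (G_ge0 _ _)) (GC t x y) -mulrDl.
  rewrite ler_wpM2r ?G_ge0// normrM -(real_normK (num_real (f x))) -(real_normK (num_real (g y))).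
  have := sqr_ge0 (`|f x| - `|g y|); have := mulr_ge0 (normr_ge0 (f x)) (normr_ge0 (g y)).
  by nra.
transitivity (\int[mu]_x \int[mu]_y (f x * (g y * G t (y - x)))).
  by apply: eq_RI => x; rewrite RIZ//; exact: gg.
rewrite (fub I2); apply: eq_RI => y.
rewrite mulrC -RIZ; last exact: gf.
by apply: eq_RI => x; rewrite (GC t y x); ring.
Qed.

Lemma heat_energy h t : L2 one h -> 0 < t ->
  \int[mu]_x (h x * H h (2 * t) x) = ip one (H h t) (H h t).
Proof.
move=> Lh t0; have [gh _] := tame_L2 Lh; have [LH _] := heat_contraction Lh t0.
transitivity (\int[mu]_x (h x * H (H h t) t x)).
  by apply: eq_RI => x; have [_ ->] := H_semigroup x gh t0 t0; rewrite mulr_natl mulr2n.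
by rewrite heat_sym//; apply: eq_RI => x; rewrite mulr1.
Qed.

(** Contraction and the semigroup law make the energies increase as the time decreases, so a limit
    exists; it is at most the norm by contraction, and at least the norm by weak lower
    semicontinuity. *)
Lemma heat_energy_cvg h : L2 one h ->
  ip one (H h (rad n)) (H h (rad n)) @[n --> \oo] --> ip one h h.
Proof.
move=> Lh; have [gh _] := tame_L2 Lh; have mh := Lh.1.
pose a n := ip one (H h (rad n)) (H h (rad n)).
have aB n : a n <= ip one h h by have [] := heat_contraction Lh (rad_gt0 n).
have nd : nondecreasing_seq a.
  apply/nondecreasing_seqP => n.
  have d0 : 0 < rad n - rad n.+1 :> R.
    by rewrite subr_gt0 /rad ltf_pV2 ?posrE ?ltr0n// ltr_nat.
  have [LH _] := heat_contraction Lh (rad_gt0 n.+1).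
  have [_] := heat_contraction LH d0; rewrite /a.
  have -> : H (H h (rad n.+1)) (rad n - rad n.+1) = H h (rad n).
    apply/funext => x; have [_ ->] := H_semigroup x gh (rad_gt0 n.+1) d0.
    by rewrite addrC subrK.
  by [].
have ub : has_ubound (range a) by exists (ip one h h) => _ [n _ <-].
have ca : cvgn a by apply: nondecreasing_is_cvgn.
suff -> : ip one h h = limn a by exact: ca.
apply/eqP; rewrite eq_le; apply/andP; split; last by apply: limr_le => //; exact: nearW.
have w1 : wt one by split; [exact: measurable_cst|move=> x; exact: ler01].
have l1 : locInt one.
  by split; [exact: measurable_cst|move=> x y; apply: eq_Int (Int_box x y) => z; rewrite mul1r].
suff [_ ] : L2 one h /\ ip one h h <= limn a by [].
apply: (@lsc _ one (fun n => H h (rad n)) h (limn a) w1 l1 mh).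
- by have := gtest_locInt gh; congr locInt; apply/funext => x; rewrite mulr1.
- by move=> k; have [] := heat_contraction Lh (rad_gt0 k).
- by move=> k; exact: nondecreasing_cvgn_le.
- move=> x y xy; have := @gauss_box_cvg _ h x y gh.
  rewrite (_ : \int[mu]_z (h z * one z * box x y z) = \int[mu]_z (h z * box x y z)); last first.
    by apply: eq_RI => z; rewrite mulr1.
  rewrite (_ : (fun n => \int[mu]_z (H h (rad n) z * one z * box x y z)) =
    (fun n => \int[mu]_z (H h (rad n) z * box x y z)))//.
  by apply/funext => n; apply: eq_RI => z; rewrite mulr1.
Qed.

(** Polarisation of the convergence of energies; the time is doubled because the energy at time t is
    a pairing with the flow at time 2 t. *)
Lemma heat_pair_cvg f g : L2 one f -> L2 one g ->
  \int[mu]_x (f x * H g (2 * rad n) x) @[n --> \oo] --> \int[mu]_x (f x * g x).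
Proof.
move=> Lf Lg; have w1 := @wt1 R.
have [gf _] := tame_L2 Lf; have [gg _] := tame_L2 Lg.
have LD := L2D w1 Lf Lg; have LB := L2B w1 Lf Lg.
have r2 n : 0 < 2 * rad n :> R by rewrite mulr_gt0 ?rad_gt0.
have In u : 0 < u -> forall f g, L2 one f -> L2 one g -> Int (fun x => f x * H g u x).
  move=> u0 f' g' Lf' Lg'; have [LH _] := heat_contraction Lg' u0.
  by apply: eq_Int (L2_Int w1 Lf' LH) => x; rewrite mulr1.
pose A n := ip one (H (fun x => f x + g x) (rad n)) (H (fun x => f x + g x) (rad n)).
pose B n := ip one (H (fun x => f x - g x) (rad n)) (H (fun x => f x - g x) (rad n)).
have Ifg := L2_Int w1 Lf Lg; have Iff := L2_Int w1 Lf Lf; have Igg := L2_Int w1 Lg Lg.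
have -> : \int[mu]_x (f x * g x) = 4^-1 * (ip one (fun x => f x + g x) (fun x => f x + g x) -
    ip one (fun x => f x - g x) (fun x => f x - g x)).
  rewrite -RIB ?RIZ//; last 2 first.
  - exact: L2_Int.
  - exact: L2_Int.
  rewrite -RIZ; last by apply: IntB; exact: L2_Int.
  by apply: eq_RI => x; rewrite /one !mulr1; field.
have -> : (fun n => \int[mu]_x (f x * H g (2 * rad n) x)) = (fun n => 4^-1 * (A n - B n)).
  apply/funext => n; rewrite /A /B -(heat_energy LD (rad_gt0 n)) -(heat_energy LB (rad_gt0 n)).
  set t := 2 * rad n; have t0 : 0 < t := r2 n.
  have S : \int[mu]_x (g x * H f t x) = \int[mu]_x (f x * H g t x).
    by rewrite heat_sym//; apply: eq_RI => x; rewrite mulrC.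
  have e1 x : (f x + g x) * H (fun x => f x + g x) t x - (f x - g x) * H (fun x => f x - g x) t x =
      2 * (f x * H g t x) + 2 * (g x * H f t x).
    rewrite HD// (_ : H (fun x => f x - g x) t x = H f t x - H g t x); first by ring.
    have := HD t x gf (gtestZ (-1) gg); rewrite HZ// mulN1r => <-.
    by congr H; apply/funext => y; rewrite mulN1r.
  rewrite -RIB; [|exact: In..].
  rewrite (eq_RI e1) RID; [|exact/IntZ/In..].
  rewrite !RIZ ?S; [|exact: In..].
  by field.
apply: cvgM; first exact: cvg_cst.
by apply: cvgB; exact: heat_energy_cvg.
Qed.

End heat_L2.

(** * Translation estimates and moments of the derivative of the kernel *)

Section translation.
Context {R : realType}.
Notation mu := (@lebesgue_measure R).
Implicit Types (a c t u x y z h M : R) (F f v q : R -> R).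

Lemma box_translate x y h : box (x - h) x y = box y (y + h) x.
Proof. by rewrite /box ltrBlDr andbC. Qed.

(** The increment is the integral of f over an interval of length |h|; Tonelli in the position of
    that interval. A negative h is reduced to a positive one by a shift. *)
Lemma L1_translate F f h : measurable_fun setT F -> Int f ->
  (forall x y, x < y -> F y - F x = \int[mu]_z (f z * box x y z)) ->
  Int (fun x => F x - F (x - h)) /\
  \int[mu]_x `|F x - F (x - h)| <= `|h| * \int[mu]_x `|f x|.
Proof.
move=> mF If hF; have mf := Int_meas If; have Inf := Int_norm If.
have pos k : 0 < k -> Int (fun x => F x - F (x - k)) /\
    \int[mu]_x `|F x - F (x - k)| <= k * \int[mu]_x `|f x|.
  move=> k0.
  have Ib y : Int (fun x => `|f y| * box y (y + k) x) by exact/IntZ/Int_box.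
  have Eb y : \int[mu]_x (`|f y| * box y (y + k) x) = k * `|f y|.
    by rewrite RIZ ?RI_box1; [ring|rewrite lerDl ltW|exact: Int_box].
  have I2 : Int2 (fun y x => `|f y| * box y (y + k) x).
    apply: (Int2P (G := fun y => k * `|f y|)) => //; [by rewrite /meas2; mea|exact: IntZ|].
    move=> y; rewrite -Eb; apply: le_RI => //; first exact: Int_norm.
    by move=> x; rewrite ger0_norm// mulr_ge0 ?box_ge0.
  have b x : `|F x - F (x - k)| <= \int[mu]_y (`|f y| * box y (y + k) x).
    rewrite hF ?ltrBlDr ?ltrDl//.
    have I1 : Int (fun z => f z * box (x - k) x z).
      have mb : measurable_fun setT (box (x - k) x) by mea.
      by apply: eq_Int (IntMb mb (norm_box _ _) If) => z; rewrite mulrC.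
    apply: (le_trans (norm_RI I1)); rewrite le_eqVlt; apply/orP; left; apply/eqP/eq_RI => y.
    by rewrite normrM (ger0_norm (box_ge0 _ _ _)) box_translate.
  have IR := Int2_Int (Int2_swap I2).
  have I : Int (fun x => F x - F (x - k)) by apply: (le_Int _ b IR); mea.
  split=> //; rewrite -RIZ//; apply: le_trans (le_RI (Int_norm I) IR b) _.
  by rewrite -(fub I2) le_eqVlt; apply/orP; left; apply/eqP/eq_RI => y; rewrite Eb.
have [h0|h0|<-] := ltgtP 0 h.
- by have [I E] := pos h h0; rewrite gtr0_norm.
- have nh : 0 < - h by rewrite oppr_gt0.
  have [I E] := pos _ nh; rewrite ltr0_norm//.
  have e x : F x - F (x - h) = - (F (x - h) - F (x - h - - h)) by rewrite opprK subrK opprB.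
  have := Int_shift (- h) I; have := RI_shift (- h) (Int_norm I) => E2 I2.
  split; first by apply: eq_Int (IntN I2) => x; rewrite [RHS]e.
  apply: le_trans E; rewrite -E2 le_eqVlt; apply/orP; left; apply/eqP/eq_RI => x.
  by rewrite e normrN.
have e x : F x - F (x - 0) = 0 by rewrite subr0 subrr.
split; first by apply: eq_Int (Int0 (R := R)) => x; rewrite e.
by rewrite normr0 mul0r (eq_RI (g := fun=> 0)) ?RI0// => x; rewrite e normr0.
Qed.

Lemma G_sqr_le t x : 0 < t -> x ^+ 2 * G t x <= 16 * t * G (2 * t) x.
Proof.
move=> t0; rewrite G_double//; have g0 := G_ge0 (2 * t) x.
have := mul_expRN_le1 (x ^+ 2 / (8 * t)); rewrite -mulNr; set e := expR _ => he.
have e0 : 0 <= e by exact: expR_ge0.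
have : x ^+ 2 * e <= 8 * t.
  by move: he; rewrite mulrAC ler_pdivrMr ?mul1r// mulr_gt0.
have := @sqrt2_le2 R; have := sqrtr_ge0 (2 : R); set q := Num.sqrt 2 => q0 q2 h.
rewrite mulrA ler_wpM2r// mulrCA (_ : 16 * t = 2 * (8 * t)); last by ring.
by rewrite ler_pM// mulr_ge0 ?sqr_ge0.
Qed.

Lemma norm_dG t x : 0 < t -> `|dG t x| = `|x| / (2 * t) * G t x.
Proof.
move=> t0; rewrite /dG normrM normrN (ger0_norm (G_ge0 _ _)) normrM.
by rewrite (ger0_norm (_ : 0 <= (2 * t)^-1))// invr_ge0 mulr_ge0// ltW.
Qed.

Lemma Int_dG t : 0 < t -> Int (dG t) /\ \int[mu]_x `|dG t x| <= 4 * (Num.sqrt t)^-1.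
Proof.
move=> t0; have t2 : 0 < 2 * t by rewrite mulr_gt0.
have IG := IntZ (4 * (Num.sqrt t)^-1) (Int_G0 t2).
have m : measurable_fun setT (dG t) by rewrite /dG; mea.
have I := le_Int m (fun x => dG_le x t0) IG; split=> //.
apply: le_trans (le_RI (Int_norm I) IG (fun x => dG_le x t0)) _.
by rewrite RIZ ?RI_G0 ?mulr1//; exact: Int_G0.
Qed.

Lemma dG_moment1 t x : 0 < t -> `|x| * `|dG t x| <= 8 * G (2 * t) x.
Proof.
move=> t0; rewrite norm_dG// mulrA mulrA -expr2 real_normK ?num_real//.
have := G_sqr_le x t0; move: (G t x) (G (2 * t) x) => g g2 h.
rewrite mulrAC ler_pdivrMr ?mulr_gt0//; apply: (le_trans h).
by rewrite le_eqVlt; apply/orP; left; apply/eqP; ring.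
Qed.

(** The second absolute moment has order sqrt t and will remove the quadratic Taylor remainder as t
    tends to 0, while the first moment stays bounded. *)
Lemma dG_moment2 t x : 0 < t -> x ^+ 2 * `|dG t x| <= 64 * Num.sqrt (2 * t) * G (4 * t) x.
Proof.
move=> t0; have t2 : 0 < 2 * t by rewrite mulr_gt0.
have -> : x ^+ 2 * `|dG t x| = `|x| * (`|x| * `|dG t x|) by rewrite mulrA -expr2 real_normK ?num_real.
apply: (@le_trans _ _ (`|x| * (8 * G (2 * t) x))); first by rewrite ler_wpM2l ?dG_moment1.
have := dG_le x t2; rewrite norm_dG// (_ : 2 * (2 * t) = 4 * t); last by ring.
pose r : R := Num.sqrt (2 * t); rewrite -/r; have q0 : 0 < r by rewrite sqrtr_gt0.
have qq : r ^+ 2 = 2 * t by rewrite sqr_sqrtr// ltW.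
rewrite mulrAC ler_pdivrMr ?mulr_gt0//; move: (G (2 * t) x) (G (4 * t) x) => g g4.
have e4 : 4 * t = 2 * r ^+ 2 by rewrite qq; ring.
rewrite (_ : 4 / r * g4 * (4 * t) = 8 * r * g4); last by rewrite e4; field; rewrite gt_eqF.
by move=> h; rewrite mulrCA; lra.
Qed.

Lemma Int_dG1 t : 0 < t -> Int (fun x => x * dG t x) /\ \int[mu]_x `|x * dG t x| <= 8.
Proof.
move=> t0; have t2 : 0 < 2 * t by rewrite mulr_gt0.
have IG := IntZ 8 (Int_G0 t2).
have b x : `|x * dG t x| <= 8 * G (2 * t) x by rewrite normrM dG_moment1.
have m : measurable_fun setT (fun x => x * dG t x) by mea.
have I := le_Int m b IG; split=> //.
by apply: le_trans (le_RI (Int_norm I) IG b) _; rewrite RIZ ?RI_G0 ?mulr1//; exact: Int_G0.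
Qed.

(** The derivative of x G is G + x dG, and x G vanishes at infinity. Together with mean 0, this
    makes pairing with [dG] an approximation of minus the derivative. *)
Lemma RI_dG1 t : 0 < t -> \int[mu]_x (x * dG t x) = - 1.
Proof.
move=> t0; have [I _] := Int_dG1 t0; have IG := Int_G0 t0.
have ID : Int (fun x => G t x + x * dG t x) by exact: IntD.
suff : \int[mu]_x (G t x + x * dG t x) = 0.
  by rewrite RID// RI_G0// => /eqP; rewrite addrC addr_eq0 => /eqP.
have c (u : nat -> R) : (forall n, `|u n| = n.+1%:R) -> u n * G t (u n) @[n --> \oo] --> (0 : R).
  move=> hu; apply: norm_cvg0.
  apply: (@squeeze_cvgr _ _ _ _ (fun=> 0) (fun n => 16 * t * (Num.sqrt (2 * t))^-1 * rad n)).
  - near=> n; rewrite normr_ge0 normrM (ger0_norm (G_ge0 _ _)) /rad/=.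
    rewrite -[leLHS](mulfK (_ : n.+1%:R != 0)) ?pnatr_eq0// ler_wpM2r ?invr_ge0 ?ler0n//.
    rewrite mulrAC -hu -expr2 real_normK ?num_real//.
    apply: (le_trans (G_sqr_le _ t0)); rewrite ler_wpM2l ?mulr_ge0 ?(ltW t0)//.
    by rewrite G_le_sqrt// mulr_gt0.
  - exact: cvg_cst.
  - by rewrite -(mulr0 (16 * t * (Num.sqrt (2 * t))^-1)); apply: cvgM; [exact: cvg_cst|exact: rad_cvg].
rewrite -[RHS](subrr (0 : R)).
apply: (@FTC_exhaust _ (fun=> true) (fun x => x * G t x) (fun x => G t x + x * dG t x)
   (fun n => - n.+1%:R) (fun n => n.+1%:R)) => //.
- move=> x _; have d := is_derive_G x t0.
  by apply: is_derive_eq; rewrite /GRing.scale/=; ring.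
- move=> x _; have d := is_derive_G x t0; have d' := is_derive_dG x t0.
  have c1 : {for x, continuous (G t)}.
    by apply/differentiable_continuous/derivable1_diffP; exact: (@ex_derive _ _ _ _ _ _ _ d).
  have c2 : {for x, continuous (dG t)}.
    by apply/differentiable_continuous/derivable1_diffP; exact: (@ex_derive _ _ _ _ _ _ _ d').
  by apply: cvgD => //; apply: cvgM => //; exact: cvg_id.
- by mea.
- by mea.
- by move=> n; have := ltr0Sn R n; lra.
- move=> x _; near=> n; have : `|x| <= n%:R by near: n; exact: nbhs_infty_ger.
  by rewrite ler_norml -natr1 => /andP[h1 h2]; lra.
- by apply: c => n; rewrite normrN normr_nat.
- by apply: c => n; rewrite normr_nat.
Unshelve. all: by end_near. Qed.

Lemma RI_dG0 t : 0 < t -> \int[mu]_x dG t x = 0.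
Proof.
move=> t0; have [I _] := Int_dG t0; have := RI_opp I.
rewrite (eq_RI (g := fun x => - dG t x)); last by move=> x; exact: dG_odd.
by rewrite RIN// => h; apply/eqP; lra.
Qed.

Lemma RI_G_mean t m : 0 < t -> Int (fun x => x * G t (x - m)) /\ \int[mu]_x (x * G t (x - m)) = m.
Proof.
move=> t0; have [I0 _] := Int_dG t0; have t1 : 2 * t != 0 by rewrite mulf_neq0// gt_eqF.
have e x : x * G t x = - (2 * t) * dG t x by rewrite /dG; field; rewrite gt_eqF.
have I1 : Int (fun x => x * G t x) by apply: eq_Int (IntZ (- (2 * t)) I0) => x; rewrite e.
have I2 : Int (fun x => x * G t x + m * G t x) by apply: IntD => //; exact/IntZ/Int_G0.
have e2 x : (x - m) * G t (x - m) + m * G t (x - m) = x * G t (x - m) by rewrite -mulrDl subrK.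
split; first exact: eq_Int e2 (Int_shift (- m) I2).
rewrite -(eq_RI e2) (RI_shift (- m) I2) RID//; last exact/IntZ/Int_G0.
rewrite RIZ ?RI_G0 ?mulr1//; last exact: Int_G0.
by rewrite (eq_RI e) RIZ// RI_dG0// mulr0 add0r.
Qed.

(** As [dG] is - x/(2 t) times the kernel, completing the square leaves the mean of a Gaussian. *)
Lemma dG_conv u t y a : 0 < u -> 0 < t ->
  \int[mu]_x (G u (y - x) * dG t (x - a)) = dG (u + t) (y - a).
Proof.
move=> u0 t0; have ut : 0 < u + t by rewrite addr_gt0.
pose Y : R := y - a; pose p : R := u * t / (u + t).
have p0 : 0 < p by rewrite divr_gt0 ?mulr_gt0.
have mb : measurable_fun setT (fun x => G u (Y - x)) by mea.
have I : Int (fun x => G u (Y - x) * dG t x).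
  apply: (IntMb (M := (Num.sqrt u)^-1) mb) => [x|]; last by have [] := Int_dG t0.
  by rewrite ger0_norm ?G_ge0 ?G_le_sqrt.
have := RI_shift (- a) I.
rewrite (eq_RI (g := fun x => G u (y - x) * dG t (x - a))); last first.
  by move=> x; rewrite /Y (_ : y - a - (x - a) = y - x)//; ring.
move=> ->; have [I1 E1] := RI_G_mean (Y * t / (u + t)) p0.
rewrite (eq_RI (g := fun x => - (2 * t)^-1 * G (u + t) Y * (x * G p (x - Y * t / (u + t))))).
  by rewrite RIZ// E1 /dG /Y; field; rewrite !gt_eqF.
move=> x; transitivity (- (2 * t)^-1 * x * (G u (Y - x) * G t x)); first by rewrite /dG; ring.
by rewrite G_mul// /p; ring.
Qed.

Lemma H_dG_conv q u t a : Int q -> 0 < u -> 0 < t ->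
  \int[mu]_x (H q u x * dG t (x - a)) = \int[mu]_y (q y * dG (u + t) (y - a)).
Proof.
move=> Iq u0 t0; have mq := Int_meas Iq.
have I2 : Int2 (fun y x => q y * G u (y - x) * dG t (x - a)).
  apply: (le_Int2 _ _ (Int2Z (4 * t^-1) (Int2_H (Int_norm Iq) u0))); first by rewrite /meas2; mea.
  move=> y x; rewrite normrM [leLHS]mulrC ler_pM ?dG_le_sup// normrM (ger0_norm (G_ge0 _ _))//.
transitivity (\int[mu]_x \int[mu]_y (q y * G u (y - x) * dG t (x - a))).
  apply: eq_RI => x; rewrite mulrC -RIZ; last exact: Int_gtest.
  by apply: eq_RI => y; rewrite mulrC.
rewrite -(fub I2); apply: eq_RI => y; rewrite -(dG_conv y a u0 t0) -RIZ; last first.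
  have mb : measurable_fun setT (fun x => G u (y - x)) by mea.
  apply: (IntMb (M := (Num.sqrt u)^-1) mb) => [x|]; first by rewrite ger0_norm ?G_ge0 ?G_le_sqrt.
  by have [I _] := Int_dG t0; exact: Int_shift.
by apply: eq_RI => x; rewrite mulrA.
Qed.

Lemma H_lip v t M x y : measurable_fun setT v -> (forall x, `|v x| <= M) -> 0 < t ->
  `|H v t x - H v t y| <= M * (4 * (Num.sqrt t)^-1) * `|x - y|.
Proof.
move=> mv hM t0; have [Id Ed] := Int_dG t0.
have M0 : 0 <= M := le_trans (normr_ge0 _) (hM 0).
have F z z' : z < z' -> G t z' - G t z = \int[mu]_x (dG t x * box z z' x).
  move=> zz; have [|||_ ->//] := @FTC_box R (G t) (dG t) z z' zz.
  - by move=> w _; exact: is_derive_G.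
  - move=> w _; have d' := is_derive_dG w t0.
    by apply/differentiable_continuous/derivable1_diffP; exact: (@ex_derive _ _ _ _ _ _ _ d').
  - by rewrite /dG; mea.
have mG : measurable_fun setT (G t) by mea.
have [I E] := L1_translate (y - x) mG Id F.
have I' := Int_shift (- x) I; have E' := RI_shift (- x) (Int_norm I).
have e z : G t (z - x) - G t (z - x - (y - x)) = G t (z - x) - G t (z - y).
  by congr (_ - G t _); ring.
have I'' : Int (fun z => G t (z - x) - G t (z - y)) by exact: eq_Int e I'.
have gv := bounded_gtest mv hM.
rewrite -RIB; [|exact: gv..].
rewrite (eq_RI (g := fun z => v z * (G t (z - x) - G t (z - y)))); last by move=> z; ring.
have I3 := IntMb mv hM I''.
apply: (@le_trans _ _ (\int[mu]_z (M * `|G t (z - x) - G t (z - y)|))).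
  apply: norm_RI_le => //; first exact/IntZ/Int_norm.
  by move=> z; rewrite normrM ler_wpM2r.
rewrite RIZ; last exact: Int_norm.
rewrite -mulrA ler_wpM2l//; apply: (@le_trans _ _ (`|y - x| * (4 * (Num.sqrt t)^-1))); last first.
  by rewrite distrC mulrC.
apply: le_trans (ler_wpM2l (normr_ge0 _) Ed); apply: le_trans E.
by rewrite -E' le_eqVlt; apply/orP; left; apply/eqP/eq_RI => z; rewrite e.
Qed.

End translation.
Transparent Rintegral powR.

(** * The weighted system *)

Opaque Rintegral powR.

Section weighted_polynomials.
Context {R : realType}.
Notation mu := (@lebesgue_measure R).
Implicit Types (a b c d x y z h M : R) (e f g : R -> R) (n : nat).
Variables (s : R) (P : {poly R}).
Hypotheses (s0 : 0 < s) (s1 : s < 1).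
Let ms1 : - s < 1. Proof. by have := s0; lra. Qed.
Let os1 : 1 - s < 1. Proof. by have := s0; lra. Qed.
Let os0 : 0 < 1 - s. Proof. by have := s1; lra. Qed.

Lemma weightM a b x : weight a x * weight b x = weight (a + b) x.
Proof.
rewrite /weight; case: ifP => x1; last by rewrite mul0r.
by rewrite -powD ?sqr_lt1//; congr (_ `^ _); ring.
Qed.

Lemma weight_opp_le1 x : weight (- s) x <= 1.
Proof.
rewrite /weight opprK; case: ifP => // x1; have /andP[h0 h1] := sqr_le1 (ltW x1).
by have := ge0_ler_powR (ltW s0) _ _ h1; rewrite powR1; apply; rewrite nnegrE.
Qed.

Lemma wp_bounded : exists M, forall x, `|wp (- s) P x| <= M.
Proof.
have [C C0 HC] := poly_bounded P; exists C => x; rewrite /wp.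
have [x1|x1] := leP `|x| 1; last by rewrite weight_out ?mul0r ?normr0// ltW.
by rewrite normrM (ger0_norm (weight_ge0 _ _)) -[leRHS]mul1r ler_pM ?weight_ge0 ?weight_opp_le1 ?HC.
Qed.

Lemma is_derive_sqr_pow b x : `|x| < 1 -> b != 0 ->
  is_derive x (1 : R) (fun y : R => (1 - y ^+ 2) `^ b) (- (2 * x) * (b * (1 - x ^+ 2) `^ (b - 1))).
Proof.
move=> x1 b0; have x2 := sqr_lt1 x1.
have d1 : is_derive x (1 : R) (fun y : R => 1 - y ^+ 2) (- (2 * x)).
  by apply: is_derive_eq; rewrite /GRing.scale /=; ring.
have dp : is_derive (1 - x ^+ 2) (1 : R) (fun z : R => z `^ b) (b * (1 - x ^+ 2) `^ (b - 1)).
  have -> : (fun z : R => z `^ b) = (fun z => b * (b^-1 * z `^ b)).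
    by apply/funext => z; rewrite mulVKf.
  by have dq := is_derive_pow x2 b0; apply: is_derive_eq.
have dc := @is_derive1_comp R (fun z : R => z `^ b) (fun y : R => 1 - y ^+ 2) x _ _ dp d1.
by apply: (is_derive_eq dc); rewrite /GRing.scale /=; ring.
Qed.

Lemma wp_cvg e (u : nat -> R) l : (forall x, {for x, continuous e}) -> (forall n, `|u n| < 1) ->
  `|l| <= 1 -> u n @[n --> \oo] --> l ->
  (1 - u n ^+ 2) `^ s * (P.[u n] * e (u n)) @[n --> \oo] --> wp (- s) P l * e l.
Proof.
move=> ce u1 l1 ul; rewrite /wp /weight opprK -mulrA.
have c1 : 1 - u n ^+ 2 @[n --> \oo] --> 1 - l ^+ 2.
  by apply: cvgB; [exact: cvg_cst|rewrite expr2; apply: cvgM].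
apply: cvgM; last first.
  apply: cvgM; [exact: (cvg_comp _ _ ul (@continuous_horner R P l))|].
  exact: (cvg_comp _ _ ul (ce l)).
case: ifPn => [l2|]; first exact: (cvg_comp _ _ c1 (continuous_powR_gt0 (sqr_lt1 l2))).
rewrite -leNgt => l2; apply: powR_cvg0 => //.
  by move=> n; exact/ltW/sqr_lt1.
have e0 : 1 - l ^+ 2 = 0.
  by rewrite -(real_normK (num_real l)) (_ : `|l| = 1) ?expr1n ?subrr//; apply/eqP; rewrite eq_le l1.
by rewrite -e0.
Qed.

(** The interval may reach the end points 1 and -1, where the derivative blows up like (1 - x^2)^(s
    - 1) but the function itself is continuous and vanishes. *)
Lemma wp_FTC e e1 M c d : -1 <= c -> c < d -> d <= 1 ->
  (forall x, is_derive x (1 : R) e (e1 x)) -> continuous e1 ->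
  (forall x, `|x| <= 1 -> `|e x| <= M /\ `|e1 x| <= M) ->
  Int (fun x => (wp (1 - s) (lower_poly s P) x * e x + wp (- s) P x * e1 x) * box c d x) /\
  \int[mu]_x ((wp (1 - s) (lower_poly s P) x * e x + wp (- s) P x * e1 x) * box c d x) =
    wp (- s) P d * e d - wp (- s) P c * e c.
Proof.
move=> c1 cd d1 de ce1 hM.
have ce : continuous e.
  by move=> x; apply/differentiable_continuous/derivable1_diffP; exact: (@ex_derive _ _ _ _ _ _ _ (de x)).
have me := continuous_measurable_fun ce; have me1 := continuous_measurable_fun ce1.
have [C C0 HC] := poly_bounded P; have [C' C'0 HC'] := poly_bounded (lower_poly s P).
have I0 : Int (fun x => wp (1 - s) (lower_poly s P) x * e x + wp (- s) P x * e1 x).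
  apply: IntD.
    apply: (@eq_Int _ (fun x => weight (1 - s) x * ((lower_poly s P).[x] * e x))).
      by move=> x; rewrite /wp mulrA.
    apply: (@Int_weightM _ _ _ (C' * M)) => // [|x x1]; first by mea.
    by rewrite normrM ler_pM ?HC'//; have [] := hM x x1.
  apply: (@eq_Int _ (fun x => weight (- s) x * (P.[x] * e1 x))).
    by move=> x; rewrite /wp mulrA.
  apply: (@Int_weightM _ _ _ (C * M)) => // [|x x1]; first by mea.
  by rewrite normrM ler_pM ?HC//; have [] := hM x x1.
have mb : measurable_fun setT (box c d) by mea.
have I : Int (fun x => (wp (1 - s) (lower_poly s P) x * e x + wp (- s) P x * e1 x) * box c d x).
  by apply: eq_Int (IntMb mb (norm_box c d) I0) => x; rewrite mulrC.
split=> //.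
pose F x := (1 - x ^+ 2) `^ s * (P.[x] * e x).
pose f x := (1 - x ^+ 2) `^ (s - 1) * ((lower_poly s P).[x] * e x) + (1 - x ^+ 2) `^ s * (P.[x] * e1 x).
have D1 x : (c < x) && (x < d) -> `|x| < 1 by move=> /andP[h1 h2]; rewrite ltr_norml; lra.
have fE x : (if (c < x) && (x < d) then f x else 0) =
    (wp (1 - s) (lower_poly s P) x * e x + wp (- s) P x * e1 x) * box c d x.
  rewrite /box; case: ifPn => D; last by rewrite mulr0.
  by rewrite mulr1 /f /wp /weight (D1 x D) !opprK opprB !mulrA.
(* At most a third of the length is removed at each end, so that c + r n < d - r n. *)
pose r n : R := (d - c) * (3^-1 * rad n).
have rb n : 0 < r n < (d - c) / 2.
  have dc : 0 < d - c by rewrite subr_gt0.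
  have h0 := @rad_gt0 R n; have h1 := @rad_le1 R n.
  by rewrite /r !mulr_gt0 ?invr_gt0//= ltr_pM2l//; lra.
have rc : r n @[n --> \oo] --> (0 : R).
  rewrite -(mulr0 (d - c)); apply: cvgM; first exact: cvg_cst.
  by rewrite -(mulr0 3^-1); apply: cvgM; [exact: cvg_cst|exact: rad_cvg].
rewrite -(eq_RI fE).
apply: (@FTC_exhaust _ (fun x => (c < x) && (x < d)) F f (fun n => c + r n) (fun n => d - r n)).
- move=> x /D1 x1; have x2 := sqr_lt1 x1.
  have d2 := is_derive_sqr_pow x1 (lt0r_neq0 s0).
  have d3 := is_derive_poly P x; have d5 := de x.
  apply: is_derive_eq; rewrite /GRing.scale /= /f lower_polyE.
  have -> : (1 - x ^+ 2) `^ s = (1 - x ^+ 2) * (1 - x ^+ 2) `^ (s - 1).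
    have es : s = 1 + (s - 1) by ring.
    by rewrite [in LHS]es [LHS]powD// [X in X * _]powRr1// ltW.
  by ring.
- move=> x /D1 x1; have x2 := sqr_lt1 x1.
  have c0 : 1 - y ^+ 2 @[y --> x] --> 1 - x ^+ 2.
    by apply: cvgB; [exact: cvg_cst|rewrite expr2; apply: cvgM; exact: cvg_id].
  apply: cvgD; (apply: cvgM; first exact: (cvg_comp _ _ c0 (continuous_powR_gt0 x2))).
    by apply: cvgM; [exact: continuous_horner|exact: ce].
  by apply: cvgM; [exact: continuous_horner|exact: ce1].
- by rewrite /f; mea.
- rewrite (_ : (fun x => _) = (fun x => (wp (1 - s) (lower_poly s P) x * e x + wp (- s) P x * e1 x) * box c d x)).
    exact: Int_meas I.
  exact/funext.
- by move=> n; have /andP[] := rb n; lra.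
- by move=> n x; have /andP[] := rb n => h1 h2 /andP[h3 h4]; apply/andP; split; lra.
- move=> x /andP[x1 x2].
  have p1 : 0 < x - c by rewrite subr_gt0.
  have p2 : 0 < d - x by rewrite subr_gt0.
  near=> n; have : r n < x - c by near: n; exact: (cvgr_lt _ rc).
  have : r n < d - x by near: n; exact: (cvgr_lt _ rc).
  by move=> h1 h2; apply/andP; split; lra.
- by apply: eq_Int I => x; rewrite fE.
- apply: (wp_cvg ce); last 1 first.
  + by rewrite -[X in _ --> X]addr0; apply: cvgD; [exact: cvg_cst|exact: rc].
  + by move=> n; have /andP[] := rb n => h1 h2; rewrite ltr_norml; apply/andP; split; lra.
  + by rewrite ler_norml; apply/andP; split; lra.
- apply: (wp_cvg ce); last 1 first.
  + by rewrite -[X in _ --> X]subr0; apply: cvgB; [exact: cvg_cst|exact: rc].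
  + by move=> n; have /andP[] := rb n => h1 h2; rewrite ltr_norml; apply/andP; split; lra.
  + by rewrite ler_norml; apply/andP; split; lra.
Unshelve. all: by end_near. Qed.

Lemma wp_zero a p x : 1 <= `|x| -> wp a p x = 0.
Proof. by move=> x1; rewrite /wp weight_out ?mul0r. Qed.

Lemma wp_RI x y : x < y ->
  wp (- s) P y - wp (- s) P x = \int[mu]_z (wp (1 - s) (lower_poly s P) z * box x y z).
Proof.
move=> xy.
have [y1|y1] := leP y (-1).
  rewrite !wp_zero; [|rewrite ler0_norm; lra|rewrite ler0_norm; lra].
  rewrite subrr (eq_RI (g := fun=> 0)) ?RI0// => z; rewrite /box.
  case: ifP; last by rewrite mulr0.
  by move=> /andP[h1 h2]; rewrite wp_zero ?mul0r// ler0_norm; lra.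
have [x1|x1] := leP 1 x.
  rewrite !wp_zero; [|rewrite ger0_norm; lra|rewrite ger0_norm; lra].
  rewrite subrr (eq_RI (g := fun=> 0)) ?RI0// => z; rewrite /box.
  case: ifP; last by rewrite mulr0.
  by move=> /andP[h1 h2]; rewrite wp_zero ?mul0r// ger0_norm; lra.
(* Both functions vanish outside (-1,1), so the end points are clipped to [-1,1]. *)
pose c := if x < -1 then -1 else x; pose d := if 1 < y then 1 else y.
have Qc : wp (- s) P x = wp (- s) P c.
  rewrite /c; case: ifP => // h; rewrite !wp_zero ?normrN1//.
  by rewrite ler0_norm; lra.
have Qd : wp (- s) P y = wp (- s) P d.
  rewrite /d; case: ifP => // h; rewrite !wp_zero ?normr1//.
  by rewrite ger0_norm; lra.
have c1 : -1 <= c by rewrite /c; case: ltP.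
have d1 : d <= 1 by rewrite /d; case: ltP.
have cd : c < d by rewrite /c /d; case: ifP; case: ifP => *; lra.
have [||_ E] := @wp_FTC (fun=> 1) (fun=> 0) 1 c d c1 cd d1.
- by move=> z; exact: cvg_cst.
- by move=> z _; rewrite normr1 normr0.
rewrite Qc Qd; rewrite !mulr1 in E; rewrite -E; apply: eq_RI => z.
rewrite mulr0 addr0 mulr1; have [z1|z1] := leP 1 `|z|; first by rewrite wp_zero// !mul0r.
congr (_ * _); rewrite /box; congr (if _ then _ else _); move: z1; rewrite ltr_norml => /andP[z1 z2].
congr (_ && _).
  by rewrite /c; case: (ltP x (-1)) => // h; rewrite z1; apply/esym; lra.
by rewrite /d; case: (ltP 1 y) => // h; rewrite z2; apply/esym; lra.
Qed.

(** The increment is an integral of the weight of exponent 1 - s over an interval; splitting at l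
    equal to its length gives the power s. *)
Lemma wp_holder : exists2 L, 0 <= L &
  forall x y, `|wp (- s) P x - wp (- s) P y| <= L * `|x - y| `^ s.
Proof.
have [C C0 HC] := wp_le (1 - s) (lower_poly s P).
pose K := C * (2 * (2 / s + 1)).
have K0 : 0 <= K by rewrite !mulr_ge0// addr_ge0// divr_ge0// ltW.
exists K => //.
have hlt x y : x < y -> `|wp (- s) P y - wp (- s) P x| <= K * (y - x) `^ s.
  move=> xy; have l0 : 0 < y - x by rewrite subr_gt0.
  rewrite wp_RI//.
  have [|Iw Ew] := weight_conv os0 os1 l0 (Int_box x y) (S := 1).
    by move=> z; rewrite box_ge0 box_le1.
  have mq := Int_meas (Int_wp (lower_poly s P) os1).
  have b z : `|wp (1 - s) (lower_poly s P) z * box x y z| <= C * (weight (1 - s) z * box x y z).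
    by rewrite normrM (ger0_norm (box_ge0 _ _ _)) mulrA ler_wpM2r ?box_ge0.
  have I1 : Int (fun z => wp (1 - s) (lower_poly s P) z * box x y z).
    by apply: (le_Int _ b (IntZ C Iw)); mea.
  apply: le_trans (norm_RI_le I1 (IntZ C Iw) b) _; rewrite RIZ// /K -mulrA ler_wpM2l//.
  apply: (le_trans Ew); rewrite RI_box1 ?(ltW xy)// subKr mul1r.
  have -> : (y - x) `^ (- (1 - s)) * (y - x) = (y - x) `^ s.
    by rewrite -[X in _ * X](powRr1 (ltW l0)) -powD//; congr (_ `^ _); ring.
  by rewrite le_eqVlt; apply/orP; left; apply/eqP; ring.
move=> x y; have [xy|xy|->] := ltgtP x y.
- by rewrite distrC (ltr0_norm (x := x - y)) ?subr_lt0// opprB; exact: hlt.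
- by rewrite (gtr0_norm (x := x - y)) ?subr_gt0//; exact: hlt.
- by rewrite !subrr normr0 mulr_ge0// powR_ge0.
Qed.

Lemma wp_translate h : \int[mu]_x `|wp (- s) P x - wp (- s) P (x - h)| <=
  `|h| * \int[mu]_x `|wp (1 - s) (lower_poly s P) x|.
Proof.
have mQ := Int_meas (Int_wp P ms1); have Iq := Int_wp (lower_poly s P) os1.
by have [] := L1_translate h mQ Iq wp_RI.
Qed.

End weighted_polynomials.

Lemma Int2_norm (R : realType) (F : R -> R -> R) : Int2 F -> Int2 (fun x y => `|F x y|).
Proof. exact: integrable_abse. Qed.

(** * The fractional Laplacian of a Hoelder function as a singular integral *)

Section fractional_integral.
Context {R : realType}.
Notation mu := (@lebesgue_measure R).
Implicit Types (x y z h : R) (f g : R -> R).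
Variables (s M L N : R) (Q : R -> R).
Hypotheses (s0 : 0 < s) (s1 : s < 1) (IQ : Int Q) (bQ : forall x, `|Q x| <= M)
  (hQ : forall x y, `|Q x - Q y| <= L * `|x - y| `^ s)
  (lQ : forall h, \int[mu]_x `|Q x - Q (x - h)| <= `|h| * N).
Let mQ := Int_meas IQ.
Let D h x := Q x - Q (x - h).
Let mD : measurable_fun setT (fun z : R * R => D z.1 z.2).
Proof. by rewrite /D; mea. Qed.
Let ID h : Int (D h).
Proof. by apply: IntB => //; exact: (Int_shift (- h) IQ). Qed.
Let M0 : 0 <= M. Proof. exact: le_trans (normr_ge0 _) (bQ 0). Qed.
Let N0 : 0 <= N.
Proof. by have := le_trans (RI_ge0 (fun x => normr_ge0 _)) (lQ 1); rewrite normr1 mul1r. Qed.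
Let L0 : 0 <= L.
Proof. by have := le_trans (normr_ge0 _) (hQ 1 0); rewrite subr0 normr1 powR1 mulr1. Qed.
Let D_le h x : `|D h x| <= 2 * M.
Proof. by rewrite mulr_natl mulr2n; apply: le_trans (ler_normB _ _) _; exact: lerD. Qed.
Let m1 h := \int[mu]_x `|D h x|.
Let mm1 : measurable_fun setT m1.
Proof. by apply: (@meas_RIT _ _ _ (fun h x => `|D h x|)); mea. Qed.
Let m1_ge0 h : 0 <= m1 h. Proof. exact: RI_ge0. Qed.
Let W := 2 * \int[mu]_x `|Q x|.
Let m1_le h : m1 h <= W.
Proof.
have I1 := Int_norm IQ; have I2 : Int (fun x => `|Q (x - h)|) := Int_shift (- h) I1.
apply: (@le_trans _ _ (\int[mu]_x (`|Q x| + `|Q (x - h)|))).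
  by apply: le_RI; [exact: Int_norm|exact: IntD|move=> x; exact: ler_normB].
by rewrite RID// (RI_shift (- h) I1) /W mulr_natl mulr2n.
Qed.
Let W0 : 0 <= W. Proof. exact: le_trans (m1_ge0 0) (m1_le 0). Qed.

(** Pointwise the increments are only O(|h|^s), for which the integral against |h|^(-1-s) may
    diverge; in L1 they are O(|h|), so x has to be integrated first. The singular integral is thus
    known to converge almost everywhere only. *)
Lemma Int2_LK : Int2 (fun h x => (Q x - Q (x - h)) * ker s h).
Proof.
have mk := meas_ker s.
have [C C0 HC] := Int_ker s0 s1.
have [||I _] := HC N W m1 N0 W0 mm1.
- by move=> h; rewrite ger0_norm// powRr1// mulrC; exact: lQ.
- by move=> h; rewrite ger0_norm.
apply: (Int2P (G := fun h => m1 h * ker s h)) => //; first by rewrite /meas2; mea.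
  by move=> h; apply: eq_Int (IntZ (ker s h) (ID h)) => x; rewrite mulrC.
move=> h; rewrite /m1 mulrC -RIZ ?(Int_norm (ID h))// le_eqVlt; apply/orP; left; apply/eqP/eq_RI => x.
by rewrite normrM (ger0_norm (ker_ge0 s h)) mulrC.
Qed.

Lemma Int_LKQ : Int (LK s Q).
Proof. exact: Int2_Int (Int2_swap Int2_LK). Qed.

(** For fixed h, a shift in x moves the increment from phi to Q and changes h into - h; the kernel
    is even. *)
Lemma LK_sym (phi : R -> R) Mp Lp : measurable_fun setT phi -> (forall x, `|phi x| <= Mp) ->
  (forall x y, `|phi x - phi y| <= Lp * `|x - y|) ->
  [/\ Int (fun x => Q x * LK s phi x), Int (fun x => LK s Q x * phi x) &
    \int[mu]_x (LK s Q x * phi x) = \int[mu]_x (Q x * LK s phi x)].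
Proof.
move=> mp bp lp; have mk := meas_ker s.
have [C C0 HC] := LK_bound s0 s1; have hC := HC Lp Mp phi mp bp lp.
have mL : measurable_fun setT (LK s phi).
  by apply: (@meas_RIT _ _ _ (fun x h => (phi x - phi (x - h)) * ker s h)); mea.
have I1 : Int (fun x => Q x * LK s phi x).
  apply: eq_Int (IntMb (M := C * (Lp + 2 * Mp)) mL _ IQ) => [x|x]; first by rewrite mulrC.
  by have [] := hC x.
have I2 : Int (fun x => LK s Q x * phi x).
  by apply: eq_Int (IntMb mp bp Int_LKQ) => x; rewrite mulrC.
split=> //.
have F1 : Int2 (fun h x => (Q x - Q (x - h)) * ker s h * phi x).
  apply: (le_Int2 _ _ (Int2Z Mp (Int2_norm Int2_LK))); first by rewrite /meas2; mea.
  by move=> h x; rewrite normrM mulrC ler_wpM2r.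
have F2 : Int2 (fun x h => Q x * ((phi x - phi (x - h)) * ker s h)).
  apply: (Int2P (G := fun x => C * (Lp + 2 * Mp) * `|Q x|)).
  - by rewrite /meas2; mea.
  - by move=> x; apply: IntZ; have [] := hC x.
  - exact/IntZ/Int_norm.
  - move=> x; have [J B _] := hC x.
    rewrite (eq_RI (g := fun h => `|Q x| * `|(phi x - phi (x - h)) * ker s h|)).
      by rewrite (RIZ _ (Int_norm J)) [leRHS]mulrC; apply: ler_wpM2l.
    by move=> h; rewrite normrM.
have pI v : Int v -> Int (fun x => phi x * v x) by exact: IntMb.
have pQ h : Int (fun x => phi x * Q (x - h)) by apply: pI; exact: (Int_shift (- h) IQ).
have E1 : \int[mu]_x (LK s Q x * phi x) = \int[mu]_h (ker s h * \int[mu]_x (phi x * D h x)).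
  transitivity (\int[mu]_x \int[mu]_h ((Q x - Q (x - h)) * ker s h * phi x)); last first.
    rewrite -(fub F1); apply: eq_RI => h; rewrite -RIZ; last exact: pI.
    by apply: eq_RI => x; rewrite /D; ring.
  have mLQ := Int_meas Int_LKQ.
  have mR : measurable_fun setT (fun x => \int[mu]_h ((Q x - Q (x - h)) * ker s h * phi x)).
    by apply: (@meas_RIT _ _ _ (fun x h => (Q x - Q (x - h)) * ker s h * phi x)); mea.
  apply: ae_eq_RI => //; first by mea.
  by apply: ae_mp (Int2_ae (Int2_swap Int2_LK)) => x Ix; rewrite RIZr.
have E2 : \int[mu]_x (Q x * LK s phi x) = \int[mu]_h (ker s h * \int[mu]_x (phi x * D (- h) x)).
  transitivity (\int[mu]_x \int[mu]_h (Q x * ((phi x - phi (x - h)) * ker s h))).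
    by apply: eq_RI => x; rewrite RIZ//; have [] := hC x.
  rewrite (fub F2); apply: eq_RI => h.
  have Ish := pQ (- h).
  have J : Int (fun x => phi (x - h) * Q x).
    by apply: eq_Int (Int_shift (- h) Ish) => x; rewrite opprK subrK.
  transitivity (\int[mu]_x (ker s h * (phi x * Q x - phi (x - h) * Q x))).
    by apply: eq_RI => x; ring.
  rewrite RIZ; last by apply: IntB => //; exact: pI.
  congr (_ * _); rewrite RIB//; last exact: pI.
  have <- : \int[mu]_x (phi x * Q (x - - h)) = \int[mu]_x (phi (x - h) * Q x).
    by rewrite -(RI_shift (- h) Ish); apply: eq_RI => x; rewrite opprK subrK.
  by rewrite -RIB//; [apply: eq_RI => x; rewrite /D mulrBr|exact: pI].
rewrite E1 E2.
have IA : Int (fun h => ker s h * \int[mu]_x (phi x * D h x)).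
  apply: eq_Int (Int2_Int F1) => h; rewrite -RIZ; last exact: pI.
  by apply: eq_RI => x; rewrite /D; ring.
by rewrite -(RI_opp IA); apply: eq_RI => h; rewrite kerN.
Qed.

Let e := (1 + s) / 2.
Let g h : R := if `|h| < 1 then `|h| `^ e else 1.
Let e0 : 0 < e. Proof. by have := s0; rewrite /e; lra. Qed.
Let se : s < e. Proof. by have := s1; rewrite /e; lra. Qed.
Let mg : measurable_fun setT g. Proof. by rewrite /g; mea. Qed.
Let g_ge0 h : 0 <= g h. Proof. by rewrite /g; case: ifP => // _; exact: powR_ge0. Qed.
Let g_le1 h : g h <= 1.
Proof.
rewrite /g; case: ifP => // h1.
by have := ge0_ler_powR (ltW e0) _ _ (ltW h1); rewrite powR1; apply; rewrite nnegrE.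
Qed.
Let g_pow h : g h <= `|h| `^ e.
Proof.
rewrite /g; case: ltP => // h1.
by have := ge0_ler_powR (ltW e0) _ _ h1; rewrite powR1; apply; rewrite nnegrE.
Qed.
Let g_neq0 h : h != 0 -> g h != 0.
Proof. by move=> h0; rewrite /g; case: ifP => _; rewrite ?oner_neq0// gt_eqF// powR_gt0 ?normr_gt0. Qed.
Let m2 h := (\int[mu]_x (D h x ^+ 2)) / g h.
Let ID2 h : Int (fun x => D h x ^+ 2).
Proof.
have mDh := Int_meas (ID h).
apply: eq_Int (IntMb mDh (D_le h) (ID h)) => x; exact: expr2.
Qed.
Let mm2 : measurable_fun setT m2.
Proof.
have mI : measurable_fun setT (fun h => \int[mu]_x (D h x ^+ 2)).
  by apply: (@meas_RIT _ _ _ (fun h x => D h x ^+ 2)); mea.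
by rewrite /m2; mea.
Qed.
Let RD2_ge0 h : 0 <= \int[mu]_x (D h x ^+ 2).
Proof. by apply: RI_ge0 => x; exact: sqr_ge0. Qed.
Let m2_ge0 h : 0 <= m2 h. Proof. exact: divr_ge0. Qed.
(** Supremum times L1 norm: L |h|^s times N |h|, that is |h|^(1 + s), the square of |h|^e. *)
Let RD2_small h : \int[mu]_x (D h x ^+ 2) <= L * N * (`|h| `^ e * `|h| `^ e).
Proof.
apply: (@le_trans _ _ (L * `|h| `^ s * m1 h)).
  rewrite -RIZ; last exact: Int_norm.
  apply: le_RI => //; first exact/IntZ/Int_norm.
  move=> x; rewrite -(real_normK (num_real (D h x))) expr2 ler_wpM2r//.
  by have := hQ x (x - h); rewrite subKr.
have [->|h0] := eqVneq h 0.
  by rewrite normr0 !powR0 ?gt_eqF// !(mulr0, mul0r).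
rewrite -powD ?normr_gt0// (_ : e + e = s + 1); last by rewrite /e; field.
rewrite powD ?normr_gt0// powRr1// mulrACA ler_wpM2l ?mulr_ge0 ?powR_ge0//.
by rewrite mulrC; exact: lQ.
Qed.
Let B := L * N + 2 * M * W.
Let MW0 : 0 <= 2 * M * W. Proof. by apply: (mulr_ge0 _ W0); exact: mulr_ge0. Qed.
Let B0 : 0 <= B. Proof. by apply: addr_ge0 => //; exact: mulr_ge0. Qed.
Let m2_pow h : m2 h <= B * `|h| `^ e.
Proof.
have p0 := powR_ge0 `|h| e; rewrite /m2 /g; case: ltP => h1.
  have [->|h0] := eqVneq h 0; first by rewrite normr0 !powR0 ?gt_eqF// invr0 !mulr0.
  have pp : 0 < `|h| `^ e by rewrite powR_gt0 ?normr_gt0.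
  rewrite ler_pdivrMr//; apply: le_trans (RD2_small h) _; rewrite -[leRHS]mulrA.
  by apply: ler_wpM2r; [exact: mulr_ge0|rewrite lerDl].
rewrite invr1 mulr1; apply: (@le_trans _ _ (2 * M * W)).
  apply: (@le_trans _ _ (2 * M * m1 h)); last by rewrite ler_wpM2l// mulr_ge0.
  rewrite -RIZ; last exact: Int_norm.
  apply: le_RI => //; first exact/IntZ/Int_norm.
  by move=> x; rewrite -(real_normK (num_real (D h x))) expr2 ler_wpM2r.
have p1 : 1 <= `|h| `^ e.
  by have := ge0_ler_powR (ltW e0) _ _ h1; rewrite powR1; apply; rewrite nnegrE.
apply: (@le_trans _ _ B); first by rewrite lerDr; exact: mulr_ge0.
by rewrite -[leLHS]mulr1 ler_wpM2l.
Qed.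
Let m2_le h : m2 h <= B.
Proof.
have [h1|h1] := ltP `|h| 1.
  apply: le_trans (m2_pow h) _; rewrite -[leRHS]mulr1 ler_wpM2l//.
  by have := ge0_ler_powR (ltW e0) _ _ (ltW h1); rewrite powR1; apply; rewrite nnegrE.
rewrite /m2 /g ltNge h1/= invr1 mulr1; apply: (@le_trans _ _ (2 * M * m1 h)); last first.
  by apply: (@le_trans _ _ (2 * M * W)); [rewrite ler_wpM2l// mulr_ge0|rewrite lerDr; exact: mulr_ge0].
rewrite -RIZ; last exact: Int_norm.
apply: le_RI => //; first exact/IntZ/Int_norm.
by move=> x; rewrite -(real_normK (num_real (D h x))) expr2 ler_wpM2r.
Qed.

(* Cauchy-Schwarz in [h] with the weight [g h * ker s h], where [g h] behaves
   like [|h| ^ ((1 + s) / 2)] at 0; the Hoelder bound alone would only give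
   logarithmically divergent integrals. *)
Lemma L2_LKQ : L2 (fun=> 1) (LK s Q).
Proof.
have mk := meas_ker s; have mLQ := Int_meas Int_LKQ.
have k0 : ker s 0 = 0 by rewrite ker0.
have [C C0 HC] := Int_ker s0 se.
have [||I _] := HC B B m2 B0 B0 mm2.
- by move=> h; rewrite ger0_norm.
- by move=> h; rewrite ger0_norm.
have [||Ig _] := HC 1 1 g ler01 ler01 mg.
- by move=> h; rewrite ger0_norm// mul1r.
- by move=> h; rewrite ger0_norm.
have I2 : Int2 (fun h x => D h x ^+ 2 / g h * ker s h).
  apply: (Int2P (G := fun h => m2 h * ker s h)) => //; first by rewrite /meas2; mea.
    by move=> h; apply: eq_Int (IntZ (ker s h / g h) (ID2 h)) => x; ring.
  move=> h; rewrite (eq_RI (g := fun x => ker s h / g h * D h x ^+ 2)); last first.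
    move=> x; rewrite ger0_norm; first by rewrite mulrC [RHS]mulrAC mulrA.
    by apply: mulr_ge0; [apply: divr_ge0 => //; exact: sqr_ge0|exact: ker_ge0].
  by rewrite RIZ// /m2 le_eqVlt; apply/orP; left; apply/eqP; ring.
pose V x := \int[mu]_h (D h x ^+ 2 / g h * ker s h).
pose A := \int[mu]_h (g h * ker s h).
have A0 : 0 <= A by apply: RI_ge0 => h; rewrite mulr_ge0 ?ker_ge0.
have V0 x : 0 <= V x.
  by apply: RI_ge0 => h; apply: mulr_ge0; [apply: divr_ge0 => //; exact: sqr_ge0|exact: ker_ge0].
have IV : Int (fun x => A * V x) by apply: IntZ; exact: Int2_Int (Int2_swap I2).
have ae : {ae mu, forall x, LK s Q x ^+ 2 <= A * V x}.
  apply: ae_mp (Int2_ae (Int2_swap I2)) => x Ix.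
  have wr : wt (fun h => g h * ker s h).
    by split=> [|h]; [mea|rewrite mulr_ge0 ?ker_ge0].
  have L1 : L2 (fun h => g h * ker s h) (fun h => D h x / g h).
    split; first by rewrite /D; mea.
    apply: eq_Int Ix => h /=; have [->|h0] := eqVneq h 0; first by rewrite k0 !(mulr0, mul0r).
    by field; exact: g_neq0.
  have Lo : L2 (fun h => g h * ker s h) (fun=> 1).
    by split; [exact: measurable_cst|apply: eq_Int Ig => h; rewrite expr1n mul1r].
  have := CS wr L1 Lo; rewrite !ip_sqr [X in _ <= _ * X](_ : _ = A); last first.
    by apply: eq_RI => h; rewrite expr1n mul1r.
  rewrite (_ : ip _ _ _ = LK s Q x); last first.
    apply: eq_RI => h; have [->|h0] := eqVneq h 0; first by rewrite k0 !(mulr0, mul0r).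
    by rewrite /D; field; exact: g_neq0.
  rewrite mulrC (_ : \int[mu]_h _ = V x)//; apply: eq_RI => h.
  have [->|h0] := eqVneq h 0; first by rewrite k0 !(mulr0, mul0r).
  by field; exact: g_neq0.
have mV : measurable_fun setT (fun x => A * V x) := Int_meas IV.
split=> //.
pose k x := if LK s Q x ^+ 2 <= A * V x then LK s Q x ^+ 2 else 0.
have mk2 : measurable_fun setT k by rewrite /k; mea.
have Ik : Int k.
  apply: (le_Int mk2 _ IV) => x; rewrite /k; case: ifPn => h.
    by rewrite ger0_norm ?sqr_ge0.
  by rewrite normr0 mulr_ge0.
apply: ae_eq_Int Ik; first by mea.
by apply: ae_mp ae => x hx; rewrite /k hx mulr1.
Qed.

Lemma fracLap_weak_LK : is_fracLap_weak (s / 2) Q (fun x => fracLap_const (s / 2) * LK s Q x).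
Proof.
move=> phi sp; have [mp [Mp bp] [Lp lp]] := schwartz_lip sp.
have [I1 I2 E] := LK_sym mp bp lp.
have F1 x : Q x * fracLap_pv (s / 2) phi x = fracLap_const (s / 2) * (Q x * LK s phi x).
  by rewrite (fracLap_pvE x s0 s1 mp bp lp) mulrCA.
have F2 x : fracLap_const (s / 2) * LK s Q x * phi x = fracLap_const (s / 2) * (LK s Q x * phi x).
  by rewrite mulrA.
split.
- exact: eq_Int (fun x => esym (F1 x)) (IntZ _ I1).
- exact: eq_Int (fun x => esym (F2 x)) (IntZ _ I2).
- by rewrite (eq_RI F1) (eq_RI F2) (RIZ _ I1) (RIZ _ I2) E.
Qed.

End fractional_integral.

Section weighted_polynomial_Hs.
Context {R : realType}.
Notation mu := (@lebesgue_measure R).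
Variables (s : R) (P : {poly R}).
Hypotheses (s0 : 0 < s) (s1 : s < 1).
Let Q : R -> R := wp (- s) P.
Let ms1 : - s < 1. Proof. by have := s0; lra. Qed.
Let IQ : Int Q. Proof. exact: Int_wp. Qed.

Definition LQ (x : R) : R := fracLap_const (s / 2) * LK s Q x.

Lemma wp_witness : [/\ is_fracLap_weak (s / 2) Q LQ, Int LQ & L2 (fun=> 1) LQ].
Proof.
have [M bQ] := wp_bounded P s0; have [L _ hQ] := wp_holder P s0 s1.
have lQ := wp_translate P s0.
split.
- by have := fracLap_weak_LK s0 s1 IQ lQ.
- apply: IntZ; exact: (Int_LKQ s0 s1 IQ lQ).
- apply: L2Z; exact: (L2_LKQ s0 s1 IQ bQ hQ lQ).
Qed.

Lemma weight_wp x : wp (- s) P x * weight s x = weight 0 x * P.[x].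
Proof. by rewrite /wp mulrAC weightM addNr. Qed.

Lemma wp_fracLap : {ae mu, forall x, fracLap (s / 2) Q x = LQ x}.
Proof.
have [h _ _] := wp_witness; have s2 : 0 < s / 2 by rewrite divr_gt0.
have h' : is_fracLap (s / 2) Q LQ by rewrite is_fracLap_pos.
have := fracLap_witness h'; rewrite is_fracLap_pos// => h2.
exact: fracLap_weak_uniq h2 h.
Qed.

Lemma L2_wp : L2 (weight s) Q.
Proof.
have [C C0 HC] := poly_bounded P; have mQ := Int_meas IQ; split=> //.
apply: (@eq_Int _ (fun x => weight (- s) x * (P.[x] ^+ 2))).
  move=> x; rewrite expr2 -mulrA weight_wp /Q /wp mulrACA weightM addr0.
  by [].
apply: (@Int_weightM _ _ _ (C ^+ 2)) => // [|x x1]; first by mea.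
by rewrite normrX ler_pXn2r ?nnegrE ?HC.
Qed.

Lemma wp_Hs : Hs s Q.
Proof.
have mQ := Int_meas IQ; have [h I L] := wp_witness.
have s2 : 0 < s / 2 by rewrite divr_gt0.
split=> //.
- rewrite (int_restrict s (fun x => Q x ^+ 2)); have [_ IQ2] := L2_wp.
  by rewrite (Int_fin IQ2) ltry.
- apply: ae_all => x /negP x1; rewrite /Q wp_zero//.
  by rewrite leNgt; apply: contra x1 => x1; rewrite -ler_norml ltW.
- exists LQ; split; [by rewrite is_fracLap_pos|exact: Int_meas I|].
  have I2 : Int (fun x => LQ x ^+ 2) by apply: eq_Int L.2 => x; rewrite mulr1.
  by rewrite (Int_fin I2) ltry.
Qed.

End weighted_polynomial_Hs.
Transparent Rintegral powR.

(** * The pairing with the weighted system *)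

Opaque Rintegral powR riesz H pk dG.

Section riesz_regularity.
Context {R : realType}.
Notation mu := (@lebesgue_measure R).
Implicit Types (a b c d s t u x y z th ka M C : R) (f g v q : R -> R) (p r : {poly R}).

(** The flow is bounded by t^(-th/2) and its gradient by t^(-1/2 - th/2), by splitting the time into
    two halves; th lies strictly between these two exponents. *)
Lemma riesz_wp_holder th p ka : 0 < th -> th < 1 -> th < ka -> hdec ka (wp th p) ->
  exists2 C, 0 <= C & forall x z, `|riesz th (wp th p) x - riesz th (wp th p) z| <= C * `|x - z| `^ th.
Proof.
move=> th0 th1 tk dk; have Iq := Int_wp p th1; set q := wp th p in Iq dk *.
have dh : hdec (th / 2) q := hdec_wp p th0 th1.
have h2 : th / 2 < th by lra.
have h3 : th < 2^-1 + th / 2 by lra.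
have [II _] := riesz_bounded Iq h2 tk dh dk.
have [C C0 hC] := dh.
have [D D0 HD] := pk_two_sided h2 h3.
pose B := C * 4 * 2^-1 `^ (- (2^-1 + th / 2)).
have B0 : 0 <= B by rewrite !mulr_ge0// powR_ge0.
have gq := Int_gtest Iq; have mH := meas_H gq.
have lip t x z : 0 < t -> `|H q t x - H q t z| <= B * t `^ (- (2^-1 + th / 2)) * `|x - z|.
  move=> t0; have t2 : 0 < t / 2 by rewrite divr_gt0.
  have tt : t / 2 + t / 2 = t by field.
  have [_ e1] := H_semigroup x gq t2 t2; have [_ e2] := H_semigroup z gq t2 t2.
  rewrite tt in e1 e2; rewrite -e1 -e2.
  have mv : measurable_fun setT (H q (t / 2)).
    by rewrite (_ : H q (t / 2) = fun a => H q (t / 2) a)//; mea.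
  apply: (le_trans (H_lip x z mv (fun a => hC (t / 2) a t2) t2)).
  apply: ler_wpM2r => //.
  have -> : (Num.sqrt (t / 2))^-1 = (t / 2) `^ (- 2^-1) by rewrite powRN powR12_sqrt// ltW.
  rewrite (_ : C * (t / 2) `^ (- (th / 2)) * (4 * (t / 2) `^ (- 2^-1)) =
     C * 4 * ((t / 2) `^ (- (th / 2)) * (t / 2) `^ (- 2^-1))); last by ring.
  rewrite -powD// (_ : - (th / 2) + - 2^-1 = - (2^-1 + th / 2)); last by ring.
  rewrite /B -[leRHS]mulrA -powRM ?invr_ge0 ?(ltW t0)//.
  by rewrite [_^-1 * t]mulrC.
exists (D * (2 * C + B)); first by rewrite mulr_ge0// addr_ge0// mulr_ge0.
move=> x z; have [->|xz] := eqVneq x z; first by rewrite subrr normr0 mulr_ge0 ?powR_ge0// mulr_ge0// addr_ge0// mulr_ge0.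
have l0 : 0 < `|x - z| by rewrite normr_gt0 subr_eq0.
pose h t := H q t x - H q t z.
have mh : measurable_fun setT h by rewrite /h; mea.
(* Cutting the time at |x - z|^2 balances the two bounds, each giving |x - z|^th. *)
have [||I E] := HD (2 * C) (B * `|x - z|) (`|x - z| ^+ 2) h (mulr_ge0 (ler0n R 2) C0)
   (mulr_ge0 B0 (normr_ge0 _)) (exprn_gt0 2 l0) mh.
- move=> t t0; apply: (le_trans (ler_normB _ _)).
  by rewrite -mulrA mulr_natl mulr2n; apply: lerD; exact: hC.
- by move=> t t0; rewrite mulrAC; exact: lip.
have -> : riesz th q x - riesz th q z = \int[mu]_t (pk th t * h t).
  by rewrite -RIB//; apply: eq_RI => t; rewrite -mulrBr.
apply: (le_trans (norm_RI I)); apply: (le_trans E).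
rewrite -mulrA ler_wpM2l//.
have sq e : (`|x - z| ^+ 2) `^ e = `|x - z| `^ (2 * e) by rewrite powRrM powR_mulrn.
rewrite !sq (_ : 2 * (th - th / 2) = th); last by field.
rewrite (_ : 2 * (th - (2^-1 + th / 2)) = th - 1); last by field.
rewrite -(mulrA B) (_ : `|x - z| * `|x - z| `^ (th - 1) = `|x - z| `^ th); last first.
  by rewrite -{1}(powRr1 (ltW l0)) -powD//; congr (_ `^ _); ring.
by rewrite [leRHS]mulrDl.
Qed.

Lemma ae_exists (Pr : R -> Prop) a b : a < b -> {ae mu, forall x, Pr x} ->
  exists x, a < x < b /\ Pr x.
Proof.
move=> ab h; apply: contrapT => hn.
have : \int[mu]_x box a b x = \int[mu]_x (0 : R).
  have mb : measurable_fun setT (box a b) by mea.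
  apply: ae_eq_RI; [exact: mb|exact: measurable_cst|].
  apply: ae_mp h => x px; rewrite /box; case: ifP => // hx.
  by exfalso; apply: hn; exists x.
by rewrite RI0 RI_box1 ?(ltW ab)// => /eqP; rewrite subr_eq0 gt_eqF.
Qed.

(** Every interval to the right of x contains a point where the equality holds; continuity of both
    sides carries it to x. The local expansions below need the equality at every point. *)
Lemma holder_ae_poly v p th C : 0 < th -> 0 <= C ->
  (forall x y, `|v x - v y| <= C * `|x - y| `^ th) ->
  {ae mu, forall x, `|x| < 1 -> v x = p.[x]} -> forall x, `|x| < 1 -> v x = p.[x].
Proof.
move=> th0 C0 hv hae x x1; have [K K0 HK] := poly_lip p.
apply/eqP; rewrite -subr_eq0 -normr_eq0 eq_le normr_ge0 andbT leNgt; apply/negP => e0.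
have c0 : C * rad n `^ th + K * rad n @[n --> \oo] --> (0 : R).
  rewrite -[X in _ --> X](addr0 0) -[X in _ --> X + _](mulr0 C) -[X in _ --> _ + X](mulr0 K).
  apply: cvgD; (apply: cvgM; first exact: cvg_cst); last exact: rad_cvg.
  by apply: powR_cvg0 => // [n|]; [exact/ltW/rad_gt0|exact: rad_cvg].
have d0 : 0 < 1 - `|x| by rewrite subr_gt0.
have h1 : \forall n \near \oo, C * rad n `^ th + K * rad n < `|v x - p.[x]| by exact: cvgr_lt c0 _ e0.
have h2 : \forall n \near \oo, (rad n : R) < 1 - `|x| by exact: cvgr_lt (@rad_cvg R) _ d0.
near \oo => n.
have k1 : C * rad n `^ th + K * rad n < `|v x - p.[x]| by near: n.
have k2 : (rad n : R) < 1 - `|x| by near: n.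
have r0 := @rad_gt0 R n.
have xr : x < x + rad n by rewrite ltrDl.
have [y [/andP[y1 y2] hy]] := ae_exists xr hae.
have xy : `|x - y| <= rad n by rewrite distrC ger0_norm; lra.
have y11 : `|y| < 1.
  by rewrite (_ : y = x + (y - x)); [apply: (le_lt_trans (ler_normD _ _)); rewrite distrC in xy; lra|ring].
move: k1; apply/negP; rewrite -leNgt.
have -> : v x - p.[x] = (v x - v y) + (p.[y] - p.[x]) by rewrite hy//; ring.
apply: (le_trans (ler_normD _ _)); apply: lerD.
  apply: (le_trans (hv x y)); rewrite ler_wpM2l// ge0_ler_powR ?nnegrE ?(ltW th0) ?(ltW r0)//.
by apply: (le_trans (HK y x (ltW y11) (ltW x1))); rewrite ler_wpM2l// distrC.
Unshelve. all: by end_near. Qed.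

Section derivative.
Variables (s C M : R) (v : R -> R) (r : {poly R}).
Hypotheses (s0 : 0 < s) (s1 : s < 1) (C0 : 0 <= C) (mv : measurable_fun setT v)
  (bv : forall x, `|v x| <= M) (hv : forall x y, `|v x - v y| <= C * `|x - y| `^ (1 - s))
  (vr : forall x, `|x| < 1 -> v x = r.[x]).

Lemma poly_taylor2 a : exists2 K, 0 <= K &
  forall x, `|a| <= 1 -> `|x| <= 1 -> `|r.[x] - r.[a] - r^`().[a] * (x - a)| <= K * (x - a) ^+ 2.
Proof.
have /factor_theorem[g hg] : root (r - r.[a]%:P) a by rewrite /root !hornerE subrr.
have [K K0 HK] := poly_lip g; exists K => // x a1 x1.
have e1 : r.[x] - r.[a] = g.[x] * (x - a).
  by have := congr1 (fun p => p.[x]) hg; rewrite !hornerE.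
have e2 : r^`().[a] = g.[a].
  have : r = g * ('X - a%:P) + r.[a]%:P by rewrite -hg subrK.
  by move=> ->; rewrite derivD derivC addr0 derivM derivXsubC mulr1 !hornerE subrr mulr0 add0r.
rewrite e1 e2 -mulrBl normrM -(real_normK (num_real (x - a))) expr2 mulrA ler_wpM2r//.
exact: HK.
Qed.

(** As long as a + z stays inside (-1,1) by |z| < 1 - |a|, v is a polynomial. Beyond that, |z|^(1 -
    s) is at most (1 - |a|)^(- s) |z|, so a Lipschitz bound at a survives with a constant that blows
    up at the ends. *)
Let v_lip : exists2 K, 0 <= K & forall a z, `|a| < 1 ->
  `|v (a + z) - v a| <= K * (1 - `|a|) `^ (- s) * `|z|.
Proof.
have [K K0 HK] := poly_lip r; exists (K + C); first exact: addr_ge0.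
move=> a z a1; have d0 : 0 < 1 - `|a| by rewrite subr_gt0.
have p0 := powR_ge0 (1 - `|a|) (- s).
have p1 : 1 <= (1 - `|a|) `^ (- s).
  have d1 : 1 - `|a| <= 1 by rewrite gerBl.
  rewrite powRN invf_ge1 ?powR_gt0//.
  by have := ge0_ler_powR (ltW s0) _ _ d1; rewrite powR1; apply; rewrite nnegrE ltW.
have [zd|zd] := ltP `|z| (1 - `|a|).
  have az : `|a + z| < 1 by apply: (le_lt_trans (ler_normD _ _)); lra.
  rewrite !vr//; apply: (le_trans (HK _ _ (ltW az) (ltW a1))).
  rewrite addrAC subrr add0r ler_wpM2r//.
  apply: (@le_trans _ _ (K + C)); first by rewrite lerDl.
  by rewrite -[leLHS]mulr1 ler_wpM2l// addr_ge0.
have z0 : 0 < `|z| := lt_le_trans d0 zd.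
have := hv (a + z) a; rewrite addrAC subrr add0r => h; apply: (le_trans h).
rewrite (_ : 1 - s = - s + 1); last by ring.
rewrite powD// powRr1 ?(ltW z0)// mulrA ler_wpM2r//.
apply: (@le_trans _ _ (C * (1 - `|a|) `^ (- s))); last by rewrite ler_wpM2r// lerDr.
rewrite ler_wpM2l// !powRN lef_pV2 ?posrE ?powR_gt0//.
by rewrite ge0_ler_powR ?nnegrE ?(ltW s0) ?(ltW d0) ?(ltW z0).
Qed.

Let DE t a : 0 < t -> Int (fun z => (v (a + z) - v a) * dG t z) /\
  \int[mu]_y (v y * dG t (y - a)) = \int[mu]_z ((v (a + z) - v a) * dG t z).
Proof.
move=> t0; have [Id _] := Int_dG t0.
have mva : measurable_fun setT (fun z => v (a + z)) by mea.
have I1 : Int (fun z => v (a + z) * dG t z) by apply: (IntMb mva) => // x; exact: bv.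
have I2 : Int (fun z => v a * dG t z) by exact: IntZ.
split; first by apply: eq_Int (IntB I1 I2) => z; rewrite mulrBl.
transitivity (\int[mu]_z (v (a + z) * dG t z)).
  rewrite -(RI_shift (- a) I1); apply: eq_RI => y.
  by rewrite (_ : a + (y - a) = y)//; ring.
rewrite -[LHS]subr0 -(mulr0 (v a)) -(RI_dG0 t0) -RIZ// -RIB//.
by apply: eq_RI => z; rewrite mulrBl.
Qed.

(** The blow-up (1 - |a|)^(-s) is comparable to the weight itself, which is what domination
    requires, since u times the weight is integrable. *)
Lemma heat_derivative_le : exists2 K, 0 <= K & forall t a, 0 < t -> `|a| < 1 ->
  `|\int[mu]_y (v y * dG t (y - a))| <= K * weight s a.
Proof.
have [K K0 HK] := v_lip; exists (K * 2 * 8); first by rewrite !mulr_ge0.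
move=> t a t0 a1; have [I ->] := DE a t0; have [I1 E1] := Int_dG1 t0.
have d0 : 0 < 1 - `|a| by rewrite subr_gt0.
have p0 := powR_ge0 (1 - `|a|) (- s).
have wd : (1 - `|a|) `^ (- s) <= 2 * weight s a.
  have a2 := sqr_lt1 a1; rewrite /weight a1 !powRN ler_pdivlMr ?powR_gt0//.
  rewrite mulrC ler_pdivrMr ?powR_gt0//.
  apply: (@le_trans _ _ ((2 * (1 - `|a|)) `^ s)).
    rewrite ge0_ler_powR ?nnegrE ?(ltW s0) ?(ltW a2) ?mulr_ge0 ?(ltW d0)//.
    have e2 : a ^+ 2 = `|a| ^+ 2 by rewrite real_normK ?num_real.
    by rewrite e2; have := sqr_ge0 (1 - `|a|); nra.
  rewrite powRM ?(ltW d0)// ler_wpM2r ?powR_ge0//.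
  rewrite -[leRHS](powRr1 (_ : 0 <= 2))//; apply: ler_powR; [by lra|exact: ltW].
apply: (@le_trans _ _ (\int[mu]_z (K * (1 - `|a|) `^ (- s) * `|z * dG t z|))).
  apply: norm_RI_le => //; first exact/IntZ/Int_norm.
  move=> z; rewrite (normrM (v (a + z) - v a)) (normrM z) mulrA.
  by apply: ler_wpM2r; [exact: normr_ge0|exact: HK].
rewrite RIZ; last exact: Int_norm.
apply: (@le_trans _ _ (K * (1 - `|a|) `^ (- s) * 8)); first by rewrite ler_wpM2l// mulr_ge0.
by have := ler_wpM2l K0 wd; lra.
Qed.

(** Subtract the tangent line, whose pairing is exact because the kernel has mean 0 and first moment
    -1; the rest is O(z^2) on the whole line and contributes O(sqrt t). *)
Lemma heat_derivative_cvg a : `|a| < 1 ->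
  \int[mu]_y (v y * dG (2 * rad n) (y - a)) @[n --> \oo] --> - r^`().[a].
Proof.
move=> a1; have d0 : 0 < 1 - `|a| by rewrite subr_gt0.
have [K K0 HK] := v_lip; have [L L0 HL] := poly_taylor2 a.
pose B := L + (K * (1 - `|a|) `^ (- s) + `|r^`().[a]|) / (1 - `|a|).
have p0 : 0 <= K * (1 - `|a|) `^ (- s) by rewrite mulr_ge0 ?powR_ge0.
have B0 : 0 <= (K * (1 - `|a|) `^ (- s) + `|r^`().[a]|) / (1 - `|a|).
  by apply: divr_ge0; [exact: addr_ge0|exact: ltW].
have hpsi z : `|v (a + z) - v a - r^`().[a] * z| <= B * z ^+ 2.
  have [zd|zd] := ltP `|z| (1 - `|a|).
    have az : `|a + z| < 1 by apply: (le_lt_trans (ler_normD _ _)); lra.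
    rewrite !vr//; have := HL (a + z) (ltW a1) (ltW az); rewrite (_ : a + z - a = z); last by ring.
    by move=> h; apply: (le_trans h); rewrite ler_wpM2r ?sqr_ge0// lerDl.
  apply: (@le_trans _ _ ((K * (1 - `|a|) `^ (- s) + `|r^`().[a]|) * `|z|)).
    by apply: (le_trans (ler_normB _ _)); rewrite mulrDl normrM lerD2r HK.
  apply: (@le_trans _ _ ((K * (1 - `|a|) `^ (- s) + `|r^`().[a]|) / (1 - `|a|) * z ^+ 2)).
    rewrite -mulrA ler_wpM2l ?addr_ge0// -(real_normK (num_real z)) expr2 mulrA.
    by rewrite -[leLHS]mul1r ler_wpM2r// ler_pdivlMl// mulr1.
  by rewrite ler_wpM2r ?sqr_ge0// lerDr.
have e t : 0 < t -> `|\int[mu]_y (v y * dG t (y - a)) - - r^`().[a]| <= B * (64 * Num.sqrt (2 * t)).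
  move=> t0; have [I ->] := DE a t0; have [I1 _] := Int_dG1 t0.
  have t4 : 0 < 4 * t by rewrite mulr_gt0.
  have -> : - r^`().[a] = \int[mu]_z (r^`().[a] * (z * dG t z)) by rewrite RIZ// RI_dG1// mulrN1.
  rewrite -RIB//; last exact: IntZ.
  have IG := IntZ (B * (64 * Num.sqrt (2 * t))) (Int_G0 t4).
  apply: (@le_trans _ _ (\int[mu]_z (B * (64 * Num.sqrt (2 * t)) * G (4 * t) z))).
    apply: norm_RI_le => //; first by apply: IntB => //; exact: IntZ.
    move=> z; rewrite (mulrA r^`().[a]) -mulrBl normrM -[leRHS]mulrA.
    apply: (@le_trans _ _ (B * z ^+ 2 * `|dG t z|)); first by rewrite ler_wpM2r// hpsi.
    by rewrite -mulrA ler_wpM2l ?dG_moment2// addr_ge0.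
  by rewrite RIZ ?RI_G0 ?mulr1//; exact: Int_G0.
apply/cvgrPdist_le => eps eps0.
have c0 : B * (64 * Num.sqrt (2 * (2 * rad n))) @[n --> \oo] --> (0 : R).
  have -> : (fun n => B * (64 * Num.sqrt (2 * (2 * rad n)))) =
      (fun n => B * 128 * rad n `^ 2^-1) :> (nat -> R).
    apply/funext => n; rewrite (_ : 2 * (2 * rad n) = 2 ^+ 2 * rad n); last by ring.
    rewrite sqrtrM ?exprn_ge0// sqrtr_sqr ger0_norm// powR12_sqrt; first by ring.
    exact/ltW/rad_gt0.
  rewrite -(mulr0 (B * 128)); apply: cvgM; first exact: cvg_cst.
  by apply: powR_cvg0 => // [n|]; [exact/ltW/rad_gt0|exact: rad_cvg].
have h1 : \forall n \near \oo, B * (64 * Num.sqrt (2 * (2 * rad n))) < eps by exact: cvgr_lt c0 _ eps0.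
near=> n; rewrite distrC; apply: (le_trans (e _ _)); first by rewrite mulr_gt0 ?rad_gt0.
by apply: ltW; near: n.
Unshelve. all: by end_near. Qed.

End derivative.

End riesz_regularity.

(** * Pairing with the weighted Jacobi polynomials *)

Section pairing.
Context {R : realType}.
Notation mu := (@lebesgue_measure R).
Implicit Types (a b c t x y z : R) (u v f g : R -> R) (n : nat).
Variable s : R.
Hypotheses (s0 : 0 < s) (s1 : s < 1).
Let P n : {poly R} := jacp s n.
Let Q n : R -> R := wp (- s) (P n).
Let q n : R -> R := wp (1 - s) (lower_poly s (P n)).
Let r n : {poly R} := lower_poly s (P n).
(** The lowered polynomials start in degree 1; the constant 1 completes them to a family with one
    eigenpolynomial in each degree, as completeness requires. *)
Let E n : {poly R} := if n is k.+1 then r k else 1.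
Let ms1 : - s < 1. Proof. by have := s0; lra. Qed.
Let sm1 : -1 < s. Proof. by have := s0; lra. Qed.
Let os1 : 1 - s < 1. Proof. by have := s0; lra. Qed.
Let os0 : 0 < 1 - s. Proof. by have := s1; lra. Qed.
Let os1' : 1 - s <= 1. Proof. exact: ltW. Qed.
Let IQ n : Int (Q n). Proof. exact: Int_wp. Qed.
Let Iq n : Int (q n). Proof. exact: Int_wp. Qed.
Let eP n : eigp (- s) (eigval (- s) n) (P n). Proof. exact: eigp_jacp. Qed.
Let er n : eigp (1 - s) (eigval (1 - s) n.+1) (r n). Proof. exact: eigp_lower. Qed.
Let dq n : hdec 1 (q n).
Proof. exact: (hdec_wp_mean0 os1 (er n) (eigval_neq0 os1 _)). Qed.
Let dq2 n : hdec ((1 - s) / 2) (q n). Proof. exact: hdec_wp. Qed.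
Let h2 : (1 - s) / 2 < 1 - s. Proof. by have := os0; lra. Qed.

Let sE n : size (E n) = n.+1.
Proof. by case: n => [|n] /=; [rewrite size_poly1|apply: size_lower => //; exact: size_jacp]. Qed.

Let eE n : eigp (1 - s) (eigval (1 - s) n) (E n).
Proof.
case: n => [|n] /=; last exact: er.
by move=> x; rewrite /eigval mul0r derivC derivC !hornerC; ring.
Qed.

Lemma riesz_lower n : exists c, forall x, `|x| < 1 ->
  riesz (1 - s) (q n) x = (c *: r n).[x].
Proof.
have [c hc] := riesz_mode os0 os1 sE eE (n := n.+1) (er n) os1 (dq n).
have [C C0 hC] := riesz_wp_holder os0 os1 os1 (dq n).
exists c; apply: (holder_ae_poly os0 C0 hC).
by apply: ae_mp hc => x h x1; rewrite h// hornerZ.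
Qed.

(** Integration by parts on (-1,1), without boundary terms because the weighted polynomial vanishes
    at both ends. One of the two derivatives in |x|^2 is thus put on Q. *)
Lemma fm_parts n a x : x * fm (Q n) a x = - \int[mu]_y (q n y * sin ((y - a) * x)).
Proof.
have de y : is_derive y (1 : R) (fun y => sin ((y - a) * x)) (x * cos ((y - a) * x)).
  have d1 : is_derive y (1 : R) (fun y : R => (y - a) * x) x.
    by apply: is_derive_eq; rewrite /GRing.scale /=; ring.
  have dc := @is_derive1_comp R sin (fun y : R => (y - a) * x) y _ _ (is_derive_sin _) d1.
  by apply: (is_derive_eq dc); rewrite /GRing.scale /=; ring.
have ce : continuous (fun y => x * cos ((y - a) * x)).
  move=> y; apply: cvgM; first exact: cvg_cst.
  apply: (cvg_comp (fun y => (y - a) * x) cos _ (@continuous_cos R _)).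
  by apply: cvgM; [apply: cvgB; [exact: cvg_id|exact: cvg_cst]|exact: cvg_cst].
have l11 : (-1 : R) < 1 by lra.
have [|I E1] := wp_FTC (P n) s0 (lexx _) l11 (lexx _) de ce (M := 1 + `|x|).
  move=> y _; split; first by apply: (le_trans (norm_sin_le1 _)); rewrite lerDl.
  by rewrite normrM; apply: (@le_trans _ _ (`|x| * 1)); [rewrite ler_wpM2l ?norm_cos_le1|lra].
have Is : Int (fun y => q n y * sin ((y - a) * x)) by apply: Int_sin => //; mea.
have Ic : Int (fun y => Q n y * cos ((y - a) * x)) by apply: Int_cos => //; mea.
have : \int[mu]_y (q n y * sin ((y - a) * x) + x * (Q n y * cos ((y - a) * x))) = 0.
  have z1 : wp (- s) (P n) 1 = 0 by rewrite wp_zero ?normr1.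
  have z2 : wp (- s) (P n) (-1) = 0 by rewrite wp_zero ?normrN1.
  rewrite z1 z2 !mul0r subrr in E1; rewrite -[RHS]E1; apply: eq_RI => y; rewrite /box -ltr_norml; case: ifPn => y1.
    by rewrite mulr1 /q /Q; ring.
  by rewrite mulr0 /q /Q !wp_zero ?leNgt// !mul0r mulr0 addr0.
rewrite RID//; last exact: IntZ.
by rewrite RIZ// => /eqP; rewrite addrC addr_eq0 => /eqP.
Qed.

Let PI0 : 2 * pi != 0 :> R. Proof. by rewrite mulf_neq0 ?gt_eqF ?pi_gt0. Qed.

Let adm_fm n a al : -1 < al -> al <= 2 -> adm al (fm (Q n) a).
Proof. exact: fm_adm. Qed.

(** The factorisation |x|^(2 s) = |x|^2 |x|^(-2 (1 - s)): one derivative falls on Q, one stays on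
    the Gaussian, and the remaining factor is a Riesz potential of order 1 - s. *)
Lemma MM_riesz n t a : 0 < t -> MM (s + s) (fm (Q n) a) t =
  2 * pi / gamma_c (1 - s) * \int[mu]_x (riesz (1 - s) (q n) x * dG t (x - a)).
Proof.
move=> t0; have [Id _] := Int_dG t0; have Ida := Int_shift (- a) Id.
have g0 : gamma_c (1 - s) != 0 by rewrite gt_eqF// gamma_c_gt0.
have e2 : s + s = 2 - 2 * (1 - s) by ring.
have am2 : adm 2 (fm (Q n) a) by apply: adm_fm; lra.
have am3 : adm (2 - 2 * (1 - s)) (fm (Q n) a).
  by rewrite -e2; apply: adm_fm; have := s0; have := s1; lra.
have [_ S] := subordination_neg os0 os1' am2 am3 t0.
have [_ _ ->] := riesz_pair_bounded (Iq n) Ida h2 os1 (dq2 n) (dq n).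
apply: (mulfI g0); rewrite e2 -S.
have F (k c x : R) : k != 0 -> k * (c / k * x) = c * x.
  by move=> k0; rewrite mulrA mulrCA divff// mulr1.
rewrite (F _ _ _ g0).
have [_ I _] := riesz_pair_bounded (Iq n) Ida h2 os1 (dq2 n) (dq n).
rewrite -RIZ//; apply: eq_RI => u; have [u0|u0] := ltP 0 u; last by rewrite pk_neg// !mul0r mulr0.
rewrite mulrCA; congr (_ * _).
rewrite (MM2 (IQ n) (Iq n) (addr_gt0 t0 u0) (fm_parts n a)).
by rewrite (H_dG_conv a (Iq n) u0 t0) [u + t]addrC.
Qed.

Let kap : R := fracLap_const (s / 2).

(** Each application of (-Delta)^(s/2) raises the exponent by s, first from 0 to s and then from s
    to 2 s; the constants are collected in c. *)
Lemma LQ_pairing_kernel n : exists c, forall t a, 0 < t ->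
  kap * \int[mu]_x (LQ s (P n) x * LG s t (x - a)) =
  c * \int[mu]_x (riesz (1 - s) (q n) x * dG t (x - a)).
Proof.
pose c1 : R := (2 * pi)^-1; pose c2 := kap * (c1 * gamma_d (s / 2) / cG s).
pose c3 := kap * (c2 * gamma_d (s / 2) / cG s) * (2 * pi / gamma_c (1 - s)).
exists c3 => t a t0; have [hw IL LL] := wp_witness (P n) s0 s1.
have am a' : adm s (fm (Q n) a') by apply: adm_fm; have := s0; have := s1; lra.
have am0 a' : adm 0 (fm (Q n) a') by apply: adm_fm; lra.
have ams a' : adm (s + s) (fm (Q n) a') by apply: adm_fm; have := s0; have := s1; lra.
have HE y : 0 < y -> H (LQ s (P n)) y a = c2 * MM s (fm (Q n) a) y.
  move=> u0; rewrite (fracLap_weak_heat a s0 s1 u0 hw) /c2 -mulrA; congr (_ * _).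
  have am' : adm (0 + s) (fm (Q n) a) by rewrite add0r.
  have := tame_LG_MM s0 s1 u0 (tame_Int (IQ n)) _ (am0 a) am' (c := c1); rewrite add0r; apply.
  move=> y' u0'; rewrite (MM0 a (IQ n) u0') /c1 mulrA mulVf ?mul1r//.
rewrite (tame_LG_MM s0 s1 t0 (tame_Int IL) HE (am a) (ams a)) (MM_riesz n a t0) /c3.
by rewrite !mulrA.
Qed.

(** The constant 1 lies in L2 of the weight because s < 1, and the weight is at least 1 on (-1,1),
    which also gives integrability of u itself. *)
Lemma Hs_L1 u : Hs s u -> Int u /\ Int (fun x => u x * weight s x).
Proof.
move=> hu; have [Lu _ _ _ su] := Hs_facts s0 hu; have mu_ := Lu.1.
have L1 : L2 (weight s) (fun=> 1 : R).
  split; first exact: measurable_cst.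
  by apply: eq_Int (Int_weight s1) => x; rewrite expr1n mul1r.
have I1 := L2_Int (wt_weight s) Lu L1.
have I2 : Int (fun x => u x * weight s x) by apply: eq_Int I1 => x; rewrite mulr1.
split=> //.
have I3 : Int (fun x => if `|x| < 1 then u x else 0).
  have m3 : measurable_fun setT (fun x => if `|x| < 1 then u x else 0) by mea.
  apply: (le_Int m3 _ (Int_norm I2)) => x; case: ifPn => x1; last by rewrite normr0.
  rewrite normrM (ger0_norm (weight_ge0 _ _)) -[leLHS]mulr1 ler_wpM2l// /weight x1.
  have /andP[h0 h1] := sqr_le1 (ltW x1); rewrite powRN invf_ge1 ?powR_gt0 ?sqr_lt1//.
  by have := ge0_ler_powR (ltW s0) _ _ h1; rewrite powR1; apply; rewrite nnegrE.
apply: ae_eq_Int I3 => //.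
apply: ae_mp (ae_and su (ae_and (ae_neq 1) (ae_neq (-1)))) => x [h [n1 n2]].
case: ltP => // x1; rewrite h// lt_neqAle x1 andbT eq_sym.
by rewrite eqr_norml negb_and negb_or n1 n2.
Qed.

Lemma ip1_ae_eq f g h : measurable_fun setT f -> measurable_fun setT g ->
  measurable_fun setT h -> {ae mu, forall x, g x = h x} ->
  ip (fun=> 1) f g = \int[mu]_x (f x * h x).
Proof.
move=> mf mg mh e; apply: ae_eq_RI; [by mea|by mea|].
by apply: ae_mp e => x ->; rewrite mulr1.
Qed.

(** The fractional Laplacian of Q is replaced by its heat flow at time t and the operator is moved
    onto the Gaussian, so that u enters only through an integral against [D t]. As t tends to 0 this
    converges on (-1,1) to a multiple of the polynomial, dominated by the weight. *)
Lemma Q_pairing n : exists lam, forall u, Hs s u ->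
  ip (fun=> 1) (fracLap (s / 2) u) (fracLap (s / 2) (Q n)) = lam * ip (weight s) u (Q n).
Proof.
have [c hc] := riesz_lower n; have [k hk] := LQ_pairing_kernel n.
have [C C0 hC] := riesz_wp_holder os0 os1 os1 (dq n).
have [_ [M hM]] := riesz_bounded (Iq n) h2 os1 (dq2 n) (dq n).
have mv := riesz_meas (1 - s) (Iq n).
pose D t x := \int[mu]_y (riesz (1 - s) (q n) y * dG t (y - x)).
have [K K0 HK] := heat_derivative_le s0 s1 C0 mv hM hC hc.
have cvgD := heat_derivative_cvg s0 C0 mv hM hC hc.
(* k comes from the two operators of order s/2, c from the Riesz potential, and the eigenvalue from
   differentiating the lowered polynomial. *)
exists (k * (c * eigval (1 - s) n.+1)) => u hu.
have [Lu LLu _ wu su] := Hs_facts s0 hu; have [Iu Iuw] := Hs_L1 hu.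
have [hw IL LL] := wp_witness (P n) s0 s1; have mu_ := Lu.1.
have r2 m : 0 < 2 * rad m :> R by rewrite mulr_gt0 ?rad_gt0.
have DB t x : 0 < t -> `|D t x| <= M * (4 * (Num.sqrt t)^-1).
  move=> t0; have [Id Ed] := Int_dG t0; have Idx := Int_shift (- x) Id.
  have I := IntMb mv hM Idx; apply: (le_trans (norm_RI I)).
  apply: (@le_trans _ _ (\int[mu]_y (M * `|dG t (y - x)|))).
    apply: le_RI; [exact: Int_norm|exact/IntZ/Int_norm|move=> y].
    by rewrite (normrM (riesz _ _ _)) ler_wpM2r.
  rewrite RIZ; last exact: Int_norm.
  rewrite (RI_shift (- x) (Int_norm Id)) ler_wpM2l//.
  exact: le_trans (normr_ge0 _) (hM 0).
have mD t : 0 < t -> measurable_fun setT (D t).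
  move=> t0; apply: (@meas_RIT _ _ _ (fun x y => riesz (1 - s) (q n) y * dG t (y - x))).
  by mea.
have E1 t : 0 < t -> \int[mu]_x (fracLap (s / 2) u x * H (LQ s (P n)) t x) = k * \int[mu]_x (u x * D t x).
  move=> t0; rewrite heat_sym//.
  have IuD : Int (fun x => u x * D t x).
    by apply: eq_Int (IntMb (mD t t0) (fun x => DB t x t0) Iu) => x; rewrite mulrC.
  have [B hB] := LG_bounded s0 s1 t0; have mL := meas_LG s0 s1 t0.
  have mLQ := Int_meas IL.
  have I2 : Int2 (fun a x => LQ s (P n) a * (u x * LG s t (x - a))).
    apply: (le_Int2 _ _ (Int2Z B (Int2_prod (Int_norm IL) (Int_norm Iu)))).
      by rewrite /meas2; mea.
    by move=> a x; rewrite mulrA !normrM mulrC ler_wpM2r ?mulr_ge0.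
  have Ia a : Int (fun x => u x * LG s t (x - a)).
    have mLa : measurable_fun setT (fun x => LG s t (x - a)) by mea.
    by apply: eq_Int (IntMb mLa (fun x => hB (x - a)) Iu) => x; rewrite mulrC.
  have Ix x : Int (fun a => LQ s (P n) a * LG s t (a - x)).
    have mLa : measurable_fun setT (fun a => LG s t (a - x)) by mea.
    by apply: eq_Int (IntMb mLa (fun a => hB (a - x)) IL) => a; rewrite mulrC.
  transitivity (kap * \int[mu]_a \int[mu]_x (LQ s (P n) a * (u x * LG s t (x - a)))).
    rewrite -RIZ; last exact: Int2_Int I2.
    apply: eq_RI => a; rewrite (fracLap_weak_heat a s0 s1 t0 wu) (RIZ _ (Ia a)).
    by rewrite mulrC mulrCA.
  rewrite (fub I2) -RIZ; last exact: Int2_Int (Int2_swap I2).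
  have F x : \int[mu]_a (LQ s (P n) a * (u x * LG s t (x - a))) =
      u x * \int[mu]_a (LQ s (P n) a * LG s t (a - x)).
    rewrite -(RIZ _ (Ix x)); apply: eq_RI => a.
    by rewrite -(LG_even (a - x) s0 s1 t0) opprB mulrCA.
  have F2 x : kap * \int[mu]_a (LQ s (P n) a * (u x * LG s t (x - a))) = k * (u x * D t x).
    by rewrite F mulrCA hk// mulrCA.
  by rewrite (eq_RI F2) RIZ//; exact: IuD.
have lim1 := heat_pair_cvg LLu LL.
have -> : ip (fun=> 1) (fracLap (s / 2) u) (fracLap (s / 2) (Q n)) =
    \int[mu]_x (fracLap (s / 2) u x * LQ s (P n) x).
  exact: (ip1_ae_eq LLu.1 (meas_fracLap s0 (Q n)) LL.1 (wp_fracLap (P n) s0 s1)).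
have lim2 : k * \int[mu]_x (u x * D (2 * rad m) x) @[m --> \oo] -->
    k * (c * eigval (1 - s) n.+1 * ip (weight s) u (Q n)).
  apply: cvgM; first exact: cvg_cst.
  pose u0 x := if `|x| < 1 then u x else 0.
  have mu0 : measurable_fun setT u0 by rewrite /u0; mea.
  have ue : {ae mu, forall x, u x = u0 x}.
    apply: ae_mp (ae_and su (ae_and (ae_neq 1) (ae_neq (-1)))) => x [h [n1 n2]].
    rewrite /u0; case: ltP => // x1; rewrite h// lt_neqAle x1 andbT eq_sym.
    by rewrite eqr_norml negb_and negb_or n1 n2.
  have e1 m : \int[mu]_x (u x * D (2 * rad m) x) = \int[mu]_x (u0 x * D (2 * rad m) x).
    have mDm := mD _ (r2 m); apply: ae_eq_RI; [by mea|by mea|].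
    by apply: ae_mp ue => x ->.
  rewrite (_ : (fun m => \int[mu]_x (u x * D (2 * rad m) x)) =
    (fun m => \int[mu]_x (u0 x * D (2 * rad m) x))); last exact/funext.
  have Lw := L2_wp (P n) s0; have IuQ := L2_Int (wt_weight s) Lu Lw.
  rewrite -(RIZ _ IuQ).
  have e2 x : c * eigval (1 - s) n.+1 * (u x * Q n x * weight s x) =
      u0 x * (- (c *: r n)^`().[x]).
    rewrite /Q -(mulrA (u x)) weight_wp /u0 /weight oppr0 powRr0; case: ifPn => x1; last first.
      by rewrite !(mul0r, mulr0).
    by rewrite derivZ hornerZ (lower_poly_deriv (eP n)); ring.
  rewrite (eq_RI e2).
  apply: (@dct _ _ _ (fun x => K * `|u x * weight s x|)).
  - by move=> m; have mDm := mD _ (r2 m); mea.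
  - by mea.
  - exact/IntZ/Int_norm.
  - move=> m x; rewrite /u0; case: ifPn => x1; last by rewrite mul0r normr0 mulr_ge0.
    rewrite (normrM (u x)) normrM (ger0_norm (weight_ge0 _ _)) mulrCA.
    by apply: ler_wpM2l => //; exact: HK.
  - apply: ae_all => x; rewrite /u0; case: ifPn => x1; last first.
      by rewrite mul0r; under eq_fun do rewrite mul0r; exact: cvg_cst.
    by apply: cvgM; [exact: cvg_cst|exact: cvgD].
have e m : \int[mu]_x (fracLap (s / 2) u x * H (LQ s (P n)) (2 * rad m) x) =
  k * \int[mu]_x (u x * D (2 * rad m) x) by exact: E1.
rewrite (_ : (fun m => _) = (fun m => k * \int[mu]_x (u x * D (2 * rad m) x))) in lim1; last exact/funext.
rewrite -!mulrA; rewrite -!mulrA in lim2; exact: cvg_unique lim1 lim2.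
Qed.

End pairing.
Transparent Rintegral powR riesz H pk dG.

(** * Frame bounds *)

Opaque Rintegral powR riesz H pk dG fracLap jacp.

Lemma fracLap_weakD (R : realType) (s : R) (u v f g : R -> R) :
  is_fracLap_weak s u f -> is_fracLap_weak s v g ->
  is_fracLap_weak s (fun x => u x + v x) (fun x => f x + g x).
Proof.
move=> hu hv phi sp; have [I1 I2 E] := hu phi sp; have [J1 J2 F] := hv phi sp.
have F1 x : u x * fracLap_pv s phi x + v x * fracLap_pv s phi x =
  (u x + v x) * fracLap_pv s phi x by rewrite mulrDl.
have F2 x : f x * phi x + g x * phi x = (f x + g x) * phi x by rewrite mulrDl.
split; [exact: eq_Int F1 (IntD I1 J1)|exact: eq_Int F2 (IntD I2 J2)|].
by rewrite -(eq_RI F1) -(eq_RI F2) (RID I1 J1) (RID I2 J2) E F.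
Qed.

Lemma sqr_mul_quotient (F : fieldType) (l b k : F) : (l * b) ^+ 2 / (l * k) = l * (b ^+ 2 / k).
Proof.
have [->|k0] := eqVneq k 0; first by rewrite mulr0 invr0 !mulr0.
have [->|l0] := eqVneq l 0; first by rewrite !mul0r expr0n mul0r.
by field; rewrite ?k0 ?l0.
Qed.

Lemma sqr_quotient_mul (F : fieldType) (l b k : F) : (- (b / k)) ^+ 2 * (l * k) = l * (b ^+ 2 / k).
Proof.
have [->|k0] := eqVneq k 0; first by rewrite invr0 !mulr0.
by field.
Qed.

Section frame.
Context {R : realType}.
Notation mu := (@lebesgue_measure R).
Implicit Types (a t x y z S : R) (f g v : R -> R) (n i j N : nat).
Variables (s : R) (u : R -> R).
Hypotheses (s0 : 0 < s) (s1 : s < 1) (hu : Hs s u).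
Let E n : {poly R} := jacp s n.
Let Q n : R -> R := wp (- s) (E n).
Local Notation L := (fracLap (s / 2)).
Local Notation one := (fun=> 1).
Local Notation w := (weight s).
Local Notation rho := (weight (- s)).
(** Division by (1 - x^2)^s is an isometry onto L2 with weight (1 - x^2)^s, under which the
    expansion of u in the Q_n becomes the Jacobi expansion of f. *)
Let f x := u x * w x.
Let ms1 : - s < 1. Proof. by have := s0; lra. Qed.
Let sm1 : -1 < s. Proof. by have := s0; lra. Qed.
Let s2_gt0 : 0 < s / 2. Proof. by rewrite divr_gt0. Qed.
Let sE n : size (E n) = n.+1. Proof. exact: size_jacp. Qed.
Let oE i j : i != j -> ip rho (horner (E i)) (horner (E j)) = 0.
Proof. by move=> ij; apply: (eigp_orth ms1 (eigp_jacp i sm1) (eigp_jacp j sm1)); exact: eigval_inj. Qed.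
Let ww : wt w := wt_weight s.
Let wr : wt rho := wt_weight (- s).

Let Lu : L2 w u. Proof. by have [] := Hs_facts s0 hu. Qed.
Let LLu : L2 one (L u). Proof. by have [] := Hs_facts s0 hu. Qed.
Let hL : is_fracLap_weak (s / 2) u (L u). Proof. by have [] := Hs_facts s0 hu. Qed.

Let w2 x : w x ^+ 2 * rho x = w x.
Proof. by rewrite expr2 -mulrA weightM subrr weightM addr0. Qed.

Lemma L2_quotient : L2 rho f.
Proof.
have mu_ := Lu.1; have mw := ww.1; split; first by rewrite /f; mea.
by apply: eq_Int Lu.2 => x; rewrite /f exprMn -[RHS]mulrA w2.
Qed.

Lemma ip_quotient p : ip rho f (horner p) = ip w u (wp (- s) p).
Proof.
apply: eq_RI => x; rewrite /f /wp.
have F (a b c d : R) : a * b * c * d = a * (d * c) * b by ring.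
exact: F.
Qed.

Lemma ip_quotient_self : ip rho f f = ip w u u.
Proof. by rewrite !ip_sqr; apply: eq_RI => x; rewrite /f exprMn -mulrA w2. Qed.

Lemma ip_wp p r : ip w (wp (- s) p) (wp (- s) r) = ip rho (horner p) (horner r).
Proof.
apply: eq_RI => x; rewrite -(mulrA (wp _ _ _)) weight_wp /wp mulrACA weightM addr0.
by rewrite mulrC.
Qed.

Opaque ip weight.
Let h i := ip rho (horner (E i)) (horner (E i)).
Let be i := ip w u (Q i).
(** Only existence of the eigenvalue is known, independently of u, and a choice fixes it for all
    functions at once. *)
Let lam i : R := xget 0 [set l | forall v, Hs s v -> ip one (L v) (L (Q i)) = l * ip w v (Q i)].
Let lamP i v : Hs s v -> ip one (L v) (L (Q i)) = lam i * ip w v (Q i).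
Proof.
have [l hl] := Q_pairing s0 s1 i.
by move: v; apply: (@xgetPex _ 0 [set l | forall v, Hs s v -> ip one (L v) (L (Q i)) = l * ip w v (Q i)]); exists l.
Qed.
Let HQ p : Hs s (wp (- s) p). Proof. exact: wp_Hs. Qed.
Let LLp p : L2 one (L (wp (- s) p)). Proof. by have [] := Hs_facts s0 (HQ p). Qed.
Let LQQ i j : ip one (L (Q i)) (L (Q j)) = if i == j then lam i * h i else 0.
Proof.
rewrite (lamP j (HQ (E i))) ip_wp; case: eqVneq => [->//|ij].
by rewrite oE// mulr0.
Qed.

Let h_ge0 i : 0 <= h i. Proof. exact: ip_ge0. Qed.
(** The eigenvalue times h i is a squared norm, which spares its explicit computation. *)
Let lam_ge0 i : h i != 0 -> 0 <= lam i.
Proof.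
move=> hi; have := ip_ge0 (L (Q i)) (@wt1 R); rewrite LQQ eqxx pmulr_lge0//.
by rewrite lt0r hi h_ge0.
Qed.
Let beE i : be i = ip rho f (horner (E i)). Proof. by rewrite ip_quotient. Qed.
Let be0 i : h i = 0 -> be i = 0.
Proof.
move=> hi; have := CS wr L2_quotient (L2_weight_poly (E i) ms1).
rewrite -/(h i) hi mulr0 -beE => b0; apply/eqP; rewrite -sqrf_eq0 eq_le b0 sqr_ge0//.
Qed.

Let A N := \sum_(i < N) be i ^+ 2 / h i.
Let B N := \sum_(i < N) lam i * (be i ^+ 2 / h i).
Let a_ge0 i : 0 <= be i ^+ 2 / h i. Proof. by rewrite divr_ge0 ?sqr_ge0. Qed.
Let b_ge0 i : 0 <= lam i * (be i ^+ 2 / h i).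
Proof.
have [hi|hi] := eqVneq (h i) 0; first by rewrite hi invr0 !mulr0.
by apply: mulr_ge0 => //; exact: lam_ge0.
Qed.

Lemma Q_hat_term i : Hs_inner s u (Q_hat s i) ^+ 2 = be i ^+ 2 / h i + lam i * (be i ^+ 2 / h i).
Proof.
have sn : s != 0 by rewrite gt_eqF.
rewrite /Q_hat (weighted_jacobiE i sm1 sn).
have [[mQ _ _ _] [_ _ e _ _]] := (HQ (E i), Hs_facts s0 (HQ (E i))).
rewrite (Hs_inner_normalize s0 mQ hu) e ltry.
transitivity ((be i + lam i * be i) ^+ 2 / (h i + lam i * h i)).
  congr ((_ + _) ^+ 2 / (_ + _)); [exact: (lamP i hu)|exact: ip_wp|].
  by apply: (etrans (LQQ i i)); rewrite eqxx.
have [hi|hi] := eqVneq (h i) 0; first by rewrite (be0 hi) mulr0 addr0 expr0n !mul0r mulr0 addr0.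
have := lam_ge0 hi; move: (lam i) (be i) (h i) hi => l b k k0 l0.
by rewrite -{1}(mul1r b) -{1}(mul1r k) -!mulrDl sqr_mul_quotient mulrDl mul1r.
Qed.

Lemma coef_sum_le N : A N <= ip w u u.
Proof.
rewrite -ip_quotient_self; have := fourier_sum_le ms1 oE L2_quotient N; apply: le_trans.
by rewrite le_eqVlt; apply/orP; left; apply/eqP; apply: eq_bigr => i _; rewrite beE.
Qed.

Lemma energy_sum_le N : B N <= ip one (L u) (L u).
Proof.
have := bessel N (@wt1 R) (fun n => LLp (E n)) _ LLu => bs.
apply: le_trans (bs _); last by move=> i j ij; rewrite LQQ ltn_eqF.
rewrite le_eqVlt; apply/orP; left; apply/eqP; apply: eq_bigr => i _.
rewrite -sqr_mul_quotient; congr (_ ^+ 2 / _); first exact: esym (lamP i hu).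
by apply/esym/(etrans (LQQ i i)); rewrite eqxx.
Qed.

Let p N : {poly R} := fourier_sum (- s) E f N.
Let U N : R -> R := wp (- s) (p N).

Let US N : U N.+1 = (fun x => U N x + be N / h N * Q N x).
Proof.
apply/funext => x; rewrite /U /wp /p /fourier_sum big_ord_recr/= hornerD hornerZ beE.
by rewrite mulrDr; congr (_ + _); rewrite mulrCA.
Qed.

Lemma energy_partial_sum N : ip one (L (U N)) (L (U N)) = B N.
Proof.
elim: N => [|N IH].
  (* The zero function is written as 0 times itself so that homogeneity yields a vanishing
     fractional Laplacian. *)
  have e : U 0 = fun x => 0 * U 0 x.
    by apply/funext => x; rewrite /U /wp /p /fourier_sum big_ord0 horner0 !mulr0.
  have mL0 : measurable_fun setT (L (U 0)) by exact: meas_fracLap.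
  rewrite /B big_ord0 (ip1_ae_eq mL0 mL0 (measurable_cst (0 : R))).
    by rewrite (eq_RI (g := fun=> 0)) ?RI0// => x; rewrite mulr0.
  by rewrite e; apply: ae_mp (fracLapZ 0 (U 0) s2_gt0) => x ->; rewrite mul0r.
pose al := - (be N / h N).
have [_ _ _ hU _] := Hs_facts s0 (HQ (p N)); have [_ _ _ hQ _] := Hs_facts s0 (HQ (E N)).
have [_ _ _ hS _] := Hs_facts s0 (HQ (p N.+1)).
have e1 : {ae mu, forall x, L (U N.+1) x = 1 * (L (U N) x - al * L (Q N) x)}.
  have hD := fracLap_weakD hU (fracLap_weakZ (be N / h N) hQ).
  have hS' : is_fracLap_weak (s / 2) (fun x => U N x + be N / h N * Q N x) (L (U N.+1)).
    by rewrite -US.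
  apply: ae_mp (fracLap_weak_uniq hS' hD) => x ->.
  by rewrite mul1r /al mulNr opprK.
have Lal := L2Z al (LLp (E N)); have LD := L2B (@wt1 R) (LLp (p N)) Lal.
have e2 : {ae mu, forall x, (1 : R) != 0 -> L (U N.+1) x = 1 * (L (U N) x - al * L (Q N) x)}.
  by apply: ae_mp e1 => x.
rewrite (ip_ae_scale (@wt1 R) (LLp _).1 (LLp _).1 LD LD e2 e2) !mul1r.
rewrite (ip_expand al (@wt1 R) (LLp (p N)) (LLp (E N))).
have e3 : ip one (L (U N)) (L (Q N)) = 0.
  have h3 := ip_fourier_sum ms1 oE L2_quotient N N; rewrite ltnn in h3.
  rewrite (lamP N (HQ (p N))) -[RHS](mulr0 (lam N)); congr (_ * _).
  exact: etrans (ip_wp (p N) (E N)) h3.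
have e4 : ip one (L (Q N)) (L (Q N)) = lam N * h N by rewrite LQQ eqxx.
have e5 : B N.+1 = B N + lam N * (be N ^+ 2 / h N) by rewrite /B big_ord_recr.
transitivity (B N - 2 * al * 0 + al ^+ 2 * (lam N * h N)).
  by congr (_ - _ * _ + _ * _); [exact: IH|exact: e3|exact: e4].
by rewrite mulr0 subr0 /al sqr_quotient_mul e5.
Qed.

Transparent ip weight.
Let LGa t a x : R := LG s t (x - a).

(** The partial sums converge to u in the weighted space only. After smoothing, the operator acts on
    the Gaussian and becomes pairing with a bounded function, which is continuous for that
    convergence. *)
Lemma heat_partial_sum_cvg t a : 0 < t -> H (L (U N)) t a @[N --> \oo] --> H (L u) t a.
Proof.
move=> t0; have mLG := meas_LG s0 s1 t0; have [M hM] := LG_bounded s0 s1 t0.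
have mLa : measurable_fun setT (LGa t a) by rewrite /LGa; mea.
have LLG : L2 rho (LGa t a) by apply: (L2_weight ms1 mLa (M := M)) => x _; exact: hM.
pose kap : R := fracLap_const (s / 2).
have [_ _ _ _ su] := Hs_facts s0 hu; have mu_ := Lu.1.
have E0 : H (L u) t a = kap * ip rho f (LGa t a).
  rewrite (fracLap_weak_heat a s0 s1 t0 hL); congr (_ * _).
  have mf := L2_quotient.1; have mr := wr.1.
  apply: ae_eq_RI; [by rewrite -/(LGa t a); mea|by mea|].
  apply: ae_mp (ae_and su (ae_and (ae_neq 1) (ae_neq (-1)))) => x [hx [n1 n2]].
  rewrite /f /LGa mulrAC -(mulrA (u x)) weightM subrr /weight oppr0 powRr0.
  case: ltP => x1; first by rewrite mulr1.
  rewrite hx ?mul0r// lt_neqAle x1 andbT eq_sym.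
  by rewrite eqr_norml negb_and negb_or n1 n2.
have EN N : H (L (U N)) t a = kap * ip rho (horner (p N)) (LGa t a).
  have [_ _ _ hU _] := Hs_facts s0 (HQ (p N)).
  rewrite (fracLap_weak_heat a s0 s1 t0 hU); congr (_ * _).
  by apply: eq_RI => x; rewrite /U /wp /LGa -mulrA mulrC.
rewrite (_ : (fun N => H (L (U N)) t a) = fun N => kap * ip rho (horner (p N)) (LGa t a)); last exact/funext.
rewrite E0; apply: cvgM; first exact: cvg_cst.
have Lr N : L2 rho (fun x => f x - (p N).[x]) by apply: L2B => //; [exact: L2_quotient|exact: L2_weight_poly].
pose D := Num.sqrt (ip rho (LGa t a) (LGa t a)).
have b N : `|ip rho f (LGa t a) - ip rho (horner (p N)) (LGa t a)| <=
    Num.sqrt (ip rho (fun x => f x - (p N).[x]) (fun x => f x - (p N).[x])) * D.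
  rewrite -ipBl//; [exact: CS_sqrt|exact: L2_quotient|exact: L2_weight_poly].
have c0 : Num.sqrt (ip rho (fun x => f x - (p N).[x]) (fun x => f x - (p N).[x])) * D
    @[N --> \oo] --> (0 : R).
  rewrite -(mul0r D); apply: cvgM; last exact: cvg_cst.
  rewrite (_ : (fun N => Num.sqrt _) = fun N =>
    ip rho (fun x => f x - (p N).[x]) (fun x => f x - (p N).[x]) `^ 2^-1); last first.
    by apply/funext => N; rewrite powR12_sqrt// ip_ge0.
  apply: powR_cvg0 => //; first by move=> N; exact: ip_ge0.
  exact: (residual_cvg0 ms1 sE oE L2_quotient).
apply/cvgrPdist_le => e e0.
have hn : \forall N \near \oo,
    Num.sqrt (ip rho (fun x => f x - (p N).[x]) (fun x => f x - (p N).[x])) * D < e.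
  exact: cvgr_lt c0 _ e0.
near=> N; apply: (le_trans (b N)); apply: ltW; near: N; exact: hn.
Unshelve. all: by end_near. Qed.

Opaque ip weight.
(** At a fixed time Fatou in N applies, because the smoothed partial sums converge at every point
    and contraction bounds their norms by [B N]; the time tends to 0 only afterwards. *)
Lemma energy_le S : (forall N, B N <= S) -> ip one (L u) (L u) <= S.
Proof.
move=> hS.
have HL t : 0 < t -> ip one (H (L u) t) (H (L u) t) <= S.
  move=> t0; have [LH _] := heat_contraction LLu t0.
  have LHN N := heat_contraction (LLp (p N)) t0.
  have mH := LH.1.
  suff [_ E1] : Int (fun x => H (L u) t x ^+ 2) /\ \int[mu]_x (H (L u) t x ^+ 2) <= S.
    rewrite ip_sqr; apply: le_trans E1; rewrite le_eqVlt; apply/orP; left; apply/eqP/eq_RI => x.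
    by rewrite mulr1.
  apply: (@fatou_bound R (fun N x => H (L (U N)) t x ^+ 2)).
  - by move=> N; have [[_ I] _] := LHN N; apply: eq_Int I => x; rewrite mulr1.
  - by move=> N x; exact: sqr_ge0.
  - by mea.
  - by move=> x; exact: sqr_ge0.
  - apply: ae_all => x e e0.
    have c : H (L (U N)) t x ^+ 2 @[N --> \oo] --> H (L u) t x ^+ 2.
      have cx := @heat_partial_sum_cvg t x t0; exact: (cvgM cx cx).
    have hlt : H (L u) t x ^+ 2 - e < H (L u) t x ^+ 2 by rewrite gtrBl.
    have hn : \forall N \near \oo, H (L u) t x ^+ 2 - e < H (L (U N)) t x ^+ 2 by exact: cvgr_gt c _ hlt.
    by near=> N; apply: ltW; near: N.
  - move=> N; have [_ le] := LHN N; apply: le_trans (hS N); rewrite -energy_partial_sum.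
    apply: le_trans le; rewrite ip_sqr le_eqVlt; apply/orP; left; apply/eqP/eq_RI => x.
    by rewrite mulr1.
have c := heat_energy_cvg LLu.
rewrite -(cvg_lim (@Rhausdorff R) c); apply: limr_le; first by apply/cvg_ex; eexists; exact: c.
by apply: nearW => n; apply: HL; exact: rad_gt0.
Unshelve. all: by end_near. Qed.

Lemma lower_bound S : (forall N, A N + B N <= S) -> ip w u u + ip one (L u) (L u) <= S.
Proof.
move=> hS.
(* The two limits are taken one after the other, so the indices are separated; both sums increase,
   and their maximum serves as common index. *)
have AB M N : A M + B N <= S.
  apply: le_trans (hS (maxn M N)); apply: lerD.
    rewrite /A -!(big_mkord xpredT (fun i => be i ^+ 2 / h i)).
    rewrite (big_cat_nat (n := M) (p := maxn M N)) ?leq_maxl//= lerDl; exact: sumr_ge0.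
  rewrite /B -!(big_mkord xpredT (fun i => lam i * (be i ^+ 2 / h i))).
  by rewrite (big_cat_nat (n := N) (p := maxn M N)) ?leq_maxr//= lerDl; exact: sumr_ge0.
have c := parseval ms1 sE oE L2_quotient.
rewrite ip_quotient_self in c.
rewrite -lerBrDr -(cvg_lim (@Rhausdorff R) c); apply: limr_le; first by apply/cvg_ex; eexists; exact: c.
apply: nearW => M; rewrite lerBrDl -lerBrDr.
apply: energy_le => N; rewrite lerBrDr addrC; apply: le_trans (AB M N); rewrite lerD2r.
by rewrite le_eqVlt; apply/orP; left; apply/eqP; apply: eq_bigr => i _; rewrite beE.
Qed.

Lemma frame_sum_bounds :
  (Hs_sqnorm s u <= \sum_(0 <= n <oo)
     (Hs_inner s u (Q_hat s n) ^+ 2 + Hs_inner s u (P_hat s n) ^+ 2)%:E)%E /\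
  (\sum_(0 <= n <oo)
     (Hs_inner s u (Q_hat s n) ^+ 2 + Hs_inner s u (P_hat s n) ^+ 2)%:E <= 2%:E * Hs_sqnorm s u)%E.
Proof.
have [_ _ e _ _] := Hs_facts s0 hu; rewrite e.
set T := ip w u u + _.
pose F n : R := Hs_inner s u (Q_hat s n) ^+ 2 + Hs_inner s u (P_hat s n) ^+ 2.
have F0 n : (0 <= (F n)%:E)%E by rewrite lee_fin addr_ge0 ?sqr_ge0.
have cF := @is_cvg_nneseries R (fun n => (F n)%:E) xpredT 0 (fun n _ _ => F0 n).
have sumF N : (\sum_(0 <= i < N) (F i)%:E)%E = (\sum_(i < N) F i)%:E.
  by rewrite sumEFin big_mkord.
have QE N : \sum_(i < N) Hs_inner s u (Q_hat s i) ^+ 2 = A N + B N.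
  by rewrite /A /B -big_split; apply: eq_bigr => i _; rewrite Q_hat_term.
have FE N : \sum_(i < N) F i = A N + B N + \sum_(i < N) Hs_inner s u (P_hat s i) ^+ 2.
  by rewrite -QE; exact: big_split.
have up : (\sum_(0 <= n <oo) (F n)%:E <= (2 * T)%:E)%E.
  apply: lime_le => //; apply: nearW => N; rewrite sumF lee_fin FE mulr_natl mulr2n.
  by apply: lerD; [apply: lerD; [exact: coef_sum_le|exact: energy_sum_le]|exact: dual_upper].
have S0 : (0 <= \sum_(0 <= n <oo) (F n)%:E)%E by apply: nneseries_ge0.
(* Finiteness of the series, given by the upper bound, lets it be used as the real number S of
   [lower_bound]. *)
have Sf : (\sum_(0 <= n <oo) (F n)%:E)%E \is a fin_num.
  by rewrite ge0_fin_numE//; apply: le_lt_trans up _; rewrite ltry.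
split; last exact: up.
rewrite -(fineK Sf) lee_fin; apply: lower_bound => N.
rewrite -lee_fin fineK//.
apply: le_trans (nneseries_lim_ge (u_ := fun n => (F n)%:E) (P := xpredT) (m := 0) N (fun n _ _ => F0 n)).
by rewrite sumF lee_fin FE lerDl; apply: sumr_ge0 => i _; exact: sqr_ge0.
Qed.

End frame.

Theorem theorem5p2 (R : realType) (s : R) (s0 : 0 < s) (s1 : s < 1) :
  exists c C : R, [/\ 0 < c, c <= C &
    forall u : R -> R, Hs s u ->
      (c%:E * Hs_sqnorm s u <=
         \sum_(0 <= n <oo)
           (Hs_inner s u (Q_hat s n) ^+ 2 + Hs_inner s u (P_hat s n) ^+ 2)%:E)%E
      /\
      (\sum_(0 <= n <oo)
         (Hs_inner s u (Q_hat s n) ^+ 2 + Hs_inner s u (P_hat s n) ^+ 2)%:E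
       <= C%:E * Hs_sqnorm s u)%E].
Proof.
exists 1, 2; split; [exact: ltr01|by lra|move=> u hu].
by have [lo up] := frame_sum_bounds s0 s1 hu; rewrite mul1e.
Qed.
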